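(* For a holomorphic function $f$ on the upper half plane let $\mathrm{dwt}(f)\in\mathbb{Z}\cup\{\pm\infty\}$ be the largest integer $k$ such that $f$ satisfies a monic MLDE of weight $k$, with $\mathrm{dwt}(f)=\infty$ if there is no largest one and $\mathrm{dwt}(f)=-\infty$ if $f$ satisfies no monic MLDE of integral weight. Then for all such $f,g$: (1) $\mathrm{dwt}(fg)\ge\mathrm{dwt}(f)+\mathrm{dwt}(g)$, with the convention $\infty+(-\infty)=-\infty$; (2) if $\mathrm{dwt}(f)=\mathrm{dwt}(g)$, then $\mathrm{dwt}(f+g)\ge\mathrm{dwt}(g)$; (3) if $\mathrm{dwt}(f)>\mathrm{dwt}(g)$, then $\mathrm{dwt}(f+g)=\mathrm{dwt}(g)$; (4) if $f$ is a nonzero quasimodular form of weight $k$ and depth $s$, then $\mathrm{dwt}(f)=k-s$.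
   Context: $q=e^{2\pi iz}$, $f'=\frac{1}{2\pi i}\frac{df}{dz}$; $E_2,E_4,E_6$ are the Eisenstein series with constant term $1$, and $\mathcal{M}_w$ is the space of holomorphic modular forms of weight $w$ on $\mathrm{SL}(2,\mathbb{Z})$. For $k\in\mathbb{R}$, $D_kf=f'-\frac{k}{12}E_2f$, $D_k^{(0)}=\mathrm{id}$, $D_k^{(j)}=D_{k+2j-2}\circ\cdots\circ D_k$. A monic MLDE of weight $k$ is an equation $(D_k^{(n)}+g_1D_k^{(n-1)}+\cdots+g_n)f=0$ with $n\ge0$ and $g_i\in\mathcal{M}_{2i}$. A quasimodular form of weight $k$ is a homogeneous element of weight $k$ of $\mathbb{C}[E_2,E_4,E_6]$ (with $E_2,E_4,E_6$ of weights $2,4,6$); its depth is its degree in $E_2$. *)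

(* Defs.v *)
From Stdlib Require Import Reals ZArith Lia ClassicalEpsilon ClassicalDescription.
From Coquelicot Require Import Coquelicot.
Open Scope R_scope.

Definition in_H (z : C) : Prop := 0 < Im z.

Definition cderiv_at (f : C -> C) (z l : C) : Prop :=
  @is_derive C_AbsRing C_NormedModule f z l.

Definition holo_H (f : C -> C) : Prop :=
  forall z, in_H z -> @ex_derive C_AbsRing C_NormedModule f z.

(** q^n = e^{2 pi i n z} *)
Definition qpow (z : C) (n : nat) : C :=
  (exp (- 2 * PI * INR n * Im z) * cos (2 * PI * INR n * Re z),
   exp (- 2 * PI * INR n * Im z) * sin (2 * PI * INR n * Re z))%R.

Definition sigma (r n : nat) : R :=
  sum_n (fun d => if ((1 <=? d)%nat && (n mod d =? 0)%nat)%bool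
                  then (INR d ^ r)%R else 0%R) n.

Definition cseries (a : nat -> C) : C :=
  (Series (fun n => fst (a n)), Series (fun n => snd (a n))).

Definition Eis (c : R) (r : nat) (z : C) : C :=
  Cplus (RtoC 1) (Cmult (RtoC c)
    (cseries (fun n => Cmult (RtoC (sigma r (S n))) (qpow z (S n))))).
Definition E2 : C -> C := Eis (-24) 1.
Definition E4 : C -> C := Eis 240 3.
Definition E6 : C -> C := Eis (-504) 5.

Definition modular_form (w : nat) (f : C -> C) : Prop :=
  holo_H f /\
  (forall (a b c d : Z) (z : C), (a * d - b * c)%Z = 1%Z -> in_H z ->
     f (Cdiv (Cplus (Cmult (IZR a) z) (IZR b)) (Cplus (Cmult (IZR c) z) (IZR d)))
     = Cmult (pow_n (K := C_Ring) (Cplus (Cmult (IZR c) z) (IZR d)) w) (f z)) /\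
  (* holomorphic at the cusp: bounded as Im z -> infinity *)
  (exists M : R, forall z, 1 <= Im z -> Cmod (f z) <= M).

(** f satisfies the monic MLDE of weight k
    (D_k^{(n)} + g_1 D_k^{(n-1)} + ... + g_n) f = 0,  g_i in M_{2i}.
    h j plays the role of D_k^{(j)} f on H; D_k h = h' - k/12 E2 h with
    h' = (1/(2 pi i)) dh/dz, i.e. dh/dz = 2 pi i (D_k h + k/12 E2 h). *)
Definition satisfies_MLDE (k : Z) (f : C -> C) : Prop :=
  exists (n : nat) (g : nat -> C -> C) (h : nat -> C -> C),
    (forall i, (1 <= i <= n)%nat -> modular_form (2 * i) (g i)) /\
    (forall z, in_H z -> h O z = f z) /\
    (forall j, (j < n)%nat -> forall z, in_H z ->
        cderiv_at (h j) z
          (Cmult (Cmult (RtoC (2 * PI)) Ci)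
             (Cplus (h (S j) z)
                (Cmult (RtoC (IZR (k + 2 * Z.of_nat j) / 12)) (Cmult (E2 z) (h j z)))))) /\
    (forall z, in_H z ->
        Cplus (h n z) (sum_n (fun i => if (1 <=? i)%nat
                                        then Cmult (g i z) (h (n - i)%nat z)
                                        else RtoC 0) n) = RtoC 0).

Inductive zbar : Type := Fin (k : Z) | PInf | MInf.

Definition zbar_le (x y : zbar) : Prop :=
  match x, y with
  | MInf, _ => True
  | _, PInf => True
  | Fin a, Fin b => (a <= b)%Z
  | _, _ => False
  end.

Definition zbar_lt (x y : zbar) : Prop := zbar_le x y /\ x <> y.

Definition zbar_add (x y : zbar) : zbar :=
  match x, y with
  | MInf, _ => MInf
  | _, MInf => MInf
  | PInf, _ => PInf
  | _, PInf => PInf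
  | Fin a, Fin b => Fin (a + b)
  end.

Definition dwt (f : C -> C) : zbar :=
  match excluded_middle_informative
          (exists k, satisfies_MLDE k f /\ forall j, satisfies_MLDE j f -> (j <= k)%Z) with
  | left H => Fin (proj1_sig (constructive_indefinite_description _ H))
  | right _ =>
      match excluded_middle_informative (exists k, satisfies_MLDE k f) with
      | left _ => PInf
      | right _ => MInf
      end
  end.

Definition Emon (a b c : nat) (z : C) : C :=
  Cmult (pow_n (K := C_Ring) (E2 z) a)
    (Cmult (pow_n (K := C_Ring) (E4 z) b) (pow_n (K := C_Ring) (E6 z) c)).

(** f is (on H) the quasimodular form given by the weight-k homogeneous element
    sum_{2a+4b+6c=k} coef(a,b,c) E2^a E4^b E6^c of C[E2,E4,E6], whose degree in
    E2 is s.  (Exponents are bounded by k, so the sums are over a finite box.) *)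
Definition quasimodular (k : Z) (s : nat) (f : C -> C) : Prop :=
  exists coef : nat -> nat -> nat -> C,
    (forall z, in_H z ->
       f z = sum_n (fun a => sum_n (fun b => sum_n (fun c =>
               if Z.eqb (Z.of_nat (2 * a + 4 * b + 6 * c)) k
               then Cmult (coef a b c) (Emon a b c z) else RtoC 0)
             (Z.to_nat k)) (Z.to_nat k)) (Z.to_nat k)) /\
    (exists b c, Z.of_nat (2 * s + 4 * b + 6 * c) = k /\ coef s b c <> RtoC 0) /\
    (forall a b c, Z.of_nat (2 * a + 4 * b + 6 * c) = k -> (s < a)%nat ->
       coef a b c = RtoC 0).

(* Main.v *)
(** A function satisfies a monic MLDE of weight [k] if and only if it is a degree-0 element of a finitely generated
    graded module over the ring [M] of modular forms that is stable under [D], with weights shifted by [k].  In one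
    direction take the module spanned by the iterated derivatives; in the other, the [M]-module generated by the
    coordinate vectors of the derivatives of [f] is noetherian, in the concrete form that its elements [a] of large
    weight are [E4 b + E6 c], so that some [D^n f] is a combination of lower derivatives with coefficients of
    positive weight.  Such modules are closed under sums and products, and [D_(-1) 1 = E2 / 12] shows that [1] has
    an equation of weight [-1]; so the set of weights of [f] is downward closed, which gives (1), (2) and (3).
    For (4), [E2] has an equation of weight 1, whence [>=].  If the weight [l] exceeds [k - s], the coefficient of
    [E2^(s+j)] in [D_l^(j) f] is [phi] times the product over [i < j] of [(k - s - l - i) / 12], with [phi <> 0] the top
    coefficient of [f]; as these factors do not vanish, an equation contradicts the transcendence of [E2] over [M].

    The modular transformations of [E2, E4, E6] come from the Lipschitz formula for [sum 1/(z+j)^k] and from summing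
    the lattice by rows or by columns.  Cusp forms of weight at most 10 vanish because [y^v |f|] is invariant; this
    gives Ramanujan's differential equations, the nonvanishing of the discriminant, and [D : M_w -> M_(w+2)]. *)

(* The difficulty is that an equation must be monic: linear dependence of the derivatives over [M]
   is not enough, and a leading coefficient 1 needs finiteness over [M]. Membership in [E4 S + E6 S]
   is the useful form of finiteness because both multipliers have positive weight and forms of
   negative weight vanish: the cofactors of an element of weight [n] then involve only generators of
   smaller index. A function has no canonical coordinates in its module, so the argument runs in the
   free module on the generators, with the connection matrix of [D] acting there.

   Finiteness itself comes from division by the discriminant: subtract an element with the same
   constant term, divide the remainder by [modDelta], and the weight drops by 12. The function
   theory behind this is that a bounded periodic holomorphic function is a constant plus [O(q)] at
   the cusp, and that a function which is [O(q)] decays at a definite rate from any horizontal line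
   upwards. Both come from one integral formula over a horizontal period, in which [1 - e (w - z)]
   replaces the Cauchy kernel. Weights are halved throughout: [MF v] has weight [2 v]. *)
Require Import Defs.
From Stdlib Require Import Reals ZArith Lia Lra Psatz List Classical ClassicalEpsilon.
From Coquelicot Require Import Coquelicot.
Import ListNotations.
Open Scope R_scope.

(** * Complex derivatives and the exponential *)

Lemma C_eq (a b : C) : Re a = Re b -> Im a = Im b -> a = b.
Proof. destruct a, b; unfold Re, Im; simpl; intros; congruence. Qed.

(** The filter-based differential is traded for an error bound on [f (z + h) - f z - l h], the form
    in which derivatives are estimated by hand below. *)
Lemma cderiv_eps (f : C -> C) (z l : C) :
  cderiv_at f z l <->
  forall eps, 0 < eps -> exists d, 0 < d /\ forall h : C, Cmod h < d ->
    Cmod (f (z + h) - f z - l * h)%C <= eps * Cmod h.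
Proof.
  split.
  - intros [_ H] eps He.
    specialize (H z (fun P HP => HP) (mkposreal eps He)).
    destruct H as [d Hd].
    exists d. split; [apply cond_pos|]. intros h Hh.
    assert (B : ball (z : C_AbsRing) d (z + h)%C).
    { unfold ball; simpl. unfold AbsRing_ball, abs, minus, plus, opp; simpl.
      replace (z + h + - z)%C with h by ring. exact Hh. }
    specialize (Hd _ B).
    unfold norm, minus, plus, opp, scal, mult in Hd; simpl in Hd.
    unfold abs, mult in Hd; simpl in Hd.
    replace (f (z + h) - f z - l * h)%C
      with (f (z + h)%C + - f z + - ((z + h + - z) * l))%C by ring.
    replace h with (z + h + - z)%C at 3 by ring. exact Hd.
  - intros H. split; [apply is_linear_scal_l|].
    intros x Hx.
    assert (x = z) as -> by (symmetry; apply (@is_filter_lim_locally_unique _ (AbsRing_NormedModule C_AbsRing) z x Hx)).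
    intros [eps He].
    destruct (H eps He) as [d [Hd H1]].
    exists (mkposreal d Hd). intros y Hy. change C in y.
    unfold ball in Hy; simpl in Hy. unfold AbsRing_ball, abs, minus, plus, opp in Hy; simpl in Hy.
    specialize (H1 _ Hy).
    unfold norm, minus, plus, opp, scal, mult; simpl. unfold abs, mult; simpl.
    replace (z + (y + - z))%C with y in H1 by ring.
    replace (f y + - f z + - ((y + - z) * l))%C
      with (f y - f z - l * (y + - z))%C by ring. exact H1.
Qed.

Lemma cderiv_ext_H (f g : C -> C) (z l : C) :
  in_H z -> (forall w, in_H w -> f w = g w) -> cderiv_at f z l -> cderiv_at g z l.
Proof.
  unfold in_H. intros Hz E. rewrite !cderiv_eps. intros H eps He.
  destruct (H eps He) as [d [Hd H1]].
  (* A radius at most [Im z] keeps the whole disc inside the half plane, where [f] and [g] are known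
     to agree. *)
  exists (Rmin d (Im z)). split; [apply Rmin_glb_lt; assumption|].
  intros h Hh.
  assert (0 < Im (z + h)%C).
  { rewrite im_plus. assert (T := Rmax_Cmod h).
    assert (T2 := Rmax_r (Rabs (fst h)) (Rabs (snd h))).
    assert (T3 := Rmin_r d (Im z)). unfold Im at 2.
    assert (T4 := Rle_abs (- snd h)). rewrite Rabs_Ropp in T4. lra. }
  rewrite <- !E; auto. apply H1. assert (T3 := Rmin_l d (Im z)). lra.
Qed.

Lemma cderiv_ext_loc (f g : C -> C) (z l : C) (d : R) :
  0 < d -> (forall u : C, Cmod (u - z)%C < d -> f u = g u) -> cderiv_at f z l -> cderiv_at g z l.
Proof.
  intros Hd E. apply (is_derive_ext_loc (K := C_AbsRing) (V := C_NormedModule)).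
  exists (mkposreal d Hd). intros u Hu. apply E, Hu.
Qed.

Lemma cderiv_ext (f g : C -> C) (z l : C) : (forall u, f u = g u) -> cderiv_at f z l -> cderiv_at g z l.
Proof. intros E. apply (cderiv_ext_loc f g z l 1); auto. lra. Qed.

Lemma cderiv_plus (f g : C -> C) (z a b : C) :
  cderiv_at f z a -> cderiv_at g z b -> cderiv_at (fun z => f z + g z)%C z (a + b)%C.
Proof. intros; apply (is_derive_plus (V := C_NormedModule) f g z a b); assumption. Qed.

(* Complex functions carry two normed-module structures over [C_AbsRing]; the norms agree. *)
Lemma cderiv_abs_ring (f : C -> C) (z l : C) :
  cderiv_at f z l <-> is_derive (K := C_AbsRing) (V := AbsRing_NormedModule C_AbsRing) f z l.
Proof. split; intros [[H1 H2 H3] H]; (split; [split; [exact H1 | exact H2 | exact H3] | exact H]). Qed.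

Lemma cderiv_mult (f g : C -> C) (z a b : C) :
  cderiv_at f z a -> cderiv_at g z b -> cderiv_at (fun z => f z * g z)%C z (a * g z + f z * b)%C.
Proof.
  rewrite !cderiv_abs_ring. intros H1 H2. apply (is_derive_mult (K := C_AbsRing) f g z a b H1 H2).
  intros; apply Cmult_comm.
Qed.

Lemma cderiv_const (c z : C) : cderiv_at (fun _ => c) z (RtoC 0).
Proof. apply (is_derive_const (V := C_NormedModule)). Qed.

Lemma cderiv_id (z : C) : cderiv_at (fun z => z) z (RtoC 1).
Proof. apply cderiv_abs_ring. apply (is_derive_id (K := C_AbsRing)). Qed.

Lemma cderiv_comp (f g : C -> C) (z a b : C) :
  cderiv_at f (g z) a -> cderiv_at g z b -> cderiv_at (fun z => f (g z)) z (a * b)%C.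
Proof.
  intros H1 H2. rewrite Cmult_comm. apply (is_derive_comp (V := C_NormedModule) f g z a b H1).
  apply cderiv_abs_ring, H2.
Qed.

Lemma cderiv_eq (f : C -> C) (z a b : C) : cderiv_at f z a -> a = b -> cderiv_at f z b.
Proof. intros; subst; auto. Qed.

Lemma cderiv_unique (f : C -> C) (z a b : C) : cderiv_at f z a -> cderiv_at f z b -> a = b.
Proof. intros H1 H2. transitivity (C_derive f z); [symmetry|]; apply is_C_derive_unique; assumption. Qed.

Lemma cderiv_scal (c : C) (f : C -> C) (z a : C) :
  cderiv_at f z a -> cderiv_at (fun z => c * f z)%C z (c * a)%C.
Proof. intros H. eapply cderiv_eq. apply cderiv_mult. apply cderiv_const. exact H. simpl. ring. Qed.

Lemma cderiv_pow (f : C -> C) (z a : C) (n : nat) :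
  cderiv_at f z a -> cderiv_at (fun z => f z ^ S n)%C z (INR (S n) * f z ^ n * a)%C.
Proof.
  intros H. induction n.
  - apply (cderiv_ext f); [intros; simpl; ring|].
    replace (INR 1 * f z ^ 0 * a)%C with a by (simpl; ring). exact H.
  - change (cderiv_at (fun z0 : C => (f z0 * f z0 ^ S n)%C) z (INR (S (S n)) * f z ^ S n * a)%C).
    eapply cderiv_eq. apply cderiv_mult; eassumption. rewrite (S_INR (S n)), RtoC_plus.
    simpl Cpow. ring.
Qed.

Definition ccont (f : C -> C) (z : C) : Prop :=
  forall eps, 0 < eps -> exists d, 0 < d /\ forall w : C, Cmod (w - z)%C < d -> Cmod (f w - f z)%C < eps.

Lemma cderiv_ccont (f : C -> C) (z l : C) : cderiv_at f z l -> ccont f z.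
Proof.
  rewrite cderiv_eps. intros H eps He. destruct (H 1 Rlt_0_1) as [d [Hd H1]].
  assert (P : 0 < 2 + Cmod l) by (assert (T := Cmod_ge_0 l); lra).
  exists (Rmin d (eps / (2 + Cmod l))). split.
  { apply Rmin_glb_lt; auto. apply Rdiv_lt_0_compat; auto. }
  intros w Hw. specialize (H1 (w - z)%C).
  replace (z + (w - z))%C with w in H1 by ring.
  assert (T3 := Rmin_l d (eps / (2 + Cmod l))). assert (T4 := Rmin_r d (eps / (2 + Cmod l))).
  specialize (H1 ltac:(lra)).
  replace (f w - f z)%C with ((f w - f z - l * (w - z)) + l * (w - z))%C by ring.
  eapply Rle_lt_trans; [apply Cmod_triangle|]. rewrite Cmod_mult.
  assert (Cmod (w - z)%C < eps / (2 + Cmod l)) by lra.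
  apply Rlt_div_r in H0; [|lra]. assert (Q := Cmod_ge_0 (w - z)%C).
  apply Rle_lt_trans with (Cmod (w - z) * (1 + Cmod l)); nra.
Qed.

Lemma Cmod_sub_lower (a b : C) : Cmod a - Cmod b <= Cmod (a - b)%C.
Proof. assert (T := Cmod_triangle (a - b) b). replace (a - b + b)%C with a in T by ring. lra. Qed.

Lemma cderiv_inv (f : C -> C) (z a : C) :
  f z <> RtoC 0 -> cderiv_at f z a -> cderiv_at (fun z => / f z)%C z (- a / (f z * f z))%C.
Proof.
  intros Hz H.
  (* By the chain rule only [Cinv] itself matters. Its error at [u] is exactly
     [h^2 / (u^2 (u + h))], and [|h| < |u| / 2] keeps the denominator away from zero. *)
  enough (D : forall u : C, u <> RtoC 0 -> cderiv_at Cinv u (- / (u * u))%C).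
  { eapply cderiv_eq. apply (cderiv_comp Cinv f). apply D, Hz. exact H. field. auto. }
  clear. intros u Hu. rewrite cderiv_eps. intros eps He.
  assert (P : 0 < Cmod u) by (apply Cmod_gt_0; auto).
  exists (Rmin (Cmod u / 2) (eps * Cmod u ^ 3 / 2)). split.
  { apply Rmin_glb_lt. lra. assert (0 < Cmod u ^ 3) by (apply pow_lt; auto). nra. }
  intros h Hh. assert (T1 := Rmin_l (Cmod u / 2) (eps * Cmod u ^ 3 / 2)).
  assert (T2 := Rmin_r (Cmod u / 2) (eps * Cmod u ^ 3 / 2)).
  assert (L : Cmod u / 2 <= Cmod (u + h)%C).
  { assert (T := Cmod_sub_lower u (- h)%C). rewrite Cmod_opp in T.
    replace (u - - h)%C with (u + h)%C in T by ring. lra. }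
  assert (N : (u + h)%C <> RtoC 0) by (apply Cmod_gt_0; lra).
  replace (/ (u + h) - / u - - / (u * u) * h)%C with (h * h * / (u * u * (u + h)))%C
    by (field; auto).
  rewrite !Cmod_mult, Cmod_inv by (repeat apply Cmult_neq_0; auto). rewrite !Cmod_mult.
  assert (Q := Cmod_ge_0 h).
  rewrite Rmult_assoc, Rmult_comm. apply Rmult_le_compat_r; auto.
  apply Rle_div_l. { apply Rlt_gt. repeat apply Rmult_lt_0_compat; lra. }
  assert (Cmod u * Cmod u * (Cmod u / 2) <= Cmod u * Cmod u * Cmod (u + h)) by (apply Rmult_le_compat_l; nra).
  apply Rle_trans with (eps * (Cmod u * Cmod u * (Cmod u / 2))). simpl in T2, Hh. lra.
  apply Rmult_le_compat_l; lra.
Qed.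

Definition e (z : C) : C := qpow z 1.

Lemma e_re (z : C) : Re (e z) = exp (- 2 * PI * Im z) * cos (2 * PI * Re z).
Proof. unfold e, qpow, Re at 1; simpl. rewrite !Rmult_1_r. reflexivity. Qed.
Lemma e_im (z : C) : Im (e z) = exp (- 2 * PI * Im z) * sin (2 * PI * Re z).
Proof. unfold e, qpow, Im at 1; simpl. rewrite !Rmult_1_r. reflexivity. Qed.

Lemma e_plus (z w : C) : e (z + w)%C = (e z * e w)%C.
Proof.
  apply C_eq; rewrite ?re_mult, ?im_mult, ?e_re, ?e_im, ?re_plus, ?im_plus.
  - replace (- 2 * PI * (Im z + Im w)) with (- 2 * PI * Im z + - 2 * PI * Im w) by ring.
    replace (2 * PI * (Re z + Re w)) with (2 * PI * Re z + 2 * PI * Re w) by ring.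
    rewrite exp_plus, cos_plus. ring.
  - replace (- 2 * PI * (Im z + Im w)) with (- 2 * PI * Im z + - 2 * PI * Im w) by ring.
    replace (2 * PI * (Re z + Re w)) with (2 * PI * Re z + 2 * PI * Re w) by ring.
    rewrite exp_plus, sin_plus. ring.
Qed.

Lemma e_0 : e (RtoC 0) = RtoC 1.
Proof. apply C_eq; rewrite ?e_re, ?e_im, ?re_RtoC, ?im_RtoC, !Rmult_0_r, exp_0, ?cos_0, ?sin_0; ring. Qed.

Lemma Cmod_e (z : C) : Cmod (e z) = exp (- 2 * PI * Im z).
Proof.
  assert (P := exp_pos (- 2 * PI * Im z)).
  apply Rsqr_inj; [apply Cmod_ge_0|lra|]. rewrite !Rsqr_pow2, Cmod2_alt, e_re, e_im.
  assert (T := sin2_cos2 (2 * PI * Re z)). unfold Rsqr in T.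
  transitivity (exp (- 2 * PI * Im z) ^ 2 * (sin (2 * PI * Re z) * sin (2 * PI * Re z) + cos (2 * PI * Re z) * cos (2 * PI * Re z))).
  ring. rewrite T; ring.
Qed.

Lemma e_neq0 (z : C) : e z <> RtoC 0.
Proof. apply Cmod_gt_0. rewrite Cmod_e. apply exp_pos. Qed.

Lemma e_1 : e (RtoC 1) = RtoC 1.
Proof. apply C_eq; rewrite ?e_re, ?e_im, ?re_RtoC, ?im_RtoC, Rmult_0_r, exp_0, Rmult_1_r, ?cos_2PI, ?sin_2PI; ring. Qed.

Lemma e_half : e (RtoC (1 / 2)) = RtoC (-1).
Proof.
  apply C_eq; rewrite ?e_re, ?e_im, ?re_RtoC, ?im_RtoC, Rmult_0_r, exp_0;
  replace (2 * PI * (1/2)) with PI by field; rewrite ?cos_PI, ?sin_PI; ring. Qed.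

Lemma e_opp (z : C) : e (- z)%C = (/ e z)%C.
Proof.
  assert (e (- z) * e z = 1)%C. { rewrite <- e_plus. replace (- z + z)%C with (RtoC 0) by ring. apply e_0. }
  transitivity (e (- z) * e z * / e z)%C. field; apply e_neq0. rewrite H. field. apply e_neq0.
Qed.

Lemma qpow_e (z : C) (n : nat) : qpow z n = (e z ^ n)%C.
Proof.
  assert (Q : forall n, qpow z n = e (INR n * z)%C).
  { intros m. apply C_eq; rewrite ?e_re, ?e_im, ?re_scal_l, ?im_scal_l; unfold qpow;
    [unfold Re at 1 | unfold Im at 1]; simpl fst; simpl snd; f_equal; f_equal; ring. }
  induction n. rewrite Q. replace (INR 0 * z)%C with (RtoC 0) by (simpl; ring). apply e_0.
  rewrite Q, S_INR, RtoC_plus. replace ((INR n + 1) * z)%C with (z + INR n * z)%C by ring.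
  rewrite e_plus, <- Q, IHn. reflexivity.
Qed.

Definition I2pi : C := (RtoC (2 * PI) * Ci)%C.
Lemma I2pi_re : Re I2pi = 0. Proof. unfold I2pi. rewrite re_scal_l. unfold Ci, Re; simpl. ring. Qed.
Lemma I2pi_im : Im I2pi = 2 * PI. Proof. unfold I2pi. rewrite im_scal_l. unfold Ci, Im; simpl. ring. Qed.
Lemma I2pi_neq0 : I2pi <> RtoC 0.
Proof. intros H. assert (T := I2pi_im). rewrite H, im_RtoC in T. assert (P := PI_RGT_0). lra. Qed.
Lemma Cmod_le_sum (z : C) : Cmod z <= Rabs (Re z) + Rabs (Im z).
Proof.
  apply Rsqr_incr_0_var; [|assert (A := Rabs_pos (Re z)); assert (B := Rabs_pos (Im z)); lra].
  rewrite !Rsqr_pow2, Cmod2_alt, <- (pow2_abs (Re z)), <- (pow2_abs (Im z)).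
  assert (A := Rabs_pos (Re z)); assert (B := Rabs_pos (Im z)); nra.
Qed.

Lemma im_le_Cmod (z : C) : Rabs (Im z) <= Cmod z.
Proof. eapply Rle_trans; [apply Rmax_r|apply Rmax_Cmod]. Qed.

Lemma real_deriv0 (f : R -> R) (l : R) : derivable_pt_lim f 0 l -> forall eps, 0 < eps ->
  exists d, 0 < d /\ forall x, Rabs x < d -> Rabs (f x - f 0 - l * x) <= eps * Rabs x.
Proof.
  intros H eps He. destruct (H eps He) as [[d Hd] H1]. exists d. split; auto. intros x Hx.
  destruct (Req_dec x 0) as [->|N].
  - replace (f 0 - f 0 - l * 0) with 0 by ring. rewrite Rabs_R0. lra.
  - specialize (H1 x N Hx). rewrite Rplus_0_l in H1.
    replace (f x - f 0 - l * x) with (((f x - f 0) / x - l) * x) by (field; auto).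
    rewrite Rabs_mult. apply Rmult_le_compat_r; [apply Rabs_pos|lra].
Qed.

(** The functional equation [e z * e (w - z) = e w] moves everything to the origin, where the real
    derivatives of [exp], [sin] and [cos] at 0 control the real and imaginary parts. *)
Lemma cderiv_e (z : C) : cderiv_at e z (I2pi * e z)%C.
Proof.
  enough (D : cderiv_at e (RtoC 0) I2pi).
  { apply (cderiv_ext (fun w => (e z * e (w - z))%C)).
    { intros t. rewrite <- e_plus. replace (z + (t - z))%C with t by ring. reflexivity. }
    eapply cderiv_eq. apply cderiv_scal. apply (cderiv_comp e (fun w => w - z)%C).
    replace (z - z)%C with (RtoC 0) by ring. exact D.
    apply (cderiv_plus (fun w => w) (fun _ => - z)%C). apply cderiv_id. apply cderiv_const.
    simpl. ring. }
  rewrite cderiv_eps. intros eps He0.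
  (* With [PI <= 4] both [a] and [b] below are at most [8 |h|], and the four error terms add up to
     at most [64 ep |h|]; the divisor 1000 leaves a margin. *)
  set (ep := Rmin 1 (eps / 1000)).
  assert (P1 := Rmin_l 1 (eps / 1000)). assert (P2 := Rmin_r 1 (eps / 1000)).
  assert (He : 0 < ep) by (apply Rmin_glb_lt; lra). fold ep in P1, P2. clearbody ep.
  destruct (real_deriv0 exp 1 derivable_pt_lim_exp_0 ep He) as [d1 [Hd1 E1]].
  destruct (real_deriv0 sin 1 derivable_pt_lim_sin_0 ep He) as [d2 [Hd2 E2]].
  assert (DC : derivable_pt_lim cos 0 0) by (generalize (derivable_pt_lim_cos 0); rewrite sin_0, Ropp_0; auto).
  destruct (real_deriv0 cos 0 DC ep He) as [d3 [Hd3 E3]].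
  exists (Rmin (Rmin d1 d2) (Rmin d3 ep) / 10). split.
  { apply Rdiv_lt_0_compat; [repeat apply Rmin_glb_lt; auto|lra]. }
  intros h Hh.
  replace (0 + h)%C with h by ring. rewrite e_0.
  assert (M1 := Rmin_l (Rmin d1 d2) (Rmin d3 ep)). assert (M2 := Rmin_r (Rmin d1 d2) (Rmin d3 ep)).
  assert (M3 := Rmin_l d1 d2). assert (M4 := Rmin_r d1 d2).
  assert (M5 := Rmin_l d3 ep). assert (M6 := Rmin_r d3 ep).
  set (a := - 2 * PI * Im h). set (b := 2 * PI * Re h).
  assert (BPI : 0 < PI <= 4) by (split; [apply PI_RGT_0|apply PI_4]).
  assert (Ha : Rabs a <= 8 * Cmod h).
  { unfold a. rewrite !Rabs_mult. assert (T := im_le_Cmod h). rewrite (Rabs_right PI) by lra.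
    replace (Rabs (-2)) with 2 by (rewrite Rabs_left; lra). assert (T2 := Rabs_pos (Im h)). nra. }
  assert (Hb : Rabs b <= 8 * Cmod h).
  { unfold b. rewrite !Rabs_mult. assert (T := re_le_Cmod h). rewrite (Rabs_right PI) by lra.
    rewrite (Rabs_right 2) by lra. assert (T2 := Rabs_pos (Re h)). nra. }
  specialize (E1 a ltac:(lra)). specialize (E2 b ltac:(lra)). specialize (E3 b ltac:(lra)).
  rewrite exp_0 in E1. rewrite sin_0 in E2. rewrite cos_0 in E3. clear DC.
  eapply Rle_trans; [apply Cmod_le_sum|].
  assert (RE : Re (e h - 1 - I2pi * h)%C = (exp a - 1 - 1 * a) * cos b + (1 + a) * (cos b - 1 - 0 * b)).
  { unfold Cminus. rewrite !re_plus, !re_opp, re_mult, e_re, I2pi_re, I2pi_im, re_RtoC. fold a b. replace (0 * Re h - 2 * PI * Im h) with a by (unfold a; ring). ring. }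
  assert (IE : Im (e h - 1 - I2pi * h)%C = exp a * (sin b - 0 - 1 * b) + (exp a - 1) * b).
  { unfold Cminus. rewrite !im_plus, !im_opp, im_mult, e_im, I2pi_re, I2pi_im, im_RtoC. fold a b. replace (0 * Im h + 2 * PI * Re h) with b by (unfold b; ring). ring. }
  rewrite RE, IE.
  assert (Q := Cmod_ge_0 h). assert (A1 := Rabs_pos a). assert (B1 := Rabs_pos b).
  assert (S1 : Rabs (exp a - 1) <= 2 * Rabs a).
  { replace (exp a - 1) with ((exp a - 1 - 1 * a) + a) by ring. eapply Rle_trans; [apply Rabs_triang|]. nra. }
  assert (S2 : Rabs (exp a) <= 3).
  { replace (exp a) with ((exp a - 1) + 1) by ring. eapply Rle_trans; [apply Rabs_triang|]. rewrite (Rabs_right 1) by lra. lra. }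
  assert (S3 : Rabs (cos b) <= 1) by (apply Rabs_le; apply COS_bound).
  assert (S4 : Rabs (1 + a) <= 2). { eapply Rle_trans; [apply Rabs_triang|]. rewrite (Rabs_right 1) by lra. lra. }
  assert (T1 := Rabs_triang ((exp a - 1 - 1 * a) * cos b) ((1 + a) * (cos b - 1 - 0 * b))).
  assert (T2 := Rabs_triang (exp a * (sin b - 0 - 1 * b)) ((exp a - 1) * b)).
  rewrite !Rabs_mult in T1, T2.
  assert (U1 : Rabs (exp a - 1 - 1 * a) * Rabs (cos b) <= (ep * Rabs a) * 1) by (apply Rmult_le_compat; auto using Rabs_pos).
  assert (U2 : Rabs (1 + a) * Rabs (cos b - 1 - 0 * b) <= 2 * (ep * Rabs b)) by (apply Rmult_le_compat; auto using Rabs_pos).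
  assert (U3 : Rabs (exp a) * Rabs (sin b - 0 - 1 * b) <= 3 * (ep * Rabs b)) by (apply Rmult_le_compat; auto using Rabs_pos).
  assert (U4 : Rabs (exp a - 1) * Rabs b <= (2 * ep) * Rabs b). { apply Rmult_le_compat_r; auto. lra. }
  assert (V1 : ep * Rabs a <= ep * (8 * Cmod h)) by (apply Rmult_le_compat_l; lra).
  assert (V2 : ep * Rabs b <= ep * (8 * Cmod h)) by (apply Rmult_le_compat_l; lra).
  assert (V3 : ep * Cmod h <= eps / 1000 * Cmod h) by (apply Rmult_le_compat_r; lra).
  assert (V4 : 0 <= eps * Cmod h) by (apply Rmult_le_pos; lra).
  lra.
Qed.

(** * Limits and series of complex numbers, dominated convergence, interchange of sums *)

Definition clim (a : nat -> C) (l : C) : Prop :=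
  forall eps, 0 < eps -> exists N, forall n, (N <= n)%nat -> Cmod (a n - l)%C < eps.

Lemma clim_ext (a b : nat -> C) l : (forall n, a n = b n) -> clim a l -> clim b l.
Proof. intros E H eps He. destruct (H eps He) as [N HN]. exists N; intros; rewrite <- E; auto. Qed.

Lemma clim_const (c : C) : clim (fun _ => c) c.
Proof. intros eps He. exists O. intros. replace (c - c)%C with (RtoC 0) by ring. rewrite Cmod_0; auto. Qed.

Lemma clim_plus (a b : nat -> C) l m : clim a l -> clim b m -> clim (fun n => a n + b n)%C (l + m)%C.
Proof.
  intros H1 H2 eps He. destruct (H1 (eps/2) ltac:(lra)) as [N1 F1]. destruct (H2 (eps/2) ltac:(lra)) as [N2 F2].
  exists (max N1 N2). intros n Hn. specialize (F1 n ltac:(lia)). specialize (F2 n ltac:(lia)).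
  replace (a n + b n - (l + m))%C with ((a n - l) + (b n - m))%C by ring.
  eapply Rle_lt_trans; [apply Cmod_triangle|]. lra.
Qed.

Lemma clim_mult (a b : nat -> C) l m : clim a l -> clim b m -> clim (fun n => a n * b n)%C (l * m)%C.
Proof.
  intros H1 H2 eps He.
  set (K := 1 + Cmod l + Cmod m). assert (Q1 := Cmod_ge_0 l). assert (Q2 := Cmod_ge_0 m).
  assert (HK : 1 <= K) by (unfold K; lra).
  set (d := Rmin 1 (eps / (2 * K))).
  assert (D1 := Rmin_l 1 (eps / (2 * K))). assert (D2 := Rmin_r 1 (eps / (2 * K))). fold d in D1, D2.
  assert (D : 0 < d). { apply Rmin_glb_lt. lra. apply Rdiv_lt_0_compat; lra. }
  destruct (H1 d D) as [N1 F1]. destruct (H2 d D) as [N2 F2].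
  exists (max N1 N2). intros n Hn. specialize (F1 n ltac:(lia)). specialize (F2 n ltac:(lia)).
  replace (a n * b n - l * m)%C with ((a n - l) * (b n - m) + (a n - l) * m + l * (b n - m))%C by ring.
  eapply Rle_lt_trans; [apply Cmod_triangle|]. eapply Rle_lt_trans; [apply Rplus_le_compat_r, Cmod_triangle|].
  rewrite !Cmod_mult. assert (A := Cmod_ge_0 (a n - l)%C). assert (B := Cmod_ge_0 (b n - m)%C).
  apply Rle_lt_trans with (d * K). unfold K. nra.
  apply Rle_lt_trans with (eps / (2 * K) * K). apply Rmult_le_compat_r; lra.
  replace (eps / (2 * K) * K) with (eps / 2) by (field; lra). lra.
Qed.

Lemma clim_scal (c : C) (a : nat -> C) l : clim a l -> clim (fun n => c * a n)%C (c * l)%C.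
Proof. intros. apply clim_mult; auto using clim_const. Qed.

Lemma clim_minus (a b : nat -> C) l m : clim a l -> clim b m -> clim (fun n => a n - b n)%C (l - m)%C.
Proof.
  intros H1 H2. replace (l - m)%C with (l + (- (1)) * m)%C by ring.
  eapply clim_ext; [|apply (clim_plus _ _ _ _ H1 (clim_scal (- (1))%C _ _ H2))]. intros; simpl; ring.
Qed.

Lemma clim_unique (a : nat -> C) l m : clim a l -> clim a m -> l = m.
Proof.
  intros H1 H2. apply Ceq_minus. apply Cmod_eq_0. apply Rle_antisym; [|apply Cmod_ge_0].
  apply Rnot_lt_le. intros P.
  destruct (H1 (Cmod (l - m)%C / 2) ltac:(lra)) as [N1 F1].
  destruct (H2 (Cmod (l - m)%C / 2) ltac:(lra)) as [N2 F2].
  specialize (F1 (max N1 N2) ltac:(lia)). specialize (F2 (max N1 N2) ltac:(lia)).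
  assert (T := Cmod_triangle (a (max N1 N2) - m)%C (- (a (max N1 N2) - l))%C).
  rewrite Cmod_opp in T. replace (a (max N1 N2) - m + - (a (max N1 N2) - l))%C with (l - m)%C in T by ring. lra.
Qed.

Lemma clim_bound (a : nat -> C) l K : clim a l -> (forall n, Cmod (a n) <= K) -> Cmod l <= K.
Proof.
  intros H B. apply Rnot_lt_le. intros P. destruct (H (Cmod l - K) ltac:(lra)) as [N F].
  specialize (F N (le_n N)). specialize (B N). assert (T := Cmod_sub_lower l (a N)).
  replace (l - a N)%C with (- (a N - l))%C in T by ring. rewrite Cmod_opp in T. lra.
Qed.

Lemma clim_0_bound (a : nat -> C) (u : nat -> R) :
  (forall n, Cmod (a n) <= u n) -> is_lim_seq u 0 -> clim a (RtoC 0).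
Proof.
  intros B L eps He. apply is_lim_seq_spec in L. destruct (L (mkposreal eps He)) as [N HN].
  exists N. intros n Hn. specialize (HN n Hn). simpl in HN. rewrite Rminus_0_r in HN.
  replace (a n - 0)%C with (a n) by ring. specialize (B n). assert (T := Rle_abs (u n)). lra.
Qed.

Lemma clim_subseq (a : nat -> C) l (s : nat -> nat) : (forall n, (n <= s n)%nat) -> clim a l -> clim (fun n => a (s n)) l.
Proof. intros S H eps He. destruct (H eps He) as [N F]. exists N. intros n Hn. apply F. specialize (S n). lia. Qed.

Lemma ccont_clim (f : C -> C) (a : nat -> C) l : ccont f l -> clim a l -> clim (fun n => f (a n)) (f l).
Proof.
  intros F A eps He. destruct (F eps He) as [d [Hd H]]. destruct (A d Hd) as [N HN].
  exists N. intros n Hn. apply H, HN, Hn.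
Qed.

Fixpoint psum (a : nat -> C) (n : nat) : C :=
  match n with O => RtoC 0 | S n => (psum a n + a n)%C end.

Definition cser (a : nat -> C) (l : C) : Prop := clim (psum a) l.

Lemma psum_ext (a b : nat -> C) n : (forall k, (k < n)%nat -> a k = b k) -> psum a n = psum b n.
Proof. induction n; intros H; simpl; auto. rewrite IHn by (intros; apply H; lia). rewrite H by lia. auto. Qed.
Lemma psum_plus (a b : nat -> C) n : psum (fun k => a k + b k)%C n = (psum a n + psum b n)%C.
Proof. induction n; simpl; [ring|rewrite IHn; ring]. Qed.
Lemma psum_scal (c : C) (a : nat -> C) n : psum (fun k => c * a k)%C n = (c * psum a n)%C.
Proof. induction n; simpl; [ring|rewrite IHn; ring]. Qed.
Lemma psum_shift (a : nat -> C) n : psum a (S n) = (a O + psum (fun k => a (S k)) n)%C.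
Proof. induction n; simpl in *; [ring|rewrite IHn; ring]. Qed.
Lemma psum_add (a : nat -> C) n m : psum a (n + m) = (psum a n + psum (fun k => a (n + k)%nat) m)%C.
Proof.
  induction m; simpl. rewrite Nat.add_0_r; ring. rewrite Nat.add_succ_r; simpl. rewrite IHm; ring.
Qed.

Lemma cser_ext (a b : nat -> C) l : (forall n, a n = b n) -> cser a l -> cser b l.
Proof. intros E. apply clim_ext. intros n. apply psum_ext. auto. Qed.
Lemma cser_plus (a b : nat -> C) l m : cser a l -> cser b m -> cser (fun n => a n + b n)%C (l + m)%C.
Proof. intros H1 H2. eapply clim_ext; [|apply (clim_plus _ _ _ _ H1 H2)]. intros; simpl. rewrite psum_plus; auto. Qed.
Lemma cser_scal (c : C) (a : nat -> C) l : cser a l -> cser (fun n => c * a n)%C (c * l)%C.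
Proof. intros H. eapply clim_ext; [|apply (clim_scal c _ _ H)]. intros; simpl. rewrite psum_scal; auto. Qed.
Lemma cser_minus (a b : nat -> C) l m : cser a l -> cser b m -> cser (fun n => a n - b n)%C (l - m)%C.
Proof.
  intros H1 H2. replace (l - m)%C with (l + (- (1)) * m)%C by ring.
  eapply cser_ext; [|apply (cser_plus _ _ _ _ H1 (cser_scal (- (1))%C _ _ H2))]. intros; simpl; ring.
Qed.
Lemma cser_unique (a : nat -> C) l m : cser a l -> cser a m -> l = m.
Proof. apply clim_unique. Qed.
Lemma cser_incr (a : nat -> C) l : cser a l -> cser (fun n => a (S n)) (l - a O)%C.
Proof.
  intros H. eapply clim_ext; [|apply (clim_minus _ _ _ _ (clim_subseq _ _ S ltac:(intros; lia) H) (clim_const (a O)))].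
  intros n; cbv beta. rewrite psum_shift. ring.
Qed.
Lemma cser_decr (a : nat -> C) l : cser (fun n => a (S n)) l -> cser a (a O + l)%C.
Proof.
  intros H eps He. destruct (clim_plus _ _ _ _ (clim_const (a O)) H eps He) as [N F].
  exists (S N). intros n Hn. destruct n; [lia|]. rewrite psum_shift. apply F; lia.
Qed.

Lemma psum_Cmod (a : nat -> C) (u : nat -> R) n :
  (forall k, Cmod (a k) <= u k) -> Cmod (psum a (S n)) <= sum_n u n.
Proof.
  intros H. induction n.
  - rewrite sum_O. simpl. rewrite Cplus_0_l. auto.
  - rewrite sum_Sn. change (psum a (S (S n))) with (psum a (S n) + a (S n))%C.
    eapply Rle_trans; [apply Cmod_triangle|]. apply Rplus_le_compat; auto.
Qed.

Lemma ser_pos_le (u : nat -> R) n : (forall k, 0 <= u k) -> ex_series u -> sum_n u n <= Series u.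
Proof.
  intros P H. apply Series_correct in H.
  apply (is_lim_seq_incr_compare (sum_n u)); [exact H|].
  intros k. rewrite sum_Sn. unfold plus; simpl. specialize (P (S k)). lra.
Qed.

Lemma cser_bound (a : nat -> C) (u : nat -> R) l :
  cser a l -> (forall k, Cmod (a k) <= u k) -> ex_series u -> Cmod l <= Series u.
Proof.
  intros H B E. assert (P : forall k, 0 <= u k) by (intros k; eapply Rle_trans; [apply Cmod_ge_0|apply B]).
  apply (clim_bound (fun n => psum a (S n))).
  - apply (clim_subseq _ _ S ltac:(intros; lia) H).
  - intros n. eapply Rle_trans; [apply (psum_Cmod a u); auto|]. apply ser_pos_le; auto.
Qed.

Lemma Re_psum (a : nat -> C) n : Re (psum a (S n)) = sum_n (fun k => Re (a k)) n.
Proof.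
  induction n. rewrite sum_O. simpl psum. rewrite Cplus_0_l; auto.
  rewrite sum_Sn, <- IHn. change (psum a (S (S n))) with (psum a (S n) + a (S n))%C. apply re_plus.
Qed.
Lemma Im_psum (a : nat -> C) n : Im (psum a (S n)) = sum_n (fun k => Im (a k)) n.
Proof.
  induction n. rewrite sum_O. simpl psum. rewrite Cplus_0_l; auto.
  rewrite sum_Sn, <- IHn. change (psum a (S (S n))) with (psum a (S n) + a (S n))%C. apply im_plus.
Qed.

(** [cseries] is a total function built on [Series], hence meaningful only under convergence;
    domination by a summable [u] supplies it for both components. *)
Lemma cser_cseries (a : nat -> C) (u : nat -> R) :
  (forall k, Cmod (a k) <= u k) -> ex_series u -> cser a (cseries a).
Proof.
  intros B E.
  assert (ER : ex_series (fun n => Re (a n))).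
  { apply (ex_series_le (K := R_AbsRing) (V := R_CompleteNormedModule) _ u); auto.
    intros n. eapply Rle_trans; [apply re_le_Cmod|auto]. }
  assert (EI : ex_series (fun n => Im (a n))).
  { apply (ex_series_le (K := R_AbsRing) (V := R_CompleteNormedModule) _ u); auto.
    intros n. eapply Rle_trans; [apply im_le_Cmod|auto]. }
  apply Series_correct in ER. apply Series_correct in EI.
  intros eps He.
  assert (LR : is_lim_seq (sum_n (fun n => Re (a n))) (Series (fun n => Re (a n)))) by exact ER.
  assert (LI : is_lim_seq (sum_n (fun n => Im (a n))) (Series (fun n => Im (a n)))) by exact EI.
  apply is_lim_seq_spec in LR. apply is_lim_seq_spec in LI.
  assert (He2 : 0 < eps / 2) by lra.
  destruct (LR (mkposreal _ He2)) as [N1 F1]. destruct (LI (mkposreal _ He2)) as [N2 F2].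
  exists (S (max N1 N2)). intros n Hn. destruct n; [lia|].
  specialize (F1 n ltac:(lia)). specialize (F2 n ltac:(lia)). simpl in F1, F2.
  eapply Rle_lt_trans; [apply Cmod_le_sum|].
  unfold Cminus. rewrite re_plus, im_plus, re_opp, im_opp, Re_psum, Im_psum.
  change (Re (cseries a)) with (Series (fun n => Re (a n))). change (Im (cseries a)) with (Series (fun n => Im (a n))).
  change (sum_n (fun k : nat => Re (a k)) n + - Series (fun n0 : nat => Re (a n0))) with (sum_n (fun k : nat => Re (a k)) n - Series (fun n0 : nat => Re (a n0))).
  change (sum_n (fun k : nat => Im (a k)) n + - Series (fun n0 : nat => Im (a n0))) with (sum_n (fun k : nat => Im (a k)) n - Series (fun n0 : nat => Im (a n0))).
  lra.
Qed.

Lemma ex_series_tail_small (u : nat -> R) : (forall k, 0 <= u k) -> ex_series u ->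
  forall eps, 0 < eps -> exists N, Series (fun k => u (N + k)%nat) < eps.
Proof.
  intros P H eps He. assert (L := Series_correct _ H).
  assert (L2 : is_lim_seq (sum_n u) (Series u)) by exact L. apply is_lim_seq_spec in L2.
  destruct (L2 (mkposreal eps He)) as [N F]. exists (S N). specialize (F N (le_n N)). simpl in F.
  rewrite (Series_incr_n u (S N) ltac:(lia) H) in F. simpl pred in F. rewrite <- sum_n_Reals in F.
  apply Rabs_def2 in F. lra.
Qed.

(** Dominated convergence for series. The tail of [u] bounds the tails of every [t M] and of the
    limit, so only a finite head has to converge. *)
Theorem tannery (t : nat -> nat -> C) (t' : nat -> C) (T : nat -> C) (u : nat -> R) :
  ex_series u -> (forall M j, Cmod (t M j) <= u j) -> (forall j, clim (fun M => t M j) (t' j)) ->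
  (forall M, cser (t M) (T M)) -> cser t' (cseries t') /\ clim T (cseries t').
Proof.
  intros E B L S.
  assert (B' : forall j, Cmod (t' j) <= u j) by (intros j; apply (clim_bound _ _ _ (L j)); auto).
  assert (P : forall k, 0 <= u k) by (intros k; eapply Rle_trans; [apply Cmod_ge_0|apply B']).
  assert (C' := cser_cseries t' u B' E). split; auto.
  intros eps He. destruct (ex_series_tail_small u P E (eps/4) ltac:(lra)) as [N HN].
  assert (F : forall J eps, 0 < eps -> exists M0, forall M, (M0 <= M)%nat -> Cmod (psum (t M) J - psum t' J)%C < eps).
  { intros J. change (clim (fun M => psum (t M) J) (psum t' J)). induction J; simpl.
    apply clim_const. apply clim_plus; auto. }
  destruct (F N (eps/2) ltac:(lra)) as [M0 HM]. exists M0. intros M HM'. specialize (HM M HM').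
  assert (TL : forall a l, cser a l -> (forall j, Cmod (a j) <= u j) -> Cmod (l - psum a N)%C <= Series (fun k => u (N + k)%nat)).
  { clear - E P. intros a l H B. apply (cser_bound (fun k => a (N + k)%nat)); auto.
    - intros eps He. destruct (clim_minus _ _ _ _ H (clim_const (psum a N)) eps He) as [K F].
      exists K. intros n Hn. specialize (F (N + n)%nat ltac:(lia)). rewrite psum_add in F.
      replace (psum (fun k : nat => a (N + k)%nat) n - (l - psum a N))%C
       with (psum a N + psum (fun k : nat => a (N + k)%nat) n - psum a N - (l - psum a N))%C by ring. exact F.
    - apply (proj1 (ex_series_incr_n u N)). exact E. }
  assert (T1 := TL _ _ (S M) (B M)). assert (T2 := TL _ _ C' B').
  replace (T M - cseries t')%C with ((T M - psum (t M) N) + (psum (t M) N - psum t' N) + - (cseries t' - psum t' N))%C by ring.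
  eapply Rle_lt_trans; [apply Cmod_triangle|]. rewrite Cmod_opp.
  eapply Rle_lt_trans; [apply Rplus_le_compat_r, Cmod_triangle|]. lra.
Qed.

(** Tannery's theorem for the rows truncated at [M] terms: their total over [n] is [psum Q M], and
    it tends to the total of the full rows. The product bound [u n * v m] dominates all truncations
    at once. *)
Theorem fubini (c : nat -> nat -> C) (u v : nat -> R) (R Q : nat -> C) :
  ex_series u -> ex_series v -> (forall n, 0 <= u n) -> (forall n, 0 <= v n) -> (forall n m, Cmod (c n m) <= u n * v m) ->
  (forall n, cser (c n) (R n)) -> (forall m, cser (fun n => c n m) (Q m)) ->
  cser R (cseries R) /\ cser Q (cseries R).
Proof.
  intros Eu Ev Pu Pv B HR HQ.
  destruct (tannery (fun M n => psum (c n) M) R (fun M => psum Q M) (fun n => u n * Series v)) as [A1 A2]; auto.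
  - destruct Eu as [U HU]. exists (U * Series v). apply (is_series_scal_r (Series v)). exact HU.
  - intros M n. destruct M.
    + simpl. rewrite Cmod_0. apply Rmult_le_pos; auto. eapply Rle_trans; [|apply (ser_pos_le v 0); auto].
      rewrite sum_O. auto.
    + eapply Rle_trans; [apply (psum_Cmod (c n) (fun m => u n * v m)); auto|].
      rewrite <- (Series_scal_l (u n) v). apply ser_pos_le.
      intros; apply Rmult_le_pos; auto. apply (ex_series_scal_l (u n) v Ev).
  - intros M. induction M; simpl.
    + intros eps He. exists O. intros n _. enough (psum (fun _ => RtoC 0) n = RtoC 0) as ->.
      replace (0 - 0)%C with (RtoC 0) by ring. rewrite Cmod_0; auto.
      clear. induction n; simpl; auto. rewrite IHn; ring.
    + apply (cser_plus _ _ _ _ IHM (HQ M)).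
Qed.

(** * Power series in q *)

Lemma ex_ser_scal_l (c : R) (u : nat -> R) : ex_series u -> ex_series (fun n => c * u n).
Proof. intros [l H]. exists (c * l). exact (is_series_scal_l c u l H). Qed.
Lemma ex_ser_scal_r (c : R) (u : nat -> R) : ex_series u -> ex_series (fun n => u n * c).
Proof. intros H. eapply ex_series_ext; [|exact (ex_ser_scal_l c u H)]. intros; simpl; ring. Qed.

(** Bernoulli's inequality for [/ r]; the case [r = 0], where [/ r] is meaningless, is treated
    separately. *)
Lemma lin_geom_bound (r : R) : 0 <= r < 1 -> exists K, 0 < K /\ forall n, INR n * r ^ n <= K.
Proof.
  intros [H0 H1]. destruct H0 as [H0|<-].
  - exists (/ (/ r - 1)). assert (1 < / r) by (rewrite <- Rinv_1; apply Rinv_lt_contravar; lra).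
    split. apply Rinv_0_lt_compat; lra. intros n.
    assert (P : 0 < r ^ n) by (apply pow_lt; auto).
    assert (B := poly n (/ r - 1) ltac:(lra)).
    replace (1 + (/ r - 1)) with (/ r) in B by ring. rewrite pow_inv in B.
    apply Rmult_le_reg_r with (/ r - 1); [lra|].
    rewrite Rinv_l by lra. apply Rmult_le_reg_r with (/ r ^ n). apply Rinv_0_lt_compat; auto.
    replace (INR n * r ^ n * (/ r - 1) * / r ^ n) with (INR n * (/ r - 1)) by (field; split; lra). lra.
  - exists 1. split; [lra|]. intros [|n]; simpl; lra.
Qed.

(** Each factor [n] is absorbed by raising [x] to the midpoint [y] between [x] and 1, since
    [n (x / y)^n] is bounded. *)
Lemma ex_series_pow_geom (p : nat) : forall x, 0 <= x < 1 -> ex_series (fun n => INR n ^ p * x ^ n).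
Proof.
  induction p; intros x Hx.
  - apply ex_series_ext with (fun n => x ^ n). intros; simpl; ring.
    apply ex_series_geom. apply Rabs_def1; lra.
  - set (y := (1 + x) / 2). assert (Hy : x < y < 1) by (unfold y; lra).
    destruct (lin_geom_bound (x / y)) as [K [HK B]].
    { split. apply Rdiv_le_0_compat; lra. apply Rlt_div_l; lra. }
    apply (ex_series_le (K := R_AbsRing) (V := R_CompleteNormedModule) _ (fun n => K * (INR n ^ p * y ^ n))).
    2: { apply (ex_ser_scal_l K). apply IHp. lra. }
    intros n. unfold norm; simpl. unfold abs; simpl.
    assert (P1 : 0 <= INR n ^ p) by (apply pow_le, pos_INR).
    assert (P2 : 0 < y ^ n) by (apply pow_lt; lra). assert (P3 : 0 <= x ^ n) by (apply pow_le; lra).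
    rewrite Rabs_right. 2: { apply Rle_ge. repeat apply Rmult_le_pos; auto. apply pos_INR. }
    replace (INR n * INR n ^ p * x ^ n) with ((INR n * (x / y) ^ n) * (INR n ^ p * y ^ n)).
    apply Rmult_le_compat_r. nra. apply B.
    unfold Rdiv. rewrite Rpow_mult_distr, pow_inv. field. lra.
Qed.

Lemma ex_series_pow_geom_S (p : nat) (x : R) : 0 <= x < 1 -> ex_series (fun n => INR (S n) ^ p * x ^ n).
Proof.
  intros [Hx0 Hx]. destruct Hx0 as [Hx0|<-].
  - assert (E := proj1 (ex_series_incr_1 _) (ex_series_pow_geom p x ltac:(lra))).
    apply (ex_series_ext (fun n => / x * (INR (S n) ^ p * x ^ S n))).
    intros n. change (/ x * (INR (S n) ^ p * (x * x ^ n)) = INR (S n) ^ p * x ^ n). field. lra. apply (ex_ser_scal_l (/ x)), E.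
  - apply ex_series_incr_1. apply ex_series_ext with (fun n => 0 ^ n * 0). intros n. change (0 ^ n * 0 = INR (S (S n)) ^ p * (0 * 0 ^ n)). ring.
    apply (ex_ser_scal_r 0). apply ex_series_geom. rewrite Rabs_R0; lra.
Qed.

(** Polynomially bounded coefficients, for which [sum a_n q^n] can be differentiated termwise on the half plane. *)
Definition pbd (a : nat -> C) : Prop := exists K p, forall n, Cmod (a n) <= K * INR (S n) ^ p.
Definition qser (a : nat -> C) (z : C) : C := cseries (fun n => a n * e z ^ n)%C.

Lemma pbd_derive (a : nat -> C) : pbd a -> pbd (fun n => INR n * a n)%C.
Proof.
  intros [K [p H]]. exists K, (S p). intros n. rewrite Cmod_mult, Cmod_R, Rabs_right by (apply Rle_ge, pos_INR).
  change (INR (S n) ^ S p) with (INR (S n) * INR (S n) ^ p). specialize (H n). assert (T := S_INR n). assert (T2 := pos_INR n). assert (T3 := Cmod_ge_0 (a n)).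
  apply Rle_trans with (INR (S n) * (K * INR (S n) ^ p)); [apply Rmult_le_compat; lra|]. right; ring.
Qed.

Lemma exp_m2pi_lt1 (z : C) : in_H z -> 0 < Cmod (e z) < 1.
Proof.
  unfold in_H. intros H. rewrite Cmod_e. split. apply exp_pos. rewrite <- exp_0. apply exp_increasing.
  assert (P := PI_RGT_0). nra.
Qed.

Lemma ex_series_pbd (a : nat -> C) (x : R) : pbd a -> 0 <= x < 1 -> ex_series (fun n => Cmod (a n) * x ^ n).
Proof.
  intros [K [p H]] Hx. apply (ex_series_le (K := R_AbsRing) (V := R_CompleteNormedModule) _ (fun n => K * (INR (S n) ^ p * x ^ n))).
  2: { apply (ex_ser_scal_l K). apply ex_series_pow_geom_S; auto. }
  intros n. unfold norm; simpl. unfold abs; simpl.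
  assert (P : 0 <= x ^ n) by (apply pow_le; lra).
  rewrite Rabs_right. rewrite <- Rmult_assoc. apply Rmult_le_compat_r; auto.
  apply Rle_ge, Rmult_le_pos; auto using Cmod_ge_0.
Qed.

Lemma cser_pow (a : nat -> C) (q : C) : pbd a -> Cmod q < 1 -> cser (fun n => a n * q ^ n)%C (cseries (fun n => a n * q ^ n)%C).
Proof.
  intros P H. apply cser_cseries with (fun n => Cmod (a n) * Cmod q ^ n).
  intros; rewrite Cmod_mult, Cmod_pow; lra. apply ex_series_pbd; auto. split; auto using Cmod_ge_0.
Qed.

Lemma qser_cser (a : nat -> C) (z : C) : pbd a -> in_H z -> cser (fun n => a n * e z ^ n)%C (qser a z).
Proof. intros P H. apply cser_pow; auto. apply exp_m2pi_lt1; auto. Qed.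

Definition dpow (q : C) (n : nat) : C := match n with O => RtoC 0 | S m => (INR n * q ^ m)%C end.

(** The Taylor remainder is of order [n^2 r^(n-2) |h|^2]; multiplying by [r^2] removes the exponent
    [n - 2]. For the induction, the remainder for [n + 1] is [q + h] times that for [n], plus
    [dpow q n * h^2]. *)
Lemma pow_taylor2 (q h : C) (r : R) (n : nat) :
  0 < r -> Cmod q <= r -> Cmod (q + h)%C <= r ->
  r * r * Cmod ((q + h) ^ n - q ^ n - dpow q n * h)%C <= INR n * INR n * r ^ n * (Cmod h * Cmod h).
Proof.
  intros Hr Hq Hh.
  assert (D : forall n, r * Cmod (dpow q n) <= INR n * r ^ n).
  { intros [|m]. simpl. rewrite Cmod_0. lra. simpl dpow.
    rewrite Cmod_mult, Cmod_R, Rabs_right, Cmod_pow by (apply Rle_ge, (pos_INR (S m))).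
    assert (Cmod q ^ m <= r ^ m). { apply pow_incr. split; auto using Cmod_ge_0. }
    change (match m with O => 1 | S _ => INR m + 1 end) with (INR (S m)).
    simpl pow. assert (0 <= INR (S m)) by apply pos_INR.
    assert (r * (INR (S m) * Cmod q ^ m) <= r * (INR (S m) * r ^ m)). { apply Rmult_le_compat_l; [lra|]. apply Rmult_le_compat_l; auto. }
    lra. }
  assert (E : forall n, dpow q (S n) = (q * dpow q n + q ^ n)%C).
  { intros [|m]. simpl. ring. simpl dpow. change (match m with O => 1 | S _ => INR m + 1 end) with (INR (S m)).
    rewrite RtoC_plus. simpl Cpow. ring. }
  induction n.
  - simpl. replace (1 - 1 - 0 * h)%C with (RtoC 0) by ring. rewrite Cmod_0. lra.
  - replace ((q + h) ^ S n - q ^ S n - dpow q (S n) * h)%C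
      with ((q + h) * ((q + h) ^ n - q ^ n - dpow q n * h) + dpow q n * (h * h))%C
      by (rewrite E; simpl Cpow; ring).
    set (b := Cmod ((q + h) ^ n - q ^ n - dpow q n * h)%C) in *.
    assert (T := Cmod_triangle ((q + h) * ((q + h) ^ n - q ^ n - dpow q n * h))%C (dpow q n * (h * h))%C).
    rewrite !Cmod_mult in T. fold b in T. specialize (D n).
    assert (Q := Cmod_ge_0 h). assert (Q2 : 0 <= b) by apply Cmod_ge_0.
    assert (Q3 := pos_INR n). assert (Q4 : 0 < r ^ n) by (apply pow_lt; auto).
    assert (Q5 := Cmod_ge_0 (q + h)%C). set (H := Cmod h * Cmod h) in *. assert (Q6 : 0 <= H) by (unfold H; nra).
    apply Rle_trans with (r * r * (r * b + Cmod (dpow q n) * H)).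
    { apply Rmult_le_compat_l; [nra|]. eapply Rle_trans; [apply T|]. apply Rplus_le_compat_r. apply Rmult_le_compat_r; auto. }
    rewrite S_INR. simpl pow.
    apply Rle_trans with (r * (INR n * INR n * r ^ n * H) + r * ((INR n * r ^ n) * H)).
    { replace (r * r * (r * b + Cmod (dpow q n) * H)) with (r * (r * r * b) + r * ((r * Cmod (dpow q n)) * H)) by ring.
      apply Rplus_le_compat; apply Rmult_le_compat_l; try lra. apply Rmult_le_compat_r; auto. }
    replace ((INR n + 1) * (INR n + 1) * (r * r ^ n) * H)
      with (r * (INR n * INR n * r ^ n * H) + r * (INR n * r ^ n * H) + (INR n + 1) * (r * (r ^ n * H))) by ring.
    assert (0 <= (INR n + 1) * (r * (r ^ n * H))). { apply Rmult_le_pos; [lra|]. apply Rmult_le_pos; [lra|]. nra. }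
    lra.
Qed.

(** The quadratic remainders sum to a constant times [|h|^2] once [r] lies strictly between [|q|]
    and 1. Here [r] is the midpoint and [S] the sum of [|a_n| n^2 r^n]. *)
Lemma pow_series_deriv (a : nat -> C) (q : C) : pbd a -> Cmod q < 1 ->
  cderiv_at (fun q => cseries (fun n => a n * q ^ n)%C) q (cseries (fun n => a n * dpow q n)%C).
Proof.
  intros P Hq. assert (Q0 := Cmod_ge_0 q).
  set (r := (1 + Cmod q) / 2). assert (Hr : 0 < r < 1) by (unfold r; lra).
  assert (Ed := ex_series_pbd _ r (pbd_derive _ (pbd_derive _ P)) ltac:(lra)).
  assert (B : forall n, Cmod (INR n * (INR n * a n))%C * r ^ n = Cmod (a n) * (INR n * INR n * r ^ n)).
  { intros n. rewrite !Cmod_mult, !Cmod_R, !Rabs_right by (apply Rle_ge, pos_INR). ring. }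
  set (S := Series (fun n => Cmod (a n) * (INR n * INR n * r ^ n))).
  assert (ES : ex_series (fun n => Cmod (a n) * (INR n * INR n * r ^ n))) by (eapply ex_series_ext; [exact B|exact Ed]).
  assert (PS : 0 <= S).
  { apply Rle_trans with (sum_n (fun n => Cmod (a n) * (INR n * INR n * r ^ n)) 0).
    rewrite sum_O. simpl. lra. apply ser_pos_le; auto. intros k. apply Rmult_le_pos. apply Cmod_ge_0.
    assert (T := pos_INR k). assert (T2 : 0 < r ^ k) by (apply pow_lt; lra). apply Rmult_le_pos; nra. }
  assert (D0 : cser (fun n => a n * dpow q n)%C (cseries (fun n => a n * dpow q n)%C)).
  { apply cser_cseries with (fun n => / r * (Cmod (INR n * a n)%C * r ^ n)).
    2: apply (ex_ser_scal_l (/ r)), ex_series_pbd; [apply pbd_derive; auto|lra].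
    intros [|m]. simpl dpow. rewrite Cmult_0_r, Cmod_0. apply Rmult_le_pos. left; apply Rinv_0_lt_compat; lra.
    apply Rmult_le_pos; [apply Cmod_ge_0|simpl; lra].
    unfold dpow. rewrite !Cmod_mult, Cmod_pow. simpl pow.
    replace (/ r * (Cmod (INR (Datatypes.S m)) * Cmod (a (Datatypes.S m)) * (r * r ^ m)))
      with (Cmod (a (Datatypes.S m)) * (Cmod (INR (Datatypes.S m)) * r ^ m)) by (field; lra).
    apply Rmult_le_compat_l. apply Cmod_ge_0. apply Rmult_le_compat_l. apply Cmod_ge_0.
    apply pow_incr. unfold r; lra. }
  rewrite cderiv_eps. intros eps He.
  exists (Rmin ((1 - Cmod q) / 2) (eps * (r * r) / (S + 1))). split.
  { apply Rmin_glb_lt. lra. apply Rdiv_lt_0_compat; [repeat apply Rmult_lt_0_compat; lra|lra]. }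
  intros h Hh. assert (M1 := Rmin_l ((1 - Cmod q) / 2) (eps * (r * r) / (S + 1))).
  assert (M2 := Rmin_r ((1 - Cmod q) / 2) (eps * (r * r) / (S + 1))).
  assert (QH : Cmod (q + h)%C <= r). { eapply Rle_trans; [apply Cmod_triangle|]. unfold r; lra. }
  assert (C1 := cser_pow a (q + h)%C P ltac:(lra)). assert (C2 := cser_pow a q P Hq).
  assert (C3 := cser_minus _ _ _ _ (cser_minus _ _ _ _ C1 C2) (cser_scal h _ _ D0)).
  rewrite (Cmult_comm _ h).
  assert (N := Cmod_ge_0 h).
  assert (HH : Cmod h * (S + 1) < eps * (r * r)). { apply Rlt_div_r; lra. }
  apply Rmult_le_reg_l with (r * r). nra.
  apply Rle_trans with (S * (Cmod h * Cmod h)); [|nra].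
  assert (BB := cser_bound _ (fun n => / (r * r) * (Cmod (a n) * (INR n * INR n * r ^ n) * (Cmod h * Cmod h))) _ C3).
  assert (E2 : ex_series (fun n => / (r * r) * (Cmod (a n) * (INR n * INR n * r ^ n) * (Cmod h * Cmod h)))).
  { apply (ex_ser_scal_l (/ (r * r))). apply (ex_ser_scal_r (Cmod h * Cmod h)). exact ES. }
  assert (E3 : Series (fun n => / (r * r) * (Cmod (a n) * (INR n * INR n * r ^ n) * (Cmod h * Cmod h))) = / (r * r) * (S * (Cmod h * Cmod h))).
  { rewrite Series_scal_l, Series_scal_r. reflexivity. }
  rewrite E3 in BB.
  apply Rmult_le_reg_l with (/ (r * r)). apply Rinv_0_lt_compat; nra.
  rewrite <- Rmult_assoc, Rinv_l, Rmult_1_l by nra. apply BB; [|exact E2].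
  intros k. replace (a k * (q + h) ^ k - a k * q ^ k - h * (a k * dpow q k))%C
    with (a k * ((q + h) ^ k - q ^ k - dpow q k * h))%C by ring.
  rewrite Cmod_mult. assert (T := pow_taylor2 q h r k ltac:(lra) ltac:(unfold r; lra) QH).
  replace (/ (r * r) * (Cmod (a k) * (INR k * INR k * r ^ k) * (Cmod h * Cmod h)))
    with (Cmod (a k) * (/ (r * r) * (INR k * INR k * r ^ k * (Cmod h * Cmod h)))) by ring.
  apply Rmult_le_compat_l. apply Cmod_ge_0. apply Rmult_le_reg_l with (r * r). nra.
  rewrite <- (Rmult_assoc (r * r) (/ (r * r))), Rinv_r, Rmult_1_l by nra. exact T.
Qed.

Lemma qser_deriv (a : nat -> C) (z : C) : pbd a -> in_H z ->
  cderiv_at (qser a) z (I2pi * qser (fun n => INR n * a n)%C z)%C.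
Proof.
  intros P H. assert (L := exp_m2pi_lt1 z H).
  eapply cderiv_eq.
  apply (cderiv_comp (fun q => cseries (fun n => a n * q ^ n)%C) e). apply pow_series_deriv; auto. lra. apply cderiv_e.
  rewrite (Cmult_comm _ (I2pi * e z)%C), <- Cmult_assoc. f_equal.
  apply (cser_unique (fun n => INR n * a n * e z ^ n)%C).
  2: { apply qser_cser; auto. apply pbd_derive; auto. }
  eapply cser_ext; [|apply cser_scal].
  2:{ apply cser_cseries with (fun n => / Cmod (e z) * (Cmod (INR n * a n)%C * Cmod (e z) ^ n)).
    2: apply (ex_ser_scal_l (/ Cmod (e z))), ex_series_pbd; [apply pbd_derive; auto|lra].
    intros [|m]. simpl dpow. rewrite Cmult_0_r, Cmod_0. apply Rmult_le_pos. left; apply Rinv_0_lt_compat; lra.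
    apply Rmult_le_pos; [apply Cmod_ge_0|simpl; lra].
    unfold dpow. rewrite !Cmod_mult, Cmod_pow. right. simpl pow. field. lra. }
  intros [|m]; [simpl; ring|unfold dpow; rewrite Cpow_S; ring].
Qed.

(** The tail is [e z] times a series that is dominated by its value at height [1 / 2], where
    [|e z| = exp (- PI)]; hence a single constant [K]. *)
Lemma qser_near_cusp (a : nat -> C) : pbd a ->
  exists K, 0 <= K /\ forall z, / 2 <= Im z -> Cmod (qser a z - a O)%C <= K * exp (- 2 * PI * Im z).
Proof.
  intros P. set (x := exp (- PI)). assert (X : 0 < x < 1).
  { split. apply exp_pos. rewrite <- exp_0. apply exp_increasing. assert (T := PI_RGT_0). lra. }
  assert (E := ex_series_pbd a x P ltac:(lra)).
  assert (E1 := proj1 (ex_series_incr_1 _) E).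
  exists (/ x * Series (fun n => Cmod (a (S n)) * x ^ S n)). split.
  { apply Rmult_le_pos. left; apply Rinv_0_lt_compat; lra.
    apply Rle_trans with (sum_n (fun n => Cmod (a (S n)) * x ^ S n) 0).
    rewrite sum_O. apply Rmult_le_pos. apply Cmod_ge_0. apply pow_le; lra.
    apply ser_pos_le; auto. intros. apply Rmult_le_pos. apply Cmod_ge_0. apply pow_le; lra. }
  intros z Hz. assert (HH : in_H z) by (unfold in_H; lra).
  assert (C1 := cser_incr _ _ (qser_cser a z P HH)). simpl in C1.
  rewrite Cmult_1_r in C1.
  assert (LE : Cmod (e z) <= x). { rewrite Cmod_e. unfold x. assert (T := PI_RGT_0).
    destruct (Req_dec (- 2 * PI * Im z) (- PI)) as [->|N]. lra. left. apply exp_increasing. nra. }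
  rewrite <- Cmod_e. set (y := Cmod (e z)) in *. assert (Y : 0 < y) by apply exp_m2pi_lt1, HH.
  assert (E2 : ex_series (fun n => y * (/ x * (Cmod (a (S n)) * x ^ S n)))).
  { apply (ex_ser_scal_l y). apply (ex_ser_scal_l (/ x)). auto. }
  assert (BB := cser_bound _ (fun n => y * (/ x * (Cmod (a (S n)) * x ^ S n))) _ C1).
  rewrite !Series_scal_l in BB. rewrite (Rmult_comm _ y). apply BB; auto.
  intros k. rewrite !Cmod_mult, Cmod_pow. fold y. simpl pow.
  replace (y * (/ x * (Cmod (a (S k)) * (x * x ^ k)))) with (Cmod (a (S k)) * (y * x ^ k)) by (field; lra).
  apply Rmult_le_compat_l. apply Cmod_ge_0. apply Rmult_le_compat_l. lra. apply pow_incr. lra.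
Qed.

Lemma qser_plus_1 (a : nat -> C) (z : C) : qser a (z + 1)%C = qser a z.
Proof. unfold qser. rewrite e_plus, e_1, Cmult_1_r. reflexivity. Qed.

Definition Ecoef (c : R) (r n : nat) : C := match n with O => RtoC 1 | S _ => RtoC (c * Defs.sigma r n) end.

Lemma sigma_bound (r n : nat) : 0 <= Defs.sigma r n <= INR (S n) ^ S r.
Proof.
  unfold Defs.sigma.
  assert (G : forall m, (m <= n)%nat -> 0 <= sum_n (fun d => if ((1 <=? d)%nat && (n mod d =? 0)%nat)%bool then (INR d ^ r)%R else 0%R) m <= INR (S m) * INR (S n) ^ r).
  { assert (T : forall d, (d <= n)%nat -> 0 <= (if ((1 <=? d)%nat && (n mod d =? 0)%nat)%bool then (INR d ^ r)%R else 0%R) <= INR (S n) ^ r).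
    { intros d Hd. destruct (_ && _)%bool. split. apply pow_le, pos_INR. apply pow_incr. split. apply pos_INR. apply le_INR; lia.
      split. lra. apply pow_le, pos_INR. }
    induction m; intros Hm.
    - rewrite sum_O. specialize (T O ltac:(lia)). change (INR 1) with 1. rewrite Rmult_1_l. exact T.
    - rewrite sum_Sn, (S_INR (S m)). destruct (IHm ltac:(lia)) as [A1 A2]. destruct (T (S m) Hm) as [B1 B2].
      split. apply (Rplus_le_le_0_compat _ _ A1 B1).
      rewrite Rmult_plus_distr_r, Rmult_1_l. apply (Rplus_le_compat _ _ _ _ A2 B2). }
  apply (G n (le_n n)).
Qed.

Lemma pbd_Ecoef c r : pbd (Ecoef c r).
Proof.
  exists (Rabs c + 1), (S r). assert (A := Rabs_pos c). intros [|n].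
  - unfold Ecoef. rewrite Cmod_1. simpl INR. rewrite pow1. lra.
  - unfold Ecoef. rewrite Cmod_R, Rabs_mult. assert (T := sigma_bound r (S n)). rewrite (Rabs_right (Defs.sigma _ _)) by lra.
    apply Rmult_le_compat; try lra.
Qed.

Lemma Eis_qser (c : R) (r : nat) (z : C) : in_H z -> Eis c r z = qser (Ecoef c r) z.
Proof.
  intros H. assert (L := exp_m2pi_lt1 z H).
  apply (cser_unique (fun n => Ecoef c r n * e z ^ n)%C).
  2: apply qser_cser; auto; apply pbd_Ecoef.
  unfold Eis. replace (RtoC 1) with (Ecoef c r O * e z ^ O)%C at 1 by (simpl; ring).
  apply (cser_decr (fun n => Ecoef c r n * e z ^ n)%C).
  eapply cser_ext; [|apply cser_scal].
  2:{ apply cser_cseries with (fun n => Cmod (Ecoef 1 r (S n)) * Cmod (e z) ^ (S n)).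
     intros k. unfold Ecoef. rewrite Cmod_mult, qpow_e, Cmod_pow, Rmult_1_l. lra.
     apply (proj1 (ex_series_incr_1 (fun n => Cmod (Ecoef 1 r n) * Cmod (e z) ^ n))).
     apply ex_series_pbd. apply pbd_Ecoef. lra. }
  intros n. cbv beta. rewrite qpow_e. unfold Ecoef. rewrite RtoC_mult. ring.
Qed.

(** * Contour integrals and Goursat's theorem *)

(** Integrals are taken componentwise along horizontal and vertical segments, since rectangles are
    the only contours that occur. *)
Definition CI (f : R -> C) (a b : R) : C := (RInt (fun x => Re (f x)) a b, RInt (fun x => Im (f x)) a b).
Definition Rcont (f : R -> C) (x : R) : Prop := continuous (fun t => Re (f t)) x /\ continuous (fun t => Im (f t)) x.

Lemma re_CI f a b : Re (CI f a b) = RInt (fun x => Re (f x)) a b. Proof. reflexivity. Qed.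
Lemma im_CI f a b : Im (CI f a b) = RInt (fun x => Im (f x)) a b. Proof. reflexivity. Qed.

Lemma ccont_Rcont (F : C -> C) (g : R -> C) (x : R) :
  ccont F (g x) -> (forall t, Cmod (g t - g x)%C <= Rabs (t - x)) -> Rcont (fun t => F (g t)) x.
Proof.
  intros H L. split; apply filterlim_locally; intros [eps He]; destruct (H eps He) as [d [Hd H1]];
  exists (mkposreal d Hd); intros t Ht; specialize (H1 (g t)); specialize (L t);
  assert (Cmod (g t - g x)%C < d) by (eapply Rle_lt_trans; [apply L|exact Ht]); specialize (H1 H0).
  - assert (T := re_le_Cmod (F (g t) - F (g x))%C). unfold Cminus in T at 1. rewrite re_plus, re_opp in T.
    eapply Rle_lt_trans; [exact T|exact H1].
  - assert (T := im_le_Cmod (F (g t) - F (g x))%C). unfold Cminus in T at 1. rewrite im_plus, im_opp in T.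
    eapply Rle_lt_trans; [exact T|exact H1].
Qed.

Lemma ccont_Rcont_h (F : C -> C) (x y : R) : ccont F (x, y) -> Rcont (fun t => F (t, y)) x.
Proof.
  intros H. apply (ccont_Rcont F (fun t => (t, y))); auto. intros t.
  replace ((t, y) - (x, y))%C with (RtoC (t - x)) by (apply C_eq; simpl; ring). rewrite Cmod_R; lra.
Qed.
Lemma ccont_Rcont_v (F : C -> C) (x y : R) : ccont F (x, y) -> Rcont (fun t => F (x, t)) y.
Proof.
  intros H. apply (ccont_Rcont F (fun t => (x, t))); auto. intros t.
  replace ((x, t) - (x, y))%C with (Ci * RtoC (t - y))%C by (apply C_eq; simpl; ring).
  rewrite Cmod_mult, Cmod_Ci, Cmod_R; lra.
Qed.

Lemma ex_RInt_Re f a b : a <= b -> (forall x, a <= x <= b -> Rcont f x) -> ex_RInt (fun x => Re (f x)) a b.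
Proof. intros L H. apply (ex_RInt_continuous (V := R_CompleteNormedModule)). intros z Hz. rewrite Rmin_left, Rmax_right in Hz by auto. exact (proj1 (H z Hz)). Qed.
Lemma ex_RInt_Im f a b : a <= b -> (forall x, a <= x <= b -> Rcont f x) -> ex_RInt (fun x => Im (f x)) a b.
Proof. intros L H. apply (ex_RInt_continuous (V := R_CompleteNormedModule)). intros z Hz. rewrite Rmin_left, Rmax_right in Hz by auto. exact (proj2 (H z Hz)). Qed.

Lemma CI_Chasles f a b c : a <= b <= c -> (forall x, a <= x <= c -> Rcont f x) -> CI f a c = (CI f a b + CI f b c)%C.
Proof.
  intros L H.
  assert (H1 : forall x, a <= x <= b -> Rcont f x) by (intros; apply H; lra).
  assert (H2 : forall x, b <= x <= c -> Rcont f x) by (intros; apply H; lra).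
  assert (L1 : a <= b) by lra. assert (L2 : b <= c) by lra.
  apply C_eq; [rewrite re_plus|rewrite im_plus]; symmetry.
  - exact (RInt_Chasles (V := R_CompleteNormedModule) _ a b c (ex_RInt_Re f a b L1 H1) (ex_RInt_Re f b c L2 H2)).
  - exact (RInt_Chasles (V := R_CompleteNormedModule) _ a b c (ex_RInt_Im f a b L1 H1) (ex_RInt_Im f b c L2 H2)).
Qed.

Lemma CI_ext f g a b : a <= b -> (forall x, a <= x <= b -> f x = g x) -> CI f a b = CI g a b.
Proof. intros L H. unfold CI. f_equal; apply RInt_ext; intros x; rewrite Rmin_left, Rmax_right by auto; intros; rewrite H; auto; lra. Qed.

Lemma CI_plus f g a b : a <= b -> (forall x, a <= x <= b -> Rcont f x) -> (forall x, a <= x <= b -> Rcont g x) ->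
  CI (fun x => f x + g x)%C a b = (CI f a b + CI g a b)%C.
Proof.
  intros L Hf Hg. apply C_eq; rewrite ?re_plus, ?im_plus, ?re_CI, ?im_CI.
  - rewrite <- (RInt_plus (V := R_CompleteNormedModule)) by (apply ex_RInt_Re; auto).
    apply RInt_ext; intros; rewrite re_plus; auto.
  - rewrite <- (RInt_plus (V := R_CompleteNormedModule)) by (apply ex_RInt_Im; auto).
    apply RInt_ext; intros; rewrite im_plus; auto.
Qed.

Lemma CI_scal (c : C) f a b : a <= b -> (forall x, a <= x <= b -> Rcont f x) ->
  CI (fun x => c * f x)%C a b = (c * CI f a b)%C.
Proof.
  intros L H. assert (E1 := ex_RInt_Re f a b L H). assert (E2 := ex_RInt_Im f a b L H).
  assert (S : forall k (u : R -> R), ex_RInt u a b -> k * RInt u a b = RInt (fun x => k * u x) a b).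
  { intros k u Hu. symmetry. apply (RInt_scal (V := R_CompleteNormedModule)); auto. }
  assert (SE : forall k (u : R -> R), ex_RInt u a b -> ex_RInt (fun x => k * u x) a b).
  { intros k u Hu. apply (ex_RInt_scal (V := R_NormedModule)); auto. }
  apply C_eq; rewrite ?re_mult, ?im_mult, ?re_CI, ?im_CI, !S by auto.
  - rewrite <- (RInt_minus (V := R_CompleteNormedModule)) by auto. apply RInt_ext; intros; rewrite re_mult; auto.
  - rewrite <- (RInt_plus (V := R_CompleteNormedModule)) by auto. apply RInt_ext; intros; rewrite im_mult; auto.
Qed.

(** Estimating the two components separately costs the factor 2, which does no harm in the
    applications. *)
Lemma CI_bound f a b M : a <= b -> (forall x, a <= x <= b -> Rcont f x) ->
  (forall x, a <= x <= b -> Cmod (f x) <= M) -> Cmod (CI f a b) <= 2 * M * (b - a).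
Proof.
  intros L H B. eapply Rle_trans; [apply Cmod_le_sum|]. rewrite re_CI, im_CI.
  assert (B1 : Rabs (RInt (fun x => Re (f x)) a b) <= (b - a) * M).
  { apply (norm_RInt_le_const (fun x => Re (f x)) a b _ M L).
    intros x Hx. eapply Rle_trans; [apply re_le_Cmod|auto].
    apply (RInt_correct (V := R_CompleteNormedModule)), ex_RInt_Re; auto. }
  assert (B2 : Rabs (RInt (fun x => Im (f x)) a b) <= (b - a) * M).
  { apply (norm_RInt_le_const (fun x => Im (f x)) a b _ M L).
    intros x Hx. eapply Rle_trans; [apply im_le_Cmod|auto].
    apply (RInt_correct (V := R_CompleteNormedModule)), ex_RInt_Im; auto. }
  lra.
Qed.

Lemma RInt_affine (p q a b : R) : RInt (fun x => p + q * x) a b = p * (b - a) + q * (b * b - a * a) / 2.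
Proof.
  apply is_RInt_unique.
  replace (p * (b - a) + q * (b * b - a * a) / 2) with (minus (p * b + q * (b * b) / 2) (p * a + q * (a * a) / 2))
    by (unfold minus, plus, opp; simpl; field).
  apply (is_RInt_derive (fun x => p * x + q * (x * x) / 2) (fun x => p + q * x)).
  - intros x _. auto_derive; auto. field.
  - intros x _. apply (ex_derive_continuous (V := R_NormedModule)). auto_derive; auto.
Qed.

Definition contour (G : C -> C) (a b c d : R) : C :=
  (CI (fun x => G (x, c)) a b - CI (fun x => G (x, d)) a b
   + Ci * (CI (fun y => G (b, y)) c d - CI (fun y => G (a, y)) c d))%C.

Definition contR (G : C -> C) (a b c d : R) := forall x y, a <= x <= b -> c <= y <= d -> ccont G (x, y).

Lemma contour_affine (A B : C) a b c d : contour (fun z => A + B * z)%C a b c d = RtoC 0.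
Proof.
  assert (HH : forall y a b, CI (fun x => A + B * (x, y))%C a b =
    (((Re A - Im B * y) * (b - a) + Re B * (b * b - a * a) / 2), ((Im A + Re B * y) * (b - a) + Im B * (b * b - a * a) / 2))).
  { intros y a' b'. unfold CI. f_equal; rewrite <- RInt_affine; apply RInt_ext; intros x _.
    rewrite re_plus, re_mult; simpl; ring. rewrite im_plus, im_mult; simpl; ring. }
  assert (VV : forall x a b, CI (fun y => A + B * (x, y))%C a b =
    (((Re A + Re B * x) * (b - a) + (- Im B) * (b * b - a * a) / 2), ((Im A + Im B * x) * (b - a) + Re B * (b * b - a * a) / 2))).
  { intros x a' b'. unfold CI. f_equal; rewrite <- RInt_affine; apply RInt_ext; intros y _.
    rewrite re_plus, re_mult; simpl; ring. rewrite im_plus, im_mult; simpl; ring. }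
  unfold contour. rewrite !HH, !VV. apply C_eq; simpl; field.
Qed.

Lemma contour_plus F G a b c d : a <= b -> c <= d -> contR F a b c d -> contR G a b c d ->
  contour (fun z => F z + G z)%C a b c d = (contour F a b c d + contour G a b c d)%C.
Proof.
  intros L1 L2 HF HG. unfold contour.
  rewrite !CI_plus; auto; try (intros; (apply ccont_Rcont_h || apply ccont_Rcont_v); (apply HF || apply HG); lra).
  ring.
Qed.

Lemma contour_bound G a b c d M : a <= b -> c <= d -> contR G a b c d ->
  (forall x y, a <= x <= b -> c <= y <= d -> Cmod (G (x, y)) <= M) ->
  Cmod (contour G a b c d) <= 4 * M * (b - a + (d - c)).
Proof.
  intros L1 L2 HG B. unfold contour.
  assert (B1 : Cmod (CI (fun x => G (x, c)) a b) <= 2 * M * (b - a)) by (apply CI_bound; auto; intros; [apply ccont_Rcont_h, HG; lra | apply B; lra]).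
  assert (B2 : Cmod (CI (fun x => G (x, d)) a b) <= 2 * M * (b - a)) by (apply CI_bound; auto; intros; [apply ccont_Rcont_h, HG; lra | apply B; lra]).
  assert (B3 : Cmod (CI (fun y => G (b, y)) c d) <= 2 * M * (d - c)) by (apply CI_bound; auto; intros; [apply ccont_Rcont_v, HG; lra | apply B; lra]).
  assert (B4 : Cmod (CI (fun y => G (a, y)) c d) <= 2 * M * (d - c)) by (apply CI_bound; auto; intros; [apply ccont_Rcont_v, HG; lra | apply B; lra]).
  assert (TT : forall u v, Cmod (u - v)%C <= Cmod u + Cmod v) by (intros; eapply Rle_trans; [apply Cmod_triangle|rewrite Cmod_opp; lra]).
  eapply Rle_trans; [apply Cmod_triangle|]. rewrite Cmod_mult, Cmod_Ci.
  assert (T1 := TT (CI (fun x => G (x, c)) a b) (CI (fun x => G (x, d)) a b)).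
  assert (T2 := TT (CI (fun y => G (b, y)) c d) (CI (fun y => G (a, y)) c d)). lra.
Qed.

Lemma contour_split G a b c d m n : a <= m <= b -> c <= n <= d -> contR G a b c d ->
  contour G a b c d = (contour G a m c n + contour G m b c n + contour G a m n d + contour G m b n d)%C.
Proof.
  intros L1 L2 HG. unfold contour.
  assert (Hh : forall y, c <= y <= d -> CI (fun x => G (x, y)) a b = (CI (fun x => G (x, y)) a m + CI (fun x => G (x, y)) m b)%C).
  { intros. apply CI_Chasles; auto. intros. apply ccont_Rcont_h, HG; lra. }
  assert (Hv : forall x, a <= x <= b -> CI (fun y => G (x, y)) c d = (CI (fun y => G (x, y)) c n + CI (fun y => G (x, y)) n d)%C).
  { intros. apply CI_Chasles; auto. intros. apply ccont_Rcont_v, HG; lra. }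
  rewrite (Hh c), (Hh d), (Hv a), (Hv b) by lra. ring.
Qed.

Lemma ccont_plus F G z : ccont F z -> ccont G z -> ccont (fun z => F z + G z)%C z.
Proof.
  intros HF HG eps He. destruct (HF (eps/2) ltac:(lra)) as [d1 [P1 H1]]. destruct (HG (eps/2) ltac:(lra)) as [d2 [P2 H2]].
  exists (Rmin d1 d2). split. apply Rmin_glb_lt; auto. intros w Hw.
  assert (M1 := Rmin_l d1 d2). assert (M2 := Rmin_r d1 d2).
  specialize (H1 w ltac:(lra)). specialize (H2 w ltac:(lra)).
  replace (F w + G w - (F z + G z))%C with ((F w - F z) + (G w - G z))%C by ring.
  eapply Rle_lt_trans; [apply Cmod_triangle|lra].
Qed.

(** An affine function has contour integral zero, so only the error of the linear approximation
    contributes: it is at most [eps] times the half perimeter, over a boundary of comparable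
    length. *)
Lemma contour_local (G : C -> C) (z l : C) eps : 0 < eps -> cderiv_at G z l ->
  exists del, 0 < del /\ forall a b c d, a <= Re z <= b -> c <= Im z <= d -> contR G a b c d ->
   b - a + (d - c) < del -> Cmod (contour G a b c d) <= 4 * eps * (b - a + (d - c)) * (b - a + (d - c)).
Proof.
  intros He H. destruct (proj1 (cderiv_eps G z l) H eps He) as [del [Hd H1]]. exists del. split; auto.
  intros a b c d Ha Hc HG HS.
  set (A := (G z - l * z)%C).
  assert (AC : forall (P Q : C) w, ccont (fun z => P + Q * z)%C w).
  { intros P Q w. eapply (cderiv_ccont _ _ _). apply cderiv_plus. apply cderiv_const. apply cderiv_scal, cderiv_id. }
  set (r := (fun w => G w + (- A + (- l) * w))%C).
  assert (HR : contR r a b c d). { intros x y Hx Hy. apply ccont_plus. apply HG; auto. apply AC. }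
  assert (E : contour G a b c d = contour r a b c d).
  { transitivity (contour (fun w => r w + (A + l * w))%C a b c d).
    - unfold contour. assert (EX : forall w, G w = (r w + (A + l * w))%C) by (intros; unfold r; ring).
      f_equal; [f_equal|f_equal; f_equal]; try apply CI_ext; try lra; intros; try apply EX; auto;
      try (f_equal; apply CI_ext; [lra|intros; apply EX]).
    - rewrite contour_plus; try lra; auto. rewrite contour_affine. ring. intros x y _ _; apply AC. }
  rewrite E. assert (S0 : 0 <= b - a + (d - c)) by lra.
  replace (4 * eps * (b - a + (d - c)) * (b - a + (d - c))) with (4 * (eps * (b - a + (d - c))) * (b - a + (d - c))) by ring.
  apply contour_bound; try lra; auto. intros x y Hx Hy.
  assert (D : Cmod ((x, y) - z)%C <= b - a + (d - c)).
  { eapply Rle_trans; [apply Cmod_le_sum|]. unfold Cminus. rewrite re_plus, im_plus, re_opp, im_opp. simpl.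
    apply Rplus_le_compat; apply Rabs_le; lra. }
  specialize (H1 ((x, y) - z)%C ltac:(lra)).
  assert (EQ : forall u v : C, (v + (u - v))%C = u) by (intros; ring). rewrite EQ in H1.
  replace (r (x, y)) with (G (x, y) - G z - l * ((x, y) - z))%C by (unfold r, A; generalize ((x, y) : C); intros; ring).
  eapply Rle_trans; [exact H1|]. apply Rmult_le_compat_l; lra.
Qed.

Section Bisection.
Variable G : C -> C.

Definition quarter (R : (R * R) * (R * R)) : (Rdefinitions.R * Rdefinitions.R) * (Rdefinitions.R * Rdefinitions.R) :=
  let '((a, b), (c, d)) := R in
  let m := (a + b) / 2 in let n := (c + d) / 2 in
  let big x y u v := Rle_dec (Cmod (contour G a b c d) / 4) (Cmod (contour G x y u v)) in
  if big a m c n then ((a, m), (c, n)) else if big m b c n then ((m, b), (c, n))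
  else if big a m n d then ((a, m), (n, d)) else ((m, b), (n, d)).

Lemma quarter_spec a b c d : a <= b -> c <= d -> contR G a b c d ->
  exists a' b' c' d', quarter ((a, b), (c, d)) = ((a', b'), (c', d')) /\
  a <= a' /\ b' <= b /\ c <= c' /\ d' <= d /\ b' - a' = (b - a) / 2 /\ d' - c' = (d - c) / 2 /\
  Cmod (contour G a b c d) / 4 <= Cmod (contour G a' b' c' d').
Proof.
  intros L1 L2 HG. unfold quarter.
  assert (S := contour_split G a b c d ((a + b) / 2) ((c + d) / 2) ltac:(lra) ltac:(lra) HG).
  destruct (Rle_dec _ _) as [B1|B1]; [do 4 eexists; split; [reflexivity|]; repeat split; try lra; auto|].
  destruct (Rle_dec _ _) as [B2|B2]; [do 4 eexists; split; [reflexivity|]; repeat split; try lra; auto|].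
  destruct (Rle_dec _ _) as [B3|B3]; [do 4 eexists; split; [reflexivity|]; repeat split; try lra; auto|].
  (* The last quarter is the default: if each of the other three carries less than a quarter of the
     total, the triangle inequality leaves at least a quarter for it. *)
  do 4 eexists; split; [reflexivity|]; repeat split; try lra.
  apply (f_equal Cmod) in S.
  match type of S with _ = Cmod (?p + ?q + ?r + ?s)%C =>
    assert (T1 := Cmod_triangle (p + q + r)%C s); assert (T2 := Cmod_triangle (p + q)%C r); assert (T3 := Cmod_triangle p q) end.
  lra.
Qed.

(** Bisection never lowers the ratio of the integral to the squared size, while differentiability at
    the common point of the nested rectangles makes this ratio arbitrarily small. *)
Theorem goursat a b c d : a <= b -> c <= d ->
  (forall x y, a <= x <= b -> c <= y <= d -> exists l, cderiv_at G (x, y) l) -> contour G a b c d = RtoC 0.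
Proof.
  intros L1 L2 HD.
  assert (HG : contR G a b c d) by (intros x y Hx Hy; destruct (HD x y Hx Hy) as [l Hl]; eapply cderiv_ccont; eauto).
  apply Cmod_eq_0. apply Rle_antisym; [|apply Cmod_ge_0]. apply Rnot_lt_le. intros P.
  set (eta := Cmod (contour G a b c d)) in *.
  set (rs := fun n => Nat.iter n quarter ((a, b), (c, d))).
  set (an := fun n => fst (fst (rs n))). set (bn := fun n => snd (fst (rs n))).
  set (cn := fun n => fst (snd (rs n))). set (dn := fun n => snd (snd (rs n))).
  assert (HR : forall n, rs n = ((an n, bn n), (cn n, dn n))).
  { intros n. unfold an, bn, cn, dn. destruct (rs n) as [[? ?] [? ?]]; reflexivity. }
  assert (I : forall n, a <= an n /\ bn n <= b /\ c <= cn n /\ dn n <= d /\ bn n - an n = (b - a) / 2 ^ n /\ dn n - cn n = (d - c) / 2 ^ n /\ eta / 4 ^ n <= Cmod (contour G (an n) (bn n) (cn n) (dn n))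
    /\ an n <= an (S n) /\ bn (S n) <= bn n /\ cn n <= cn (S n) /\ dn (S n) <= dn n).
  { assert (STEP : forall n, a <= an n -> bn n <= b -> c <= cn n -> dn n <= d -> an n <= bn n -> cn n <= dn n ->
      an n <= an (S n) /\ bn (S n) <= bn n /\ cn n <= cn (S n) /\ dn (S n) <= dn n /\
      bn (S n) - an (S n) = (bn n - an n) / 2 /\ dn (S n) - cn (S n) = (dn n - cn n) / 2 /\
      Cmod (contour G (an n) (bn n) (cn n) (dn n)) / 4 <= Cmod (contour G (an (S n)) (bn (S n)) (cn (S n)) (dn (S n)))).
    { intros n A1 A2 A3 A4 A5 A6.
      destruct (quarter_spec (an n) (bn n) (cn n) (dn n) A5 A6) as (a' & b' & c' & d' & EQ & Q).
      { intros x y Hx Hy. apply HG; lra. }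
      assert (E2 : rs (S n) = quarter (rs n)) by reflexivity. rewrite HR, (HR n) in E2. rewrite EQ in E2.
      injection E2 as -> -> -> ->. tauto. }
    assert (P2 : forall n, 0 < 2 ^ n) by (intros; apply pow_lt; lra).
    assert (P4 : forall n, 0 < 4 ^ n) by (intros; apply pow_lt; lra).
    assert (I0 : forall n, a <= an n /\ bn n <= b /\ c <= cn n /\ dn n <= d /\ bn n - an n = (b - a) / 2 ^ n /\ dn n - cn n = (d - c) / 2 ^ n /\ eta / 4 ^ n <= Cmod (contour G (an n) (bn n) (cn n) (dn n))).
    { induction n.
      - unfold an, bn, cn, dn, rs; simpl. repeat split; try lra. unfold eta. lra.
      - destruct IHn as (A1 & A2 & A3 & A4 & A5 & A6 & A7). specialize (P2 n). specialize (P4 n).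
        assert (0 <= (b - a) / 2 ^ n) by (apply Rdiv_le_0_compat; lra).
        assert (0 <= (d - c) / 2 ^ n) by (apply Rdiv_le_0_compat; lra).
        destruct (STEP n) as (B1 & B2 & B3 & B4 & B5 & B6 & B7); try lra.
        repeat split; try lra.
        rewrite B5, A5. simpl. field. lra. rewrite B6, A6. simpl. field. lra.
        replace (eta / 4 ^ S n) with (eta / 4 ^ n / 4) by (simpl; field; lra). lra. }
    intros n. destruct (I0 n) as (A1 & A2 & A3 & A4 & A5 & A6 & A7).
    assert (0 <= (b - a) / 2 ^ n) by (apply Rdiv_le_0_compat; [lra|apply P2]).
    assert (0 <= (d - c) / 2 ^ n) by (apply Rdiv_le_0_compat; [lra|apply P2]).
    destruct (STEP n) as (B1 & B2 & B3 & B4 & B5 & B6 & B7); try lra. }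
  assert (NEST : forall (u v : nat -> R), (forall n, u n <= u (S n)) -> (forall n, v (S n) <= v n) -> (forall n, u n <= v n) -> exists x, forall n, u n <= x <= v n).
  { intros u v Hu Hv Huv.
    assert (MU : forall n k, u n <= u (n + k)%nat). { intros n k. induction k. rewrite Nat.add_0_r; lra. rewrite Nat.add_succ_r. specialize (Hu (n + k)%nat). lra. }
    assert (MV : forall n k, v (n + k)%nat <= v n). { intros n k. induction k. rewrite Nat.add_0_r; lra. rewrite Nat.add_succ_r. specialize (Hv (n + k)%nat). lra. }
    assert (UV : forall n m, u n <= v m). { intros n m. specialize (MU n m). specialize (MV m n). specialize (Huv (n + m)%nat). rewrite (Nat.add_comm m n) in MV. lra. }
    destruct (completeness (fun x => exists n, x = u n)) as [x [X1 X2]].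
    exists (v O). intros x [n ->]. apply UV. exists (u O), O; auto.
    exists x. intros n. split. apply X1; eauto. apply X2. intros y [m ->]. apply UV. }
  assert (P2 : forall n, 0 < 2 ^ n) by (intros; apply pow_lt; lra).
  destruct (NEST an bn) as [x Hx]; try (intros n; destruct (I n) as (A1 & A2 & A3 & A4 & A5 & A6 & A7 & A8 & A9 & A10 & A11); auto).
  { assert (0 <= (b - a) / 2 ^ n) by (apply Rdiv_le_0_compat; [lra|apply P2]). lra. }
  destruct (NEST cn dn) as [y Hy]; try (intros n; destruct (I n) as (A1 & A2 & A3 & A4 & A5 & A6 & A7 & A8 & A9 & A10 & A11); auto).
  { assert (0 <= (d - c) / 2 ^ n) by (apply Rdiv_le_0_compat; [lra|apply P2]). lra. }
  assert (HX : a <= x <= b) by (destruct (I O); specialize (Hx O); lra).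
  assert (HY : c <= y <= d) by (destruct (I O) as (? & ? & ? & ? & ?); specialize (Hy O); lra).
  destruct (HD x y HX HY) as [l Hl].
  set (w := b - a + (d - c)). assert (W : 0 <= w) by (unfold w; lra).
  (* [K] exceeds [4 w^2], so the local estimate with [eta / (2 K)] bounds [eta / 4^n] by at most
     half of itself. *)
  set (K := 4 * w * w + 1). assert (HK : 0 < K) by (unfold K; nra).
  destruct (contour_local G (x, y) l (eta / (2 * K)) ltac:(apply Rdiv_lt_0_compat; lra) Hl) as [del [Hdel CL]].
  assert (exists n, w / 2 ^ n < del) as [n Hn].
  { destruct (pow_lt_1_zero (/ 2) ltac:(rewrite Rabs_right; lra) (del / (w + 1)) ltac:(apply Rdiv_lt_0_compat; lra)) as [N HN].
    exists N. specialize (HN N (le_n N)). rewrite pow_inv, Rabs_right in HN by (apply Rle_ge; left; apply Rinv_0_lt_compat; apply P2).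
    apply Rlt_div_r in HN; [|lra]. unfold Rdiv. assert (0 < / 2 ^ N) by (apply Rinv_0_lt_compat; apply P2). nra. }
  destruct (I n) as (A1 & A2 & A3 & A4 & A5 & A6 & A7 & _).
  assert (WN : bn n - an n + (dn n - cn n) = w / 2 ^ n) by (rewrite A5, A6; unfold w; field; specialize (P2 n); lra).
  specialize (CL (an n) (bn n) (cn n) (dn n) (Hx n) (Hy n)).
  assert (CC : contR G (an n) (bn n) (cn n) (dn n)) by (intros u v Hu Hv; apply HG; lra).
  specialize (CL CC ltac:(lra)). rewrite WN in CL.
  assert (F4 : 4 ^ n = 2 ^ n * 2 ^ n). { rewrite <- Rpow_mult_distr. f_equal; lra. }
  assert (BAD : eta / 4 ^ n <= eta / (2 * K) * (4 * w * w) / 4 ^ n).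
  { eapply Rle_trans; [exact A7|]. eapply Rle_trans; [exact CL|]. right. rewrite F4. field. specialize (P2 n). lra. }
  assert (P4 : 0 < 4 ^ n) by (apply pow_lt; lra).
  unfold Rdiv in BAD at 1 2. apply Rmult_le_reg_r in BAD; [|apply Rinv_0_lt_compat; lra].
  assert (eta / (2 * K) * (4 * w * w) <= eta / (2 * K) * K).
  { apply Rmult_le_compat_l. apply Rdiv_le_0_compat; lra. unfold K; lra. }
  replace (eta / (2 * K) * K) with (eta / 2) in H by (field; lra). unfold Rdiv in H, BAD. lra.
Qed.
End Bisection.

(** * Cauchy's formula for functions of period 1 *)

Lemma strip (G : C -> C) x0 y1 y2 : y1 <= y2 ->
  (forall x y, x0 <= x <= x0 + 1 -> y1 <= y <= y2 -> exists l, cderiv_at G (x, y) l) ->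
  (forall y, y1 <= y <= y2 -> G (x0 + 1, y) = G (x0, y)) ->
  CI (fun x => G (x, y1)) x0 (x0 + 1) = CI (fun x => G (x, y2)) x0 (x0 + 1).
Proof.
  intros L HD HP. assert (T := goursat G x0 (x0 + 1) y1 y2 ltac:(lra) L HD). unfold contour in T.
  rewrite (CI_ext (fun y => G (x0 + 1, y)) (fun y => G (x0, y)) y1 y2 L HP) in T.
  apply Ceq_minus. rewrite <- T. ring.
Qed.

Lemma CI_minus f g a b : a <= b -> (forall x, a <= x <= b -> Rcont f x) -> (forall x, a <= x <= b -> Rcont g x) ->
  CI (fun x => f x - g x)%C a b = (CI f a b - CI g a b)%C.
Proof.
  intros L Hf Hg.
  assert (E := CI_scal (- (1))%C g a b L Hg).
  assert (Hg' : forall x, a <= x <= b -> Rcont (fun x => (- (1)) * g x)%C x).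
  { intros x Hx. destruct (Hg x Hx) as [H1 H2]. split.
    - apply (continuous_ext (fun t => opp (Re (g t)))). intros t. rewrite re_mult. simpl. unfold opp; simpl. ring.
      apply (continuous_opp (V := R_NormedModule)); exact H1.
    - apply (continuous_ext (fun t => opp (Im (g t)))). intros t. rewrite im_mult. simpl. unfold opp; simpl. ring.
      apply (continuous_opp (V := R_NormedModule)); exact H2. }
  transitivity (CI (fun x => f x + (- (1)) * g x)%C a b). apply CI_ext; auto. intros; ring.
  rewrite CI_plus, E; auto. ring.
Qed.

Lemma CI_const (c : C) a b : a <= b -> CI (fun _ => c) a b = ((b - a)%R * c)%C.
Proof.
  intros L. apply C_eq.
  - rewrite re_scal_l. exact (RInt_const (V := R_CompleteNormedModule) a b (Re c)).
  - rewrite im_scal_l. exact (RInt_const (V := R_CompleteNormedModule) a b (Im c)).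
Qed.

Lemma unif_cont (g : C -> C) a b c d : contR g a b c d ->
  forall eps, 0 < eps -> exists del, 0 < del /\ forall x y u v, a <= x <= b -> c <= y <= d -> a <= u <= b -> c <= v <= d ->
   Rabs (u - x) < del -> Rabs (v - y) < del -> Cmod (g (u, v) - g (x, y))%C <= eps.
Proof.
  intros HG eps He.
  assert (C2 : forall x y, a <= x <= b -> c <= y <= d -> continuity_2d_pt (fun x y => Re (g (x, y))) x y /\ continuity_2d_pt (fun x y => Im (g (x, y))) x y).
  { intros x y Hx Hy. split; intros [ep Hep]; destruct (HG x y Hx Hy ep Hep) as [de [Hde H1]];
    assert (Hde2 : 0 < de / 2) by lra; exists (mkposreal _ Hde2); simpl; intros u w Hu Hw;
    (assert (DD : Cmod ((u, w) - (x, y))%C < de);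
     [eapply Rle_lt_trans; [apply Cmod_le_sum|]; unfold Cminus; rewrite re_plus, im_plus, re_opp, im_opp; simpl;
      unfold Rminus in Hu, Hw; lra|]); specialize (H1 _ DD).
    - eapply Rle_lt_trans; [|exact H1]. eapply Rle_trans; [|apply re_le_Cmod].
      unfold Cminus; rewrite re_plus, re_opp. unfold Rminus. lra.
    - eapply Rle_lt_trans; [|exact H1]. eapply Rle_trans; [|apply im_le_Cmod].
      unfold Cminus; rewrite im_plus, im_opp. unfold Rminus. lra. }
  assert (Hep : 0 < eps / 2) by lra.
  destruct (uniform_continuity_2d _ a b c d (fun x y Hx Hy => proj1 (C2 x y Hx Hy)) (mkposreal _ Hep)) as [[d1 P1] H1].
  destruct (uniform_continuity_2d _ a b c d (fun x y Hx Hy => proj2 (C2 x y Hx Hy)) (mkposreal _ Hep)) as [[d2 P2] H2].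
  simpl in H1, H2.
  exists (Rmin d1 d2). split. apply Rmin_glb_lt; auto. intros x y u v Hx Hy Hu Hv L1 L2.
  assert (M1 := Rmin_l d1 d2). assert (M2 := Rmin_r d1 d2).
  specialize (H1 x y u v Hx Hy Hu Hv ltac:(lra) ltac:(lra)).
  specialize (H2 x y u v Hx Hy Hu Hv ltac:(lra) ltac:(lra)).
  eapply Rle_trans; [apply Cmod_le_sum|]. unfold Cminus. rewrite re_plus, im_plus, re_opp, im_opp.
  unfold Rminus in H1, H2. lra.
Qed.

(** Allows the line of integration to pass through the height of [w], where the integrand below is
    only known to be continuous. *)
Lemma CI_cont (g : C -> C) a b c d v : a <= b -> c < v < d -> contR g a b c d ->
  forall eps, 0 < eps -> exists del, 0 < del /\ forall y, Rabs (y - v) < del -> c <= y <= d ->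
   Cmod (CI (fun x => g (x, y)) a b - CI (fun x => g (x, v)) a b)%C <= eps.
Proof.
  intros L Hv HG eps He.
  set (w := b - a + 1). assert (W : 0 < w) by (unfold w; lra).
  assert (Hep : 0 < eps / (2 * w)) by (apply Rdiv_lt_0_compat; lra).
  destruct (unif_cont g a b c d HG _ Hep) as [del [Hd H1]].
  exists del. split; auto. intros y Hy Hyc.
  rewrite <- CI_minus; auto; try (intros; apply ccont_Rcont_h, HG; lra).
  apply Rle_trans with (2 * (eps / (2 * w)) * (b - a)).
  - apply CI_bound; auto.
    + intros x Hx. destruct (ccont_Rcont_h _ _ _ (HG x y Hx Hyc)) as [A1 A2]. destruct (ccont_Rcont_h g x v (HG x v Hx ltac:(lra))) as [B1 B2].
      split.
      * apply (continuous_ext (fun t => minus (Re (g (t, y))) (Re (g (t, v))))). intros t. unfold Cminus. rewrite re_plus, re_opp. reflexivity.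
        apply (continuous_minus (V := R_NormedModule)); assumption.
      * apply (continuous_ext (fun t => minus (Im (g (t, y))) (Im (g (t, v))))). intros t. unfold Cminus. rewrite im_plus, im_opp. reflexivity.
        apply (continuous_minus (V := R_NormedModule)); assumption.
    + intros x Hx. apply H1; try lra. rewrite Rminus_diag, Rabs_R0; auto.
  - replace (2 * (eps / (2 * w)) * (b - a)) with (eps * ((b - a) / w)) by (field; lra).
    rewrite <- (Rmult_1_r eps) at 2. apply Rmult_le_compat_l; [lra|]. apply Rle_div_l; unfold w; lra.
Qed.

(** A periodic substitute for [w - z]: it vanishes to first order at [w + Z], tends to 1 far below
    [w] and grows without bound far above. The behaviour below produces the value [f w], the
    behaviour above kills the remaining integral. *)
Definition ker (w z : C) : C := (1 - e (w - z))%C.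

Lemma cderiv_ker w z : cderiv_at (ker w) z (I2pi * e (w - z))%C.
Proof.
  apply (cderiv_ext (fun z => 1 + - (1) * e (w - z))%C). intros; unfold ker; ring.
  eapply cderiv_eq. apply (cderiv_plus (fun _ => RtoC 1) (fun z => - (1) * e (w - z))%C). apply cderiv_const.
  apply cderiv_scal. apply (cderiv_comp e (fun z => w - z)%C). apply cderiv_e.
  apply (cderiv_plus (fun _ => w) (fun z => - z)%C). apply cderiv_const.
  apply (cderiv_ext (fun z => - (1) * z)%C). intros; ring.
  apply cderiv_scal, cderiv_id. cbv beta. ring.
Qed.

Lemma ker_per w x y : ker w (x + 1, y) = ker w (x, y).
Proof.
  unfold ker. replace (w - (x, y))%C with ((w - ((x + 1)%R, y)) + 1)%C by (apply C_eq; simpl; ring).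
  rewrite e_plus, e_1. ring.
Qed.

Lemma Cmod_ew w z : Cmod (e (w - z)%C) = exp (2 * PI * (Im z - Im w)).
Proof. rewrite Cmod_e. f_equal. unfold Cminus. rewrite im_plus, im_opp. ring. Qed.

Lemma ker_below w z : Im z < Im w -> 1 - exp (2 * PI * (Im z - Im w)) <= Cmod (ker w z) /\ 0 < 1 - exp (2 * PI * (Im z - Im w)).
Proof.
  intros H. split.
  - rewrite <- Cmod_ew, <- Cmod_1. apply Cmod_sub_lower.
  - assert (exp (2 * PI * (Im z - Im w)) < exp 0). apply exp_increasing. assert (P := PI_RGT_0). nra. rewrite exp_0 in H0. lra.
Qed.

Lemma ker_above w z : Im w < Im z -> exp (2 * PI * (Im z - Im w)) - 1 <= Cmod (ker w z) /\ 0 < exp (2 * PI * (Im z - Im w)) - 1.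
Proof.
  intros H. split.
  - rewrite <- Cmod_ew, <- Cmod_1. unfold ker. replace (1 - e (w - z))%C with (- (e (w - z) - 1))%C by ring. rewrite Cmod_opp. apply Cmod_sub_lower.
  - assert (exp 0 < exp (2 * PI * (Im z - Im w))). apply exp_increasing. assert (P := PI_RGT_0). nra. rewrite exp_0 in H0. lra.
Qed.

Lemma ker_neq0 w z : Im z <> Im w -> ker w z <> RtoC 0.
Proof.
  intros H. apply Cmod_gt_0. destruct (Rtotal_order (Im z) (Im w)) as [L|[L|L]]; [|contradiction|].
  destruct (ker_below w z L); lra. destruct (ker_above w z L); lra.
Qed.

Lemma ker_line w x : Rabs (x - Re w) <= / 2 -> ker w (x, Im w) = RtoC 0 -> x = Re w.
Proof.
  intros H K. assert (E : e (w - (x, Im w))%C = RtoC 1). { unfold ker in K. apply Ceq_minus in K. auto. }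
  assert (E1 := f_equal Re E). assert (E2 := f_equal Im E). rewrite e_re in E1. rewrite e_im in E2.
  unfold Cminus in E1, E2. rewrite im_plus, im_opp, re_plus, re_opp in E1, E2.
  change (Im (x, Im w)) with (Im w) in E1, E2. change (Re (x, Im w)) with x in E1, E2.
  rewrite Rplus_opp_r, Rmult_0_r, exp_0, Rmult_1_l in E1, E2. rewrite re_RtoC in E1. rewrite im_RtoC in E2.
  set (t := Re w + - x) in *. assert (P := PI_RGT_0).
  assert (T : -/2 <= t <= /2). { unfold t. apply Rabs_le_between in H. lra. }
  enough (t = 0) by (unfold t in *; lra).
  assert (ND : forall s, 0 < s <= / 2 -> sin (2 * PI * s) = 0 -> cos (2 * PI * s) = 1 -> False).
  { intros s Hs S1 S2. destruct (proj2 Hs) as [Hl|He].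
    - assert (0 < sin (2 * PI * s)) by (apply sin_gt_0; nra). lra.
    (* At the end [s = 1 / 2] of the interval the sine vanishes as well, and the value [-1] of the
       cosine decides. *)
    - rewrite He in S2. replace (2 * PI * / 2) with PI in S2 by field. rewrite cos_PI in S2. lra. }
  destruct (Rtotal_order t 0) as [L|[L|L]]; auto; exfalso.
  - apply (ND (- t)). lra. replace (2 * PI * - t) with (- (2 * PI * t)) by ring. rewrite sin_neg; lra.
    replace (2 * PI * - t) with (- (2 * PI * t)) by ring. rewrite cos_neg; lra.
  - apply (ND t); lra.
Qed.

(** The singularity is removable: near [w] the numerator and the kernel are [l h] and [I2pi h] up to
    [o(h)]. Testing [ker w z = 0] instead of [z = w] assigns the value at all of [w + Z], which
    keeps the quotient periodic when [f] is. *)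
Lemma ccont_quot (f : C -> C) (w l : C) : cderiv_at f w l ->
  ccont (fun z => if Ceq_dec (ker w z) 0 then (l / I2pi)%C else ((f z - f w) / ker w z)%C) w.
Proof.
  intros H eps He.
  set (L := (l / I2pi)%C). assert (QL := Cmod_ge_0 L).
  set (ep := Rmin 1 (eps / (2 * (1 + Cmod L)))).
  assert (Hep : 0 < ep). { apply Rmin_glb_lt. lra. apply Rdiv_lt_0_compat; lra. }
  assert (EP1 : ep <= 1) by apply Rmin_l. assert (EP2 : ep <= eps / (2 * (1 + Cmod L))) by apply Rmin_r. clearbody ep.
  destruct (proj1 (cderiv_eps _ _ _) H ep Hep) as [d1 [D1 H1]].
  destruct (proj1 (cderiv_eps _ _ _) (cderiv_ker w w) ep Hep) as [d2 [D2 H2]].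
  assert (K0 : ker w w = RtoC 0). { unfold ker. replace (w - w)%C with (RtoC 0) by ring. rewrite e_0; ring. }
  replace (w - w)%C with (RtoC 0) in H2 by ring. rewrite e_0, K0 in H2.
  exists (Rmin d1 d2). split. apply Rmin_glb_lt; auto. intros z Hz.
  assert (M1 := Rmin_l d1 d2). assert (M2 := Rmin_r d1 d2).
  specialize (H1 (z - w)%C ltac:(lra)). specialize (H2 (z - w)%C ltac:(lra)).
  replace (w + (z - w))%C with z in H1, H2 by ring.
  destruct (Ceq_dec (ker w w) 0) as [_|N]; [|contradiction].
  destruct (Ceq_dec (ker w z) 0) as [E|N].
  { fold L. replace (L - L)%C with (RtoC 0) by ring. rewrite Cmod_0; auto. }
  fold L. set (h := (z - w)%C) in *.
  (* The linearisation error is at most [|h|] because [ep <= 1], and [|I2pi| >= 2 PI]; hence the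
     kernel dominates [h]. *)
  assert (LB : Cmod h <= Cmod (ker w z)).
  { assert (T := Cmod_sub_lower (I2pi * 1 * h)%C (- (ker w z - 0 - I2pi * 1 * h))%C).
    rewrite Cmod_opp in T. replace (I2pi * 1 * h - - (ker w z - 0 - I2pi * 1 * h))%C with (ker w z) in T by ring.
    rewrite !Cmod_mult, Cmod_1, Rmult_1_r in T.
    assert (2 * PI <= Cmod I2pi). { eapply Rle_trans; [|apply im_le_Cmod]. rewrite I2pi_im. apply Rle_abs. }
    assert (P := PI2_1). assert (Q := Cmod_ge_0 h). nra. }
  assert (HP : 0 < Cmod (ker w z)) by (apply Cmod_gt_0; auto).
  replace ((f z - f w) / ker w z - L)%C with (((f z - f w - l * h) - L * (ker w z - 0 - I2pi * 1 * h)) / ker w z)%C.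
  2: { unfold L. field. split; auto. apply I2pi_neq0. }
  rewrite Cmod_div by auto. apply Rlt_div_l; auto.
  eapply Rle_lt_trans; [apply Cmod_triangle|]. rewrite Cmod_opp, Cmod_mult.
  apply Rle_lt_trans with (ep * (1 + Cmod L) * Cmod h). { assert (Q := Cmod_ge_0 h). nra. }
  apply Rle_lt_trans with (eps / 2 * Cmod (ker w z)); [|nra].
  apply Rmult_le_compat; auto using Cmod_ge_0. nra.
  apply Rle_trans with (eps / (2 * (1 + Cmod L)) * (1 + Cmod L)). apply Rmult_le_compat_r; lra. right; field; lra.
Qed.

Lemma holo_deriv f z : holo_H f -> in_H z -> exists l, cderiv_at f z l.
Proof. intros H Hz. destruct (H z Hz) as [l Hl]. exists l. exact Hl. Qed.

(** Cauchy's formula on a horizontal strip: [(f z - f w) / (1 - e (w - z))] is periodic and continuous at [w], so its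
    integrals over a period below and above [w] agree, and the kernel tends to [0] far above [w]. *)
Theorem kernel_formula (f : C -> C) (w : C) (y1 M : R) :
  holo_H f -> (forall z, in_H z -> f (z + 1)%C = f z) -> (forall z, 1 <= Im z -> Cmod (f z) <= M) ->
  0 < y1 < Im w ->
  f w = CI (fun x => f (x, y1) / ker w (x, y1))%C (Re w - / 2) (Re w - / 2 + 1).
Proof.
  intros HF HP HB Hy. set (v := Im w) in *. set (x0 := Re w - / 2).
  destruct (holo_deriv f w HF ltac:(unfold in_H; fold v; lra)) as [l Hl].
  set (g := fun z => if Ceq_dec (ker w z) 0 then (l / I2pi)%C else ((f z - f w) / ker w z)%C).
  assert (GD : forall z, in_H z -> Im z <> v -> exists l, cderiv_at g z l).
  { intros z Hz N. destruct (holo_deriv f z HF Hz) as [lz Hlz].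
    assert (NK : ker w z <> RtoC 0) by (apply ker_neq0; auto).
    destruct (cderiv_ccont _ _ _ (cderiv_ker w z) (Cmod (ker w z)) ltac:(apply Cmod_gt_0; auto)) as [d [Hd H1]].
    eexists. apply (cderiv_ext_loc (fun z => (f z + - f w) * / ker w z)%C _ _ _ d Hd).
    2: { apply (cderiv_mult (fun z => f z + - f w)%C (fun z => / ker w z)%C). apply (cderiv_plus f (fun _ => - f w)%C). exact Hlz. apply cderiv_const. apply cderiv_inv. auto. apply cderiv_ker. }
    intros u Hu. unfold g.
    destruct (Ceq_dec (ker w u) 0) as [E|_]; [|reflexivity]. exfalso.
    specialize (H1 u Hu). rewrite E in H1. replace (0 - ker w z)%C with (- ker w z)%C in H1 by ring. rewrite Cmod_opp in H1. lra. }
  assert (GC : forall x y, x0 <= x <= x0 + 1 -> 0 < y -> ccont g (x, y)).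
  { intros x y Hx Hy0. destruct (Req_dec y v) as [->|N].
    - destruct (Req_dec x (Re w)) as [->|NX].
      + replace ((Re w, v) : C) with w by (destruct w; reflexivity). apply ccont_quot; auto.
      + assert (NK : ker w (x, v) <> RtoC 0). { intros K. apply NX. apply ker_line; auto. apply Rabs_le. unfold x0 in Hx; lra. }
        destruct (holo_deriv f (x, v) HF Hy0) as [lz Hlz].
        destruct (cderiv_ccont _ _ _ (cderiv_ker w (x, v)) (Cmod (ker w (x, v))) ltac:(apply Cmod_gt_0; auto)) as [d [Hd H1]].
        eapply cderiv_ccont. apply (cderiv_ext_loc (fun z => (f z + - f w) * / ker w z)%C _ _ _ d Hd).
        2: { apply (cderiv_mult (fun z => f z + - f w)%C (fun z => / ker w z)%C). apply (cderiv_plus f (fun _ => - f w)%C). exact Hlz. apply cderiv_const. apply cderiv_inv. auto. apply cderiv_ker. }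
        intros u Hu. unfold g.
        destruct (Ceq_dec (ker w u) 0) as [E|_]; [|reflexivity]. exfalso.
        specialize (H1 u Hu). rewrite E in H1. replace (0 - ker w (x, v))%C with (- ker w (x, v))%C in H1 by ring. rewrite Cmod_opp in H1. lra.
    - destruct (GD (x, y) Hy0 N) as [lz Hlz]. eapply cderiv_ccont; eauto. }
  assert (GP : forall y, 0 < y -> g (x0 + 1, y) = g (x0, y)).
  { intros y Hy0. unfold g. rewrite ker_per.
    replace ((x0 + 1, y) : C) with ((x0, y) + 1)%C by (apply C_eq; simpl; ring). rewrite HP by exact Hy0. reflexivity. }
  set (v1 := v + 1). assert (V1 : v1 = v + 1) by reflexivity. clearbody v1.
  set (I := fun y => CI (fun x => g (x, y)) x0 (x0 + 1)).
  assert (I1 : forall y, y1 <= y < v -> I y1 = I y).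
  { intros y Hyy. apply strip. lra. intros; apply GD; [unfold in_H; simpl; lra|simpl; lra]. intros; apply GP; lra. }
  assert (I2 : forall y y', v < y <= y' -> I y = I y').
  { intros y y' Hyy. apply strip. lra. intros; apply GD; [unfold in_H; simpl; lra|simpl; lra]. intros; apply GP; lra. }
  (* On the line through [w] only continuity is at hand; the integrals just below and just above it
     are both close to the one on it. *)
  assert (I3 : I y1 = I v1).
  { apply Ceq_minus. apply Cmod_eq_0. apply Rle_antisym; [|apply Cmod_ge_0]. apply Rnot_lt_le. intros P.
    destruct (CI_cont g x0 (x0 + 1) y1 v1 v ltac:(lra) ltac:(lra) (fun x y Hx Hy' => GC x y Hx ltac:(lra)) (Cmod (I y1 - I v1)%C / 3) ltac:(lra)) as [del [Hd HC]].
    set (t := Rmin (del / 2) (Rmin (v - y1) 1)).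
    assert (T0 : 0 < t) by (unfold t; repeat apply Rmin_glb_lt; lra).
    assert (T1 : t <= del / 2) by apply Rmin_l. assert (T2 : t <= Rmin (v - y1) 1) by apply Rmin_r.
    assert (T3 := Rmin_l (v - y1) 1). assert (T4 := Rmin_r (v - y1) 1).
    assert (C1 := HC (v - t)). assert (C2 := HC (v + t)).
    replace (v - t - v) with (- t) in C1 by ring. rewrite Rabs_Ropp, Rabs_right in C1 by lra.
    replace (v + t - v) with t in C2 by ring. rewrite Rabs_right in C2 by lra.
    specialize (C1 ltac:(lra) ltac:(lra)). specialize (C2 ltac:(lra) ltac:(lra)).
    fold (I (v - t)) in C1. fold (I (v + t)) in C2. fold (I v) in C1, C2.
    rewrite <- (I1 (v - t)) in C1 by lra. rewrite (I2 (v + t) v1) in C2 by lra.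
    assert (TT := Cmod_triangle (I y1 - I v)%C (- (I v1 - I v))%C). rewrite Cmod_opp in TT.
    replace (I y1 - I v + - (I v1 - I v))%C with (I y1 - I v1)%C in TT by ring. lra. }
  assert (Pi := PI_RGT_0).
  (* Far above [w] the kernel is at least [2 PI (y - v)] while [f] stays bounded; [y] is taken so
     high that the integral falls below its alleged modulus [N]. *)
  assert (I4 : I v1 = RtoC 0).
  { apply Cmod_eq_0. apply Rle_antisym; [|apply Cmod_ge_0]. apply Rnot_lt_le. intros P.
    set (N := Cmod (I v1)) in *.
    set (M2 := Rabs M + Cmod (f w)). assert (QM : 0 <= M2) by (unfold M2; assert (A1 := Rabs_pos M); assert (A2 := Cmod_ge_0 (f w)); lra).
    set (y := v + 1 + (2 * M2 / N + 1)). assert (QN : 0 <= 2 * M2 / N) by (apply Rdiv_le_0_compat; lra).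
    assert (EX : 1 + 2 * PI * (y - v) <= exp (2 * PI * (y - v))) by (apply exp_ineq1_le).
    assert (YV : 2 * M2 / N + 1 < 2 * PI * (y - v)). { assert (1 < PI) by (assert (T := PI2_1); lra). unfold y. nra. }
    assert (B : Cmod (I y) <= 2 * (M2 / (2 * PI * (y - v))) * (x0 + 1 - x0)).
    { apply CI_bound. lra. intros; apply ccont_Rcont_h, GC; auto; unfold y; lra.
      intros x Hx. unfold g. destruct (Ceq_dec (ker w (x, y)) 0) as [E|NK].
      - exfalso. revert E. apply ker_neq0. simpl. unfold y, v in *. lra.
      - rewrite Cmod_div by auto.
        destruct (ker_above w (x, y)) as [KA KB]. simpl; unfold y; fold v; lra.
        change (Im (x, y)) with y in KA, KB. fold v in KA, KB.
        apply Rle_trans with (M2 / Cmod (ker w (x, y))).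
        + apply Rmult_le_compat_r. left; apply Rinv_0_lt_compat; lra.
          eapply Rle_trans; [apply Cmod_triangle|]. rewrite Cmod_opp. unfold M2. apply Rplus_le_compat_r.
          eapply Rle_trans; [apply HB|apply Rle_abs]. simpl. unfold y; lra.
        + apply Rmult_le_compat_l; auto. apply Rinv_le_contravar; lra. }
    rewrite <- (I2 v1 y) in B by (unfold y; lra). fold N in B.
    assert (YP : y - v <> 0) by (unfold y; lra).
    assert (B2 : 2 * (M2 / (2 * PI * (y - v))) * (x0 + 1 - x0) < N); [|lra].
    replace (2 * (M2 / (2 * PI * (y - v))) * (x0 + 1 - x0)) with (2 * M2 / (2 * PI * (y - v))) by (field; split; lra).
    apply Rlt_div_l. lra. assert (2 * M2 / N * N < 2 * PI * (y - v) * N) by (apply Rmult_lt_compat_r; lra).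
    replace (2 * M2 / N * N) with (2 * M2) in H by (field; lra). lra. }
  assert (KC : forall x y, y < v -> ccont (fun z => / ker w z)%C (x, y)).
  { intros x y Hyy. eapply cderiv_ccont. apply cderiv_inv. apply ker_neq0; simpl; fold v; lra. apply cderiv_ker. }
  set (J := fun y => CI (fun x => / ker w (x, y))%C x0 (x0 + 1)).
  (* Unlike [f], the kernel lives on the whole plane, so this line may be pushed down without bound,
     even out of the upper half plane; there [/ ker] tends to 1. *)
  assert (J1 : forall y, y <= y1 -> J y = J y1).
  { intros y Hyy. refine (strip (fun z => / ker w z)%C x0 y y1 Hyy _ _).
    intros x' y' _ Hy'. eexists. apply cderiv_inv. apply ker_neq0; simpl; fold v; lra. apply cderiv_ker.
    intros; rewrite ker_per; auto. }
  assert (J2 : J y1 = RtoC 1).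
  { apply Ceq_minus. apply Cmod_eq_0. apply Rle_antisym; [|apply Cmod_ge_0]. apply Rnot_lt_le. intros P.
    set (N := Cmod (J y1 - 1)%C) in *.
    set (y := y1 - (2 / N + 1)). assert (QN : 0 < 2 / N) by (apply Rdiv_lt_0_compat; lra).
    assert (EX : 1 + 2 * PI * (v - y) <= exp (2 * PI * (v - y))) by (apply exp_ineq1_le).
    assert (YV : 2 / N + 1 < 2 * PI * (v - y)). { assert (1 < PI) by (assert (T := PI2_1); lra). unfold y. nra. }
    assert (B : Cmod (J y - 1)%C <= 2 * (/ (2 * PI * (v - y))) * (x0 + 1 - x0)).
    { replace (RtoC 1) with (CI (fun _ => RtoC 1) x0 (x0 + 1)).
      2: { rewrite CI_const by lra. replace (x0 + 1 - x0) with 1 by ring. ring. }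
      assert (C1 : forall x, Rcont (fun x => / ker w (x, y))%C x).
      { intros x. apply (ccont_Rcont_h (fun z => / ker w z)%C), KC. unfold y; lra. }
      assert (C2 : forall x, Rcont (fun _ => RtoC 1) x) by (intros x; split; apply continuous_const).
      unfold J. rewrite <- CI_minus; auto; [|lra]. apply CI_bound. lra.
      - intros x _. apply (ccont_Rcont_h (fun z => / ker w z - 1)%C).
        apply (ccont_plus (fun z => / ker w z)%C (fun _ => - (1))%C). apply KC; unfold y; lra. apply (cderiv_ccont _ _ _ (cderiv_const _ _)).
      - intros x _.
        assert (NK : ker w (x, y) <> RtoC 0) by (apply ker_neq0; simpl; fold v; unfold y; lra).
        replace (/ ker w (x, y) - 1)%C with (e (w - (x, y)) / ker w (x, y))%C by (unfold ker at 1 2; unfold ker in NK; field; auto).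
        rewrite Cmod_div, Cmod_ew by auto.
        destruct (ker_below w (x, y)) as [KA KB]. simpl; unfold y; fold v; lra.
        change (Im (x, y)) with y in *. fold v in KA, KB |- *.
        set (q := exp (2 * PI * (y - v))) in *.
        assert (QQ : q * exp (2 * PI * (v - y)) = 1). { unfold q. rewrite <- exp_plus, <- exp_0. f_equal. ring. }
        assert (Q0 : 0 < q) by apply exp_pos.
        apply Rle_div_l. lra. apply Rmult_le_reg_l with (2 * PI * (v - y)). lra.
        rewrite <- Rmult_assoc, Rinv_r, Rmult_1_l by lra. eapply Rle_trans; [|exact KA].
        assert (q * (1 + 2 * PI * (v - y)) <= 1) by (rewrite <- QQ; apply Rmult_le_compat_l; lra). lra. }
    rewrite J1 in B by (unfold y; lra). fold N in B.
    assert (YP : v - y <> 0) by (unfold y; lra).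
    assert (B2 : 2 * / (2 * PI * (v - y)) * (x0 + 1 - x0) < N); [|lra].
    replace (2 * / (2 * PI * (v - y)) * (x0 + 1 - x0)) with (2 / (2 * PI * (v - y))) by (field; split; lra).
    apply Rlt_div_l. lra. assert (2 / N * N < 2 * PI * (v - y) * N) by (apply Rmult_lt_compat_r; lra).
    replace (2 / N * N) with 2 in H by (field; lra). lra. }
  assert (KC1 : forall x, Rcont (fun x => / ker w (x, y1))%C x) by (intros; apply (ccont_Rcont_h (fun z => / ker w z)%C), KC; lra).
  transitivity (I y1 + f w * J y1)%C. rewrite I3, I4, J2; ring.
  unfold I, J. rewrite <- CI_scal by (auto; lra).
  rewrite <- CI_plus; try lra.
  - apply CI_ext. lra. intros x Hx. unfold g. destruct (Ceq_dec (ker w (x, y1)) 0) as [E|NK].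
    + exfalso. revert E. apply ker_neq0. simpl; fold v; lra.
    + field. auto.
  - intros; apply ccont_Rcont_h, GC; auto; lra.
  - intros x Hx. apply (ccont_Rcont_h (fun z => f w * / ker w z)%C).
    eapply cderiv_ccont. apply cderiv_scal. apply cderiv_inv. apply ker_neq0; simpl; fold v; lra. apply cderiv_ker.
Qed.

(** * Bounds, constant terms and decay at the cusp *)

Definition periodic (f : C -> C) : Prop := forall z, in_H z -> f (z + 1)%C = f z.

Lemma periodic_Z {T : Type} (f : C -> T) : (forall z, in_H z -> f (z + 1)%C = f z) ->
  forall (n : Z) z, in_H z -> f (z + IZR n)%C = f z.
Proof.
  intros H.
  assert (HH : forall z (r : R), in_H z -> in_H (z + r)%C).
  { unfold in_H. intros z r Hz. rewrite im_plus, im_RtoC. lra. }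
  assert (N : forall (n : nat) z, in_H z -> f (z + INR n)%C = f z).
  { induction n; intros z Hz. simpl INR. f_equal. ring.
    rewrite S_INR, RtoC_plus, Cplus_assoc, H by (apply HH; auto). auto. }
  intros n z Hz. destruct (Z.le_gt_cases 0 n) as [L|L].
  - rewrite <- (Z2Nat.id n L), <- INR_IZR_INZ. auto.
  - rewrite <- (N (Z.to_nat (- n)) (z + IZR n)%C) by (apply HH; auto). f_equal.
    rewrite INR_IZR_INZ, Z2Nat.id by lia. rewrite opp_IZR, RtoC_opp. ring.
Qed.

Lemma shift_half (x : R) : exists n : Z, Rabs (x + IZR n) <= / 2.
Proof.
  exists (- (up (x - / 2)))%Z. rewrite opp_IZR. destruct (archimed (x - / 2)) as [H1 H2].
  apply Rabs_le. lra.
Qed.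

Lemma shift_unit (x : R) : exists n : Z, 0 <= x + IZR n <= 1.
Proof.
  exists (1 - up x)%Z. rewrite minus_IZR. destruct (archimed x) as [H1 H2]. lra.
Qed.

Lemma holo_contR f a b c d : holo_H f -> 0 < c -> contR f a b c d.
Proof.
  intros H Hc x y Hx Hy. destruct (holo_deriv f (x, y) H) as [l Hl]. unfold in_H; simpl; lra.
  eapply cderiv_ccont; eauto.
Qed.

(** By uniform continuity on one period, any point is reached from [(0, c)] by a bounded number of
    steps of length at most [del / 2], each changing [f] by at most 1. *)
Lemma strip_bounded f c d : holo_H f -> periodic f -> 0 < c <= d -> exists B, forall z, c <= Im z <= d -> Cmod (f z) <= B.
Proof.
  intros HF HP Hc.
  destruct (unif_cont f 0 1 c d (holo_contR f 0 1 c d HF ltac:(lra)) 1 Rlt_0_1) as [del [Hd H1]].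
  assert (ST : forall (u : R -> C) a b, (forall s t, a <= s <= b -> a <= t <= b -> Rabs (t - s) < del -> Cmod (u t - u s)%C <= 1) ->
    forall n t, a <= t <= b -> t - a <= INR n * (del / 2) -> Cmod (u t) <= Cmod (u a) + INR n).
  { intros u a b HU. induction n; intros t Ht HN.
    - simpl in HN |- *. assert (t = a) as -> by lra. lra.
    - rewrite S_INR in *. destruct (Rle_or_lt (t - a) (del / 2)) as [L|L].
      + specialize (HU a t ltac:(lra) Ht). rewrite Rabs_right in HU by lra. specialize (HU ltac:(lra)).
        assert (T := Cmod_sub_lower (u t) (u a)). assert (P := pos_INR n). lra.
      + specialize (IHn (t - del / 2) ltac:(lra) ltac:(lra)). specialize (HU (t - del / 2) t ltac:(lra) Ht).
        replace (t - (t - del / 2)) with (del / 2) in HU by ring. rewrite Rabs_right in HU by lra. specialize (HU ltac:(lra)).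
        assert (T := Cmod_sub_lower (u t) (u (t - del / 2))). lra. }
  assert (AR : forall w, exists n, w <= INR n * (del / 2)).
  { intros w. destruct (INR_unbounded (w / (del / 2))) as [n Hn]. exists n. apply Rlt_le. apply Rlt_div_l in Hn; lra. }
  destruct (AR 1) as [n1 N1]. destruct (AR (d - c)) as [n2 N2].
  exists (Cmod (f (0, c)) + INR n1 + INR n2). intros z Hz.
  destruct (shift_unit (Re z)) as [n Hn].
  assert (HZ : in_H z) by (unfold in_H; lra).
  rewrite <- (periodic_Z f HP n z HZ).
  replace (z + IZR n)%C with ((Re z + IZR n, Im z) : C) by (apply C_eq; [rewrite re_plus, re_RtoC|rewrite im_plus, im_RtoC, Rplus_0_r]; reflexivity).
  set (x := Re z + IZR n) in *. set (y := Im z) in *.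
  apply Rle_trans with (Cmod (f (x, c)) + INR n2).
  - apply (ST (fun y => f (x, y)) c d); try lra. intros s t Hs Ht L. apply H1; auto. rewrite Rminus_diag, Rabs_R0; lra.
  - apply Rplus_le_compat_r. apply (ST (fun x => f (x, c)) 0 1); try lra. intros s t Hs Ht L. apply H1; auto; try lra. rewrite Rminus_diag, Rabs_R0; lra.
Qed.

Lemma RInt_period (u : R -> R) (x0 : R) : (forall x, continuous u x) -> (forall x, u (x + 1) = u x) ->
  RInt u x0 (x0 + 1) = RInt u 0 1.
Proof.
  intros HC HP.
  assert (EX : forall a b, ex_RInt u a b) by (intros; apply (ex_RInt_continuous (V := R_CompleteNormedModule)); auto).
  assert (E1 := RInt_Chasles (V := R_CompleteNormedModule) u x0 0 (x0 + 1) (EX _ _) (EX _ _)).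
  assert (E2 := RInt_Chasles (V := R_CompleteNormedModule) u 0 1 (x0 + 1) (EX _ _) (EX _ _)).
  assert (E3 := RInt_comp_lin (V := R_CompleteNormedModule) u 1 1 0 x0).
  replace (1 * 0 + 1) with 1 in E3 by ring. replace (1 * x0 + 1) with (x0 + 1) in E3 by ring.
  specialize (E3 (EX _ _)).
  rewrite (RInt_ext _ u) in E3.
  2: { intros x _. unfold scal; simpl; unfold mult; simpl. rewrite !Rmult_1_l. apply HP. }
  assert (E4 := opp_RInt_swap (V := R_CompleteNormedModule) u x0 0 (EX _ _)).
  unfold plus in E1, E2. unfold opp in E4. simpl in E1, E2, E4.
  change (RInt u x0 (x0 + 1) = RInt u 0 1). lra.
Qed.

Lemma CI_period (F : R -> C) (x0 : R) : (forall x, Rcont F x) -> (forall x, F (x + 1) = F x) -> CI F x0 (x0 + 1) = CI F 0 1.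
Proof.
  intros HC HP. unfold CI. f_equal; apply RInt_period; intros x; try (rewrite HP; reflexivity).
  exact (proj1 (HC x)). exact (proj2 (HC x)).
Qed.

Lemma in_H_pair x y : 0 < y -> in_H (x, y). Proof. auto. Qed.

(** The constant is the mean of [f] over a period at height [1 / 2]: replacing [1 / ker] by 1 in the
    kernel formula costs [e (w - z) / ker], which is [O(exp (- 2 PI Im w))]. *)
Lemma const_term f M : holo_H f -> periodic f -> (forall z, 1 <= Im z -> Cmod (f z) <= M) ->
  exists c K, 0 <= K /\ forall z, 1 <= Im z -> Cmod (f z - c)%C <= K * exp (- 2 * PI * Im z).
Proof.
  intros HF HP HB. destruct (strip_bounded f (/2) (/2) HF HP ltac:(lra)) as [B HBB].
  assert (B0 : 0 <= B) by (eapply Rle_trans; [apply (Cmod_ge_0 (f (0, /2)))|apply HBB; simpl; lra]).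
  set (F := fun x => f (x, / 2)).
  assert (FC : forall x, Rcont F x).
  { intros x. apply ccont_Rcont_h. apply (holo_contR f x x (/2) (/2) HF); lra. }
  assert (FP : forall x, F (x + 1) = F x).
  { intros x. unfold F. rewrite <- (HP (x, / 2)) by (apply in_H_pair; lra). f_equal. apply C_eq; simpl; ring. }
  assert (Pi := PI_RGT_0).
  set (q := 1 - exp (- PI)). assert (Q : 0 < q). { unfold q. assert (exp (- PI) < exp 0) by (apply exp_increasing; lra). rewrite exp_0 in H; lra. }
  exists (CI F 0 1), (2 * (B * exp PI / q)). split.
  { apply Rmult_le_pos. lra. apply Rdiv_le_0_compat; auto. apply Rmult_le_pos; auto. left; apply exp_pos. }
  intros w Hw. rewrite (kernel_formula f w (/2) M HF HP HB ltac:(lra)).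
  rewrite <- (CI_period F (Re w - / 2) FC FP).
  assert (KN : forall x, ker w (x, / 2) <> RtoC 0) by (intros; apply ker_neq0; simpl; lra).
  assert (RC : forall x, Rcont (fun x => f (x, (/ 2)%R) / ker w (x, (/ 2)%R))%C x).
  { intros x. destruct (holo_deriv f (x, /2) HF ltac:(apply in_H_pair; lra)) as [l Hl].
    apply (ccont_Rcont_h (fun z => f z * / ker w z)%C). eapply cderiv_ccont. apply cderiv_mult. exact Hl. apply cderiv_inv; auto. apply cderiv_ker. }
  rewrite <- CI_minus; auto; try lra.
  replace (2 * (B * exp PI / q) * exp (- 2 * PI * Im w)) with (2 * (B * exp PI / q * exp (- 2 * PI * Im w)) * (Re w - / 2 + 1 - (Re w - / 2))) by ring.
  apply CI_bound. lra.
  - intros x _. destruct (holo_deriv f (x, /2) HF ltac:(apply in_H_pair; lra)) as [l Hl].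
    apply (ccont_Rcont_h (fun z => f z * / ker w z - f z)%C). apply (ccont_plus (fun z => f z * / ker w z)%C (fun z => - f z)%C).
    eapply cderiv_ccont. apply cderiv_mult. exact Hl. apply cderiv_inv; auto. apply cderiv_ker.
    eapply cderiv_ccont. apply (cderiv_ext (fun z => - (1) * f z)%C). intros; ring. apply cderiv_scal. exact Hl.
  - intros x _. unfold F. set (z := (x, / 2) : C).
    replace (f z / ker w z - f z)%C with (f z * (e (w - z) / ker w z))%C.
    2: { specialize (KN x). fold z in KN. unfold ker at 1 2. unfold ker in KN. field. auto. }
    rewrite Cmod_mult, Cmod_div, Cmod_ew by apply KN.
    destruct (ker_below w z) as [KA KB]. simpl; lra.
    change (Im z) with (/2) in *.
    replace (B * exp PI / q * exp (- 2 * PI * Im w)) with (B * (exp (2 * PI * (/ 2 - Im w)) / q)).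
    2: { replace (2 * PI * (/ 2 - Im w)) with (PI + - 2 * PI * Im w) by field. rewrite exp_plus. field. lra. }
    apply Rmult_le_compat; auto using Cmod_ge_0.
    + apply Rdiv_le_0_compat. left; apply exp_pos. lra.
    + apply HBB. simpl; lra.
    + apply Rmult_le_compat_l. left; apply exp_pos. apply Rinv_le_contravar; auto. eapply Rle_trans; [|exact KA].
      unfold q. assert (exp (2 * PI * (/ 2 - Im w)) <= exp (- PI)); [|lra].
      destruct (Req_dec (2 * PI * (/ 2 - Im w)) (- PI)) as [->|N]. lra. left. apply exp_increasing. nra.
Qed.

Lemma pow_root_le (t s A : R) : 0 <= t -> 0 <= s -> (forall n, t ^ S n <= A * s ^ S n) -> t <= s.
Proof.
  intros Ht Hs H. apply Rnot_lt_le. intros L. destruct Hs as [Hs|<-].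
  - set (r := t / s). assert (R1 : 1 < r) by (unfold r; apply Rlt_div_r; lra).
    destruct (INR_unbounded (A / (r - 1))) as [n Hn].
    assert (P := poly (S n) (r - 1) ltac:(lra)). replace (1 + (r - 1)) with r in P by ring.
    assert (r ^ S n <= A). { specialize (H n). unfold r, Rdiv. rewrite Rpow_mult_distr, pow_inv.
      apply Rle_div_l. apply Rlt_gt, pow_lt; auto. exact H. }
    apply Rlt_div_l in Hn; [|lra]. rewrite S_INR in P. nra.
  - specialize (H O). simpl in H. lra.
Qed.

(** A maximum principle for [k z = f z * e (- z)], which is bounded at the cusp. A single use of the
    kernel formula gives it with a spurious constant factor; used for every power of [k] and
    followed by an [n]-th root, in the form of [pow_root_le], it loses that factor. *)
Lemma cusp_decay f C0 w y1 S0 : holo_H f -> periodic f -> (forall z, 1 <= Im z -> Cmod (f z) <= C0 * exp (- 2 * PI * Im z)) ->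
  0 < y1 < Im w -> (forall x, Cmod (f (x, y1)) <= S0) -> Cmod (f w) <= S0 * exp (- (2 * PI * (Im w - y1))).
Proof.
  intros HF HP HB Hy HS.
  set (k := fun z => (f z * e (- z))%C).
  assert (KM : forall z, Cmod (k z) = Cmod (f z) * exp (2 * PI * Im z)).
  { intros z. unfold k. rewrite Cmod_mult, Cmod_e. f_equal. f_equal. rewrite im_opp. ring. }
  assert (KH : forall n, holo_H (fun z => k z ^ S n)%C).
  { intros n z Hz. destruct (holo_deriv f z HF Hz) as [l Hl]. eexists. apply cderiv_pow. apply cderiv_mult. exact Hl.
    apply (cderiv_comp e (fun z => - z)%C). apply cderiv_e. apply (cderiv_ext (fun z => - (1) * z)%C). intros; ring. apply cderiv_scal, cderiv_id. }
  assert (KP : forall n, periodic (fun z => k z ^ S n)%C).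
  { intros n z Hz. unfold k. rewrite HP by auto. replace (- (z + 1))%C with (- z + - (1))%C by ring. rewrite e_plus, (e_opp 1), e_1.
    f_equal. field. }
  assert (KB : forall n z, 1 <= Im z -> Cmod (k z ^ S n)%C <= C0 ^ S n).
  { intros n z Hz. rewrite Cmod_pow. apply pow_incr. split. apply Cmod_ge_0. rewrite KM. specialize (HB z Hz).
    apply Rle_trans with (C0 * exp (- 2 * PI * Im z) * exp (2 * PI * Im z)).
    apply Rmult_le_compat_r; auto. left; apply exp_pos. rewrite Rmult_assoc, <- exp_plus.
    replace (- 2 * PI * Im z + 2 * PI * Im z) with 0 by ring. rewrite exp_0; lra. }
  set (s := S0 * exp (2 * PI * y1)).
  assert (KS : forall x, Cmod (k (x, y1)) <= s). { intros x. rewrite KM. simpl. apply Rmult_le_compat_r; auto. left; apply exp_pos. }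
  assert (S00 : 0 <= s) by (eapply Rle_trans; [apply Cmod_ge_0|apply (KS 0)]).
  set (q := 1 - exp (2 * PI * (y1 - Im w))).
  assert (Q : 0 < q). { apply (ker_below w (0, y1)). simpl; lra. }
  assert (MAIN : Cmod (k w) <= s).
  { apply (pow_root_le _ _ (2 / q)); auto using Cmod_ge_0. intros n. rewrite <- Cmod_pow.
    rewrite (kernel_formula (fun z => k z ^ S n)%C w y1 (C0 ^ S n) (KH n) (KP n) (KB n) Hy).
    replace (2 / q * s ^ S n) with (2 * (s ^ S n / q) * (Re w - / 2 + 1 - (Re w - / 2))) by (field; lra).
    assert (KN : forall x, ker w (x, y1) <> RtoC 0) by (intros; apply ker_neq0; simpl; lra).
    apply CI_bound. lra.
    - intros x _. destruct (KH n (x, y1)) as [l Hl]. apply in_H_pair; lra.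
      apply (ccont_Rcont_h (fun z => k z ^ S n * / ker w z)%C). eapply cderiv_ccont. apply cderiv_mult. exact Hl. apply cderiv_inv; auto. apply cderiv_ker.
    - intros x _. rewrite Cmod_div, Cmod_pow by auto.
      destruct (ker_below w (x, y1)) as [KA _]. simpl; lra. change (Im (x, y1)) with y1 in KA. fold q in KA.
      apply Rmult_le_compat. apply pow_le, Cmod_ge_0. left; apply Rinv_0_lt_compat; lra.
      apply pow_incr; split; auto using Cmod_ge_0. apply Rinv_le_contravar; lra. }
  rewrite KM in MAIN. apply Rmult_le_reg_r with (exp (2 * PI * Im w)). apply exp_pos.
  eapply Rle_trans; [exact MAIN|]. right. unfold s. rewrite (Rmult_assoc S0), <- exp_plus. f_equal. f_equal. ring.
Qed.

(** * Modular forms *)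

Lemma in_H_neq0 z : in_H z -> z <> RtoC 0.
Proof. unfold in_H. intros H E. rewrite E, im_RtoC in H. lra. Qed.

Lemma Im_inv z : z <> RtoC 0 -> Im (- / z)%C = Im z / (Cmod z) ^ 2.
Proof.
  intros H. rewrite im_opp, Cmod2_alt. unfold Cinv, Im, Re; simpl.
  assert (0 < Cmod z ^ 2) by (apply pow_lt, Cmod_gt_0; auto). rewrite Cmod2_alt in H0. unfold Re, Im in H0. simpl in H0.
  field. lra.
Qed.

Lemma in_H_S z : in_H z -> in_H (- / z)%C.
Proof.
  intros H. unfold in_H. rewrite Im_inv by (apply in_H_neq0; auto). apply Rdiv_lt_0_compat; auto.
  apply pow_lt, Cmod_gt_0, in_H_neq0; auto.
Qed.

Lemma in_H_T z : in_H z -> in_H (z + 1)%C.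
Proof. unfold in_H. intros. rewrite im_plus, im_RtoC. lra. Qed.

(** [zp z v] is [z ^ (2 v)] for [v : Z]. *)
Definition zp (z : C) (v : Z) : C := ((z * z) ^ Z.to_nat v / (z * z) ^ Z.to_nat (- v))%C.

Lemma zp_plus z u v : z <> RtoC 0 -> zp z (u + v) = (zp z u * zp z v)%C.
Proof.
  intros H. unfold zp. assert (H2 : (z * z)%C <> RtoC 0) by (apply Cmult_neq_0; auto).
  set (a := (z * z)%C) in *.
  assert (P : forall n, (a ^ n)%C <> RtoC 0) by (intros; apply Cpow_nz; auto).
  assert (E : (a ^ (Z.to_nat (u + v) + (Z.to_nat (- u) + Z.to_nat (- v))) = a ^ (Z.to_nat u + Z.to_nat v + Z.to_nat (- (u + v))))%C) by (f_equal; lia).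
  rewrite !Cpow_add_r in E.
  transitivity (a ^ Z.to_nat (u + v) * (a ^ Z.to_nat (- u) * a ^ Z.to_nat (- v)) / (a ^ Z.to_nat (- (u + v)) * a ^ Z.to_nat (- u) * a ^ Z.to_nat (- v)))%C.
  field; auto. rewrite E. field; auto.
Qed.

Lemma zp_0 z : zp z 0 = RtoC 1. Proof. unfold zp; simpl. field. Qed.
Lemma zp_nat z (n : nat) : zp z (Z.of_nat n) = ((z * z) ^ n)%C.
Proof. unfold zp. rewrite Nat2Z.id. replace (Z.to_nat (- Z.of_nat n)) with O by lia. simpl. field. Qed.
Lemma zp_neq0 z v : z <> RtoC 0 -> zp z v <> RtoC 0.
Proof.
  intros H E. assert (T := zp_plus z v (- v) H). rewrite E, Z.add_opp_diag_r, zp_0, Cmult_0_l in T. apply C1_nz, T.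
Qed.

Lemma Cmod_zp z v : z <> RtoC 0 -> Cmod (zp z v) = Rpower (Cmod z ^ 2) (IZR v).
Proof.
  intros H. assert (P : 0 < Cmod z ^ 2) by (apply pow_lt, Cmod_gt_0; auto).
  assert (N : forall n : nat, Cmod ((z * z) ^ n)%C = Rpower (Cmod z ^ 2) (INR n)).
  { intros n. rewrite Cmod_pow, Cmod_mult, Rpower_pow by auto. f_equal. ring. }
  unfold zp. rewrite Cmod_div by (apply Cpow_nz, Cmult_neq_0; auto). rewrite !N.
  unfold Rdiv. rewrite <- Rpower_Ropp, <- Rpower_plus. f_equal.
  rewrite !INR_IZR_INZ, <- opp_IZR, <- plus_IZR. f_equal. lia.
Qed.

(** [MF v]: modular forms of weight [2 v], with [v] of any sign; only the two generators of SL(2,Z) are tested. *)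
Definition MF (v : Z) (f : C -> C) : Prop :=
  holo_H f /\ periodic f /\ (forall z, in_H z -> f (- / z)%C = (zp z v * f z)%C) /\
  exists M, forall z, 1 <= Im z -> Cmod (f z) <= M.

Lemma holo_intro f : (forall z, in_H z -> exists l, cderiv_at f z l) -> holo_H f.
Proof. intros H z Hz. destruct (H z Hz) as [l Hl]. exists l. exact Hl. Qed.

Lemma holo_mult f g : holo_H f -> holo_H g -> holo_H (fun z => f z * g z)%C.
Proof.
  intros Hf Hg. apply holo_intro. intros z Hz. destruct (holo_deriv f z Hf Hz) as [a Ha]. destruct (holo_deriv g z Hg Hz) as [b Hb].
  eexists. apply cderiv_mult; eauto.
Qed.
Lemma holo_plus f g : holo_H f -> holo_H g -> holo_H (fun z => f z + g z)%C.
Proof.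
  intros Hf Hg. apply holo_intro. intros z Hz. destruct (holo_deriv f z Hf Hz) as [a Ha]. destruct (holo_deriv g z Hg Hz) as [b Hb].
  eexists. apply cderiv_plus; eauto.
Qed.
Lemma holo_const c : holo_H (fun _ => c).
Proof. apply holo_intro. intros. eexists. apply cderiv_const. Qed.

Lemma cusp_H z : 1 <= Im z -> in_H z. Proof. unfold in_H; lra. Qed.

Lemma MF_ext v f g : (forall z, in_H z -> f z = g z) -> MF v f -> MF v g.
Proof.
  intros E (H1 & H2 & H3 & M & H4). split; [|split; [|split]].
  - apply holo_intro. intros z Hz. destruct (holo_deriv f z H1 Hz) as [a Ha]. exists a. eapply cderiv_ext_H; eauto.
  - intros z Hz. rewrite <- !E; auto using in_H_T.
  - intros z Hz. rewrite <- !E; auto using in_H_S.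
  - exists M. intros z Hz. rewrite <- E; auto using cusp_H.
Qed.

Lemma MF_mult u v f g : MF u f -> MF v g -> MF (u + v) (fun z => f z * g z)%C.
Proof.
  intros (H1 & H2 & H3 & M & H4) (K1 & K2 & K3 & N & K4). split; [|split; [|split]].
  - apply holo_mult; auto.
  - intros z Hz. rewrite H2, K2; auto.
  - intros z Hz. rewrite H3, K3, zp_plus by (auto using in_H_neq0). ring.
  - exists (M * N). intros z Hz. rewrite Cmod_mult. apply Rmult_le_compat; auto using Cmod_ge_0.
Qed.

Lemma MF_plus v f g : MF v f -> MF v g -> MF v (fun z => f z + g z)%C.
Proof.
  intros (H1 & H2 & H3 & M & H4) (K1 & K2 & K3 & N & K4). split; [|split; [|split]].
  - apply holo_plus; auto.
  - intros z Hz. rewrite H2, K2; auto.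
  - intros z Hz. rewrite H3, K3 by auto. ring.
  - exists (M + N). intros z Hz. eapply Rle_trans; [apply Cmod_triangle|]. apply Rplus_le_compat; auto.
Qed.

Lemma MF_const c : MF 0 (fun _ => c).
Proof.
  split; [|split; [|split]]. apply holo_const. intros z Hz; auto. intros z Hz. rewrite zp_0. ring.
  exists (Cmod c). intros; lra.
Qed.

Lemma MF_scal v c f : MF v f -> MF v (fun z => c * f z)%C.
Proof. intros H. apply (MF_mult 0 v (fun _ => c) f (MF_const c) H). Qed.

Lemma MF_zero v : MF v (fun _ => RtoC 0).
Proof.
  split; [|split; [|split]]. apply holo_const. intros z Hz; auto. intros z Hz. ring.
  exists 0. intros; rewrite Cmod_0; lra.
Qed.

Lemma MF_minus v f g : MF v f -> MF v g -> MF v (fun z => f z - g z)%C.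
Proof.
  intros H1 H2. eapply MF_ext; [|apply (MF_plus _ _ _ H1 (MF_scal _ (- (1))%C _ H2))]. intros; cbv beta; ring.
Qed.

Lemma MF_eq u v f : u = v -> MF u f -> MF v f. Proof. intros ->; auto. Qed.

Lemma MF_pow v f n : MF v f -> MF (Z.of_nat n * v) (fun z => f z ^ n)%C.
Proof.
  intros H. induction n. apply (MF_const 1).
  apply (MF_eq (v + Z.of_nat n * v)); [lia|]. apply (MF_mult _ _ _ _ H IHn).
Qed.

(** Below height [0.86 < sqrt 3 / 2] a point with [|Re w| <= 1 / 2] satisfies [|w|^2 <= 100 / 101],
    so one inversion raises the height by at least one percent, and finitely many moves suffice. *)
Lemma fundamental_reduction (phi : C -> R) (B : R) :
  (forall z, in_H z -> phi (z + 1)%C = phi z) -> (forall z, in_H z -> phi (- / z)%C = phi z) ->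
  (forall z, 86 / 100 <= Im z -> phi z <= B) -> forall z, in_H z -> phi z <= B.
Proof.
  intros HT HS HB.
  assert (IND : forall n z, in_H z -> 86 / 100 <= Im z * (101 / 100) ^ n -> phi z <= B).
  { induction n; intros z Hz Hn.
    - apply HB. simpl in Hn. lra.
    - destruct (shift_half (Re z)) as [m Hm]. rewrite <- (periodic_Z phi HT m z Hz).
      set (w := (z + IZR m)%C).
      assert (W1 : Im w = Im z) by (unfold w; rewrite im_plus, im_RtoC; ring).
      assert (W2 : Rabs (Re w) <= / 2) by (unfold w; rewrite re_plus, re_RtoC; auto).
      assert (W3 : in_H w) by (unfold in_H in *; lra).
      destruct (Rle_or_lt (86 / 100) (Im w)) as [L|L]. apply HB; auto.
      rewrite <- HS by auto. apply IHn. apply in_H_S; auto.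
      rewrite Im_inv by (apply in_H_neq0; auto).
      assert (Q : Cmod w ^ 2 <= 100 / 101).
      { rewrite Cmod2_alt. apply Rabs_le_between in W2. unfold in_H in W3.
        assert (Re w * Re w <= / 4) by nra. assert (Im w * Im w <= 86 / 100 * (86 / 100)) by nra. lra. }
      assert (Q2 : 0 < Cmod w ^ 2) by (apply pow_lt, Cmod_gt_0, in_H_neq0; auto).
      assert (P : 0 < (101 / 100) ^ n) by (apply pow_lt; lra). unfold in_H in Hz. simpl in Hn.
      assert (101 / 100 <= / Cmod w ^ 2). { replace (101 / 100) with (/ (100 / 101)) by field. apply Rinv_le_contravar; auto. }
      rewrite W1. unfold Rdiv at 2. 
      apply Rle_trans with (Im z * (101 / 100) * (101 / 100) ^ n). lra.
      apply Rmult_le_compat_r. lra. apply Rmult_le_compat_l; lra. }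
  intros z Hz. unfold in_H in Hz.
  destruct (INR_unbounded (100 / Im z)) as [n Hn]. apply (IND n z Hz).
  assert (P := poly n (1 / 100) ltac:(lra)). replace (1 + 1 / 100) with (101 / 100) in P by field.
  apply Rlt_div_l in Hn; [|lra]. nra.
Qed.

Lemma Rpower_le_exp (y v : R) : 86 / 100 <= y <= 1 -> Rpower y v <= exp (Rabs v).
Proof.
  intros H. unfold Rpower.
  assert (L1 : ln y <= 0). { rewrite <- ln_1. destruct (Req_dec y 1) as [->|]. lra. left; apply ln_increasing; lra. }
  assert (L2 : - 1 <= ln y).
  { rewrite <- (ln_exp (-1)). left. apply ln_increasing. apply exp_pos.
    replace (-1) with (- (1)) by ring. rewrite exp_Ropp. apply Rlt_le_trans with (/ 2); [|lra].
    apply Rinv_lt_contravar. apply Rmult_lt_0_compat. lra. apply exp_pos. assert (T := exp_ineq1 1 ltac:(lra)). lra. }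
  assert (v * ln y <= Rabs v). { assert (T := Rle_abs v). assert (T2 := Rle_abs (- v)). rewrite Rabs_Ropp in T2. nra. }
  destruct H0 as [L|E]. left; apply exp_increasing; auto. rewrite E; lra.
Qed.

Lemma Rpower_le_exp2pi (y v : R) : 1 <= y -> v <= 5 -> Rpower y v <= exp (2 * PI * y).
Proof.
  intros Hy Hv. unfold Rpower.
  assert (L1 : 0 <= ln y). { rewrite <- ln_1. destruct Hy as [|<-]. left; apply ln_increasing; lra. lra. }
  assert (L2 : ln y <= y). { rewrite <- (ln_exp y) at 2. left. apply ln_increasing. lra. assert (T := exp_ineq1 y ltac:(lra)). lra. }
  assert (P := PI2_1). left. apply exp_increasing. apply Rle_lt_trans with (5 * ln y). nra. assert (P2 := PI2_3_2). nra.
Qed.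

(** Lowering the height by two percent costs at most [(100 / 98)^5 < 1.1063] and gains at least [exp
    (2 PI * 0.02 * 0.86) > 1.0258^4 > 1.107]. The comparison has to break down at [v = 6], where the
    discriminant lives. *)
Lemma contraction_const (y v : R) : 86 / 100 <= y -> v <= 5 ->
  exp (- (2 * PI * (y - 98 / 100 * y))) * Rpower (100 / 98) v <= 9999 / 10000.
Proof.
  intros Hy Hv. assert (P := PI2_3_2).
  assert (A : Rpower (100 / 98) v <= (100 / 98) ^ 5).
  { rewrite <- Rpower_pow by lra. apply Rle_Rpower. lra. simpl. lra. }
  assert (B : (1 + 258 / 10000) ^ 4 <= exp (2 * PI * (y - 98 / 100 * y))).
  { assert (X : 1032 / 10000 <= 2 * PI * (y - 98 / 100 * y)) by nra.
    set (x := 2 * PI * (y - 98 / 100 * y)) in *.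
    replace x with (x / 4 + x / 4 + x / 4 + x / 4) by field. rewrite !exp_plus.
    assert (T := exp_ineq1_le (x / 4)). 
    replace (exp (x / 4) * exp (x / 4) * exp (x / 4) * exp (x / 4)) with (exp (x / 4) ^ 4) by ring.
    apply pow_incr. lra. }
  rewrite exp_Ropp. set (E := exp (2 * PI * (y - 98 / 100 * y))) in *.
  assert (E0 : 0 < E) by apply exp_pos. apply Rmult_le_reg_l with E; auto. rewrite <- Rmult_assoc, Rinv_r, Rmult_1_l by lra.
  eapply Rle_trans; [exact A|]. eapply Rle_trans; [|apply Rmult_le_compat_r; [lra|exact B]]. lra.
Qed.

(** y^v |f| is invariant; for [v <= 5] exponential decay beats the factor y^v just below its supremum. *)
Theorem cusp_form_vanish (v : Z) (f : C -> C) (K : R) : (v <= 5)%Z -> MF v f ->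
  (forall z, 1 <= Im z -> Cmod (f z) <= K * exp (- 2 * PI * Im z)) -> forall z, in_H z -> f z = RtoC 0.
Proof.
  intros Hv (HF & HP & HS & _) HK. apply IZR_le in Hv.
  set (phi := fun z => Rpower (Im z) (IZR v) * Cmod (f z)).
  assert (P0 : forall z, 0 <= phi z). { intros; apply Rmult_le_pos. left; apply exp_pos. apply Cmod_ge_0. }
  assert (PT : forall z, in_H z -> phi (z + 1)%C = phi z).
  { intros z Hz. unfold phi. rewrite HP by auto. rewrite im_plus, im_RtoC, Rplus_0_r. auto. }
  assert (PS : forall z, in_H z -> phi (- / z)%C = phi z).
  { intros z Hz. unfold phi. assert (N := in_H_neq0 z Hz). rewrite HS, Cmod_mult, Cmod_zp, Im_inv, <- Rmult_assoc by auto.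
    assert (P : 0 < Cmod z ^ 2) by (apply pow_lt, Cmod_gt_0; auto). unfold in_H in Hz.
    rewrite Rpower_mult_distr; auto. f_equal. f_equal. field. apply Rgt_not_eq, Cmod_gt_0; auto. apply Rdiv_lt_0_compat; auto. }
  destruct (strip_bounded f (86/100) 1 HF HP ltac:(lra)) as [B HB].
  assert (B0 : 0 <= B) by (eapply Rle_trans; [apply (Cmod_ge_0 (f (0, 1)))|apply HB; simpl; lra]).
  assert (K0 : 0 <= K).
  { assert (T := HK (0, 1) ltac:(simpl; lra)). assert (T2 := Cmod_ge_0 (f (0, 1))). assert (T3 := exp_pos (- 2 * PI * Im (0, 1))).
    apply Rnot_lt_le. intros L. nra. }
  assert (BD : forall z, in_H z -> phi z <= exp (Rabs (IZR v)) * B + K).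
  (* Between heights 0.86 and 1 periodicity and compactness bound [f]; above 1 the exponential decay
     outweighs [y^v]. *)
  { apply fundamental_reduction; auto. intros z Hz. destruct (Rle_or_lt (Im z) 1) as [L|L].
    - assert (phi z <= exp (Rabs (IZR v)) * B); [|lra]. apply Rmult_le_compat; auto using Cmod_ge_0. left; apply exp_pos.
      apply Rpower_le_exp; lra.
    - assert (phi z <= K). { unfold phi. apply Rle_trans with (exp (2 * PI * Im z) * (K * exp (- 2 * PI * Im z))).
      apply Rmult_le_compat; auto using Cmod_ge_0. left; apply exp_pos. apply Rpower_le_exp2pi; lra. apply HK; lra.
      rewrite (Rmult_comm K), <- Rmult_assoc, <- exp_plus. replace (2 * PI * Im z + - 2 * PI * Im z) with 0 by ring. rewrite exp_0. lra. }
      assert (0 <= exp (Rabs (IZR v)) * B) by (apply Rmult_le_pos; auto; left; apply exp_pos). lra. }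
  destruct (completeness (fun r => exists z, in_H z /\ r = phi z)) as [S0 [S1 S2]].
  { exists (exp (Rabs (IZR v)) * B + K). intros r [z [Hz ->]]. auto. }
  { exists (phi (0, 1)), (0, 1). split; auto. unfold in_H; simpl; lra. }
  assert (SS : forall z, in_H z -> phi z <= S0) by (intros z Hz; apply S1; eauto).
  assert (Spos : 0 <= S0) by (eapply Rle_trans; [apply (P0 (0, 1))|apply SS; unfold in_H; simpl; lra]).
  (* On the line at height [y1 = 0.98 y] the supremum bounds [|f|] by [S0 y1^(-v)]. The decay from
     there up to [y] gains more than the change from [y1^v] to [y^v] can lose, so the supremum is at
     most 0.9999 times itself. *)
  assert (CT : forall z, in_H z -> phi z <= 9999 / 10000 * S0).
  { apply fundamental_reduction; auto. intros z Hz.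
    set (y := Im z) in *. set (y1 := 98 / 100 * y).
    assert (D := cusp_decay f K z y1 (S0 * Rpower y1 (- IZR v)) HF HP HK ltac:(unfold y1; fold y; lra)).
    fold y in D. unfold phi. fold y.
    assert (R1 : 0 < Rpower y1 (- IZR v)) by apply exp_pos.
    assert (R2 : 0 < Rpower y (IZR v)) by apply exp_pos.
    assert (DD : Cmod (f z) <= S0 * Rpower y1 (- IZR v) * exp (- (2 * PI * (y - y1)))).
    { apply D. intros x. assert (T := SS (x, y1) ltac:(unfold in_H, y1; simpl; lra)). unfold phi in T. change (Im (x, y1)) with y1 in T.
      rewrite Rpower_Ropp. assert (R3 : 0 < Rpower y1 (IZR v)) by apply exp_pos.
      apply Rmult_le_reg_l with (Rpower y1 (IZR v)); auto. eapply Rle_trans; [exact T|]. right. field. lra. }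
    apply Rle_trans with (Rpower y (IZR v) * (S0 * Rpower y1 (- IZR v) * exp (- (2 * PI * (y - y1))))).
    apply Rmult_le_compat_l; lra.
    replace (Rpower y (IZR v) * (S0 * Rpower y1 (- IZR v) * exp (- (2 * PI * (y - y1)))))
      with (S0 * (exp (- (2 * PI * (y - y1))) * (Rpower y (IZR v) * Rpower y1 (- IZR v)))) by ring.
    rewrite (Rmult_comm _ S0). apply Rmult_le_compat_l; auto.
    replace (Rpower y (IZR v) * Rpower y1 (- IZR v)) with (Rpower (100 / 98) (IZR v)).
    apply contraction_const; auto.
    unfold Rpower. rewrite <- exp_plus. f_equal.
    replace y with (100 / 98 * y1) at 1 by (unfold y1; field). rewrite ln_mult by (unfold y1; lra). ring. }
  assert (S0 = 0). { assert (S0 <= 9999 / 10000 * S0); [|lra]. apply S2. intros r [z [Hz ->]]. auto. }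
  intros z Hz. apply Cmod_eq_0. specialize (SS z Hz). specialize (P0 z). unfold phi in *.
  assert (0 < Rpower (Im z) (IZR v)) by apply exp_pos. assert (T := Cmod_ge_0 (f z)). nra.
Qed.

(** * The Lipschitz formula *)

Lemma ex_series_inv_sq : ex_series (fun n => / (INR (S n) * INR (S n))).
Proof.
  apply (ex_series_le (K := R_AbsRing) (V := R_CompleteNormedModule) _ (fun n => 2 * (/ INR (S n) - / INR (S (S n))))).
  - intros n. change (Rabs (/ (INR (S n) * INR (S n))) <= 2 * (/ INR (S n) - / INR (S (S n)))).
    rewrite (S_INR (S n)). assert (P : 1 <= INR (S n)) by (rewrite S_INR; assert (T := pos_INR n); lra).
    set (x := INR (S n)) in *. rewrite Rabs_right by (apply Rle_ge; left; apply Rinv_0_lt_compat; nra).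
    replace (2 * (/ x - / (x + 1))) with (2 / (x * (x + 1))) by (field; lra).
    apply Rle_div_r. nra. replace (/ (x * x) * (x * (x + 1))) with (1 + / x) by (field; lra).
    assert (/ x <= / 1) by (apply Rinv_le_contravar; lra). lra.
  - exists (2 * 1). apply (is_series_scal_l 2 (fun n => / INR (S n) - / INR (S (S n))) 1).
    enough (IL : is_lim_seq (sum_n (fun n => / INR (S n) - / INR (S (S n)))) 1) by exact IL.
    apply is_lim_seq_ext with (fun n => 1 - / INR (S (S n))).
    + induction n. rewrite sum_O. change (1 - / INR 2 = / INR 1 - / INR 2). change (INR 1) with 1. rewrite Rinv_1. reflexivity.
      rewrite sum_Sn, <- IHn. change (1 - / INR (S (S (S n))) = 1 - / INR (S (S n)) + (/ INR (S (S n)) - / INR (S (S (S n))))). ring.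
    + replace (Finite 1) with (Rbar_minus 1 0) by (simpl; f_equal; ring).
      apply is_lim_seq_minus'. apply is_lim_seq_const.
      apply (is_lim_seq_incr_1 (fun n => / INR (S n))). apply (is_lim_seq_incr_1 (fun n => / INR n)).
      replace (Finite 0) with (Rbar_inv p_infty) by reflexivity.
      apply is_lim_seq_inv. apply is_lim_seq_INR. discriminate.
Qed.

Lemma psum_rev (a : nat -> C) n : psum a n = psum (fun i => a (n - 1 - i)%nat) n.
Proof.
  induction n. reflexivity. rewrite (psum_shift (fun i => a (S n - 1 - i)%nat)).
  transitivity (a n + psum a n)%C. simpl; ring. rewrite IHn. f_equal.
  f_equal; lia. apply psum_ext; intros; f_equal; lia.
Qed.

Lemma psum_zero n : psum (fun _ => RtoC 0) n = RtoC 0.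
Proof. induction n; simpl; auto. rewrite IHn; ring. Qed.

Lemma cser_fin (a : nat -> C) n : (forall j, (n <= j)%nat -> a j = RtoC 0) -> cser a (psum a n).
Proof.
  intros H eps He. exists n. intros m Hm. replace m with (n + (m - n))%nat by lia.
  rewrite psum_add, (psum_ext (fun k => a (n + k)%nat) (fun _ => RtoC 0)) by (intros; apply H; lia).
  rewrite psum_zero. replace (psum a n + 0 - psum a n)%C with (RtoC 0) by ring. rewrite Cmod_0; auto.
Qed.

Lemma INR_pow2_pos m : 0 < INR (2 ^ m).
Proof. apply lt_0_INR. assert (T := Nat.pow_nonzero 2 m). lia. Qed.
Lemma INR_pow2_neq0 m : RtoC (INR (2 ^ m)) <> RtoC 0.
Proof. intros H. apply RtoC_inj in H. assert (T := INR_pow2_pos m). lra. Qed.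
Lemma INR_pow2_S m : INR (2 ^ S m) = 2 * INR (2 ^ m).
Proof. replace (2 ^ S m)%nat with (2 * 2 ^ m)%nat by reflexivity. rewrite mult_INR. reflexivity. Qed.

(** If [F] is 1-periodic and [F (w/2) + F ((w+1)/2) = 2^k F w], iterating gives
    [F z = 2^(-m k) sum_j F ((z + j) / 2^m)], and [F u ~ L / u^k] at [0] turns this into [sum_j L / (z + j)^k]. *)
Section Lipschitz.
Variables (F : C -> C) (k : nat) (L : C).
Hypothesis Fper : forall w, F (w + 1)%C = F w.
Hypothesis Fdup : forall w, e w <> RtoC 1 -> (F (w / 2) + F ((w + 1) / 2))%C = (2 ^ k * F w)%C.

Lemma Fper_nat w (n : nat) : F (w - INR n)%C = F w.
Proof.
  induction n. simpl. f_equal. ring. rewrite <- IHn. rewrite S_INR, RtoC_plus.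
  rewrite <- (Fper (w - (INR n + 1))%C). f_equal. ring.
Qed.

Lemma e_int (n : nat) : e (INR n) = RtoC 1.
Proof. induction n. apply e_0. rewrite S_INR, RtoC_plus, e_plus, IHn, e_1. ring. Qed.

Lemma e_mult_nat w n : e (INR n * w)%C = (e w ^ n)%C.
Proof.
  induction n. simpl. rewrite Cmult_0_l. apply e_0.
  rewrite S_INR, RtoC_plus, Cmult_plus_distr_r, Cmult_1_l, e_plus, IHn. simpl; ring.
Qed.

(** The offset [h] is free by periodicity; choosing it as half the number of terms later centres the
    sum at [z]. *)
Lemma dup_sum z h m : e z <> RtoC 1 ->
  psum (fun i => F ((z - INR h + INR i) / INR (2 ^ m)))%C (2 ^ m) = ((2 ^ k) ^ m * F z)%C.
Proof.
  intros Hz.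
  (* A subdivided argument with [e = 1] would give [e z = 1] after multiplication by the power of 2,
     so the duplication formula applies at every stage. *)
  assert (NE : forall m i, e ((z - INR h + INR i) / INR (2 ^ m))%C <> RtoC 1).
  { intros m' i E. apply Hz.
    assert (E2 : e (INR (2 ^ m') * ((z - INR h + INR i) / INR (2 ^ m')))%C = RtoC 1) by (rewrite e_mult_nat, E, Cpow_1_l; auto).
    replace (INR (2 ^ m') * ((z - INR h + INR i) / INR (2 ^ m')))%C with (z + INR i + - INR h)%C in E2 by (field; apply INR_pow2_neq0).
    rewrite !e_plus, e_opp, !e_int in E2. rewrite <- E2. field. }
  induction m.
  - simpl. replace ((z - INR h + 0) / 1)%C with (z - INR h)%C by field. rewrite Fper_nat. ring.
  - match goal with |- psum ?f _ = _ => transitivity (psum f (2 ^ m + 2 ^ m)); [f_equal; simpl; lia|] end.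
    rewrite psum_add, <- psum_plus.
    transitivity (psum (fun i => 2 ^ k * F ((z - INR h + INR i) / INR (2 ^ m)))%C (2 ^ m)).
    + apply psum_ext. intros i _. rewrite <- Fdup by auto. rewrite INR_pow2_S, plus_INR, RtoC_mult, RtoC_plus.
      assert (N := INR_pow2_neq0 m). f_equal; f_equal; field; auto.
    + rewrite psum_scal, IHm. simpl. ring.
Qed.

Definition pairF (M : R) (z : C) (j : nat) : C := (F ((z + INR (S j)) / M) + F ((z - INR (S j)) / M))%C.

(** The centred range is [-2^m, ..., 2^m - 1]. Besides [j = 0] and the pairs of opposite [j] it
    leaves the single term [j = -2^m], whence the hypothesis [Fend] below. *)
Lemma sym_sum z m : e z <> RtoC 1 ->
  (F (z / INR (2 ^ S m)) + psum (pairF (INR (2 ^ S m)) z) (2 ^ m - 1) + F ((z - INR (2 ^ m)) / INR (2 ^ S m)))%C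
  = ((2 ^ k) ^ S m * F z)%C.
Proof.
  intros Hz. rewrite <- (dup_sum z (2 ^ m) (S m) Hz).
  match goal with |- _ = psum ?f _ => transitivity (psum f (2 ^ m + 2 ^ m)); [|f_equal; simpl; lia] end.
  rewrite psum_add.
  rewrite (psum_rev _ (2 ^ m)).
  destruct (2 ^ m)%nat as [|h] eqn:EH. exfalso. apply (Nat.pow_nonzero 2 m) in EH; auto.
  replace (S h - 1)%nat with h by lia.
  rewrite (psum_ext (fun i => F ((z - INR (S h) + INR (h - i)%nat) / INR (2 ^ S m)))%C (fun i => F ((z - INR (S i)) / INR (2 ^ S m)))%C).
  2: { intros i Hi. f_equal. f_equal. rewrite minus_INR by lia. rewrite !S_INR, RtoC_minus, !RtoC_plus. ring. }
  rewrite (psum_ext (fun i => F ((z - INR (S h) + INR (S h + i)%nat) / INR (2 ^ S m)))%C (fun i => F ((z + INR i) / INR (2 ^ S m)))%C).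
  2: { intros i Hi. f_equal. f_equal. rewrite plus_INR, RtoC_plus. ring. }
  rewrite (psum_shift (fun i => F ((z + INR i) / INR (2 ^ S m)))%C).
  change (psum (fun i => F ((z - INR (S i)) / INR (2 ^ S m)))%C (S h))
    with (psum (fun i => F ((z - INR (S i)) / INR (2 ^ S m)))%C h + F ((z - INR (S h)) / INR (2 ^ S m)))%C.
  unfold pairF. rewrite psum_plus. replace (z + INR 0)%C with z by (simpl; ring). ring.
Qed.

Variables (z : C) (K : R) (m0 : nat).
Hypothesis Hz : e z <> RtoC 1.
Hypothesis Floc : forall u, e u <> RtoC 1 -> clim (fun m => / INR (2 ^ S m) ^ k * F (u / INR (2 ^ S m)))%C (L / u ^ k)%C.
Hypothesis Fdom : forall m j, (m0 <= m)%nat -> (S j < 2 ^ m)%nat ->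
  Cmod (/ INR (2 ^ S m) ^ k * pairF (INR (2 ^ S m)) z j)%C <= K * / (INR (S j) * INR (S j)).
Hypothesis Fend : clim (fun m => / INR (2 ^ S m) ^ k * F ((z - INR (2 ^ m)) / INR (2 ^ S m)))%C (RtoC 0).

Theorem lipschitz_pairs : 0 <= K -> L <> RtoC 0 ->
  cser (fun j => / (z + INR (S j)) ^ k + / (z - INR (S j)) ^ k)%C (F z / L - / z ^ k)%C.
Proof.
  intros HK HL.
  assert (NJ : forall j, e (z + INR j)%C <> RtoC 1) by (intros j E; apply Hz; rewrite e_plus, e_int, Cmult_1_r in E; auto).
  assert (NJ2 : forall j, e (z - INR j)%C <> RtoC 1).
  { intros j E. apply Hz. unfold Cminus in E. rewrite e_plus, e_opp, e_int in E. rewrite <- E. field. }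
  assert (N0 : forall u, e u <> RtoC 1 -> u <> RtoC 0) by (intros u E ->; apply E, e_0).
  (* The finite sums are padded with zeros to become series, and the index shift by [m0] makes the
     domination hold for every [m]. *)
  set (t := fun m j => if (S j <? 2 ^ (m0 + m))%nat then (/ INR (2 ^ S (m0 + m)) ^ k * pairF (INR (2 ^ S (m0 + m))) z j)%C else RtoC 0).
  set (T := fun m => (F z - / INR (2 ^ S (m0 + m)) ^ k * F (z / INR (2 ^ S (m0 + m))) - / INR (2 ^ S (m0 + m)) ^ k * F ((z - INR (2 ^ (m0 + m))) / INR (2 ^ S (m0 + m))))%C).
  set (t' := fun j => (L * (/ (z + INR (S j)) ^ k + / (z - INR (S j)) ^ k))%C).
  assert (SH : forall a l, clim a l -> clim (fun m => a (m0 + m)%nat) l) by (intros; apply clim_subseq; auto; intros; lia).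
  destruct (tannery t t' T (fun j => K * / (INR (S j) * INR (S j)))) as [A1 A2].
  - destruct ex_series_inv_sq as [l Hl]. exists (K * l). exact (is_series_scal_l K _ l Hl).
  - intros m j. unfold t. destruct (Nat.ltb_spec (S j) (2 ^ (m0 + m))) as [H|H]. apply Fdom; auto; lia.
    rewrite Cmod_0. apply Rmult_le_pos; auto. left. apply Rinv_0_lt_compat. assert (0 < INR (S j)) by (apply lt_0_INR; lia). nra.
  - intros j. intros eps He.
    assert (CL : clim (fun m => / INR (2 ^ S (m0 + m)) ^ k * pairF (INR (2 ^ S (m0 + m))) z j)%C (t' j)).
    { replace (t' j) with (L / (z + INR (S j)) ^ k + L / (z - INR (S j)) ^ k)%C.
      2: { unfold t'. field. split; apply Cpow_nz; auto. }
      eapply clim_ext; [|apply clim_plus; apply SH; apply Floc; auto]. intros m. cbv beta. unfold pairF. ring. }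
    destruct (CL eps He) as [N HN]. exists (max N (S (S j))). intros m Hm. unfold t.
    destruct (Nat.ltb_spec (S j) (2 ^ (m0 + m))) as [H|H]. apply HN; lia.
    exfalso. assert (m0 + m < 2 ^ (m0 + m))%nat by (apply Nat.pow_gt_lin_r; lia). lia.
  - intros m. unfold T.
    replace (F z - / INR (2 ^ S (m0 + m)) ^ k * F (z / INR (2 ^ S (m0 + m))) - / INR (2 ^ S (m0 + m)) ^ k * F ((z - INR (2 ^ (m0 + m))) / INR (2 ^ S (m0 + m))))%C
      with (psum (t m) (2 ^ (m0 + m) - 1)).
    + apply cser_fin. intros j Hj. unfold t. destruct (Nat.ltb_spec (S j) (2 ^ (m0 + m))) as [H|H]; auto. lia.
    + assert (S := sym_sum z (m0 + m) Hz).
      assert (PK : (INR (2 ^ Datatypes.S (m0 + m)) ^ k = (2 ^ k) ^ Datatypes.S (m0 + m))%C).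
      { rewrite <- !Cpow_mult_r, Nat.mul_comm, Cpow_mult_r. f_equal.
        rewrite pow_INR, RtoC_pow. reflexivity. }
      assert (PN : ((2 ^ k) ^ Datatypes.S (m0 + m))%C <> RtoC 0).
      { apply Cpow_nz, Cpow_nz. intros E. apply RtoC_inj in E. lra. }
      rewrite (psum_ext (t m) (fun j => / INR (2 ^ Datatypes.S (m0 + m)) ^ k * pairF (INR (2 ^ Datatypes.S (m0 + m))) z j)%C).
      2: { intros j Hj. unfold t. destruct (Nat.ltb_spec (Datatypes.S j) (2 ^ (m0 + m))) as [H|H]; auto. lia. }
      rewrite psum_scal, PK.
      replace (F z) with (/ (2 ^ k) ^ Datatypes.S (m0 + m) * ((2 ^ k) ^ Datatypes.S (m0 + m) * F z))%C by (field; auto).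
      rewrite <- S. ring.
  - assert (B := clim_minus _ _ _ _ (clim_minus _ _ _ _ (clim_const (F z)) (SH _ _ (Floc z Hz))) (SH _ _ Fend)).
    assert (E := clim_unique _ _ _ A2 B).
    eapply cser_ext; [|replace (F z / L - / z ^ k)%C with (/ L * cseries t')%C; [apply cser_scal; exact A1|]].
    + intros j. cbv beta. unfold t'. field. repeat split; auto; apply Cpow_nz; auto.
    + rewrite E. field. split; auto. apply Cpow_nz; auto.
Qed.
End Lipschitz.

Lemma sin_lower (u : R) : 0 <= u -> u <= PI -> u - u * u * u / 6 <= sin u.
Proof.
  intros H1 H2. destruct (sin_bound u 0 H1 H2) as [H _]. eapply Rle_trans; [|exact H]. right.
  unfold sin_approx, sin_term; simpl. field.
Qed.

(** From [|1 - e w|^2 = (1 - r)^2 + 4 r sin^2 (PI x)] with [r = exp (- 2 PI y)]. The bound [3 / 5]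
    leaves room around half a period while staying away from the next zero at [w = 1]. The constant
    [8 / 100] is [2 * 4 / 100], where [4 / 100] comes from [sin u >= u - u^3 / 6] for
    [u <= 12 / 5]. *)
Lemma one_minus_e_lower : exists c, 0 < c /\ forall w, Rabs (Re w) <= 3 / 5 -> 0 <= Im w <= 1 ->
  c * Cmod w <= Cmod (1 - e w)%C.
Proof.
  exists (8 / 100 * exp (- PI)). assert (EP := exp_pos (- PI)). split. lra.
  intros w Hx Hy. set (x := Re w) in *. set (y := Im w) in *.
  assert (P4 := PI_4). assert (P0 := PI2_3_2).
  apply Rsqr_incr_0_var; [|apply Cmod_ge_0].
  rewrite Rsqr_mult, !Rsqr_pow2, !Cmod2_alt.
  assert (E1 : Re (1 - e w)%C = 1 - exp (- 2 * PI * y) * cos (2 * (PI * x))).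
  { unfold Cminus. rewrite re_plus, re_opp, re_RtoC, e_re. fold x y. replace (2 * PI * x) with (2 * (PI * x)) by ring. ring. }
  assert (E2 : Im (1 - e w)%C = - (exp (- 2 * PI * y) * sin (2 * (PI * x)))).
  { unfold Cminus. rewrite im_plus, im_opp, im_RtoC, e_im. fold x y. replace (2 * PI * x) with (2 * (PI * x)) by ring. ring. }
  rewrite E1, E2. fold x y. set (r := exp (- 2 * PI * y)).
  assert (ID : (1 - r * cos (2 * (PI * x))) ^ 2 + (- (r * sin (2 * (PI * x)))) ^ 2 = (1 - r) ^ 2 + 4 * r * (sin (PI * x) * sin (PI * x))).
  { rewrite cos_2a_sin, sin_2a. assert (T := sin2_cos2 (PI * x)). unfold Rsqr in T.
    set (s := sin (PI * x)) in *. set (k := cos (PI * x)) in *.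
    replace ((1 - r * (1 - 2 * s * s)) ^ 2 + (- (r * (2 * s * k))) ^ 2) with
      ((1 - r) ^ 2 + 4 * r * (s * s) * (1 - r) + 4 * r * r * (s * s) * (s * s + k * k)) by ring. rewrite T. ring. }
  rewrite ID.
  assert (R1 : y / 2 <= 1 - r).
  { unfold r. replace (- 2 * PI * y) with (- (2 * PI * y)) by ring. rewrite exp_Ropp.
    set (t := 2 * PI * y). assert (T0 : 0 <= t) by (unfold t; nra).
    assert (T := exp_ineq1_le t). assert (/ exp t <= / (1 + t)) by (apply Rinv_le_contravar; lra).
    assert (y / 2 <= 1 - / (1 + t)); [|lra].
    replace (1 - / (1 + t)) with (t / (1 + t)) by (field; lra). assert (y <= t) by (unfold t; nra). assert (y * t <= 1 * t) by (apply Rmult_le_compat_r; lra).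
    apply Rmult_le_reg_r with (1 + t). lra. replace (t / (1 + t) * (1 + t)) with t by (field; lra). lra. }
  assert (R2 : exp (- PI) * exp (- PI) <= r).
  { rewrite <- exp_plus. unfold r. destruct (Req_dec y 1) as [->|N]. right; f_equal; ring. left; apply exp_increasing. nra. }
  assert (R3 : 4 / 100 * Rabs x <= Rabs (sin (PI * x))).
  { assert (G : forall t, 0 <= t <= 3 / 5 -> 4 / 100 * t <= sin (PI * t)).
    { intros t Ht. set (u := PI * t). assert (U0 : 0 <= u) by (unfold u; nra). assert (U1 : u <= 12 / 5) by (unfold u; nra).
      assert (U2 : u <= PI) by (unfold u; nra).
      assert (S := sin_lower u U0 U2). assert (u * u <= 576 / 100) by nra. assert (u * u * u <= 576 / 100 * u) by (apply Rmult_le_compat_r; lra).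
      assert (t <= u) by (unfold u; nra). lra. }
    apply Rabs_le_between in Hx. destruct (Rle_or_lt 0 x) as [L|L].
    - rewrite (Rabs_right x) by lra. eapply Rle_trans; [apply G; lra|apply Rle_abs].
    - rewrite (Rabs_left x) by lra. eapply Rle_trans; [apply G; lra|]. rewrite <- Rabs_Ropp, <- sin_neg.
      replace (PI * - x) with (- (PI * x)) by ring. apply Rle_abs. }
  assert (R4 : 16 / 10000 * (x * x) <= sin (PI * x) * sin (PI * x)).
  { replace (x * x) with (Rabs x * Rabs x) by (rewrite <- Rabs_mult; apply Rabs_right; nra).
    replace (sin (PI * x) * sin (PI * x)) with (Rabs (sin (PI * x)) * Rabs (sin (PI * x))) by (rewrite <- Rabs_mult; apply Rabs_right; nra).
    assert (A := Rabs_pos x). nra. }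
  set (s := sin (PI * x) * sin (PI * x)) in *. set (E := exp (- PI)) in *.
  assert (EL : E < 1). { unfold E. rewrite <- exp_0. apply exp_increasing. lra. }
  assert (R5 : (y / 2) * (y / 2) <= (1 - r) * (1 - r)) by (apply Rmult_le_compat; lra).
  assert (R6 : E * E * (16 / 10000 * (x * x)) <= r * s) by (apply Rmult_le_compat; nra).
  assert (R7 : E * E * (y * y) <= 1 * (y * y)) by (apply Rmult_le_compat_r; nra).
  simpl. nra.
Qed.

Lemma Csub_0_r (a : C) : (a - 0)%C = a. Proof. ring. Qed.

Lemma ccont_id z : ccont (fun z => z) z. Proof. exact (cderiv_ccont _ _ _ (cderiv_id z)). Qed.
Lemma clim_inv (a : nat -> C) l : l <> RtoC 0 -> clim a l -> clim (fun n => / a n)%C (/ l)%C.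
Proof. intros H. apply (ccont_clim Cinv). exact (cderiv_ccont _ _ _ (cderiv_inv (fun z => z) l _ H (cderiv_id l))). Qed.
Lemma clim_pow (a : nat -> C) l k : clim a l -> clim (fun n => a n ^ k)%C (l ^ k)%C.
Proof. intros H. induction k. exact (clim_const 1). exact (clim_mult _ _ _ _ H IHk). Qed.

Lemma clim_inv_pow2 (u : C) : clim (fun m => u / INR (2 ^ S m))%C (RtoC 0).
Proof.
  intros eps He. destruct (INR_unbounded (Cmod u / eps)) as [N HN]. exists N. intros n Hn.
  replace (u / INR (2 ^ S n) - 0)%C with (u / INR (2 ^ S n))%C by ring.
  rewrite Cmod_div, Cmod_R, Rabs_right by (try apply INR_pow2_neq0; apply Rle_ge, pos_INR).
  assert (T := INR_pow2_pos (S n)). apply Rlt_div_l; auto. apply Rlt_div_l in HN; auto.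
  assert (INR N < INR (2 ^ S n)). { apply lt_INR. assert (S n < 2 ^ S n)%nat by (apply Nat.pow_gt_lin_r; lia). lia. }
  nra.
Qed.

Lemma one_minus_e_asymp (u : C) : clim (fun m => (1 - e (u / INR (2 ^ S m))) * INR (2 ^ S m))%C (- I2pi * u)%C.
Proof.
  intros eps He. assert (D := cderiv_e 0). rewrite cderiv_eps in D.
  assert (U := Cmod_ge_0 u).
  destruct (D (eps / (Cmod u + 1)) ltac:(apply Rdiv_lt_0_compat; lra)) as [d [Hd H1]].
  destruct (clim_inv_pow2 u d Hd) as [N HN]. exists N. intros n Hn. specialize (HN n Hn).
  replace (u / INR (2 ^ S n) - 0)%C with (u / INR (2 ^ S n))%C in HN by ring.
  specialize (H1 _ HN). rewrite Cplus_0_l, e_0 in H1.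
  assert (NZ := INR_pow2_neq0 (S n)). assert (P := INR_pow2_pos (S n)).
  replace ((1 - e (u / INR (2 ^ S n))) * INR (2 ^ S n) - - I2pi * u)%C
    with (- (e (u / INR (2 ^ S n)) - 1 - I2pi * 1 * (u / INR (2 ^ S n))) * INR (2 ^ S n))%C by (field; auto).
  rewrite Cmod_mult, Cmod_opp, Cmod_R, Rabs_right by lra.
  rewrite Cmod_div, Cmod_R, Rabs_right in H1 by (auto; lra).
  apply Rle_lt_trans with (eps / (Cmod u + 1) * (Cmod u / INR (2 ^ S n)) * INR (2 ^ S n)).
  apply Rmult_le_compat_r; lra.
  replace (eps / (Cmod u + 1) * (Cmod u / INR (2 ^ S n)) * INR (2 ^ S n)) with (eps * (Cmod u / (Cmod u + 1))) by (field; split; lra).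
  rewrite <- (Rmult_1_r eps) at 2. apply Rmult_lt_compat_l; auto. apply Rlt_div_l; lra.
Qed.

Lemma one_minus_e_neq0 w : e w <> RtoC 1 -> (1 - e w)%C <> RtoC 0.
Proof. intros H E. apply H. symmetry. apply Ceq_minus, E. Qed.

Lemma e_neq1_neq0 w : e w <> RtoC 1 -> w <> RtoC 0.
Proof. intros H ->. apply H, e_0. Qed.

Section Rational.
Variables (Num : C -> C) (B : R) (k : nat).
Definition ratF (w : C) : C := (Num (e w) / (1 - e w) ^ k)%C.
Hypothesis NumB : forall q, Cmod q <= 1 -> Cmod (Num q) <= B.
Hypothesis NumC : ccont Num 1.

(** [1 - e w] is [- I2pi w] to first order, so [ratF] has at 0 a pole of order [k] with leading
    coefficient [Num 1 / (- I2pi)^k]. *)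
Lemma ratF_loc u : e u <> RtoC 1 ->
  clim (fun m => / INR (2 ^ S m) ^ k * ratF (u / INR (2 ^ S m)))%C ((Num 1 / (- I2pi) ^ k) / u ^ k)%C.
Proof.
  intros Hu. assert (U := e_neq1_neq0 u Hu).
  assert (NI : (- I2pi * u)%C <> RtoC 0).
  { intros E. apply (Cmult_neq_0 I2pi u I2pi_neq0 U). replace (I2pi * u)%C with (- (- I2pi * u))%C by ring. rewrite E. ring. }
  assert (NI2 : (- I2pi)%C <> RtoC 0) by (intros E; apply NI; rewrite E; ring).
  assert (W := clim_inv_pow2 u).
  assert (EC : clim (fun m => e (u / INR (2 ^ S m)))%C (RtoC 1)).
  { rewrite <- e_0. apply (ccont_clim e). exact (cderiv_ccont _ _ _ (cderiv_e 0)). exact W. }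
  assert (A1 := ccont_clim Num _ _ NumC EC).
  assert (A2 := clim_inv _ _ (Cpow_nz _ k NI) (clim_pow _ _ k (one_minus_e_asymp u))).
  replace (Num 1 / (- I2pi) ^ k / u ^ k)%C with (Num 1 * / (- I2pi * u) ^ k)%C.
  2: { rewrite Cpow_mult_l. field. split; apply Cpow_nz; auto. }
  eapply clim_ext; [|apply (clim_mult _ _ _ _ A1 A2)]. intros m. cbv beta. unfold ratF.
  rewrite Cpow_mult_l. assert (NZ := INR_pow2_neq0 (S m)).
  assert (H1 : (1 - e (u / INR (2 ^ S m)))%C <> RtoC 0).
  { apply one_minus_e_neq0. intros E. apply Hu. replace u with (INR (2 ^ S m) * (u / INR (2 ^ S m)))%C by (field; auto).
    rewrite e_mult_nat, E, Cpow_1_l. auto. }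
  field. split; apply Cpow_nz; auto.
Qed.

Variables (z : C) (del : R).
Hypothesis Hdel : 0 < del.
Hypothesis Him : 0 <= Im z.
Hypothesis Hz : e z <> RtoC 1.
Hypothesis Hlat : forall j, (1 <= j)%nat -> del * INR j <= Cmod (z + INR j)%C /\ del * INR j <= Cmod (z - INR j)%C.

(** The range [3 / 5] of [one_minus_e_lower] is respected because [|s|] is at most half of [2^(m+1)]
    and, for large [m], [|z|] at most a tenth of it. The second conclusion serves the case [k = 1],
    in which the first bound is not summable. *)
Lemma ratF_bound : exists c m0, 0 < c /\ forall m (s : R), (m0 <= m)%nat -> Rabs s <= INR (2 ^ m) -> (z + s)%C <> RtoC 0 ->
  Cmod (/ INR (2 ^ S m) ^ k * ratF ((z + s) / INR (2 ^ S m)))%C <= B / (c * Cmod (z + s)%C) ^ k /\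
  c * Cmod (z + s)%C <= INR (2 ^ S m) * Cmod (1 - e ((z + s) / INR (2 ^ S m)))%C.
Proof.
  destruct one_minus_e_lower as [c [Hc H1]].
  destruct (INR_unbounded (10 * Cmod z)) as [m0 Hm0]. exists c, m0. split; auto.
  intros m s Hm Hs NZ.
  assert (MM : INR m0 < INR (2 ^ S m)). { apply lt_INR. assert (S m < 2 ^ S m)%nat by (apply Nat.pow_gt_lin_r; lia). lia. }
  assert (N0 := INR_pow2_neq0 (S m)). assert (P := INR_pow2_pos (S m)). assert (M2 := INR_pow2_S m).
  set (M := INR (2 ^ S m)) in *. set (w := ((z + s) / M)%C).
  assert (WR : w = (RtoC (/ M) * (z + s))%C). { unfold w. rewrite RtoC_inv by lra. field; auto. }
  assert (W1 : Rabs (Re w) <= 3 / 5).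
  { rewrite WR, re_scal_l, re_plus, re_RtoC, Rabs_mult, Rabs_right by (apply Rle_ge; left; apply Rinv_0_lt_compat; lra).
    assert (T := re_le_Cmod z). assert (T2 := Rabs_triang (Re z) s). apply Rmult_le_reg_l with M; auto.
    rewrite <- Rmult_assoc, Rinv_r, Rmult_1_l by lra. lra. }
  assert (W2 : 0 <= Im w <= 1).
  { rewrite WR, im_scal_l, im_plus, im_RtoC, Rplus_0_r. assert (T := im_le_Cmod z). rewrite Rabs_right in T by lra.
    assert (T3 := Cmod_ge_0 z).
    split. apply Rmult_le_pos; auto. left; apply Rinv_0_lt_compat; lra.
    apply Rmult_le_reg_l with M; auto. rewrite <- Rmult_assoc, Rinv_r, Rmult_1_l by lra. lra. }
  specialize (H1 w W1 W2).
  assert (CW : Cmod w = Cmod (z + s)%C / M) by (unfold w; rewrite Cmod_div, Cmod_R, Rabs_right by (auto; lra); auto).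
  assert (PZ : 0 < Cmod (z + s)%C) by (apply Cmod_gt_0; auto).
  assert (LB : c * Cmod (z + s)%C <= M * Cmod (1 - e w)%C).
  { apply Rle_trans with (M * (c * Cmod w)). rewrite CW. right; field; lra. apply Rmult_le_compat_l; lra. }
  split; auto.
  assert (CP : 0 < c * Cmod (z + s)%C) by (apply Rmult_lt_0_compat; auto).
  assert (N1 : (1 - e w)%C <> RtoC 0). { apply Cmod_gt_0. apply Rmult_lt_reg_l with M; auto. lra. }
  unfold ratF. rewrite Cmod_mult, Cmod_div, Cmod_inv, !Cmod_pow, Cmod_R, (Rabs_right M) by (try apply Cpow_nz; auto; lra).
  replace (/ M ^ k * (Cmod (Num (e w)) / Cmod (1 - e w) ^ k)) with (Cmod (Num (e w)) / (M * Cmod (1 - e w)%C) ^ k).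
  2: { rewrite Rpow_mult_distr. field. split; apply pow_nonzero; try lra. apply Rgt_not_eq, Cmod_gt_0; auto. }
  apply Rmult_le_compat. apply Cmod_ge_0. left; apply Rinv_0_lt_compat, pow_lt; lra.
  - apply NumB. rewrite Cmod_e. rewrite <- exp_0. assert (Pi := PI_RGT_0).
    destruct (Req_dec (- 2 * PI * Im w) 0) as [->|]. lra. left; apply exp_increasing. nra.
  - apply Rinv_le_contravar. apply pow_lt; auto. apply pow_incr. lra.
Qed.

Lemma lat_neq0 j : (1 <= j)%nat -> (z + INR j)%C <> RtoC 0 /\ (z - INR j)%C <> RtoC 0.
Proof.
  intros H. destruct (Hlat j H) as [A1 A2]. assert (0 < INR j) by (apply lt_0_INR; lia).
  assert (0 < del * INR j) by (apply Rmult_lt_0_compat; auto). split; apply Cmod_gt_0; lra.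
Qed.

Lemma B_pos : 0 <= B.
Proof. eapply Rle_trans; [apply Cmod_ge_0|apply (NumB 0)]. rewrite Cmod_0; lra. Qed.

Lemma ratF_end : (1 <= k)%nat -> clim (fun m => / INR (2 ^ S m) ^ k * ratF ((z - INR (2 ^ m)) / INR (2 ^ S m)))%C (RtoC 0).
Proof.
  intros Hk. destruct ratF_bound as (c & m0 & Hc & HB). assert (B0 := B_pos).
  intros eps He. set (D := B / (c * del) ^ k + 1).
  assert (CD : 0 < c * del) by (apply Rmult_lt_0_compat; auto).
  assert (D0 : 0 < D). { unfold D. assert (0 <= B / (c * del) ^ k). apply Rdiv_le_0_compat; auto. apply pow_lt; auto. lra. }
  destruct (INR_unbounded (D / eps)) as [N HN]. exists (max m0 N). intros m Hm.
  assert (J1 : (1 <= 2 ^ m)%nat) by (assert (T := Nat.pow_nonzero 2 m); lia).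
  destruct (lat_neq0 _ J1) as [_ NZ]. destruct (Hlat _ J1) as [_ LB].
  assert (P1 : 1 <= INR (2 ^ m)) by (apply (le_INR 1); auto).
  destruct (HB m (- INR (2 ^ m)) ltac:(lia)) as [HH _].
  { rewrite Rabs_Ropp, Rabs_right; lra. }
  { rewrite RtoC_opp. exact NZ. }
  rewrite RtoC_opp in HH.
  rewrite Csub_0_r.
  eapply Rle_lt_trans; [exact HH|].
  assert (N2 : INR N < INR (2 ^ m)). { apply lt_INR. assert (m < 2 ^ m)%nat by (apply Nat.pow_gt_lin_r; lia). lia. }
  change (z + - INR (2 ^ m))%C with (z - INR (2 ^ m))%C.
  set (h := INR (2 ^ m)) in *.
  apply Rle_lt_trans with (B / (c * (del * h)) ^ k).
  - apply Rmult_le_compat_l; auto. apply Rinv_le_contravar. apply pow_lt. apply Rmult_lt_0_compat; auto. nra.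
    apply pow_incr. split. apply Rmult_le_pos; nra. apply Rmult_le_compat_l; lra.
  - apply Rle_lt_trans with (B / (c * del) ^ k * / h).
    + replace (c * (del * h)) with (c * del * h) by ring. rewrite Rpow_mult_distr.
      assert (H1 : 0 < (c * del) ^ k) by (apply pow_lt; auto). assert (H2 : 0 < h ^ k) by (apply pow_lt; lra).
      replace (B / ((c * del) ^ k * h ^ k)) with (B / (c * del) ^ k * / h ^ k) by (field; split; lra).
      apply Rmult_le_compat_l. apply Rdiv_le_0_compat; auto. apply Rinv_le_contravar. lra.
      rewrite <- (pow_1 h) at 1. apply Rle_pow; auto.
    + apply Rlt_div_l in HN; auto. apply Rlt_div_l. lra. unfold D in *. assert (INR N * eps < h * eps) by (apply Rmult_lt_compat_r; lra). lra.
Qed.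

Lemma ratF_dom : (2 <= k)%nat -> exists K m0, 0 <= K /\ forall m j, (m0 <= m)%nat -> (S j < 2 ^ m)%nat ->
  Cmod (/ INR (2 ^ S m) ^ k * pairF ratF (INR (2 ^ S m)) z j)%C <= K * / (INR (S j) * INR (S j)).
Proof.
  intros Hk. destruct ratF_bound as (c & m0 & Hc & HB). assert (B0 := B_pos).
  assert (CD : 0 < c * del) by (apply Rmult_lt_0_compat; auto).
  exists (2 * (B / (c * del) ^ k)), m0. split.
  { apply Rmult_le_pos. lra. apply Rdiv_le_0_compat; auto. apply pow_lt; auto. }
  intros m j Hm Hj.
  assert (P1 : 1 <= INR (S j)) by (apply (le_INR 1); lia).
  assert (PM : INR (S j) <= INR (2 ^ m)) by (apply le_INR; lia).
  destruct (lat_neq0 (S j) ltac:(lia)) as [Z1 Z2]. destruct (Hlat (S j) ltac:(lia)) as [L1 L2].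
  set (h := INR (S j)) in *.
  assert (G : forall t, del * h <= t -> B / (c * t) ^ k <= B / (c * del) ^ k * / (h * h)).
  { intros t Ht. apply Rle_trans with (B / (c * (del * h)) ^ k).
    - apply Rmult_le_compat_l; auto. apply Rinv_le_contravar. apply pow_lt. apply Rmult_lt_0_compat; auto. nra.
      apply pow_incr. split. apply Rmult_le_pos; nra. apply Rmult_le_compat_l; lra.
    - replace (c * (del * h)) with (c * del * h) by ring. rewrite Rpow_mult_distr.
      assert (H1 : 0 < (c * del) ^ k) by (apply pow_lt; auto). assert (H2 : 0 < h ^ k) by (apply pow_lt; lra).
      replace (B / ((c * del) ^ k * h ^ k)) with (B / (c * del) ^ k * / h ^ k) by (field; split; lra).
      apply Rmult_le_compat_l. apply Rdiv_le_0_compat; auto. apply Rinv_le_contravar. nra.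
      replace (h * h) with (h ^ 2) by ring. apply Rle_pow; auto. }
  destruct (HB m h Hm) as [A1 _]; auto. { rewrite Rabs_right; lra. }
  destruct (HB m (- h) Hm) as [A2 _]. { rewrite Rabs_Ropp, Rabs_right; lra. } { rewrite RtoC_opp. exact Z2. }
  rewrite RtoC_opp in A2. change (z + - h)%C with (z - h)%C in A2.
  unfold pairF. fold h. rewrite Cmult_plus_distr_l. eapply Rle_trans; [apply Cmod_triangle|].
  assert (G1 := G _ L1). assert (G2 := G _ L2). lra.
Qed.

Theorem ratF_lipschitz : (2 <= k)%nat -> Num 1 <> RtoC 0 -> 
  (forall w, e w <> RtoC 1 -> (ratF (w / 2) + ratF ((w + 1) / 2))%C = (2 ^ k * ratF w)%C) ->
  cser (fun j => / (z + INR (S j)) ^ k + / (z - INR (S j)) ^ k)%C (ratF z / (Num 1 / (- I2pi) ^ k) - / z ^ k)%C.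
Proof.
  intros Hk HN HD. destruct (ratF_dom Hk) as (K & m0 & HK & HB).
  apply (lipschitz_pairs ratF k _ (fun w => ltac:(unfold ratF; rewrite e_plus, e_1, Cmult_1_r; reflexivity)) HD z K m0); auto.
  - intros; apply ratF_loc; auto.
  - apply ratF_end. lia.
  - assert (NI : (- I2pi)%C <> RtoC 0). { intros E. apply I2pi_neq0. replace I2pi with (- - I2pi)%C by ring. rewrite E; ring. }
    assert (NP := Cpow_nz _ k NI). intros E. apply HN. replace (Num 1) with (Num 1 / (- I2pi) ^ k * (- I2pi) ^ k)%C by (field; auto). rewrite E; ring.
Qed.
End Rational.

(** The imaginary part bounds [a], and then the triangle inequality bounds [b] by [X + a |z|]; [D]
    collects the two constants. *)
Lemma half_plane_lower (z : C) : in_H z -> exists del, 0 < del /\ forall a b, 0 <= a -> 0 <= b ->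
  del * (a + b) <= Cmod (a * z + b)%C /\ del * (a + b) <= Cmod (a * z - b)%C.
Proof.
  intros Hz. unfold in_H in Hz. set (y := Im z) in *. assert (Z0 := Cmod_ge_0 z).
  set (D := 1 + (Cmod z + 1) / y). assert (HD : 1 <= D). { unfold D. assert (0 <= (Cmod z + 1) / y) by (apply Rdiv_le_0_compat; lra). lra. }
  exists (/ D). split. apply Rinv_0_lt_compat; lra.
  assert (G : forall a b (s : R), 0 <= a -> 0 <= b -> Rabs s = b -> / D * (a + b) <= Cmod (a * z + s)%C).
  { intros a b s Ha Hb Hs. set (X := Cmod (a * z + s)%C).
    assert (A1 : a * y <= X).
    { unfold X. eapply Rle_trans; [|apply im_le_Cmod]. rewrite im_plus, im_scal_l, im_RtoC, Rplus_0_r. apply Rle_abs. }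
    assert (A2 : b <= X + a * Cmod z).
    { unfold X. replace b with (Cmod s) by (rewrite Cmod_R; auto).
      replace (RtoC s) with ((a * z + s) + - (a * z))%C by ring. eapply Rle_trans; [apply Cmod_triangle|].
      rewrite Cmod_opp, Cmod_mult, Cmod_R, (Rabs_right a) by lra. replace (a * z + s + - (a * z) + - (a * z) + (a*z))%C with (a * z + s + - (a * z))%C by ring. 
      replace (a * z + (a * z + s + - (a * z)))%C with (a * z + s)%C by ring. lra. }
    assert (X0 : 0 <= X) by apply Cmod_ge_0.
    apply Rmult_le_reg_l with D. lra. rewrite <- Rmult_assoc, Rinv_r, Rmult_1_l by lra.
    assert (A3 : a <= X / y) by (apply Rle_div_r; lra).
    unfold D. replace ((1 + (Cmod z + 1) / y) * X) with (X + X / y * Cmod z + X / y) by (field; lra).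
    assert (a * Cmod z <= X / y * Cmod z) by (apply Rmult_le_compat_r; lra). lra. }
  intros a b Ha Hb. split. apply G; auto. apply Rabs_right; lra.
  unfold Cminus. rewrite <- RtoC_opp. apply G; auto. rewrite Rabs_Ropp, Rabs_right; lra.
Qed.

Lemma in_H_scal (a : R) z : 0 < a -> in_H z -> in_H (a * z)%C.
Proof. unfold in_H. intros. rewrite im_scal_l. apply Rmult_lt_0_compat; auto. Qed.

Lemma e_neq1_H z : in_H z -> e z <> RtoC 1.
Proof. intros H E. assert (T := exp_m2pi_lt1 z H). rewrite E, Cmod_1 in T. lra. Qed.

Lemma INR_S_pos n : 0 < INR (S n). Proof. apply lt_0_INR; lia. Qed.
Lemma INR_S_neq0 n : RtoC (INR (S n)) <> RtoC 0.
Proof. intros H. apply RtoC_inj in H. assert (T := INR_S_pos n). lra. Qed.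

(** For [k = 2, 4, 6], [Num_k q / (1 - q)^k = sum n^(k-1) q^n]; for [k = 1] it is [1/2 + sum_(n>0) q^n],
    which makes all four satisfy the duplication formula. *)
Definition Num1 (q : C) : C := ((1 + q) / 2)%C.
Definition Num2 (q : C) : C := q.
Definition Num4 (q : C) : C := (q * (1 + 4 * q + q * q))%C.
Definition Num6 (q : C) : C := (q * (1 + 26 * q + 66 * q ^ 2 + 26 * q ^ 3 + q ^ 4))%C.

Lemma ccont_mult (f g : C -> C) z : ccont f z -> ccont g z -> ccont (fun z => f z * g z)%C z.
Proof.
  intros Hf Hg eps He.
  set (K := 1 + Cmod (f z) + Cmod (g z)). assert (Q1 := Cmod_ge_0 (f z)). assert (Q2 := Cmod_ge_0 (g z)).
  set (d := Rmin 1 (eps / (2 * K))).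
  assert (D1 : d <= 1) by apply Rmin_l. assert (D2 : d <= eps / (2 * K)) by apply Rmin_r.
  assert (HK : 1 <= K) by (unfold K; lra).
  assert (D : 0 < d). { apply Rmin_glb_lt. lra. apply Rdiv_lt_0_compat; lra. } clearbody d.
  destruct (Hf d D) as [d1 [P1 F1]]. destruct (Hg d D) as [d2 [P2 F2]].
  exists (Rmin d1 d2). split. apply Rmin_glb_lt; auto. intros w Hw.
  assert (M1 := Rmin_l d1 d2). assert (M2 := Rmin_r d1 d2).
  specialize (F1 w ltac:(lra)). specialize (F2 w ltac:(lra)).
  replace (f w * g w - f z * g z)%C with ((f w - f z) * (g w - g z) + (f w - f z) * g z + f z * (g w - g z))%C by ring.
  eapply Rle_lt_trans; [apply Cmod_triangle|]. eapply Rle_lt_trans; [apply Rplus_le_compat_r, Cmod_triangle|].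
  rewrite !Cmod_mult. assert (A := Cmod_ge_0 (f w - f z)%C). assert (B := Cmod_ge_0 (g w - g z)%C).
  apply Rle_lt_trans with (d * K). unfold K. nra.
  apply Rle_lt_trans with (eps / (2 * K) * K). apply Rmult_le_compat_r; lra.
  replace (eps / (2 * K) * K) with (eps / 2) by (field; lra). lra.
Qed.

Lemma Num2_c z : ccont Num2 z. Proof. apply ccont_id. Qed.
Lemma ccont_const c z : ccont (fun _ => c) z. Proof. exact (cderiv_ccont _ _ _ (cderiv_const c z)). Qed.
Lemma Cmod_scal_le (a : R) (q : C) r : 0 <= a -> Cmod q <= r -> Cmod (a * q)%C <= a * r.
Proof. intros. rewrite Cmod_mult, Cmod_R, Rabs_right by lra. apply Rmult_le_compat_l; auto. Qed.
Lemma Cmod_plus_le (a b : C) r s : Cmod a <= r -> Cmod b <= s -> Cmod (a + b)%C <= r + s.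
Proof. intros. eapply Rle_trans; [apply Cmod_triangle|lra]. Qed.
Lemma Cmod_pow_le1 (q : C) n : Cmod q <= 1 -> Cmod (q ^ n)%C <= 1.
Proof. intros. rewrite Cmod_pow, <- (pow1 n). apply pow_incr. split; auto using Cmod_ge_0. Qed.
Lemma Cmod_mult_le1 (q r : C) s : Cmod q <= 1 -> Cmod r <= s -> Cmod (q * r)%C <= s.
Proof. intros. rewrite Cmod_mult. assert (A := Cmod_ge_0 q). assert (B := Cmod_ge_0 r). nra. Qed.

Lemma Num1_B q : Cmod q <= 1 -> Cmod (Num1 q) <= 1.
Proof.
  intros. unfold Num1. replace ((1 + q) / 2)%C with ((/ 2)%R * (1 + q))%C by (rewrite RtoC_inv by lra; field).
  apply Rle_trans with (/ 2 * (1 + 1)); [|lra]. apply Cmod_scal_le. lra. apply Cmod_plus_le; auto. rewrite Cmod_1; lra.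
Qed.
Lemma Num2_B q : Cmod q <= 1 -> Cmod (Num2 q) <= 1. Proof. auto. Qed.
Lemma Num4_B q : Cmod q <= 1 -> Cmod (Num4 q) <= 6.
Proof.
  intros. unfold Num4. apply Cmod_mult_le1; auto. replace 6 with (1 + 4 * 1 + 1) by ring.
  repeat apply Cmod_plus_le; rewrite ?Cmod_1; try lra. apply Cmod_scal_le; lra. apply Cmod_mult_le1; auto.
Qed.
Lemma Num6_B q : Cmod q <= 1 -> Cmod (Num6 q) <= 120.
Proof.
  intros. unfold Num6. apply Cmod_mult_le1; auto. replace 120 with (1 + 26 * 1 + 66 * 1 + 26 * 1 + 1) by ring.
  repeat apply Cmod_plus_le; rewrite ?Cmod_1; try lra; try (apply Cmod_scal_le; [lra|]); auto using Cmod_pow_le1.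
Qed.
Lemma Num1_c z : ccont Num1 z.
Proof. apply (ccont_mult (fun q => 1 + q)%C (fun _ => / 2)%C). apply ccont_plus. apply ccont_const. apply ccont_id. apply ccont_const. Qed.
Lemma Num4_c z : ccont Num4 z.
Proof.
  apply (ccont_mult (fun q => q) (fun q => 1 + 4 * q + q * q)%C). apply ccont_id.
  repeat apply ccont_plus; repeat apply ccont_mult; try apply ccont_const; apply ccont_id.
Qed.
Lemma Num6_c z : ccont Num6 z.
Proof.
  assert (P : forall n, ccont (fun q => q ^ n)%C z). { induction n. exact (ccont_const 1 z). exact (ccont_mult _ _ _ (ccont_id z) IHn). }
  apply (ccont_mult (fun q => q) (fun q => 1 + 26 * q + 66 * q ^ 2 + 26 * q ^ 3 + q ^ 4)%C). apply ccont_id.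
  repeat apply ccont_plus; repeat apply ccont_mult; try apply ccont_const; try apply ccont_id; apply P.
Qed.

Lemma e_double w : e w = (e (w / 2) * e (w / 2))%C.
Proof. rewrite <- e_plus. f_equal. field. Qed.
Lemma e_plus_half w : e ((w + 1) / 2)%C = (- e (w / 2))%C.
Proof.
  replace ((w + 1) / 2)%C with (w / 2 + RtoC (1 / 2))%C. rewrite e_plus, e_half. ring.
  rewrite RtoC_div by lra. field.
Qed.

Lemma dup_side w : e w <> RtoC 1 -> (1 - e (w / 2))%C <> RtoC 0 /\ (1 + e (w / 2))%C <> RtoC 0 /\ (1 - e (w / 2) * e (w / 2))%C <> RtoC 0.
Proof.
  rewrite e_double. set (q := e (w / 2)%C). intros H. assert (P : (1 - q * q)%C <> RtoC 0).
  { intros E. apply H. symmetry. apply Ceq_minus. exact E. }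
  split; [|split]; auto; intros E; apply P; [replace (1 - q * q)%C with ((1 - q) * (1 + q))%C by ring|replace (1 - q * q)%C with ((1 - q) * (1 + q))%C by ring]; rewrite E; ring.
Qed.

Ltac dup_tac := intros w Hw; destruct (dup_side w Hw) as (A1 & A2 & A3); unfold ratF;
  rewrite (e_double w), e_plus_half; generalize dependent (e (w / 2)%C); intros q A1 A2 A3;
  replace (1 - - q)%C with (1 + q)%C by ring; replace (1 - q * q)%C with ((1 - q) * (1 + q))%C by ring;
  rewrite !Cpow_mult_l; field; auto.

Lemma dup1 : forall w, e w <> RtoC 1 -> (ratF Num1 1 (w / 2) + ratF Num1 1 ((w + 1) / 2))%C = (2 ^ 1 * ratF Num1 1 w)%C.
Proof. unfold Num1. dup_tac. Qed.
Lemma dup2 : forall w, e w <> RtoC 1 -> (ratF Num2 2 (w / 2) + ratF Num2 2 ((w + 1) / 2))%C = (2 ^ 2 * ratF Num2 2 w)%C.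
Proof. unfold Num2. dup_tac. Qed.
Lemma dup4 : forall w, e w <> RtoC 1 -> (ratF Num4 4 (w / 2) + ratF Num4 4 ((w + 1) / 2))%C = (2 ^ 4 * ratF Num4 4 w)%C.
Proof. unfold Num4. dup_tac. Qed.
Lemma dup6 : forall w, e w <> RtoC 1 -> (ratF Num6 6 (w / 2) + ratF Num6 6 ((w + 1) / 2))%C = (2 ^ 6 * ratF Num6 6 w)%C.
Proof. unfold Num6. dup_tac. Qed.

Lemma lattice_H z : in_H z -> exists del, 0 < del /\ forall j, (1 <= j)%nat -> del * INR j <= Cmod (z + INR j)%C /\ del * INR j <= Cmod (z - INR j)%C.
Proof.
  intros Hz. destruct (half_plane_lower z Hz) as [del [Hd H]]. exists del. split; auto. intros j Hj.
  destruct (H 1 (INR j) ltac:(lra) (pos_INR j)) as [H1 H2]. rewrite Cmult_1_l in H1, H2. lra.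
Qed.

(** For [k = 1] only the symmetric pairs converge absolutely. *)
Theorem lipschitz_1 z : in_H z ->
  cser (fun j => / (z + INR (S j)) + / (z - INR (S j)))%C (- I2pi * ratF Num1 1 z - / z)%C.
Proof.
  intros Hz. assert (NZ := e_neq1_H z Hz). destruct (lattice_H z Hz) as (del & Hdel & Hlat).
  assert (Him : 0 <= Im z) by (unfold in_H in Hz; lra).
  assert (NI : (- I2pi)%C <> RtoC 0). { intros E. apply I2pi_neq0. replace I2pi with (- - I2pi)%C by ring. rewrite E; ring. }
  assert (N11 : Num1 1 = RtoC 1) by (unfold Num1; field).
  destruct (ratF_bound Num1 1 1 Num1_B z Him) as (c & m0 & Hc & HB).
  destruct (one_minus_e_asymp (2 * z)%C 1 Rlt_0_1) as [m1 Hm1].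
  set (K' := Cmod (- I2pi * (2 * z))%C + 1).
  assert (K0 : 0 <= K') by (unfold K'; assert (T := Cmod_ge_0 (- I2pi * (2 * z))%C); lra).
  assert (CD : 0 < c * del) by (apply Rmult_lt_0_compat; auto).
  assert (K1 : 0 <= K' * / (c * del * (c * del))) by (apply Rmult_le_pos; auto; left; apply Rinv_0_lt_compat, Rmult_lt_0_compat; auto).
  assert (T := lipschitz_pairs (ratF Num1 1) 1 (Num1 1 / (- I2pi) ^ 1)%C
    (fun w => ltac:(unfold ratF; rewrite e_plus, e_1, Cmult_1_r; reflexivity)) dup1 z (K' * / (c * del * (c * del))) (max m0 m1) NZ
    (fun u Hu => ratF_loc Num1 1 (Num1_c 1) u Hu)).
  specialize (T).
  assert (D : forall m j, (max m0 m1 <= m)%nat -> (S j < 2 ^ m)%nat ->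
    Cmod (/ INR (2 ^ S m) ^ 1 * pairF (ratF Num1 1) (INR (2 ^ S m)) z j)%C <= K' * / (c * del * (c * del)) * / (INR (S j) * INR (S j))).
  { intros m j Hm Hj.
    assert (PM : INR (S j) <= INR (2 ^ m)) by (apply le_INR; lia). assert (PJ := INR_S_pos j).
    destruct (Hlat (S j) ltac:(lia)) as [A1 A2].
    assert (DJ : 0 < del * INR (S j)) by (apply Rmult_lt_0_compat; auto).
    assert (Z1 : (z + INR (S j))%C <> RtoC 0) by (apply Cmod_gt_0; lra).
    assert (Z2 : (z - INR (S j))%C <> RtoC 0) by (apply Cmod_gt_0; lra).
    destruct (HB m (INR (S j)) ltac:(lia)) as [_ B1]; auto. { rewrite Rabs_right; lra. }
    destruct (HB m (- INR (S j)) ltac:(lia)) as [_ B2]. { rewrite Rabs_Ropp, Rabs_right; lra. } { rewrite RtoC_opp; exact Z2. }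
    rewrite RtoC_opp in B2. change (z + - INR (S j))%C with (z - INR (S j))%C in B2.
    specialize (Hm1 m ltac:(lia)). assert (M0 := INR_pow2_neq0 (S m)). assert (MP := INR_pow2_pos (S m)).
    set (M := INR (2 ^ S m)) in *.
    assert (CJ : 0 < c * (del * INR (S j))) by (apply Rmult_lt_0_compat; auto).
    assert (L1 : c * (del * INR (S j)) <= M * Cmod (1 - e ((z + INR (S j)) / M))%C) by (eapply Rle_trans; [|exact B1]; apply Rmult_le_compat_l; lra).
    assert (L2 : c * (del * INR (S j)) <= M * Cmod (1 - e ((z - INR (S j)) / M))%C) by (eapply Rle_trans; [|exact B2]; apply Rmult_le_compat_l; lra).
    set (w1 := ((z + INR (S j)) / M)%C) in *. set (w2 := ((z - INR (S j)) / M)%C) in *.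
    assert (N1 : (1 - e w1)%C <> RtoC 0). { apply Cmod_gt_0. apply Rmult_lt_reg_l with M; auto. lra. }
    assert (N2 : (1 - e w2)%C <> RtoC 0). { apply Cmod_gt_0. apply Rmult_lt_reg_l with M; auto. lra. }
    (* In a pair the numerators combine to [1 - e w1 * e w2 = 1 - e (2 z / M)], which is [O(1 / M)];
       this extra factor turns the decay [1 / j] of a single term into [1 / j^2]. *)
    assert (E12 : (e w1 * e w2)%C = e (2 * z / M)%C). { rewrite <- e_plus. f_equal. unfold w1, w2. field. auto. }
    assert (EQ : (/ M ^ 1 * pairF (ratF Num1 1) M z j)%C = (((1 - e (2 * z / M)) * M) / ((M * (1 - e w1)) * (M * (1 - e w2))))%C).
    { unfold pairF. fold w1 w2. unfold ratF, Num1. rewrite <- E12. simpl Cpow. field. repeat split; auto. }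
    rewrite EQ, Cmod_div by (repeat apply Cmult_neq_0; auto). rewrite (Cmod_mult (M * (1 - e w1))%C), !(Cmod_mult M), Cmod_R, (Rabs_right M) by lra.
    apply Rle_trans with (K' / (c * (del * INR (S j)) * (c * (del * INR (S j))))).
    - apply Rmult_le_compat. apply Cmod_ge_0. left; apply Rinv_0_lt_compat, Rmult_lt_0_compat; lra.
      unfold K'. assert (TT := Cmod_triangle ((1 - e (2 * z / M)) * M - - I2pi * (2 * z))%C (- I2pi * (2 * z))%C).
      replace ((1 - e (2 * z / M)) * M - - I2pi * (2 * z) + - I2pi * (2 * z))%C with ((1 - e (2 * z / M)) * M)%C in TT by ring. lra.
      apply Rinv_le_contravar. apply Rmult_lt_0_compat; auto. apply Rmult_le_compat; lra.
    - right. field. repeat split; lra. }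
  specialize (T D (ratF_end Num1 1 1 Num1_B z del Hdel Him Hlat (le_n 1)) K1).
  assert (LN : (Num1 1 / (- I2pi) ^ 1)%C <> RtoC 0).
  { rewrite N11. simpl. intros E. apply C1_nz. replace (RtoC 1) with (1 / (- I2pi * 1) * - I2pi)%C by (field; apply I2pi_neq0). rewrite E; ring. }
  specialize (T LN).
  replace (- I2pi * ratF Num1 1 z - / z)%C with (ratF Num1 1 z / (Num1 1 / (- I2pi) ^ 1) - / z ^ 1)%C.
  eapply cser_ext; [|exact T]. intros j. cbv beta. rewrite !Cpow_1_r. reflexivity.
  rewrite N11. simpl. field. split; [apply in_H_neq0; auto|apply I2pi_neq0].
Qed.

(** * Transformation of the Eisenstein series *)

Definition mon (p n : nat) : C := RtoC (INR n ^ p).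
Definition powser (p : nat) (z : C) : C := qser (mon p) z.

Lemma pbd_mon p : pbd (mon p).
Proof.
  exists 1, p. intros n. unfold mon. rewrite Cmod_R, Rabs_right by (apply Rle_ge, pow_le, pos_INR).
  rewrite Rmult_1_l. apply pow_incr. split. apply pos_INR. apply le_INR; lia.
Qed.

Lemma qser_shift a z : pbd a -> in_H z -> cser (fun n => a (S n) * e z ^ n)%C ((qser a z - a O) / e z)%C.
Proof.
  intros P H. assert (T := cser_incr _ _ (qser_cser a z P H)). cbv beta in T. change (e z ^ 0)%C with (RtoC 1) in T. rewrite Cmult_1_r in T.
  eapply cser_ext; [|replace ((qser a z - a O) / e z)%C with (/ e z * (qser a z - a O))%C by (field; apply e_neq0); apply cser_scal; exact T].
  intros n. cbv beta. rewrite Cpow_S. field. apply e_neq0.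
Qed.

Lemma cser_mon p z : in_H z -> cser (fun n => mon p n * e z ^ n)%C (powser p z).
Proof. intros. apply qser_cser; auto. apply pbd_mon. Qed.

Lemma mon_S p n : mon p (S n) = ((INR n + 1) ^ p)%C.
Proof. unfold mon. rewrite S_INR, RtoC_pow, RtoC_plus. reflexivity. Qed.
Lemma mon_pow p n : mon p n = (INR n ^ p)%C.
Proof. unfold mon. rewrite RtoC_pow. reflexivity. Qed.

(** Shifting the index and expanding [(n + 1)^p] expresses each power series through those of
    smaller exponent; solving this triangular recursion up to [p = 5] produces the numerators. *)
Lemma powser_closed z : in_H z -> let q := e z in
  powser 1 z = ratF Num2 2 z /\ powser 3 z = ratF Num4 4 z /\ powser 5 z = ratF Num6 6 z.
Proof.
  intros Hz q. assert (NQ := one_minus_e_neq0 z (e_neq1_H z Hz)). assert (N0 := e_neq0 z). fold q in NQ, N0.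
  assert (SH := fun p => qser_shift (mon p) z (pbd_mon p) Hz). fold q in SH.
  assert (SER := fun p => cser_mon p z Hz). fold q in SER.
  assert (A0 : powser 0 z = (/ (1 - q))%C).
  { assert (E : ((powser 0 z - 1) / q)%C = powser 0 z).
    { apply (cser_unique (fun n => mon 0 n * q ^ n)%C); auto. eapply cser_ext; [|apply SH]. intros; reflexivity. }
    assert (E2 : (powser 0 z * (1 - q))%C = RtoC 1).
    { rewrite <- E at 1. assert (powser 0 z = (powser 0 z - 1) / q)%C by auto. 
      transitivity (powser 0 z - q * ((powser 0 z - 1) / q) + (((powser 0 z - 1) / q) - powser 0 z) * (1 - q) + (q * ((powser 0 z - 1) / q) - q * powser 0 z))%C. ring. rewrite E at 2 3. rewrite E. 
      replace (q * ((powser 0 z - 1) / q))%C with (powser 0 z - 1)%C by (field; auto).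
      rewrite <- E at 2. field. auto. }
    transitivity (powser 0 z * (1 - q) * / (1 - q))%C. field; auto. rewrite E2; ring. }
  assert (REC : forall p X, (1 <= p)%nat -> cser (fun n => mon p (S n) * q ^ n)%C (X + powser p z)%C -> powser p z = (q * X / (1 - q))%C).
  { intros p X Hp HX. assert (E := cser_unique _ _ _ (SH p) HX). fold (powser p z) in E.
    assert (M0 : mon p 0 = RtoC 0). { unfold mon. simpl INR. rewrite pow_i by lia. reflexivity. }
    rewrite M0 in E.
    assert (E2 : powser p z = (q * (X + powser p z))%C) by (rewrite <- E; field; auto).
    assert (E3 : (powser p z * (1 - q))%C = (q * X)%C).
    { transitivity (powser p z - q * powser p z)%C. ring. rewrite E2 at 1. ring. }
    rewrite <- E3. field; auto. }
  assert (A1 : powser 1 z = (q * powser 0 z / (1 - q))%C).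
  { apply REC; auto. eapply cser_ext; [|apply cser_plus; apply SER]. intros n. cbv beta. rewrite mon_S, !mon_pow. ring. }
  assert (A2 : powser 2 z = (q * (powser 0 z + 2 * powser 1 z) / (1 - q))%C).
  { apply REC; auto. eapply cser_ext; [|apply cser_plus; [apply cser_plus; [apply SER|apply cser_scal, SER]|apply SER]].
    intros n. cbv beta. rewrite mon_S, !mon_pow. ring. }
  assert (A3 : powser 3 z = (q * (powser 0 z + 3 * powser 1 z + 3 * powser 2 z) / (1 - q))%C).
  { apply REC; auto. eapply cser_ext; [|apply cser_plus; [apply cser_plus; [apply cser_plus; [apply SER|apply cser_scal, SER]|apply cser_scal, SER]|apply SER]].
    intros n. cbv beta. rewrite mon_S, !mon_pow. ring. }
  assert (A4 : powser 4 z = (q * (powser 0 z + 4 * powser 1 z + 6 * powser 2 z + 4 * powser 3 z) / (1 - q))%C).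
  { apply REC; auto. eapply cser_ext; [|apply cser_plus; [apply cser_plus; [apply cser_plus; [apply cser_plus; [apply SER|apply cser_scal, SER]|apply cser_scal, SER]|apply cser_scal, SER]|apply SER]].
    intros n. cbv beta. rewrite mon_S, !mon_pow. ring. }
  assert (A5 : powser 5 z = (q * (powser 0 z + 5 * powser 1 z + 10 * powser 2 z + 10 * powser 3 z + 5 * powser 4 z) / (1 - q))%C).
  { apply REC; auto. eapply cser_ext; [|apply cser_plus; [apply cser_plus; [apply cser_plus; [apply cser_plus; [apply cser_plus; [apply SER|apply cser_scal, SER]|apply cser_scal, SER]|apply cser_scal, SER]|apply cser_scal, SER]|apply SER]].
    intros n. cbv beta. rewrite mon_S, !mon_pow. ring. }
  unfold ratF, Num2, Num4, Num6. fold q.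
  split; [|split].
  - rewrite A1, A0. field; auto.
  - rewrite A3, A2, A1, A0. field; auto.
  - rewrite A5, A4, A3, A2, A1, A0. field; auto.
Qed.

Lemma clim_geom (w : C) : Cmod w < 1 -> clim (fun n => w ^ n)%C (RtoC 0).
Proof.
  intros H. apply (clim_0_bound _ (fun n => Cmod w ^ n)). intros; rewrite Cmod_pow; lra.
  apply is_lim_seq_geom. rewrite Rabs_right; auto. apply Rle_ge, Cmod_ge_0.
Qed.

Lemma cser_geom (w : C) : Cmod w < 1 -> cser (fun n => w ^ S n)%C (w / (1 - w))%C.
Proof.
  intros H. assert (N : (1 - w)%C <> RtoC 0). { intros E. apply Ceq_minus in E. rewrite <- E, Cmod_1 in H. lra. }
  eapply clim_ext with (fun n => (w - w ^ n * w) / (1 - w))%C.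
  - induction n. simpl. field; auto.
    transitivity ((w - w ^ n * w) / (1 - w) + w ^ S n)%C. rewrite Cpow_S. field; auto. rewrite IHn. reflexivity.
  - replace (w / (1 - w))%C with ((w - 0 * w) * / (1 - w))%C by (field; auto).
    apply (clim_mult (fun n => w - w ^ n * w)%C (fun _ => / (1 - w))%C); [|apply clim_const].
    apply clim_minus. apply clim_const. apply clim_mult. apply clim_geom; auto. apply clim_const.
Qed.

(** Up to [n] there are [n / d] positive multiples of [d], so the partial sums are geometric in
    [q^d]. *)
Lemma cser_multiples (q : C) (d : nat) : (1 <= d)%nat -> Cmod q < 1 ->
  cser (fun n => if ((1 <=? n)%nat && (n mod d =? 0)%nat)%bool then (q ^ n)%C else RtoC 0) (q ^ d / (1 - q ^ d))%C.
Proof.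
  intros Hd H. set (w := (q ^ d)%C).
  assert (HW : Cmod w < 1). { unfold w. rewrite Cmod_pow. apply pow_lt_1_compat. split; auto using Cmod_ge_0. lia. }
  assert (N : (1 - w)%C <> RtoC 0). { intros E. apply Ceq_minus in E. rewrite <- E, Cmod_1 in HW. lra. }
  set (a := fun n => if ((1 <=? n)%nat && (n mod d =? 0)%nat)%bool then (q ^ n)%C else RtoC 0).
  assert (PS : forall n, psum a (S n) = ((w - w ^ (n / d) * w) / (1 - w))%C).
  { induction n.
    - rewrite Nat.Div0.div_0_l. simpl. unfold a; simpl. field; auto.
    - change (psum a (S (S n))) with (psum a (S n) + a (S n))%C. rewrite IHn. unfold a.
      simpl Nat.leb. rewrite Bool.andb_true_l.
      assert (D1 := Nat.div_mod_eq n d). assert (D2 := Nat.div_mod_eq (S n) d).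
      assert (B1 := Nat.mod_upper_bound n d ltac:(lia)). assert (B2 := Nat.mod_upper_bound (S n) d ltac:(lia)).
      destruct (Nat.eqb_spec (S n mod d) 0) as [E|E].
      + assert (S n / d = S (n / d))%nat as Q by nia. rewrite Q.
        replace (q ^ S n)%C with (w ^ S (n / d))%C. simpl. field; auto.
        unfold w. rewrite <- Cpow_mult_r. f_equal. nia.
      + assert (S n / d = n / d)%nat as -> by nia. ring. }
  intros eps He.
  assert (CL : clim (fun n => (w - w ^ n * w) / (1 - w))%C (w / (1 - w))%C).
  { replace (w / (1 - w))%C with ((w - 0 * w) * / (1 - w))%C by (field; auto).
    apply (clim_mult (fun n => w - w ^ n * w)%C (fun _ => / (1 - w))%C); [|apply clim_const].
    apply clim_minus. apply clim_const. apply clim_mult. apply clim_geom; auto. apply clim_const. }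
  destruct (CL eps He) as [K HK]. exists (S (d * K)). intros n Hn. destruct n; [lia|]. rewrite PS. apply HK.
  apply Nat.div_le_lower_bound; lia.
Qed.

Lemma ex_series_lin_geom p x : 0 <= x < 1 -> ex_series (fun n => INR n ^ p * x ^ n).
Proof. apply ex_series_pow_geom. Qed.

Lemma psum_real (u : nat -> R) n : psum (fun k => RtoC (u k)) (S n) = RtoC (sum_n u n).
Proof.
  induction n. rewrite sum_O. simpl. ring.
  rewrite sum_Sn. unfold plus; simpl plus. change (psum (fun k => RtoC (u k)) (S (S n))) with (psum (fun k => RtoC (u k)) (S n) + RtoC (u (S n)))%C.
  rewrite IHn. rewrite <- RtoC_plus. reflexivity.
Qed.

Definition divisor_sum (p n : nat) : C := RtoC (Defs.sigma p n).
Lemma pbd_divisor_sum p : pbd (divisor_sum p).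
Proof. exists 1, (S p). intros n. unfold divisor_sum. assert (T := sigma_bound p n). rewrite Cmod_R, Rabs_right, Rmult_1_l; lra. Qed.

(** Lambert series, via the two rearrangements of [sum d^p q^(d m)]. *)
Lemma lambert (p : nat) (z : C) : (1 <= p)%nat -> in_H z ->
  cser (fun m => powser p (INR (S m) * z)%C) (qser (divisor_sum p) z).
Proof.
  intros Hp Hz. set (q := e z). assert (HQ : 0 < Cmod q < 1) by (apply exp_m2pi_lt1; auto).
  (* [fubini] wants a product bound: [|q|^n] is split as [x^n x^n], and each of the two summation
     indices is paid for by one factor. *)
  set (x := sqrt (Cmod q)).
  assert (X2 : x * x = Cmod q) by (apply sqrt_sqrt; lra).
  assert (X0 : 0 < x) by (apply sqrt_lt_R0; lra). assert (X1 : x < 1) by nra.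
  assert (XP : forall a b, (b <= a)%nat -> x ^ a <= x ^ b).
  { intros a b Hab. replace a with (b + (a - b))%nat by lia. rewrite pow_add. rewrite <- (Rmult_1_r (x ^ b)) at 2.
    apply Rmult_le_compat_l. apply pow_le; lra. rewrite <- (pow1 (a - b)). apply pow_incr; lra. }
  assert (QX : forall n, Cmod (q ^ n)%C = x ^ n * x ^ n) by (intros; rewrite Cmod_pow, <- X2, Rpow_mult_distr; auto).
  set (v := fun d => INR d ^ p * x ^ d). set (u := fun n => x ^ n).
  assert (Eu : ex_series u) by (apply ex_series_geom, Rabs_def1; lra).
  assert (Ev : ex_series v) by (apply ex_series_lin_geom; lra).
  assert (Pv : forall d, 0 <= v d) by (intros; apply Rmult_le_pos; apply pow_le; [apply pos_INR|lra]).
  assert (Pu : forall d, 0 <= u d) by (intros; apply pow_le; lra).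
  set (D := fun d : nat => (mon p d * (q ^ d / (1 - q ^ d)))%C).
  assert (S1 : cser D (qser (divisor_sum p) z)).
  { set (c := fun n d => if ((1 <=? n)%nat && ((1 <=? d)%nat && (n mod d =? 0)%nat))%bool then (mon p d * q ^ n)%C else RtoC 0).
    destruct (fubini c u v (fun n => divisor_sum p n * q ^ n)%C D Eu Ev Pu Pv) as [F1 F2].
    - intros n d. unfold c.
      destruct ((1 <=? n)%nat && ((1 <=? d)%nat && (n mod d =? 0)%nat))%bool eqn:NN; [|rewrite Cmod_0; apply Rmult_le_pos; auto].
      apply Bool.andb_true_iff in NN. destruct NN as [N1 N2]. apply Nat.leb_le in N1.
      apply Bool.andb_true_iff in N2. destruct N2 as [N2 N3]. apply Nat.leb_le in N2. apply Nat.eqb_eq in N3.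
      assert (d <= n)%nat. { apply Nat.Div0.mod_divides in N3. destruct N3 as [k Hk]. apply Nat.divide_pos_le; [lia|exists k; lia]. }
      rewrite Cmod_mult, QX. unfold mon. rewrite Cmod_R, Rabs_right by (apply Rle_ge, pow_le, pos_INR). unfold u, v.
      assert (T := XP _ _ H). assert (0 <= INR d ^ p) by (apply pow_le, pos_INR). assert (0 <= x ^ n) by (apply pow_le; lra).
      replace (x ^ n * (INR d ^ p * x ^ d)) with (INR d ^ p * (x ^ n * x ^ d)) by ring.
      apply Rmult_le_compat_l; auto. apply Rmult_le_compat_l; auto.
    - intros n. destruct n as [|n].
      + replace (divisor_sum p 0 * q ^ 0)%C with (psum (c O) 1). apply cser_fin. intros; reflexivity.
        unfold divisor_sum, c, Defs.sigma. rewrite sum_O. simpl. ring.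
      + replace (divisor_sum p (S n) * q ^ S n)%C with (psum (c (S n)) (S (S n))).
        * apply cser_fin. intros d Hd. unfold c. rewrite (Nat.mod_small (S n) d) by lia. simpl. rewrite Bool.andb_false_r. auto.
        * unfold divisor_sum, Defs.sigma. rewrite <- psum_real. rewrite Cmult_comm, <- psum_scal. apply psum_ext. intros d Hd. unfold c.
          simpl Nat.leb at 1. rewrite Bool.andb_true_l. destruct (_ && _)%bool. unfold mon; ring. ring.
    - intros d. unfold D. destruct d as [|d].
      + replace (mon p 0 * (q ^ 0 / (1 - q ^ 0)))%C with (psum (fun n => c n O) 0).
        apply cser_fin. intros j _. unfold c. simpl. rewrite Bool.andb_false_r. auto.
        simpl. unfold mon. simpl INR. rewrite pow_i by lia. ring.
      + eapply cser_ext; [|apply cser_scal, (cser_multiples q (S d)); [lia|lra]].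
        intros n. unfold c. cbv beta. simpl (1 <=? S d)%nat. rewrite Bool.andb_true_l. destruct (_ && _)%bool; ring.
    - assert (E := cser_unique _ _ _ F1 (qser_cser _ z (pbd_divisor_sum p) Hz)). rewrite <- E. exact F2. }
  set (c := fun d m => (mon p d * (q ^ d) ^ S m)%C).
  destruct (fubini c v u D (fun m => powser p (INR (S m) * z)%C) Ev Eu Pv Pu) as [F1 F2].
  - intros d m. unfold c. destruct d as [|d].
    + unfold mon. simpl INR. rewrite pow_i by lia. rewrite Cmult_0_l, Cmod_0. apply Rmult_le_pos; auto.
    + rewrite <- Cpow_mult_r, Cmod_mult, QX, <- pow_add. unfold mon. rewrite Cmod_R, Rabs_right by (apply Rle_ge, pow_le, pos_INR).
      unfold u, v. rewrite Rmult_assoc. apply Rmult_le_compat_l. apply pow_le, pos_INR. rewrite <- pow_add. apply XP. nia.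
  - intros d. unfold D, c. destruct d as [|d].
    + replace (mon p 0 * (q ^ 0 / (1 - q ^ 0)))%C with (psum (fun m => c O m) 0).
      apply (cser_fin (fun m => mon p 0 * (q ^ 0) ^ S m)%C 0). intros j _. unfold mon. simpl INR. rewrite pow_i by lia. ring.
      simpl. unfold mon. simpl INR. rewrite pow_i by lia. ring.
    + apply cser_scal. apply cser_geom. rewrite Cmod_pow. apply pow_lt_1_compat. lra. lia.
  - intros m. assert (T := cser_mon p (INR (S m) * z)%C (in_H_scal _ z (INR_S_pos m) Hz)).
    eapply cser_ext; [|exact T]. intros d. unfold c. cbv beta. rewrite e_mult_nat. fold q.
    rewrite <- !Cpow_mult_r, Nat.mul_comm. reflexivity.
  - rewrite (cser_unique _ _ _ S1 F1). exact F2.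
Qed.

Lemma nI2pi_neq0 : (- I2pi)%C <> RtoC 0.
Proof. intros E. apply I2pi_neq0. replace I2pi with (- - I2pi)%C by ring. rewrite E; ring. Qed.

Section Weight.
Variables (Num : C -> C) (B : R) (k : nat).
Hypothesis NumB : forall q, Cmod q <= 1 -> Cmod (Num q) <= B.
Hypothesis NumC : ccont Num 1.
Hypothesis Hk : (2 <= k)%nat.
Hypothesis Heven : forall x : C, ((- x) ^ k)%C = (x ^ k)%C.
Hypothesis HN : Num 1 <> RtoC 0.
Hypothesis HD : forall w, e w <> RtoC 1 -> (ratF Num k (w / 2) + ratF Num k ((w + 1) / 2))%C = (2 ^ k * ratF Num k w)%C.
Hypothesis HP : forall z, in_H z -> powser (k - 1) z = ratF Num k z.

Definition Lk : C := (Num 1 / (- I2pi) ^ k)%C.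
Lemma Lk_neq0 : Lk <> RtoC 0.
Proof.
  assert (NP := Cpow_nz _ k nI2pi_neq0). intros E. apply HN. replace (Num 1) with (Lk * (- I2pi) ^ k)%C by (unfold Lk; field; auto). rewrite E; ring.
Qed.

Definition zetak : C := cseries (fun n => / INR (S n) ^ k)%C.

Lemma inv_pow_bound n : Cmod (/ INR (S n) ^ k)%C <= / (INR (S n) * INR (S n)).
Proof.
  assert (P := INR_S_pos n). assert (P1 : 1 <= INR (S n)) by (apply (le_INR 1); lia).
  rewrite Cmod_inv, Cmod_pow, Cmod_R, Rabs_right by (try (apply Cpow_nz, INR_S_neq0); lra).
  apply Rinv_le_contravar. nra. replace (INR (S n) * INR (S n)) with (INR (S n) ^ 2) by ring. apply Rle_pow; auto.
Qed.

Lemma cser_zeta : cser (fun n => / INR (S n) ^ k)%C zetak.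
Proof. apply cser_cseries with (fun n => / (INR (S n) * INR (S n))). apply inv_pow_bound. apply ex_series_inv_sq. Qed.

(** The Lipschitz formula at [z = 1 / 2], where [e z = -1], sums [1 / j^k] over the odd integers,
    and the odd part of [zetak] is [(1 - 2^(-k)) zetak]. *)
Lemma zeta_value : (Lk * zetak * (2 ^ k * (2 * (2 ^ k - 1))))%C = Num (-1).
Proof.
  set (h := RtoC (1 / 2)).
  assert (EH : e h = RtoC (-1)) by apply e_half.
  assert (N1 : RtoC (-1) <> RtoC 1) by (intros E; apply RtoC_inj in E; lra).
  assert (L := ratF_lipschitz Num B k NumB NumC h (1 / 2) ltac:(lra)).
  assert (T2 : RtoC 2 <> RtoC 0) by (intros E; apply RtoC_inj in E; lra).
  set (o := fun n => (/ INR (2 * n + 1) ^ k)%C).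
  assert (IN : forall n, RtoC (INR (2 * n + 1)) <> RtoC 0).
  { intros n. replace (2 * n + 1)%nat with (S (2 * n)) by lia. apply INR_S_neq0. }
  assert (OC : cser o (cseries o)).
  { apply cser_cseries with (fun n => / (INR (S n) * INR (S n))). 2: apply ex_series_inv_sq.
    intros n. unfold o. replace (2 * n + 1)%nat with (S (2 * n)) by lia.
    eapply Rle_trans; [apply inv_pow_bound|]. assert (P := INR_S_pos n). assert (INR (S n) <= INR (S (2 * n))) by (apply le_INR; lia).
    apply Rinv_le_contravar. nra. nra. }
  set (O := cseries o) in *.
  assert (HH : h = (/ 2)%C) by (unfold h; rewrite RtoC_div by lra; field).
  assert (EQ : (ratF Num k h / Lk - / h ^ k)%C = (2 ^ k * ((O - o 0%nat) + O))%C).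
  { apply (cser_unique (fun j => / (h + INR (S j)) ^ k + / (h - INR (S j)) ^ k)%C).
    - apply L; auto.
      + unfold h. rewrite im_RtoC. lra.
      + rewrite EH. exact N1.
      + intros j Hj. assert (1 <= INR j) by (apply (le_INR 1); auto). unfold h.
        rewrite <- RtoC_plus, <- RtoC_minus, !Cmod_R. rewrite (Rabs_right (1 / 2 + INR j)), (Rabs_left (1 / 2 - INR j)) by lra. lra.
    - eapply cser_ext; [|apply cser_scal, cser_plus; [apply cser_incr; exact OC|exact OC]].
      intros j. cbv beta. unfold o.
      assert (X1 : (h + INR (S j))%C = (INR (2 * S j + 1) * / 2)%C).
      { rewrite HH, plus_INR, mult_INR, RtoC_plus, RtoC_mult. change (INR 2) with 2. change (INR 1) with 1. field. }
      assert (X2 : (h - INR (S j))%C = (- (INR (2 * j + 1) * / 2))%C).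
      { rewrite HH, S_INR, plus_INR, mult_INR, !RtoC_plus, RtoC_mult. change (INR 2) with 2. change (INR 1) with 1. field. }
      rewrite X1, X2, Heven, !Cpow_mult_l, Cpow_inv by auto. field. repeat split; apply Cpow_nz; auto. }
  assert (O0 : o 0%nat = RtoC 1). { unfold o. simpl INR. rewrite Cpow_1_l. field. }
  assert (ZO : zetak = (O + / 2 ^ k * zetak)%C).
  (* A partial sum of even length splits exactly into its odd and its even terms. *)
  { apply (clim_unique (fun n => psum (fun n => / INR (S n) ^ k)%C (2 * n))).
    - apply (clim_subseq (psum (fun n => / INR (S n) ^ k)%C) zetak (fun n => 2 * n)%nat). intros; lia. apply cser_zeta.
    - eapply clim_ext; [|apply clim_plus; [exact OC|apply clim_scal; exact cser_zeta]].
      set (zf := fun n => (/ INR (S n) ^ k)%C).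
      assert (Z1 : forall n, o n = zf (2 * n)%nat) by (intros n; unfold o, zf; do 4 f_equal; lia).
      assert (Z2 : forall n, zf (S (2 * n)) = (/ 2 ^ k * zf n)%C).
      { intros n. unfold zf. replace (INR (S (S (2 * n)))) with (2 * INR (S n)).
        2: { change 2 with (INR 2). rewrite <- mult_INR. f_equal. lia. }
        rewrite RtoC_mult, Cpow_mult_l. field. split; apply Cpow_nz; auto. apply INR_S_neq0. }
      intros n. change (psum o n + / 2 ^ k * psum zf n = psum zf (2 * n))%C. induction n. simpl. ring.
      replace (2 * S n)%nat with (S (S (2 * n))) by lia.
      change (psum zf (S (S (2 * n)))) with (psum zf (2 * n) + zf (2 * n)%nat + zf (S (2 * n)))%C.
      rewrite <- IHn, <- Z1, Z2. simpl psum. ring. }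
  assert (P2 : (2 ^ k)%C <> RtoC 0) by (apply Cpow_nz; auto).
  assert (RF : ratF Num k h = (Num (-1) / 2 ^ k)%C). { unfold ratF. rewrite EH. f_equal. f_equal. rewrite <- RtoC_minus. f_equal. ring. }
  rewrite RF, O0, HH, Cpow_inv in EQ by auto.
  assert (EQ2 : (Num (-1) / 2 ^ k)%C = (Lk * (2 ^ k * (2 * O)))%C).
  { assert (NL := Lk_neq0). transitivity (Lk * (Num (-1) / 2 ^ k / Lk - / / 2 ^ k + 2 ^ k))%C. field; auto. rewrite EQ. ring. }
  replace (Num (-1)) with (2 ^ k * (Num (-1) / 2 ^ k))%C by (field; auto). rewrite EQ2.
  assert (EO : ((2 ^ k - 1) * zetak)%C = (2 ^ k * O)%C).
  { transitivity (2 ^ k * (zetak - / 2 ^ k * zetak))%C. field; auto. f_equal. rewrite ZO at 1. ring. }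
  transitivity (Lk * 2 ^ k * 2 * ((2 ^ k - 1) * zetak))%C. ring. rewrite EO. ring.
Qed.

Definition lat (z : C) (n m : nat) : C :=
  (/ (INR (S n) * z + INR (S m)) ^ k + / (INR (S n) * z - INR (S m)) ^ k)%C.

Lemma lat_row z n : in_H z -> cser (lat z n) (powser (k - 1) (INR (S n) * z)%C / Lk - / (INR (S n) * z) ^ k)%C.
Proof.
  intros Hz. assert (Hw := in_H_scal _ z (INR_S_pos n) Hz). destruct (lattice_H _ Hw) as (del & Hdel & Hlat).
  rewrite HP by auto. apply (ratF_lipschitz Num B k NumB NumC _ del); auto. unfold in_H in Hw; lra. apply e_neq1_H; auto.
Qed.

(** Since [n z + m = z (n - m (- / z))], inversion exchanges the two lattice indices up to signs,
    which the evenness of [k] absorbs. Columns at [z] are thus rows at [- / z]. *)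
Lemma lat_swap z n m : in_H z -> lat z n m = (/ z ^ k * lat (- / z) m n)%C.
Proof.
  intros Hz. assert (NZ := in_H_neq0 z Hz). unfold lat. rewrite Cmult_plus_distr_l.
  assert (G : forall a b : C, (a * z + b)%C <> RtoC 0 -> (/ (a * z + b) ^ k)%C = (/ z ^ k * / (a + b / z) ^ k)%C).
  { intros a b H. replace (a * z + b)%C with (z * (a + b / z))%C in * by (field; auto). rewrite Cpow_mult_l. field.
    split; apply Cpow_nz; auto. intros E. apply H. rewrite E. ring. }
  assert (NH : forall (s : R), (INR (S n) * z + s)%C <> RtoC 0).
  { intros s E. apply (f_equal Im) in E. rewrite im_plus, im_scal_l, !im_RtoC, Rplus_0_r in E. unfold in_H in Hz. assert (T := INR_S_pos n).
    assert (0 < INR (S n) * Im z) by (apply Rmult_lt_0_compat; auto). lra. }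
  assert (A1 : (/ (INR (S n) * z + INR (S m)) ^ k)%C = (/ z ^ k * / (INR (S m) * - / z - INR (S n)) ^ k)%C).
  { rewrite G by auto. do 2 f_equal. rewrite <- Heven. f_equal. field; auto. }
  assert (A2 : (/ (INR (S n) * z - INR (S m)) ^ k)%C = (/ z ^ k * / (INR (S m) * - / z + INR (S n)) ^ k)%C).
  { unfold Cminus. rewrite <- RtoC_opp. rewrite G by auto. do 3 f_equal. rewrite RtoC_opp. field; auto. }
  rewrite A1, A2. ring.
Qed.

Lemma lat_col z m : in_H z -> cser (fun n => lat z n m) (/ z ^ k * (powser (k - 1) (INR (S m) * - / z)%C / Lk) - / INR (S m) ^ k)%C.
Proof.
  intros Hz. assert (NZ := in_H_neq0 z Hz).
  eapply cser_ext; [intros n; symmetry; apply (lat_swap z n m Hz)|].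
  replace (/ z ^ k * (powser (k - 1) (INR (S m) * - / z)%C / Lk) - / INR (S m) ^ k)%C
    with (/ z ^ k * (powser (k - 1) (INR (S m) * - / z)%C / Lk - / (INR (S m) * - / z) ^ k))%C.
  apply cser_scal. apply (lat_row (- / z)%C m). apply in_H_S; auto.
  assert (P1 := Cpow_nz _ k NZ). assert (P2 := Cpow_nz _ k (INR_S_neq0 m)). assert (NL := Lk_neq0).
  replace (INR (S m) * - / z)%C with (- (INR (S m) * / z))%C at 2 by ring. rewrite Heven, Cpow_mult_l, Cpow_inv by auto.
  field. auto.
Qed.

Definition Lam (z : C) : C := qser (divisor_sum (k - 1)) z.

Lemma rows_total z : in_H z ->
  cser (fun n => powser (k - 1) (INR (S n) * z)%C / Lk - / (INR (S n) * z) ^ k)%C (Lam z / Lk - zetak / z ^ k)%C.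
Proof.
  intros Hz. assert (NZ := in_H_neq0 z Hz). assert (P1 := Cpow_nz _ k NZ). assert (NL := Lk_neq0).
  replace (Lam z / Lk - zetak / z ^ k)%C with (/ Lk * Lam z - / z ^ k * zetak)%C by (field; auto).
  eapply cser_ext; [|apply cser_minus; [apply cser_scal, (lambert (k - 1) z); auto; lia|apply cser_scal, cser_zeta]].
  intros n. cbv beta. rewrite Cpow_mult_l. assert (P2 := Cpow_nz _ k (INR_S_neq0 n)). field. auto.
Qed.

Lemma cols_total z : in_H z ->
  cser (fun m => / z ^ k * (powser (k - 1) (INR (S m) * - / z)%C / Lk) - / INR (S m) ^ k)%C (/ z ^ k * (Lam (- / z) / Lk) - zetak)%C.
Proof.
  intros Hz. assert (NL := Lk_neq0).
  replace (/ z ^ k * (Lam (- / z) / Lk) - zetak)%C with ((/ z ^ k * / Lk) * Lam (- / z) - zetak)%C by (unfold Cdiv; ring).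
  eapply cser_ext; [|apply cser_minus; [apply cser_scal, (lambert (k - 1) (- / z)%C); [lia|apply in_H_S; auto]|apply cser_zeta]].
  intros n. cbv beta. unfold Cdiv. ring.
Qed.
End Weight.

(** The inequality [a b <= (a + b)^2], squared. With fourth powers the lattice sum is dominated by a
    product of two summable sequences, as [fubini] requires. *)
Lemma sum4_bound (a b del : R) : 0 < del -> 1 <= a -> 1 <= b -> forall x, del * (a + b) <= x ->
  / x ^ 4 <= / del ^ 4 * (/ (a * a) * / (b * b)).
Proof.
  intros Hd Ha Hb x Hx. assert (P : 0 < del * (a + b)) by (apply Rmult_lt_0_compat; lra).
  apply Rle_trans with (/ (del * (a + b)) ^ 4).
  - apply Rinv_le_contravar. apply pow_lt; auto. apply pow_incr. lra.
  - rewrite Rpow_mult_distr, Rinv_mult. apply Rmult_le_compat_l. left. apply Rinv_0_lt_compat, pow_lt; auto.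
    rewrite <- Rinv_mult. apply Rinv_le_contravar. repeat apply Rmult_lt_0_compat; lra.
    assert (a * b <= (a + b) * (a + b)) by nra.
    replace (a * a * (b * b)) with ((a * b) * (a * b)) by ring. replace ((a + b) ^ 4) with (((a + b) * (a + b)) * ((a + b) * (a + b))) by ring.
    apply Rmult_le_compat; nra.
Qed.

Definition invsq (n : nat) : R := / (INR (S n) * INR (S n)).
Lemma invsq_pos n : 0 <= invsq n.
Proof. unfold invsq. left. apply Rinv_0_lt_compat. assert (T := INR_S_pos n). nra. Qed.

Section Weight4.
Variables (Num : C -> C) (B : R) (k : nat).
Hypothesis NumB : forall q, Cmod q <= 1 -> Cmod (Num q) <= B.
Hypothesis NumC : ccont Num 1.
Hypothesis Hk : (4 <= k)%nat.
Hypothesis Heven : forall x : C, ((- x) ^ k)%C = (x ^ k)%C.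
Hypothesis HN : Num 1 <> RtoC 0.
Hypothesis HD : forall w, e w <> RtoC 1 -> (ratF Num k (w / 2) + ratF Num k ((w + 1) / 2))%C = (2 ^ k * ratF Num k w)%C.
Hypothesis HP : forall z, in_H z -> powser (k - 1) z = ratF Num k z.

Lemma lat_bound z : in_H z -> exists K, 0 <= K /\ forall n m, Cmod (lat k z n m) <= (K * invsq n) * invsq m.
Proof.
  intros Hz. destruct (half_plane_lower z Hz) as (del0 & Hd0 & H0).
  set (del := Rmin del0 (/ 2)). assert (Hdel : 0 < del) by (apply Rmin_glb_lt; lra).
  assert (D1 : del <= del0) by apply Rmin_l.
  assert (ED : 0 < / del ^ 4) by (apply Rinv_0_lt_compat, pow_lt; auto).
  exists (2 * / del ^ k). split. { apply Rmult_le_pos. lra. left. apply Rinv_0_lt_compat, pow_lt; auto. }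
  intros n m. assert (P1 : 1 <= INR (S n)) by (apply (le_INR 1); lia). assert (P2 : 1 <= INR (S m)) by (apply (le_INR 1); lia).
  destruct (H0 (INR (S n)) (INR (S m)) ltac:(lra) ltac:(lra)) as [H1 H2].
  assert (G : forall w : C, del0 * (INR (S n) + INR (S m)) <= Cmod w -> Cmod (/ w ^ k)%C <= / del ^ k * invsq n * invsq m).
  { intros w Hw. set (s := INR (S n) + INR (S m)) in *.
    assert (S2 : 2 <= s) by (unfold s; lra).
    assert (W : del * s <= Cmod w). { eapply Rle_trans; [|exact Hw]. apply Rmult_le_compat_r; lra. }
    assert (WP : 0 < del * s) by (apply Rmult_lt_0_compat; lra).
    rewrite Cmod_inv, Cmod_pow by (apply Cpow_nz, Cmod_gt_0; lra).
    apply Rle_trans with (/ (del * s) ^ k). apply Rinv_le_contravar. apply pow_lt; auto. apply pow_incr; lra.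
    rewrite Rpow_mult_distr, Rinv_mult, Rmult_assoc. apply Rmult_le_compat_l. left; apply Rinv_0_lt_compat, pow_lt; auto.
    apply Rle_trans with (/ s ^ 4). apply Rinv_le_contravar. apply pow_lt; lra. apply Rle_pow; [lra|lia].
    assert (T := sum4_bound (INR (S n)) (INR (S m)) 1 ltac:(lra) P1 P2 s ltac:(unfold s; lra)).
    rewrite pow1, Rinv_1, Rmult_1_l in T. exact T. }
  unfold lat. eapply Rle_trans; [apply Cmod_triangle|]. assert (G1 := G _ H1). assert (G2 := G _ H2). lra.
Qed.

(** By rows the lattice sums to [Lam z / Lk - zetak / z^k], by columns to
    [Lam (- / z) / (z^k Lk) - zetak]. Equating the two is a transformation law for [Lam + Lk zetak],
    which for [k = 4, 6] is a constant multiple of the Eisenstein series. *)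
Theorem lattice_modular z : in_H z ->
  (Lam k (- / z) + Lk Num k * zetak k)%C = (z ^ k * (Lam k z + Lk Num k * zetak k))%C.
Proof.
  intros Hz. destruct (lat_bound z Hz) as (K & HK & HB).
  assert (K2 : (2 <= k)%nat) by lia.
  assert (EX : ex_series invsq) by apply ex_series_inv_sq.
  destruct (fubini (lat k z) (fun n => K * invsq n) invsq _ _ (ex_ser_scal_l K _ EX) EX
    (fun n => Rmult_le_pos _ _ HK (invsq_pos n)) invsq_pos HB
    (fun n => lat_row Num B k NumB NumC K2 HN HD HP z n Hz)
    (fun m => lat_col Num B k NumB NumC K2 Heven HN HD HP z m Hz)) as [F1 F2].
  assert (R1 := rows_total Num k K2 HN z Hz). assert (R2 := cols_total Num k K2 HN z Hz).
  assert (E := cser_unique _ _ _ F1 R1). assert (E2 := cser_unique _ _ _ F2 R2). rewrite E in E2.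
  assert (NL := Lk_neq0 Num k HN). assert (P1 := Cpow_nz _ k (in_H_neq0 z Hz)).
  set (L := Lk Num k) in *. set (Zt := zetak k) in *.
  transitivity (z ^ k * L * ((/ z ^ k * (Lam k (- / z) / L) - Zt) + Zt + Zt / z ^ k))%C. field; auto.
  rewrite <- E2. field; auto.
Qed.
End Weight4.

Lemma sigma_0 r : Defs.sigma r 0 = 0.
Proof. unfold Defs.sigma. rewrite sum_O. reflexivity. Qed.

Lemma Eis_sig c r z : in_H z -> Eis c r z = (1 + c * qser (divisor_sum r) z)%C.
Proof.
  intros Hz. rewrite Eis_qser by auto.
  apply (cser_unique _ _ _ (qser_cser _ z (pbd_Ecoef c r) Hz)).
  set (dl := fun n : nat => match n with O => RtoC 1 | _ => RtoC 0 end).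
  assert (D : cser dl 1). { replace (RtoC 1) with (psum dl 1) by (simpl; ring). apply cser_fin. intros [|j] H; [lia|reflexivity]. }
  eapply cser_ext; [|apply cser_plus; [exact D|apply cser_scal, qser_cser; [apply pbd_divisor_sum|exact Hz]]].
  intros [|n]; cbv beta; unfold dl, divisor_sum, Ecoef. rewrite sigma_0. simpl. ring. rewrite RtoC_mult. ring.
Qed.

Lemma RtoC_neq (a b : R) : a <> b -> RtoC a <> RtoC b. Proof. intros H E. apply H, RtoC_inj, E. Qed.

Lemma even4 (x : C) : ((- x) ^ 4 = x ^ 4)%C. Proof. ring. Qed.
Lemma even6 (x : C) : ((- x) ^ 6 = x ^ 6)%C. Proof. ring. Qed.
Lemma even2 (x : C) : ((- x) ^ 2 = x ^ 2)%C. Proof. ring. Qed.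
Lemma Num2_1 : Num2 1 <> RtoC 0. Proof. apply C1_nz. Qed.
Lemma Num4_1 : Num4 1 <> RtoC 0.
Proof. unfold Num4. replace (1 * (1 + 4 * 1 + 1 * 1))%C with (RtoC 6). apply RtoC_neq; lra. ring. Qed.
Lemma Num6_1 : Num6 1 <> RtoC 0.
Proof. unfold Num6. replace (1 * (1 + 26 * 1 + 66 * 1 ^ 2 + 26 * 1 ^ 3 + 1 ^ 4))%C with (RtoC 120). apply RtoC_neq; lra. ring. Qed.
Lemma pw2 z : in_H z -> powser (2 - 1) z = ratF Num2 2 z. Proof. intros H. apply (powser_closed z H). Qed.
Lemma pw4 z : in_H z -> powser (4 - 1) z = ratF Num4 4 z. Proof. intros H. apply (powser_closed z H). Qed.
Lemma pw6 z : in_H z -> powser (6 - 1) z = ratF Num6 6 z. Proof. intros H. apply (powser_closed z H). Qed.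

(** Here [Num4 (-1) = 2] and [2^4 * 2 * (2^4 - 1) = 480]; the quotient is the reciprocal of the
    coefficient 240 in [E4]. *)
Lemma LZ4 : (Lk Num4 4 * zetak 4 = / 240)%C.
Proof.
  assert (T := zeta_value Num4 6 4 Num4_B (Num4_c 1) ltac:(lia) even4 Num4_1 dup4).
  set (X := (Lk Num4 4 * zetak 4)%C) in *.
  replace (Num4 (-1)) with (RtoC 2) in T by (unfold Num4; ring).
  assert (N : RtoC 480 <> RtoC 0) by (apply RtoC_neq; lra).
  transitivity (X * (2 ^ 4 * (2 * (2 ^ 4 - 1))) / 480)%C. field; apply RtoC_neq; lra. rewrite T. field; split; apply RtoC_neq; lra.
Qed.
Lemma LZ6 : (Lk Num6 6 * zetak 6 = - / 504)%C.
Proof.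
  assert (T := zeta_value Num6 120 6 Num6_B (Num6_c 1) ltac:(lia) even6 Num6_1 dup6).
  set (X := (Lk Num6 6 * zetak 6)%C) in *.
  replace (Num6 (-1)) with (RtoC (-16)) in T by (unfold Num6; ring).
  transitivity (X * (2 ^ 6 * (2 * (2 ^ 6 - 1))) / 8064)%C. field; apply RtoC_neq; lra. rewrite T. field; split; apply RtoC_neq; lra.
Qed.
Lemma LZ2 : (Lk Num2 2 * zetak 2 = - / 24)%C.
Proof.
  assert (T := zeta_value Num2 1 2 Num2_B (Num2_c 1) ltac:(lia) even2 Num2_1 dup2).
  set (X := (Lk Num2 2 * zetak 2)%C) in *. unfold Num2 in T at 1.
  transitivity (X * (2 ^ 2 * (2 * (2 ^ 2 - 1))) / 24)%C. field; apply RtoC_neq; lra. rewrite T. field; apply RtoC_neq; lra.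
Qed.

Theorem E4_S z : in_H z -> E4 (- / z)%C = (z ^ 4 * E4 z)%C.
Proof.
  intros Hz. unfold E4. rewrite !Eis_sig by (auto using in_H_S).
  assert (T := lattice_modular Num4 6 4 Num4_B (Num4_c 1) ltac:(lia) even4 Num4_1 dup4 pw4 z Hz).
  rewrite LZ4 in T. unfold Lam in T. simpl (4 - 1)%nat in T.
  transitivity (240 * (qser (divisor_sum 3) (- / z) + / 240))%C. field; apply RtoC_neq; lra. rewrite T. field; apply RtoC_neq; lra.
Qed.
Theorem E6_S z : in_H z -> E6 (- / z)%C = (z ^ 6 * E6 z)%C.
Proof.
  intros Hz. unfold E6. rewrite !Eis_sig by (auto using in_H_S).
  assert (T := lattice_modular Num6 120 6 Num6_B (Num6_c 1) ltac:(lia) even6 Num6_1 dup6 pw6 z Hz).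
  rewrite LZ6 in T. unfold Lam in T. simpl (6 - 1)%nat in T.
  transitivity (-504 * (qser (divisor_sum 5) (- / z) + - / 504))%C. field; apply RtoC_neq; lra. rewrite T. field; apply RtoC_neq; lra.
Qed.

(** Weight 2: [lat] is compared with the telescoping [tele], whose two iterated sums differ. *)
Section Weight2.
Variable z : C.
Hypothesis Hz : in_H z.
Let NZ : z <> RtoC 0 := in_H_neq0 z Hz.

(** Half-integers, because [1 / (x - 1/2) - 1 / (x + 1/2) = 1 / (x^2 - 1/4)] differs from [1 / x^2]
    only in order [x^(-4)]; this makes [lat - tele] absolutely summable. *)
Definition hb (m : nat) : R := INR m + / 2.
Definition pr (b : R) (n : nat) : C := (/ (INR (S n) * z - b) - / (INR (S n) * z + b))%C.
Definition tele (n m : nat) : C := (pr (hb (S m)) n - pr (hb m) n)%C.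

Lemma hb_pos m : 0 < hb m. Proof. unfold hb. assert (T := pos_INR m). lra. Qed.

Lemma lin_neq0 n (s : R) : (INR (S n) * z + s)%C <> RtoC 0.
Proof.
  intros E. apply (f_equal Im) in E. rewrite im_plus, im_scal_l, !im_RtoC, Rplus_0_r in E. assert (T := INR_S_pos n).
  unfold in_H in Hz. assert (0 < INR (S n) * Im z) by (apply Rmult_lt_0_compat; auto). lra.
Qed.
Lemma lin_neq0' n (s : R) : (INR (S n) * z - s)%C <> RtoC 0.
Proof. unfold Cminus. rewrite <- RtoC_opp. apply lin_neq0. Qed.

Lemma tele_row n : cser (tele n) (- pr (hb 0) n)%C.
Proof.
  assert (PS : forall J, psum (tele n) J = (pr (hb J) n - pr (hb 0) n)%C).
  { induction J. simpl. ring. simpl. rewrite IHJ. unfold tele. ring. }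
  eapply clim_ext; [intros J; symmetry; apply PS|].
  replace (- pr (hb 0) n)%C with (0 - pr (hb 0) n)%C by ring. apply clim_minus; [|apply clim_const].
  destruct (half_plane_lower z Hz) as (del & Hd & H).
  apply (clim_0_bound _ (fun J => 2 * / del * / INR (S J))).
  - intros J. assert (T := pos_INR J). assert (P := INR_S_pos n).
    destruct (H (INR (S n)) (hb J) ltac:(lra) ltac:(left; apply hb_pos)) as [H1 H2].
    assert (Q : del * INR (S J) <= del * (INR (S n) + hb J)).
    { apply Rmult_le_compat_l. lra. rewrite S_INR. unfold hb. assert (1 <= INR (S n)) by (apply (le_INR 1); lia). lra. }
    assert (PJ := INR_S_pos J). assert (PD : 0 < del * INR (S J)) by (apply Rmult_lt_0_compat; auto).
    unfold pr. eapply Rle_trans; [apply Cmod_triangle|]. rewrite Cmod_opp, !Cmod_inv by (apply lin_neq0 || apply lin_neq0').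
    replace (2 * / del * / INR (S J)) with (/ (del * INR (S J)) + / (del * INR (S J))) by (field; split; lra).
    apply Rplus_le_compat; apply Rinv_le_contravar; lra.
  - replace (Finite 0) with (Rbar_mult (2 * / del) 0) by (simpl; f_equal; ring).
    apply is_lim_seq_scal_l. apply (is_lim_seq_incr_1 (fun n => / INR n)).
    replace (Finite 0) with (Rbar_inv p_infty) by reflexivity. apply is_lim_seq_inv. apply is_lim_seq_INR. discriminate.
Qed.

Definition colval (b : R) : C := (/ z * (- I2pi * ratF Num1 1 (b * - / z)) + / b)%C.

Lemma pr_col b : 0 < b -> cser (pr b) (colval b).
Proof.
  intros Hb. assert (HW : in_H (b * - / z)%C) by (apply in_H_scal; auto; apply in_H_S; auto).
  assert (T := cser_scal (/ z)%C _ _ (lipschitz_1 _ HW)).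
  assert (NB : RtoC b <> RtoC 0) by (apply RtoC_neq; lra).
  replace (colval b) with (/ z * (- I2pi * ratF Num1 1 (b * - / z) - / (b * - / z)))%C by (unfold colval; field; auto).
  eapply cser_ext; [|exact T]. intros n. cbv beta. unfold pr.
  assert (N1 := lin_neq0 n b). assert (N2 := lin_neq0' n b).
  assert (X1 : (b * - / z + INR (S n))%C = ((INR (S n) * z - b) / z)%C) by (field; auto).
  assert (X2 : (b * - / z - INR (S n))%C = (- (INR (S n) * z + b) / z)%C) by (field; auto).
  rewrite X1, X2. field. auto.
Qed.

(** As [b] grows, [e (- b / z)] tends to 0 and [ratF Num1 1] to the constant [1 / 2] of its
    [q]-expansion. This surviving limit is the source of the anomaly of [E2]. *)
Lemma colval_lim : clim (fun m => colval (hb m)) (- I2pi / (2 * z))%C.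
Proof.
  assert (T0 : RtoC 2 <> RtoC 0) by (apply RtoC_neq; lra).
  replace (- I2pi / (2 * z))%C with (/ z * (- I2pi * (Num1 0 / (1 - 0))) + 0)%C by (unfold Num1; field; auto).
  apply clim_plus.
  - apply clim_scal, clim_scal.
    assert (QL : clim (fun m => e (hb m * - / z)%C) (RtoC 0)).
    { set (w := (- / z)%C). assert (HW : in_H w) by (apply in_H_S; auto).
      apply (clim_0_bound _ (fun m => Cmod (e w) ^ m)).
      - intros m. rewrite !Cmod_e, im_scal_l. unfold hb. assert (TT := pos_INR m). unfold in_H in HW.
        assert (PE : forall n, exp (- 2 * PI * Im w) ^ n = exp (INR n * (- 2 * PI * Im w))).
        { induction n. rewrite pow_O, Rmult_0_l, exp_0; auto. rewrite S_INR, <- tech_pow_Rmult, IHn, <- exp_plus. f_equal; ring. }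
        rewrite PE. left; apply exp_increasing. assert (P := PI_RGT_0). assert (0 < PI * Im w) by (apply Rmult_lt_0_compat; auto). nra.
      - apply is_lim_seq_geom. assert (T := exp_m2pi_lt1 w HW). rewrite Rabs_right; lra. }
    eapply clim_ext with (fun m => Num1 (e (hb m * - / z)) * / (1 - e (hb m * - / z)))%C.
    { intros m. unfold ratF. rewrite Cpow_1_r. reflexivity. }
    apply clim_mult. apply (ccont_clim Num1); auto. apply Num1_c.
    apply clim_inv. intros E. apply C1_nz. rewrite <- E. ring. apply clim_minus; auto. apply clim_const.
  - apply (clim_0_bound _ (fun m => 2 * / INR (S m))).
    + intros m. assert (P := hb_pos m). rewrite Cmod_inv, Cmod_R, Rabs_right by (try apply RtoC_neq; lra).
      assert (TT := pos_INR m). apply Rle_trans with (/ (/ 2 * INR (S m))). 2: right; field; assert (Q := INR_S_pos m); lra.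
      apply Rinv_le_contravar. assert (Q := INR_S_pos m). lra. unfold hb. rewrite S_INR. lra.
    + replace (Finite 0) with (Rbar_mult 2 0) by (simpl; f_equal; ring).
      apply is_lim_seq_scal_l. apply (is_lim_seq_incr_1 (fun n => / INR n)).
      replace (Finite 0) with (Rbar_inv p_infty) by reflexivity. apply is_lim_seq_inv. apply is_lim_seq_INR. discriminate.
Qed.

Lemma lat_tele_bound : exists K, 0 <= K /\ forall n m, Cmod (lat 2 z n m - tele n m)%C <= (K * invsq n) * invsq m.
Proof.
  destruct (half_plane_lower z Hz) as (del & Hdel & H0).
  exists (/ 2 * / (del / 2) ^ 4). split. { apply Rmult_le_pos. lra. left. apply Rinv_0_lt_compat, pow_lt; lra. }
  intros n m. assert (P1 : 1 <= INR (S n)) by (apply (le_INR 1); lia). assert (P2 : 1 <= INR (S m)) by (apply (le_INR 1); lia).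
  set (a := INR (S n)) in *. set (b := INR (S m)) in *.
  assert (B1 : hb (S m) = b + / 2) by reflexivity.
  assert (B0 : hb m = b - / 2) by (unfold hb, b; rewrite S_INR; lra).
  assert (LB : forall t, b - / 2 <= t -> del / 2 * (a + b) <= Cmod (a * z + t)%C /\ del / 2 * (a + b) <= Cmod (a * z - t)%C).
  { intros t Ht. destruct (H0 a t ltac:(lra) ltac:(lra)) as [A1 A2].
    assert (del / 2 * (a + b) <= del * (a + t)); [|lra]. unfold Rdiv. rewrite Rmult_assoc. apply Rmult_le_compat_l; lra. }
  assert (SP : 0 < del / 2 * (a + b)) by (apply Rmult_lt_0_compat; lra).
  destruct (LB b ltac:(lra)) as [X1 X2]. destruct (LB (b - / 2) ltac:(lra)) as [Y1 Y2]. destruct (LB (b + / 2) ltac:(lra)) as [W1 W2].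
  assert (T0 : RtoC 2 <> RtoC 0) by (apply RtoC_neq; lra).
  assert (HH : RtoC (/ 2) = (/ 2)%C) by (rewrite RtoC_inv by lra; auto).
  assert (CORE : forall x p r : C, del / 2 * (a + b) <= Cmod x -> del / 2 * (a + b) <= Cmod p -> del / 2 * (a + b) <= Cmod r ->
     Cmod (- / 4 * (/ (x * x) * (/ p * / r)))%C <= / 4 * (/ (del / 2) ^ 4 * (/ (a * a) * / (b * b)))).
  { intros x p r H1 H2 H3.
    assert (xn : x <> RtoC 0) by (apply Cmod_gt_0; lra). assert (pn : p <> RtoC 0) by (apply Cmod_gt_0; lra). assert (rn : r <> RtoC 0) by (apply Cmod_gt_0; lra).
    replace (- / 4)%C with (RtoC (- / 4)) by (rewrite RtoC_opp, RtoC_inv by lra; auto).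
    rewrite !Cmod_mult, Cmod_R, !Cmod_inv, Cmod_mult by (auto; apply Cmult_neq_0; auto).
    rewrite Rabs_left by lra. replace (- - / 4) with (/ 4) by ring. apply Rmult_le_compat_l. lra.
    eapply Rle_trans; [|apply (sum4_bound a b (del / 2)); auto; [lra|apply Rle_refl]].
    set (s := del / 2 * (a + b)) in *. rewrite <- !Rinv_mult. apply Rinv_le_contravar. apply pow_lt; auto.
    replace (s ^ 4) with ((s * s) * (s * s)) by ring. apply Rmult_le_compat; try (apply Rmult_le_compat; lra); nra. }
  assert (ID : (lat 2 z n m - tele n m)%C =
    (- / 4 * (/ ((a * z + b) * (a * z + b)) * (/ (a * z + (b - / 2)%R) * / (a * z + (b + / 2)%R)))
     + - / 4 * (/ ((a * z - b) * (a * z - b)) * (/ (a * z - (b - / 2)%R) * / (a * z - (b + / 2)%R))))%C).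
  { unfold lat, tele, pr. rewrite B0, B1. fold a b. rewrite !RtoC_plus, !RtoC_minus, HH.
    assert (N : forall t, b - / 2 <= t -> (a * z + t)%C <> RtoC 0 /\ (a * z - t)%C <> RtoC 0).
    { intros t Ht. destruct (LB t Ht). split; apply Cmod_gt_0; lra. }
    destruct (N b ltac:(lra)) as [n1 n2]. destruct (N (b - / 2) ltac:(lra)) as [n3 n4]. destruct (N (b + / 2) ltac:(lra)) as [n5 n6].
    rewrite RtoC_minus, HH in n3, n4. rewrite RtoC_plus, HH in n5, n6.
    assert (F : forall x h : C, x <> RtoC 0 -> (x - h)%C <> RtoC 0 -> (x + h)%C <> RtoC 0 -> h = (/ 2)%C ->
       (/ x ^ 2 - (/ (x - h) - / (x + h)))%C = (- / 4 * (/ (x * x) * (/ (x - h) * / (x + h))))%C).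
    { intros x h h1 h2 h3 Eh. assert (E4' : (h * h)%C = (/ 4)%C) by (rewrite Eh; field; apply RtoC_neq; lra).
      assert (E5' : (h + h)%C = RtoC 1) by (rewrite Eh; field; auto).
      replace (- / 4)%C with (- (h * h))%C by (rewrite E4'; auto).
      assert (G1 : (/ (x - h) - / (x + h))%C = (((h + h)) * (/ (x - h) * / (x + h)))%C) by (field; auto).
      rewrite G1, E5'. field. auto. }
    set (x := (a * z + b)%C) in *. set (y := (a * z - b)%C) in *. set (h := (/ 2)%C) in *.
    replace (a * z + (b - h))%C with (x - h)%C in * by (unfold x; ring).
    replace (a * z + (b + h))%C with (x + h)%C in * by (unfold x; ring).
    replace (a * z - (b - h))%C with (y + h)%C in * by (unfold y; ring).
    replace (a * z - (b + h))%C with (y - h)%C in * by (unfold y; ring).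
    rewrite (Cmult_comm (/ (y + h)) (/ (y - h))).
    rewrite <- (F x h), <- (F y h) by auto. ring. }
  rewrite ID. eapply Rle_trans; [apply Cmod_triangle|].
  assert (C1 := CORE _ _ _ X1 Y1 W1). assert (C2 := CORE _ _ _ X2 Y2 W2). unfold invsq. fold a b. lra.
Qed.

Theorem E2_S : E2 (- / z)%C = (z ^ 2 * E2 z + 12 * z / I2pi)%C.
Proof.
  destruct lat_tele_bound as (K & HK & HB).
  assert (EX : ex_series invsq) by apply ex_series_inv_sq.
  assert (K2 : (2 <= 2)%nat) by lia.
  assert (RW : forall n, cser (fun m => lat 2 z n m - tele n m)%C _)
    by (intros n; apply cser_minus; [apply (lat_row Num2 1 2 Num2_B (Num2_c 1) K2 Num2_1 dup2 pw2 z n Hz)|apply (tele_row n)]).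
  assert (CW : forall m, cser (fun n => lat 2 z n m - tele n m)%C _)
    by (intros m; apply cser_minus; [apply (lat_col Num2 1 2 Num2_B (Num2_c 1) K2 even2 Num2_1 dup2 pw2 z m Hz)
        |apply cser_minus; apply pr_col; apply hb_pos]).
  destruct (fubini (fun n m => lat 2 z n m - tele n m)%C (fun n => K * invsq n) invsq _ _ (ex_ser_scal_l K _ EX) EX
    (fun n => Rmult_le_pos _ _ HK (invsq_pos n)) invsq_pos HB RW CW) as [F1 F2].
  assert (R1 := rows_total Num2 2 K2 Num2_1 z Hz). assert (R2 := cols_total Num2 2 K2 Num2_1 z Hz).
  (* By rows [tele] totals [- colval (hb 0)], by columns the same plus [- I2pi / (2 z)]; the
     discrepancy becomes the term [12 z / I2pi]. *)
  assert (S1 : cser (fun n => - pr (hb 0) n)%C (- colval (hb 0))%C).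
  { replace (- colval (hb 0))%C with (- (1) * colval (hb 0))%C by ring.
    eapply cser_ext; [|apply cser_scal, pr_col, hb_pos]. intros; cbv beta; ring. }
  assert (S2 : cser (fun m => colval (hb (S m)) - colval (hb m))%C (- I2pi / (2 * z) - colval (hb 0))%C).
  { eapply clim_ext with (fun J => colval (hb J) - colval (hb 0))%C.
    - induction n. simpl; ring. simpl. rewrite <- IHn. ring.
    - apply clim_minus; [apply colval_lim|apply clim_const]. }
  assert (EQ1 := cser_unique _ _ _ F1 (cser_minus _ _ _ _ R1 S1)).
  assert (EQ2 := cser_unique _ _ _ F2 (cser_minus _ _ _ _ R2 S2)).
  rewrite EQ1 in EQ2. unfold E2. rewrite !Eis_sig by (auto using in_H_S).
  assert (LZ := LZ2). assert (NL := Lk_neq0 Num2 2 Num2_1). unfold Lam in EQ2. simpl (2 - 1)%nat in EQ2.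
  assert (LE : Lk Num2 2 = (/ (I2pi * I2pi))%C) by (unfold Lk, Num2; field; apply I2pi_neq0).
  assert (NI := I2pi_neq0).
  set (X := qser (divisor_sum 1) (- / z)) in *. set (Y := qser (divisor_sum 1) z) in *. set (Zt := zetak 2) in *. rewrite LE in *.
  set (J := (I2pi * I2pi)%C) in *. assert (NJ : J <> RtoC 0) by (apply Cmult_neq_0; auto).
  assert (T0 : RtoC 2 <> RtoC 0) by (apply RtoC_neq; lra).
  assert (T24 : RtoC 24 <> RtoC 0) by (apply RtoC_neq; lra).
  (* Euler's value [PI^2 / 6] of the sum of inverse squares, written as [- I2pi^2 / 24]. *)
  assert (ZE : Zt = (- J / 24)%C). { transitivity (J * (/ J * Zt))%C. field; auto. rewrite LZ. field; auto. }
  rewrite ZE in EQ2. set (u := colval (hb 0)) in *.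
  assert (EX2 : (/ z ^ 2 * (X / / J))%C = (Y / / J - (- J / 24) / z ^ 2 + - J / 24 + - I2pi / (2 * z))%C).
  { transitivity (/ z ^ 2 * (X / / J) - - J / 24 - (- I2pi / (2 * z) - u) + (- J / 24) + (- I2pi / (2 * z) - u))%C. ring. rewrite <- EQ2. ring. }
  assert (EX3 : X = (z ^ 2 / J * (Y / / J - (- J / 24) / z ^ 2 + - J / 24 + - I2pi / (2 * z)))%C).
  { rewrite <- EX2. field. auto. }
  rewrite EX3. unfold J. field. auto.
Qed.
End Weight2.

(** * Ramanujan's differential equations *)

(** [HC f c]: f = c + O(q) at the cusp. *)
Definition HC (f : C -> C) (c : C) : Prop :=
  exists K, 0 <= K /\ forall z, 1 <= Im z -> Cmod (f z - c)%C <= K * exp (- 2 * PI * Im z).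

Lemma expq_pos y : 0 < exp (- 2 * PI * y). Proof. apply exp_pos. Qed.
Lemma expq_le1 y : 1 <= y -> exp (- 2 * PI * y) <= 1.
Proof. intros. rewrite <- exp_0. left. apply exp_increasing. assert (P := PI_RGT_0). nra. Qed.

Lemma HC_const c : HC (fun _ => c) c.
Proof. exists 0. split. lra. intros. replace (c - c)%C with (RtoC 0) by ring. rewrite Cmod_0. lra. Qed.

Lemma HC_plus f g c d : HC f c -> HC g d -> HC (fun z => f z + g z)%C (c + d)%C.
Proof.
  intros [K [HK H]] [L [HL G]]. exists (K + L). split. lra. intros z Hz. specialize (H z Hz). specialize (G z Hz).
  replace (f z + g z - (c + d))%C with ((f z - c) + (g z - d))%C by ring. eapply Rle_trans; [apply Cmod_triangle|]. lra.
Qed.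

Lemma HC_bounded f c : HC f c -> exists M, 0 <= M /\ forall z, 1 <= Im z -> Cmod (f z) <= M.
Proof.
  intros [K [HK H]]. exists (K + Cmod c). split. assert (T := Cmod_ge_0 c); lra. intros z Hz.
  replace (f z) with ((f z - c) + c)%C by ring. eapply Rle_trans; [apply Cmod_triangle|]. apply Rplus_le_compat_r.
  eapply Rle_trans; [apply H; auto|]. assert (T := expq_le1 (Im z) Hz). nra.
Qed.

Lemma HC_mult f g c d : HC f c -> HC g d -> HC (fun z => f z * g z)%C (c * d)%C.
Proof.
  intros Hf Hg. destruct (HC_bounded g d Hg) as [M [HM B]]. destruct Hf as [K [HK H]], Hg as [L [HL G]].
  assert (C0 := Cmod_ge_0 c).
  exists (K * M + Cmod c * L). split. nra. intros z Hz. specialize (H z Hz). specialize (G z Hz). specialize (B z Hz).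
  replace (f z * g z - c * d)%C with ((f z - c) * g z + c * (g z - d))%C by ring.
  eapply Rle_trans; [apply Cmod_triangle|]. rewrite !Cmod_mult.
  assert (E := expq_pos (Im z)). set (x := exp (- 2 * PI * Im z)) in *.
  assert (Cmod (f z - c) * Cmod (g z) <= (K * x) * M) by (apply Rmult_le_compat; auto using Cmod_ge_0).
  assert (Cmod c * Cmod (g z - d) <= Cmod c * (L * x)) by (apply Rmult_le_compat_l; auto). lra.
Qed.

Lemma HC_scal a f c : HC f c -> HC (fun z => a * f z)%C (a * c)%C.
Proof. intros H. apply (HC_mult (fun _ => a) f a c (HC_const a) H). Qed.

Lemma HC_ext f g c : (forall z, in_H z -> f z = g z) -> HC f c -> HC g c.
Proof. intros E [K [HK H]]. exists K. split; auto. intros z Hz. rewrite <- E by (apply cusp_H; auto). auto. Qed.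

Lemma HC_eq f c d : HC f c -> c = d -> HC f d. Proof. intros H <-; auto. Qed.

Lemma HC_pow f c n : HC f c -> HC (fun z => f z ^ n)%C (c ^ n)%C.
Proof. intros H. induction n. exact (HC_const 1). exact (HC_mult _ _ _ _ H IHn). Qed.

Lemma HC_unique f c d : HC f c -> HC f d -> c = d.
Proof.
  intros [K [HK H]] [L [HL G]]. apply Ceq_minus. apply Cmod_eq_0. apply Rle_antisym; [|apply Cmod_ge_0]. apply Rnot_lt_le. intros P.
  set (t := Cmod (c - d)%C) in *.
  set (y := 1 + (K + L) / t). assert (Y : 0 <= (K + L) / t) by (apply Rdiv_le_0_compat; lra).
  assert (Hy : 1 <= Im (0, y)) by (simpl; unfold y; lra).
  specialize (H (0, y) Hy). specialize (G (0, y) Hy). simpl Im in H, G.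
  assert (T := Cmod_triangle (- (f (0, y) - c))%C (f (0, y) - d)%C). rewrite Cmod_opp in T.
  replace (- (f (0, y) - c) + (f (0, y) - d))%C with (c - d)%C in T by ring. fold t in T.
  assert (X : exp (- 2 * PI * y) <= / y).
  { replace (- 2 * PI * y) with (- (2 * PI * y)) by ring. rewrite exp_Ropp. apply Rinv_le_contravar. unfold y; lra.
    assert (E := exp_ineq1_le (2 * PI * y)). assert (P2 := PI2_1). assert (1 <= y) by (unfold y; lra). nra. }
  assert ((K + L) * exp (- 2 * PI * y) <= (K + L) * / y) by (apply Rmult_le_compat_l; lra).
  change (snd (0, y)) with y in *.
  assert ((K + L) * / y < t); [|lra]. apply Rmult_lt_reg_r with y. unfold y; lra.
  rewrite Rmult_assoc, Rinv_l, Rmult_1_r by (unfold y; lra). unfold y. replace (t * (1 + (K + L) / t)) with (t + (K + L)) by (field; lra). lra.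
Qed.

Lemma HC_qser a : pbd a -> HC (qser a) (a O).
Proof. intros P. destruct (qser_near_cusp a P) as [K [HK H]]. exists K. split; auto. intros z Hz. apply H. lra. Qed.

Lemma HC_Eis c r : HC (Eis c r) 1.
Proof.
  apply (HC_ext (qser (Ecoef c r))). intros; rewrite Eis_qser; auto. apply (HC_qser (Ecoef c r)). apply pbd_Ecoef.
Qed.

Lemma Eis_T c r : periodic (Eis c r).
Proof. intros z Hz. rewrite !Eis_qser by (auto using in_H_T). apply qser_plus_1. Qed.

Definition thE (c : R) (r : nat) : C -> C := qser (fun n => INR n * Ecoef c r n)%C.
Lemma pbd_thE c r : pbd (fun n => INR n * Ecoef c r n)%C. Proof. apply pbd_derive, pbd_Ecoef. Qed.

Lemma Eis_deriv c r z : in_H z -> cderiv_at (Eis c r) z (I2pi * thE c r z)%C.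
Proof.
  intros Hz. apply (cderiv_ext_H (qser (Ecoef c r))); auto. intros; rewrite Eis_qser; auto.
  apply qser_deriv; auto. apply pbd_Ecoef.
Qed.

Lemma holo_Eis c r : holo_H (Eis c r).
Proof. apply holo_intro. intros z Hz. eexists. apply Eis_deriv; auto. Qed.
Lemma holo_qser a : pbd a -> holo_H (qser a).
Proof. intros P. apply holo_intro. intros z Hz. eexists. apply qser_deriv; auto. Qed.
Lemma HC_thE c r : HC (thE c r) 0.
Proof. eapply HC_eq. apply HC_qser, pbd_thE. simpl. ring. Qed.
Lemma thE_T c r : periodic (thE c r). Proof. intros z Hz. apply qser_plus_1. Qed.

Lemma zp2 z : zp z 2 = (z ^ 4)%C. Proof. change (zp z (Z.of_nat 2) = (z ^ (2 * 2))%C). rewrite zp_nat. simpl. ring. Qed.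
Lemma zp3 z : zp z 3 = (z ^ 6)%C. Proof. change (zp z (Z.of_nat 3) = (z ^ (2 * 3))%C). rewrite zp_nat. simpl. ring. Qed.
Lemma zp4 z : zp z 4 = (z ^ 8)%C. Proof. change (zp z (Z.of_nat 4) = (z ^ (2 * 4))%C). rewrite zp_nat. simpl. ring. Qed.

Lemma MF_intro v f c : holo_H f -> periodic f -> (forall z, in_H z -> f (- / z)%C = (zp z v * f z)%C) -> HC f c -> MF v f.
Proof. intros H1 H2 H3 H4. destruct (HC_bounded f c H4) as [M [_ HM]]. split; [|split; [|split]]; auto. exists M; auto. Qed.

Lemma MF_E4 : MF 2 E4.
Proof. apply (MF_intro 2 _ 1). apply holo_Eis. apply Eis_T. intros. rewrite zp2. apply E4_S; auto. apply HC_Eis. Qed.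
Lemma MF_E6 : MF 3 E6.
Proof. apply (MF_intro 3 _ 1). apply holo_Eis. apply Eis_T. intros. rewrite zp3. apply E6_S; auto. apply HC_Eis. Qed.

Lemma cderiv_S z : in_H z -> cderiv_at (fun z => - / z)%C z (/ (z * z))%C.
Proof.
  intros Hz. assert (N := in_H_neq0 z Hz).
  apply (cderiv_ext (fun z => - (1) * / z)%C). intros; ring.
  eapply cderiv_eq. apply cderiv_scal. apply (cderiv_inv (fun z => z)); auto. apply cderiv_id. field. auto.
Qed.

(** The transformation law is differentiated by the chain rule on one side and the product rule on
    the other; the inhomogeneous term is of the shape that [E2 * f] produces through [E2_S]. *)
Lemma theta_S (f th : C -> C) (k : nat) : (forall z, in_H z -> cderiv_at f z (I2pi * th z)%C) ->
  (forall z, in_H z -> f (- / z)%C = (z ^ S k * f z)%C) ->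
  forall z, in_H z -> th (- / z)%C = (z ^ (S k + 2) * th z + INR (S k) * z ^ (S k + 1) * f z / I2pi)%C.
Proof.
  intros HD HS z Hz. assert (N := in_H_neq0 z Hz). assert (NI := I2pi_neq0).
  assert (D1 := cderiv_comp f (fun z => - / z)%C z _ _ (HD _ (in_H_S z Hz)) (cderiv_S z Hz)).
  assert (D2 := cderiv_mult (fun z => z ^ S k)%C f z _ _ (cderiv_pow (fun z => z) z _ k (cderiv_id z)) (HD z Hz)).
  assert (D3 := cderiv_ext_H _ (fun z => z ^ S k * f z)%C z _ Hz HS D1).
  assert (E := cderiv_unique _ _ _ _ D3 D2). cbv beta in E.
  transitivity (z * z / I2pi * (I2pi * th (- / z) * / (z * z)))%C. field; auto. rewrite E.
  rewrite !Cpow_add_r. simpl Cpow. field. auto.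
Qed.

Lemma theta_E2_S z : in_H z -> thE (-24) 1 (- / z)%C = (z ^ 4 * thE (-24) 1 z + 2 * z ^ 3 * E2 z / I2pi + 12 * z ^ 2 / (I2pi * I2pi))%C.
Proof.
  intros Hz. assert (N := in_H_neq0 z Hz). assert (NI := I2pi_neq0).
  assert (D1 := cderiv_comp E2 (fun z => - / z)%C z _ _ (Eis_deriv _ _ _ (in_H_S z Hz)) (cderiv_S z Hz)).
  assert (D2 := cderiv_plus _ _ z _ _ (cderiv_mult (fun z => z ^ 2)%C E2 z _ _ (cderiv_pow (fun z => z) z _ 1 (cderiv_id z)) (Eis_deriv (-24) 1 z Hz)) (cderiv_scal (12 / I2pi)%C (fun z => z) z _ (cderiv_id z))).
  assert (ES : forall w, in_H w -> E2 (- / w)%C = (w ^ 2 * E2 w + 12 / I2pi * w)%C) by (intros w Hw; rewrite E2_S by auto; field; auto).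
  assert (D3 := cderiv_ext_H _ (fun z => z ^ 2 * E2 z + 12 / I2pi * z)%C z _ Hz ES D1).
  assert (E := cderiv_unique _ _ _ _ D3 D2). cbv beta in E.
  transitivity (z * z / I2pi * (I2pi * thE (-24) 1 (- / z) * / (z * z)))%C. field; auto. rewrite E.
  change (INR 2) with 2. field. auto.
Qed.

Lemma HC_neg f c : HC f c -> HC (fun z => - f z)%C (- c)%C.
Proof. intros H. eapply HC_eq. eapply HC_ext; [|apply (HC_scal (- (1))%C f c H)]. intros; cbv beta; ring. ring. Qed.

Lemma HC_minus f g c d : HC f c -> HC g d -> HC (fun z => f z - g z)%C (c - d)%C.
Proof. intros H1 H2. apply (HC_plus f (fun z => - g z)%C c (- d)%C H1 (HC_neg g d H2)). Qed.

Lemma vanish v f : (v <= 5)%Z -> MF v f -> HC f 0 -> forall z, in_H z -> f z = RtoC 0.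
Proof.
  intros Hv H [K [_ HK]]. apply (cusp_form_vanish v f K Hv H). intros z Hz. rewrite <- (Csub_0_r (f z)). auto.
Qed.

Lemma holo_scal a f : holo_H f -> holo_H (fun z => a * f z)%C.
Proof. intros H. apply (holo_mult (fun _ => a)); auto. apply holo_const. Qed.
Lemma holo_minus f g : holo_H f -> holo_H g -> holo_H (fun z => f z - g z)%C.
Proof.
  intros H1 H2 z Hz. assert (T := holo_plus f (fun z => - (1) * g z)%C H1 (holo_scal _ g H2)).
  destruct (holo_deriv _ z T Hz) as [l Hl]. exists l. apply (cderiv_ext _ (fun z => f z - g z)%C) in Hl. exact Hl. intros; ring.
Qed.

Ltac rneq := apply RtoC_neq; lra.

(** The inhomogeneous terms of [theta_E2_S] and [E2_S] cancel, so the difference of the two sides is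
    modular of weight 4 without constant term. The other two equations follow the same pattern. *)
Theorem ramanujan2 z : in_H z -> thE (-24) 1 z = ((E2 z * E2 z - E4 z) * / 12)%C.
Proof.
  intros Hz. apply Ceq_minus. revert z Hz. apply (vanish 2). lia.
  - apply (MF_intro 2 _ (0 - (1 * 1 - 1) * / 12)%C).
    + apply holo_minus. apply holo_qser, pbd_thE. apply holo_mult; [|apply holo_const]. apply holo_minus; [apply holo_mult|]; apply holo_Eis.
    + intros z Hz. rewrite thE_T, (Eis_T (-24) 1 z Hz : E2 _ = _), (Eis_T 240 3 z Hz : E4 _ = _); auto.
    + intros z Hz. rewrite zp2, theta_E2_S, E2_S, E4_S by auto. field. repeat split; try rneq; apply I2pi_neq0.
    + apply HC_minus. apply HC_thE. apply HC_mult; [|apply HC_const]. apply HC_minus; [apply HC_mult|]; apply HC_Eis.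
  - eapply HC_eq. apply HC_minus. apply HC_thE. apply HC_mult; [|apply HC_const]. apply HC_minus; [apply HC_mult|]; apply HC_Eis. ring.
Qed.

Theorem ramanujan4 z : in_H z -> thE 240 3 z = ((E2 z * E4 z - E6 z) * / 3)%C.
Proof.
  intros Hz. apply Ceq_minus. revert z Hz. apply (vanish 3). lia.
  - apply (MF_intro 3 _ (0 - (1 * 1 - 1) * / 3)%C).
    + apply holo_minus. apply holo_qser, pbd_thE. apply holo_mult; [|apply holo_const]. apply holo_minus; [apply holo_mult|]; apply holo_Eis.
    + intros z Hz. rewrite thE_T, (Eis_T (-24) 1 z Hz : E2 _ = _), (Eis_T 240 3 z Hz : E4 _ = _), (Eis_T (-504) 5 z Hz : E6 _ = _); auto.
    + intros z Hz. rewrite zp3, (theta_S E4 (thE 240 3) 3 (Eis_deriv 240 3) E4_S), E2_S, E4_S, E6_S by auto.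
      replace (INR 4) with 4 by (simpl; ring). change (4 + 2)%nat with 6%nat. change (4 + 1)%nat with 5%nat. field. repeat split; try rneq; apply I2pi_neq0.
    + apply HC_minus. apply HC_thE. apply HC_mult; [|apply HC_const]. apply HC_minus; [apply HC_mult|]; apply HC_Eis.
  - eapply HC_eq. apply HC_minus. apply HC_thE. apply HC_mult; [|apply HC_const]. apply HC_minus; [apply HC_mult|]; apply HC_Eis. ring.
Qed.

Theorem ramanujan6 z : in_H z -> thE (-504) 5 z = ((E2 z * E6 z - E4 z * E4 z) * / 2)%C.
Proof.
  intros Hz. apply Ceq_minus. revert z Hz. apply (vanish 4). lia.
  - apply (MF_intro 4 _ (0 - (1 * 1 - 1 * 1) * / 2)%C).
    + apply holo_minus. apply holo_qser, pbd_thE. apply holo_mult; [|apply holo_const]. apply holo_minus; apply holo_mult; apply holo_Eis.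
    + intros z Hz. rewrite thE_T, (Eis_T (-24) 1 z Hz : E2 _ = _), (Eis_T 240 3 z Hz : E4 _ = _), (Eis_T (-504) 5 z Hz : E6 _ = _); auto.
    + intros z Hz. rewrite zp4, (theta_S E6 (thE (-504) 5) 5 (Eis_deriv (-504) 5) E6_S), E2_S, E4_S, E6_S by auto.
      replace (INR 6) with 6 by (simpl; ring). change (6 + 2)%nat with 8%nat. change (6 + 1)%nat with 7%nat. field. repeat split; try rneq; apply I2pi_neq0.
    + apply HC_minus. apply HC_thE. apply HC_mult; [|apply HC_const]. apply HC_minus; apply HC_mult; apply HC_Eis.
  - eapply HC_eq. apply HC_minus. apply HC_thE. apply HC_mult; [|apply HC_const]. apply HC_minus; apply HC_mult; apply HC_Eis. ring.
Qed.

Lemma E2_deriv z : in_H z -> cderiv_at E2 z (I2pi * ((E2 z * E2 z - E4 z) * / 12))%C.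
Proof. intros Hz. rewrite <- ramanujan2 by auto. apply Eis_deriv; auto. Qed.
Lemma E4_deriv z : in_H z -> cderiv_at E4 z (I2pi * ((E2 z * E4 z - E6 z) * / 3))%C.
Proof. intros Hz. rewrite <- ramanujan4 by auto. apply Eis_deriv; auto. Qed.
Lemma E6_deriv z : in_H z -> cderiv_at E6 z (I2pi * ((E2 z * E6 z - E4 z * E4 z) * / 2))%C.
Proof. intros Hz. rewrite <- ramanujan6 by auto. apply Eis_deriv; auto. Qed.

Definition modDelta (z : C) : C := ((E4 z * (E4 z * E4 z) - E6 z * E6 z) * / 1728)%C.

Lemma MF_Delta : MF 6 modDelta.
Proof.
  eapply MF_ext; [|apply (MF_scal 6 (/ 1728)%C)]. 2: apply MF_minus.
  2: apply (MF_mult 2 4 E4 _ MF_E4 (MF_mult 2 2 E4 E4 MF_E4 MF_E4)). 2: apply (MF_mult 3 3 E6 E6 MF_E6 MF_E6).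
  intros; unfold modDelta; ring.
Qed.

Lemma HC_Delta : HC modDelta 0.
Proof.
  eapply HC_eq. apply HC_mult; [|apply HC_const]. apply HC_minus. apply HC_mult; [|apply HC_mult]; apply HC_Eis. apply HC_mult; apply HC_Eis. ring.
Qed.

Lemma Delta_deriv z : in_H z -> cderiv_at modDelta z (I2pi * (E2 z * modDelta z))%C.
Proof.
  intros Hz. assert (D4 := E4_deriv z Hz). assert (D6 := E6_deriv z Hz).
  apply (cderiv_ext (fun z => / 1728 * (E4 z * (E4 z * E4 z) + - (1) * (E6 z * E6 z)))%C). intros; unfold modDelta; ring.
  eapply cderiv_eq. apply cderiv_scal. apply (cderiv_plus (fun z => E4 z * (E4 z * E4 z))%C (fun z => - (1) * (E6 z * E6 z))%C).
  apply (cderiv_mult E4 (fun z => E4 z * E4 z)%C). exact D4. apply cderiv_mult; exact D4. apply cderiv_scal. apply cderiv_mult; exact D6.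
  unfold modDelta. field.
Qed.

(** The half plane is convex, so [f] may be followed along a segment; real and imaginary parts are
    1-Lipschitz functionals [P], for which the statement becomes one about real functions. *)
Lemma zero_deriv_const f : (forall z, in_H z -> cderiv_at f z 0) -> forall z w, in_H z -> in_H w -> f z = f w.
Proof.
  intros H z w Hz Hw.
  set (g := fun t : R => (z + t * (w - z))%C).
  assert (HG : forall t, 0 <= t <= 1 -> in_H (g t)).
  { intros t Ht. unfold g, in_H in *. unfold Cminus. rewrite im_plus, im_scal_l, im_plus, im_opp. nra. }
  assert (W := Cmod_ge_0 (w - z)%C).
  assert (D : forall t, 0 <= t <= 1 -> forall eps, 0 < eps -> exists d, 0 < d /\ forall s, Rabs (s - t) < d -> Cmod (f (g s) - f (g t))%C <= eps * Rabs (s - t)).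
  { intros t Ht eps He. destruct (proj1 (cderiv_eps _ _ _) (H (g t) (HG t Ht)) (eps / (Cmod (w - z)%C + 1)) ltac:(apply Rdiv_lt_0_compat; lra)) as [d [Hd H1]].
    exists (d / (Cmod (w - z)%C + 1)). split. apply Rdiv_lt_0_compat; lra. intros s Hs.
    set (h := ((s - t)%R * (w - z))%C).
    assert (CH : Cmod h = Rabs (s - t) * Cmod (w - z)%C) by (unfold h; rewrite Cmod_mult, Cmod_R; auto).
    assert (A0 := Rabs_pos (s - t)). apply Rlt_div_r in Hs; [|lra].
    specialize (H1 h ltac:(rewrite CH; nra)).
    replace (g t + h)%C with (g s) in H1 by (unfold g, h; rewrite RtoC_minus; ring).
    replace (f (g s) - f (g t) - 0 * h)%C with (f (g s) - f (g t))%C in H1 by ring.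
    eapply Rle_trans; [exact H1|]. rewrite CH.
    replace (eps / (Cmod (w - z) + 1) * (Rabs (s - t) * Cmod (w - z))) with (eps * Rabs (s - t) * (Cmod (w - z) / (Cmod (w - z) + 1))) by (field; lra).
    rewrite <- (Rmult_1_r (eps * Rabs (s - t))) at 2. apply Rmult_le_compat_l. nra. apply Rle_div_l; lra. }
  assert (RD : forall P : C -> R, (forall a b, Rabs (P a - P b) <= Cmod (a - b)%C) -> P (f (g 1)) = P (f (g 0))).
  { intros P HP. symmetry. apply (eq_is_derive (fun t => P (f (g t))) 0 1); [|lra]. intros t Ht.
    split. apply is_linear_scal_l. intros x Hx. assert (x = t) as -> by (symmetry; apply (is_filter_lim_locally_unique t x Hx)).
    intros [eps He]. destruct (D t Ht eps He) as [d [Hd H1]]. exists (mkposreal d Hd). intros s Hs. specialize (H1 s Hs).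
    eapply Rle_trans; [|exact H1]. unfold norm, minus, plus, opp, scal, zero; simpl. unfold abs, mult; simpl.
    replace (P (f (g s)) + - P (f (g t)) + - ((s + - t) * 0)) with (P (f (g s)) - P (f (g t))) by ring. apply HP. }
  assert (G0 : g 0 = z) by (unfold g; ring). assert (G1 : g 1 = w) by (unfold g; ring). rewrite <- G0, <- G1. symmetry.
  apply C_eq; apply RD; intros a b.
  - unfold Rminus. rewrite <- re_opp, <- re_plus. apply re_le_Cmod.
  - unfold Rminus. rewrite <- im_opp, <- im_plus. apply im_le_Cmod.
Qed.

(** * The discriminant and the Serre derivative *)

Lemma pbd_shift a : pbd a -> pbd (fun n => a (S n)).
Proof.
  intros [K [p H]]. exists (Rabs K * 2 ^ p), p. intros n. eapply Rle_trans; [apply H|].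
  rewrite Rmult_assoc, <- Rpow_mult_distr. apply Rle_trans with (Rabs K * INR (S (S n)) ^ p).
  apply Rmult_le_compat_r. apply pow_le, pos_INR. apply Rle_abs.
  apply Rmult_le_compat_l. apply Rabs_pos. apply pow_incr. split. apply pos_INR. rewrite !S_INR. assert (T := pos_INR n). lra.
Qed.

Lemma HC_e : HC e 0.
Proof. exists 1. split. lra. intros z Hz. rewrite Csub_0_r, Cmod_e. lra. Qed.

Lemma qser_step a z : pbd a -> in_H z -> qser a z = (a O + e z * qser (fun n => a (S n)) z)%C.
Proof.
  intros P Hz. apply (cser_unique _ _ _ (qser_cser a z P Hz)).
  replace (a O) with (a O * e z ^ 0)%C at 1 by (simpl; ring).
  apply (cser_decr (fun n => a n * e z ^ n)%C).
  eapply cser_ext; [|apply cser_scal, qser_cser; [apply pbd_shift; exact P|exact Hz]]. intros n. cbv beta. rewrite Cpow_S. ring.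
Qed.

Lemma Ecoef_1 c r : Ecoef c r 1 = RtoC c.
Proof.
  unfold Ecoef, Defs.sigma. rewrite sum_Sn, sum_O. unfold plus; simpl. rewrite pow1. f_equal. ring.
Qed.

(** Coefficients of the antiderivative of [E2 - 1] with respect to [q d/dq], so that
    [e (z + eta_X z)] is the 24th power of Dedekind's eta function. *)
Definition eta_b (n : nat) : C := match n with O => RtoC 0 | S _ => (Ecoef (-24) 1 n / INR n)%C end.
Lemma pbd_eta : pbd eta_b.
Proof.
  destruct (pbd_Ecoef (-24) 1) as [K [p H]]. exists (Rabs K), p. intros [|n]; unfold eta_b.
  - rewrite Cmod_0. apply Rmult_le_pos. apply Rabs_pos. apply pow_le, pos_INR.
  - rewrite Cmod_div, Cmod_R, Rabs_right by (try apply INR_S_neq0; apply Rle_ge, pos_INR).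
    assert (P : 1 <= INR (S n)) by (apply (le_INR 1); lia).
    apply Rle_trans with (Cmod (Ecoef (-24) 1 (S n)) * 1). apply Rmult_le_compat_l. apply Cmod_ge_0.
    rewrite <- Rinv_1. apply Rinv_le_contravar; lra.
    rewrite Rmult_1_r. eapply Rle_trans; [apply H|]. apply Rmult_le_compat_r. apply pow_le, pos_INR. apply Rle_abs.
Qed.

Definition eta_X (z : C) : C := (qser eta_b z / I2pi)%C.

Lemma eta_X_deriv z : in_H z -> cderiv_at eta_X z (E2 z - 1)%C.
Proof.
  intros Hz. apply (cderiv_ext (fun z => / I2pi * qser eta_b z)%C). intros; unfold eta_X, Cdiv; ring.
  eapply cderiv_eq. apply cderiv_scal. apply qser_deriv; auto. apply pbd_eta.
  transitivity (qser (fun n => INR n * eta_b n)%C z). field. apply I2pi_neq0.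
  unfold E2. rewrite Eis_qser by auto.
  rewrite (qser_step (Ecoef (-24) 1)) by (auto; apply pbd_Ecoef). rewrite (qser_step (fun n => INR n * eta_b n)%C) by (auto; apply pbd_derive, pbd_eta).
  simpl (INR 0). unfold eta_b at 1. unfold Ecoef at 1.
  replace (qser (fun n => INR (S n) * eta_b (S n))%C z) with (qser (fun n => Ecoef (-24) 1 (S n)) z). ring.
  apply (cser_unique (fun n => Ecoef (-24) 1 (S n) * e z ^ n)%C).
  apply qser_cser; auto. apply pbd_shift, pbd_Ecoef.
  eapply cser_ext; [|apply qser_cser; [exact (pbd_shift (fun n => INR n * eta_b n)%C (pbd_derive _ pbd_eta))|exact Hz]].
  intros n. cbv beta. unfold eta_b. field. apply INR_S_neq0.
Qed.

(** With [E4 = 1 + q a] and [E6 = 1 + q b], the quotient [(E4^3 - E6^2) / q] has constant term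
    [3 * 240 + 2 * 504 = 1728]. *)
Lemma Delta_not_zero : ~ (forall z, in_H z -> modDelta z = RtoC 0).
Proof.
  intros H.
  set (a := qser (fun n => Ecoef 240 3 (S n))). set (b := qser (fun n => Ecoef (-504) 5 (S n))).
  assert (HA : HC a 240) by (eapply HC_eq; [apply HC_qser, pbd_shift, pbd_Ecoef|apply Ecoef_1]).
  assert (HB : HC b (-504)) by (eapply HC_eq; [apply HC_qser, pbd_shift, pbd_Ecoef|apply Ecoef_1]).
  assert (EA : forall z, in_H z -> E4 z = (1 + e z * a z)%C).
  { intros z Hz. unfold E4. rewrite Eis_qser by auto. apply (qser_step (Ecoef 240 3)); auto. apply pbd_Ecoef. }
  assert (EB : forall z, in_H z -> E6 z = (1 + e z * b z)%C).
  { intros z Hz. unfold E6. rewrite Eis_qser by auto. apply (qser_step (Ecoef (-504) 5)); auto. apply pbd_Ecoef. }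
  assert (P1 : HC (fun z => (3 * a z - 2 * b z) + e z * (3 * (a z * a z) + e z * (a z * (a z * a z)) - b z * b z))%C
     ((3 * 240 - 2 * -504) + 0 * (3 * (240 * 240) + 0 * (240 * (240 * 240)) - -504 * -504))%C).
  { apply HC_plus. apply HC_minus; apply HC_scal; auto. apply HC_mult. apply HC_e.
    apply HC_minus; [apply HC_plus|]. apply HC_scal, HC_mult; auto. apply HC_mult. apply HC_e. repeat apply HC_mult; auto. apply HC_mult; auto. }
  assert (P2 : HC (fun z => (3 * a z - 2 * b z) + e z * (3 * (a z * a z) + e z * (a z * (a z * a z)) - b z * b z))%C 0).
  { apply (HC_ext (fun _ => RtoC 0)); [|apply HC_const]. intros z Hz. specialize (H z Hz). unfold modDelta in H. rewrite EA, EB in H by auto.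
    assert (N := e_neq0 z).
    transitivity (1728 / e z * (((1 + e z * a z) * ((1 + e z * a z) * (1 + e z * a z)) - (1 + e z * b z) * (1 + e z * b z)) * / 1728))%C.
    rewrite H. ring. field. auto. }
  assert (E := HC_unique _ _ _ P1 P2). apply (RtoC_neq 1728 0); [lra|]. rewrite <- E. ring.
Qed.

(** [q exp (int (E2 - 1))] has the logarithmic derivative [E2] of [modDelta]; so [modDelta] has no zeros. *)
Theorem Delta_eta : exists c, c <> RtoC 0 /\ forall z, in_H z -> modDelta z = (c * e z * e (eta_X z))%C.
Proof.
  set (F := fun z => (modDelta z * e (- (z + eta_X z)))%C).
  assert (HF : forall z, in_H z -> cderiv_at F z 0).
  { intros z Hz. eapply cderiv_eq. apply cderiv_mult. apply Delta_deriv; auto.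
    apply (cderiv_comp e (fun z => - (z + eta_X z))%C). apply cderiv_e.
    apply (cderiv_ext (fun z => - (1) * (z + eta_X z))%C). intros; ring.
    apply cderiv_scal. apply (cderiv_plus (fun z => z) eta_X). apply cderiv_id. apply eta_X_deriv; auto. cbv beta. ring. }
  set (z0 := (0, 1) : C). assert (H0 : in_H z0) by (unfold in_H; simpl; lra).
  assert (EQ : forall z, in_H z -> modDelta z = (F z0 * e z * e (eta_X z))%C).
  { intros z Hz. rewrite (zero_deriv_const F HF z0 z H0 Hz). unfold F. rewrite <- Cmult_assoc, <- e_plus, e_opp.
    rewrite <- Cmult_assoc. rewrite (Cmult_comm (/ _)). field. apply e_neq0. }
  exists (F z0). split; auto. intros E. apply Delta_not_zero. intros z Hz. rewrite EQ, E by auto. ring.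
Qed.

Lemma Delta_neq0 z : in_H z -> modDelta z <> RtoC 0.
Proof. destruct Delta_eta as [c [Hc H]]. intros Hz. rewrite H by auto. repeat apply Cmult_neq_0; auto using e_neq0. Qed.

(** In the formula of [Delta_eta] the function [eta_X] is bounded for [Im z >= 1], so only the
    factor [e z] decays. *)
Lemma Delta_lower : exists c, 0 < c /\ forall z, 1 <= Im z -> c * exp (- 2 * PI * Im z) <= Cmod (modDelta z).
Proof.
  destruct Delta_eta as [c [Hc H]]. destruct (HC_bounded _ _ (HC_qser eta_b pbd_eta)) as [M [HM B]].
  assert (PI2 := PI2_1).
  exists (Cmod c * exp (- 2 * PI * M)). split. { apply Rmult_lt_0_compat. apply Cmod_gt_0; auto. apply exp_pos. }
  intros z Hz. rewrite H, !Cmod_mult, !Cmod_e by (apply cusp_H; auto).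
  rewrite !Rmult_assoc. apply Rmult_le_compat_l. apply Cmod_ge_0. rewrite Rmult_comm. apply Rmult_le_compat_l. left; apply exp_pos.
  assert (IX : Im (eta_X z) <= M).
  { eapply Rle_trans; [apply Rle_abs|]. eapply Rle_trans; [apply im_le_Cmod|]. unfold eta_X. rewrite Cmod_div by apply I2pi_neq0.
    specialize (B z Hz). assert (L : 1 <= Cmod I2pi). { eapply Rle_trans; [|apply im_le_Cmod]. rewrite I2pi_im. eapply Rle_trans; [|apply Rle_abs]. lra. }
    apply Rle_div_l. lra. assert (T := Cmod_ge_0 (qser eta_b z)). nra. }
  destruct (Req_dec (Im (eta_X z)) M) as [->|N]. lra. left. apply exp_increasing. nra.
Qed.

(** [modDelta] has no zeros in the half plane and vanishes to exactly first order at the cusp, so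
    the quotient stays holomorphic and bounded. This descent drives the later inductions on the
    weight. *)
Theorem divide_Delta v f : MF v f -> HC f 0 -> exists g, MF (v - 6) g /\ forall z, in_H z -> f z = (modDelta z * g z)%C.
Proof.
  intros (H1 & H2 & H3 & _) [K [HK HB]]. destruct Delta_lower as [c [Hc HD]]. destruct MF_Delta as (D1 & D2 & D3 & _).
  exists (fun z => f z * / modDelta z)%C. split; [split; [|split; [|split]]|].
  - apply holo_intro. intros z Hz. destruct (holo_deriv f z H1 Hz) as [l Hl]. eexists. apply cderiv_mult. exact Hl.
    apply cderiv_inv. apply Delta_neq0; auto. apply Delta_deriv; auto.
  - intros z Hz. rewrite H2, D2; auto.
  - intros z Hz. assert (N := in_H_neq0 z Hz). assert (ND := Delta_neq0 z Hz). assert (Z6 := zp_neq0 z 6 N).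
    rewrite H3, D3 by auto. replace v with ((v - 6) + 6)%Z at 1 by lia. rewrite zp_plus by auto. field. auto.
  - exists (K / c). intros z Hz. specialize (HB z Hz). specialize (HD z Hz). rewrite Csub_0_r in HB.
    assert (E := expq_pos (Im z)). set (x := exp (- 2 * PI * Im z)) in *.
    assert (CX : 0 < c * x) by (apply Rmult_lt_0_compat; auto).
    rewrite Cmod_mult, Cmod_inv by (apply Delta_neq0, cusp_H; auto).
    apply Rle_trans with ((K * x) * / (c * x)). apply Rmult_le_compat; auto using Cmod_ge_0. left; apply Rinv_0_lt_compat; lra. apply Rinv_le_contravar; auto.
    right. field. split; lra.
  - intros z Hz. field. apply Delta_neq0; auto.
Qed.

Lemma MF_HC v f : MF v f -> exists c, HC f c.
Proof. intros (H1 & H2 & _ & M & H4). destruct (const_term f M H1 H2 H4) as (c & K & HK & H). exists c, K. auto. Qed.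

(** After multiplication by [modDelta] the weight is still below 12 and the constant term is 0, so
    the vanishing theorem applies. *)
Lemma MF_neg v f : (v < 0)%Z -> MF v f -> forall z, in_H z -> f z = RtoC 0.
Proof.
  intros Hv H z Hz. destruct (MF_HC v f H) as [c Hc].
  assert (H0 : HC (fun z => modDelta z * f z)%C 0) by (eapply HC_eq; [apply (HC_mult _ _ _ _ HC_Delta Hc)|ring]).
  assert (T := vanish (6 + v) (fun z => modDelta z * f z)%C ltac:(lia) (MF_mult _ _ _ _ MF_Delta H) H0 z Hz). cbv beta in T.
  transitivity (/ modDelta z * (modDelta z * f z))%C. field. apply Delta_neq0; auto. rewrite T. ring.
Qed.

(** Low weight forces [f^2 = c^2 E4] and [f^3 = c^3 E6] for the constant term [c]. Comparing sixth
    powers gives [c^6 (E4^3 - E6^2) = 0], and [modDelta] has no zeros, so [c = 0]. *)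
Lemma MF_1 f : MF 1 f -> forall z, in_H z -> f z = RtoC 0.
Proof.
  intros H. destruct (MF_HC 1 f H) as [c Hc].
  assert (A2 : forall z, in_H z -> (f z * f z - (c * c) * E4 z)%C = RtoC 0).
  { apply (vanish 2). lia. apply MF_minus. apply (MF_mult 1 1); auto. apply MF_scal, MF_E4.
    eapply HC_eq. apply HC_minus. apply HC_mult; exact Hc. apply HC_scal, HC_Eis. ring. }
  assert (A3 : forall z, in_H z -> (f z * (f z * f z) - (c * (c * c)) * E6 z)%C = RtoC 0).
  { apply (vanish 3). lia. apply MF_minus. apply (MF_mult 1 2); auto. apply (MF_mult 1 1); auto. apply MF_scal, MF_E6.
    eapply HC_eq. apply HC_minus. apply HC_mult; [|apply HC_mult]; exact Hc. apply HC_scal, HC_Eis. ring. }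
  assert (C0 : c = RtoC 0).
  { destruct (Ceq_dec c 0) as [E|N]; auto. exfalso. set (z0 := (0, 1) : C). assert (H0 : in_H z0) by (unfold in_H; simpl; lra).
    apply (Delta_neq0 z0 H0). unfold modDelta. specialize (A2 z0 H0). specialize (A3 z0 H0). apply Ceq_minus in A2. apply Ceq_minus in A3.
    assert (P6 : (c * c * (c * c * (c * c)))%C <> RtoC 0) by (repeat apply Cmult_neq_0; auto).
    assert (E : (c * c * (c * c * (c * c)) * (E4 z0 * (E4 z0 * E4 z0) - E6 z0 * E6 z0))%C = RtoC 0).
    { transitivity ((c * c * E4 z0) * ((c * c * E4 z0) * (c * c * E4 z0)) - (c * (c * c) * E6 z0) * (c * (c * c) * E6 z0))%C. ring. rewrite <- A2, <- A3. ring. }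
    transitivity (/ (c * c * (c * c * (c * c))) * (c * c * (c * c * (c * c)) * (E4 z0 * (E4 z0 * E4 z0) - E6 z0 * E6 z0)) * / 1728)%C. field; auto. rewrite E; ring. }
  apply (vanish 1); auto. lia. eapply HC_eq; eauto.
Qed.

(** [f'] is the Serre derivative of [f] of weight [2 v]. *)
Definition serre (v : Z) (f f' : C -> C) : Prop :=
  forall z, in_H z -> cderiv_at f z (I2pi * (f' z + RtoC (IZR v / 6) * (E2 z * f z)))%C.

Lemma serre_ext v f g f' g' : (forall z, in_H z -> f z = g z) -> (forall z, in_H z -> f' z = g' z) -> serre v f f' -> serre v g g'.
Proof. intros E E' H z Hz. rewrite <- E, <- E' by auto. apply (cderiv_ext_H f); auto. Qed.

Lemma RtoC_div6 u : RtoC (IZR u / 6) = (IZR u * / 6)%C.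
Proof. rewrite RtoC_div by lra. reflexivity. Qed.

Lemma serre_mult u v f g f' g' : serre u f f' -> serre v g g' ->
  serre (u + v) (fun z => f z * g z)%C (fun z => f' z * g z + f z * g' z)%C.
Proof.
  intros H1 H2 z Hz. eapply cderiv_eq. apply cderiv_mult. apply H1; auto. apply H2; auto.
  cbv beta. rewrite !RtoC_div6, plus_IZR, RtoC_plus. ring.
Qed.

Lemma serre_plus v f g f' g' : serre v f f' -> serre v g g' -> serre v (fun z => f z + g z)%C (fun z => f' z + g' z)%C.
Proof. intros H1 H2 z Hz. eapply cderiv_eq. apply cderiv_plus. apply H1; auto. apply H2; auto. cbv beta. ring. Qed.

Lemma serre_scal v c f f' : serre v f f' -> serre v (fun z => c * f z)%C (fun z => c * f' z)%C.
Proof. intros H z Hz. eapply cderiv_eq. apply cderiv_scal. apply H; auto. cbv beta. ring. Qed.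

Definition MFD (v : Z) (f : C -> C) : Prop := exists f', MF (v + 1) f' /\ serre v f f'.

Lemma MFD_mult u v f g : MF u f -> MF v g -> MFD u f -> MFD v g -> MFD (u + v) (fun z => f z * g z)%C.
Proof.
  intros Hf Hg [f' [F1 F2]] [g' [G1 G2]]. eexists. split; [|apply serre_mult; eauto].
  apply MF_plus. apply (MF_eq (u + 1 + v)). lia. apply MF_mult; auto. apply (MF_eq (u + (v + 1))). lia. apply MF_mult; auto.
Qed.
Lemma MFD_plus v f g : MFD v f -> MFD v g -> MFD v (fun z => f z + g z)%C.
Proof. intros [f' [F1 F2]] [g' [G1 G2]]. eexists. split; [|apply serre_plus; eauto]. apply MF_plus; auto. Qed.
Lemma MFD_scal v c f : MFD v f -> MFD v (fun z => c * f z)%C.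
Proof. intros [f' [F1 F2]]. eexists. split; [|apply serre_scal; eauto]. apply MF_scal; auto. Qed.
Lemma MFD_ext v f g : (forall z, in_H z -> f z = g z) -> MFD v f -> MFD v g.
Proof. intros E [f' [F1 F2]]. exists f'. split; auto. apply (serre_ext v f g f' f'); auto. Qed.
Lemma MFD_eq u v f : u = v -> MFD u f -> MFD v f. Proof. intros ->; auto. Qed.

Lemma MFD_const c : MFD 0 (fun _ => c).
Proof.
  exists (fun _ => RtoC 0). split. apply MF_zero. intros z Hz. eapply cderiv_eq. apply cderiv_const.
  rewrite RtoC_div6. ring.
Qed.
Lemma MFD_zero v : MFD v (fun _ => RtoC 0).
Proof. exists (fun _ => RtoC 0). split. apply MF_zero. intros z Hz. eapply cderiv_eq. apply cderiv_const. ring. Qed.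

Lemma MFD_E4 : MFD 2 E4.
Proof.
  exists (fun z => (- / 3) * E6 z)%C. split. apply MF_scal, MF_E6. intros z Hz. eapply cderiv_eq. apply E4_deriv; auto.
  rewrite RtoC_div6. field.
Qed.
Lemma MFD_E6 : MFD 3 E6.
Proof.
  exists (fun z => (- / 2) * (E4 z * E4 z))%C. split. apply MF_scal. apply (MF_mult 2 2); apply MF_E4. intros z Hz. eapply cderiv_eq. apply E6_deriv; auto.
  rewrite RtoC_div6. field.
Qed.
Lemma MFD_Delta : MFD 6 modDelta.
Proof.
  exists (fun _ => RtoC 0). split. apply MF_zero. intros z Hz. eapply cderiv_eq. apply Delta_deriv; auto.
  rewrite RtoC_div6. field.
Qed.
Lemma MFD_pow v f n : MF v f -> MFD v f -> MFD (Z.of_nat n * v) (fun z => f z ^ n)%C.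
Proof.
  intros H D. induction n. apply (MFD_const 1). apply (MFD_eq (v + Z.of_nat n * v)); [lia|].
  apply (MFD_mult v (Z.of_nat n * v) f (fun z => f z ^ n)%C); auto. apply MF_pow; auto.
Qed.

Definition E46 (a b : nat) (z : C) : C := (E4 z ^ a * E6 z ^ b)%C.
Lemma MF_E46 a b : MF (2 * Z.of_nat a + 3 * Z.of_nat b) (E46 a b).
Proof. eapply MF_eq; [|apply MF_mult; apply MF_pow; [apply MF_E4|apply MF_E6]]. lia. Qed.
Lemma HC_E46 a b : HC (E46 a b) 1.
Proof. eapply HC_eq. apply HC_mult; apply HC_pow; apply HC_Eis. rewrite !Cpow_1_l. ring. Qed.

(** Induction on the weight: subtracting [c E4^a E6^b] removes the constant term, and the rest is
    [modDelta] times a form of smaller weight. The Serre derivatives of [E4], [E6] and [modDelta]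
    being known, boundedness of the derivative at the cusp is inherited from them. *)
Theorem MF_D v f : MF v f -> MFD v f.
Proof.
  enough (G : forall n v f, (v < 6 * Z.of_nat n)%Z -> MF v f -> MFD v f) by (apply (G (S (Z.to_nat v))); lia).
  clear. induction n; intros v f Hv H.
  - apply (MFD_ext v (fun _ => RtoC 0)). intros; symmetry; apply (MF_neg v); auto; lia. apply MFD_zero.
  - destruct (Z.lt_ge_cases v 0) as [L|L].
    { apply (MFD_ext v (fun _ => RtoC 0)). intros; symmetry; apply (MF_neg v); auto; lia. apply MFD_zero. }
    destruct (Z.eq_dec v 1) as [->|N1].
    { apply (MFD_ext 1 (fun _ => RtoC 0)). intros; symmetry; apply MF_1; auto. apply MFD_zero. }
    destruct (MF_HC v f H) as [c Hc].
    (* Every [v >= 0] except 1 has the form [2 a + 3 b]; this is why [v = 1] is removed first. *)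
    assert (AB : exists a b, (2 * Z.of_nat a + 3 * Z.of_nat b = v)%Z).
    { destruct (Z.even v) eqn:EV.
      - exists (Z.to_nat (v / 2)), O. apply Z.even_spec in EV. destruct EV as [k ->]. assert (E : (2 * k / 2 = k)%Z) by (rewrite Z.mul_comm; apply Z.div_mul; lia). rewrite E. lia.
      - exists (Z.to_nat ((v - 3) / 2)), 1%nat. rewrite <- Z.negb_odd in EV. apply Bool.negb_false_iff in EV. apply Z.odd_spec in EV. destruct EV as [k ->].
        replace (2 * k + 1 - 3)%Z with ((k - 1) * 2)%Z by lia. rewrite Z.div_mul by lia. lia. }
    destruct AB as [a [b AB]].
    assert (DAB : MFD v (E46 a b)).
    { eapply MFD_eq; [exact AB|]. eapply MFD_eq; [|apply MFD_mult; [apply MF_pow, MF_E4|apply MF_pow, MF_E6|apply MFD_pow; [apply MF_E4|apply MFD_E4]|apply MFD_pow; [apply MF_E6|apply MFD_E6]]]. lia. }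
    destruct (divide_Delta v (fun z => f z - c * E46 a b z)%C) as [g [G1 G2]].
    { apply MF_minus; auto. apply MF_scal. eapply MF_eq; [exact AB|apply MF_E46]. }
    { eapply HC_eq. apply HC_minus. exact Hc. apply HC_scal, HC_E46. ring. }
    apply (MFD_ext v (fun z => c * E46 a b z + modDelta z * g z)%C). intros z Hz. rewrite <- G2 by auto. ring.
    apply MFD_plus. apply MFD_scal; auto. apply (MFD_eq (6 + (v - 6))). lia. apply MFD_mult; auto using MF_Delta, MFD_Delta. apply IHn; auto. lia.
Qed.

(** * Noetherianity of graded modules over modular forms *)

(** Subsets of N^2 stable under the steps (2,0), (3,0), (0,1) have finitely many minimal elements. *)
Lemma dickson (U : nat -> nat -> Prop) :
  (forall p m, U p m -> U (p + 2)%nat m) -> (forall p m, U p m -> U (p + 3)%nat m) -> (forall p m, U p m -> U p (S m)) ->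
  exists w0, forall p m, U p m -> (w0 <= p + 6 * m)%nat -> ((2 <= p)%nat /\ U (p - 2)%nat m) \/ ((1 <= m)%nat /\ U p (m - 1)%nat).
Proof.
  intros U2 U3 UM.
  (* Steps of 2 and 3 reach every increment from 2 on, but not 1; hence the margins of 2 below. *)
  assert (UJ : forall j p m, U p m -> U (p + j + 2)%nat m).
  { assert (G : forall j, (forall p m, U p m -> U (p + j + 2)%nat m) /\ (forall p m, U p m -> U (p + j + 3)%nat m)).
    { induction j. split; intros; rewrite Nat.add_0_r; auto. destruct IHj as [I1 I2]. split; intros.
      replace (p + S j + 2)%nat with (p + j + 3)%nat by lia; auto.
      replace (p + S j + 3)%nat with (p + j + 2 + 2)%nat by lia; auto. }
    intros j; apply G. }
  assert (UMM : forall k p m, U p m -> U p (m + k)%nat).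
  { induction k; intros. rewrite Nat.add_0_r; auto. rewrite Nat.add_succ_r. auto. }
  destruct (classic (exists p1 m1, U p1 m1)) as [[p1 [m1 H1]]|HN].
  2: { exists O. intros p m H. exfalso. eauto. }
  assert (HP : forall M, exists P, forall m p, (m <= M)%nat -> (P <= p)%nat -> U p m -> (2 <= p)%nat /\ U (p - 2)%nat m).
  { assert (ONE : forall m, exists P, forall p, (P <= p)%nat -> U p m -> (2 <= p)%nat /\ U (p - 2)%nat m).
    { intros m. destruct (classic (exists p0, U p0 m)) as [[p0 H0]|N].
      - exists (p0 + 4)%nat. intros p Hp _. split. lia. replace (p - 2)%nat with (p0 + (p - 4 - p0) + 2)%nat by lia. auto.
      - exists O. intros p _ H. exfalso; eauto. }
    induction M. destruct (ONE O) as [P HP]. exists P. intros m p Hm. replace m with O by lia. apply HP.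
    destruct IHM as [P HP]. destruct (ONE (S M)) as [P' HP']. exists (P + P')%nat. intros m p Hm Hp.
    destruct (Nat.eq_dec m (S M)) as [->|]. apply HP'; lia. apply HP; lia. }
  assert (HQ : forall N, exists Q, forall p m, (p <= N)%nat -> (Q <= m)%nat -> U p m -> (1 <= m)%nat /\ U p (m - 1)%nat).
  { assert (ONE : forall p, exists Q, forall m, (Q <= m)%nat -> U p m -> (1 <= m)%nat /\ U p (m - 1)%nat).
    { intros p. destruct (classic (exists m0, U p m0)) as [[m0 H0]|N].
      - exists (S m0). intros m Hm _. split. lia. replace (m - 1)%nat with (m0 + (m - 1 - m0))%nat by lia. auto.
      - exists O. intros m _ H. exfalso; eauto. }
    induction N. destruct (ONE O) as [P HP']. exists P. intros p m Hm. replace p with O by lia. apply HP'.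
    destruct IHN as [P HP']. destruct (ONE (S N)) as [P' HP'']. exists (P + P')%nat. intros p m Hm Hp.
    destruct (Nat.eq_dec p (S N)) as [->|]. apply HP''; lia. apply HP'; lia. }
  (* [(p1, m1)] is some element of [U]. For [m <= m1] a large weight forces [p] to be large, for
     [p <= p1 + 2] it forces [m] to be large, and every other point lies above [(p1, m1)] with room
     to lower [m]. *)
  destruct (HP m1) as [P HP1]. destruct (HQ (p1 + 2)%nat) as [Q HQ1].
  exists (P + 6 * m1 + p1 + 2 + 6 * Q)%nat. intros p m H Hw.
  destruct (Nat.le_gt_cases m m1) as [L|L]. left. apply HP1; auto; lia.
  destruct (Nat.le_gt_cases p (p1 + 2)) as [L2|L2]. right. apply HQ1; auto; lia.
  right. split. lia. replace (m - 1)%nat with (m1 + (m - 1 - m1))%nat by lia. apply UMM.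
  replace p with (p1 + (p - 2 - p1) + 2)%nat by lia. auto.
Qed.

Section Noether.
Variables (I : Type) (o : I -> Z).
Definition vadd (a b : I -> C -> C) : I -> C -> C := fun i z => (a i z + b i z)%C.
Definition vmul (g : C -> C) (a : I -> C -> C) : I -> C -> C := fun i z => (g z * a i z)%C.

(** Submodules of a direct sum of shifted copies of the ring of modular forms. Only coordinates in
    [l] are constrained, so that coordinates can be discarded one at a time. *)
Record graded_submodule (l : list I) (S : Z -> (I -> C -> C) -> Prop) : Prop := {
  gs_zero : forall w, S w (fun _ _ => RtoC 0);
  gs_add : forall w a b, S w a -> S w b -> S w (vadd a b);
  gs_mul : forall u w g a, MF u g -> S w a -> S (u + w)%Z (vmul g a);
  gs_MF : forall w a i, S w a -> In i l -> MF (w - o i) (a i) }.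

Definition fg_step (S : Z -> (I -> C -> C) -> Prop) (w : Z) (a : I -> C -> C) (P : I -> Prop) :=
  exists b c, S (w - 2)%Z b /\ S (w - 3)%Z c /\ forall i, P i -> forall z, in_H z -> a i z = (E4 z * b i z + E6 z * c i z)%C.

Lemma gs_weight (S : Z -> (I -> C -> C) -> Prop) u w a : u = w -> S u a -> S w a. Proof. intros <-; auto. Qed.

Lemma gs_scal l S w c a : graded_submodule l S -> S w a -> S w (vmul (fun _ => c) a).
Proof. intros HS H. exact (gs_mul l S HS 0 w _ a (MF_const c) H). Qed.

(** A leading-term argument on one coordinate. An element of exponent [(p, m)] is there
    [modDelta^m v] with [v] in [MF p] of constant term 1. Beyond the bound from [dickson], its
    leading term is cancelled by [E4] or [modDelta] times another element of [S]; the second case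
    also lands in [E4 S + E6 S], as [1728 modDelta = E4^3 - E6^2]. *)
Lemma ideal_step l S i : graded_submodule l S -> In i l ->
  exists w0, forall w a, (w0 <= w)%Z -> S w a -> fg_step S w a (fun j => j = i).
Proof.
  intros HS Hi.
  set (U := fun p m : nat => exists a v, S (Z.of_nat p + 6 * Z.of_nat m + o i)%Z a /\ MF (Z.of_nat p) v /\ HC v 1 /\
     forall z, in_H z -> a i z = (modDelta z ^ m * v z)%C).
  assert (HE4 : HC E4 1) by apply HC_Eis. assert (HE6 : HC E6 1) by apply HC_Eis.
  assert (UM : forall j (g : C -> C), MF (Z.of_nat j) g -> HC g 1 -> forall p m, U p m -> U (p + j)%nat m).
  { intros j g Hg Cg p m (a & v & A1 & A2 & A3 & A4). exists (vmul g a), (fun z => g z * v z)%C. split; [|split; [|split]].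
    - eapply (gs_weight S); [|apply (gs_mul l S HS _ _ _ _ Hg A1)]; lia.
    - eapply MF_eq; [|apply (MF_mult _ _ _ _ Hg A2)]. lia.
    - eapply HC_eq. apply (HC_mult _ _ _ _ Cg A3). ring.
    - intros z Hz. unfold vmul. rewrite A4 by auto. ring. }
  destruct (dickson U) as [w0 Hw0].
  - intros p m. apply (UM 2%nat E4 MF_E4 HE4).
  - intros p m. apply (UM 3%nat E6 MF_E6 HE6).
  - intros p m (a & v & A1 & A2 & A3 & A4). exists (vmul modDelta a), v. split; [|split; [|split]]; auto.
    + eapply (gs_weight S); [|apply (gs_mul l S HS _ _ _ _ MF_Delta A1)]; lia.
    + intros z Hz. unfold vmul. rewrite A4 by auto. simpl. ring.
  (* Induction on [p] at constant total weight: each reduction trades [p] for [p - 6] and [m] for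
     [m + 1], until a form of negative weight, hence zero, is left. *)
  - enough (G : forall n p m a v, (p < 6 * Z.of_nat n)%Z -> (Z.of_nat w0 <= p + 6 * Z.of_nat m)%Z -> S (p + 6 * Z.of_nat m + o i)%Z a -> MF p v ->
       (forall z, in_H z -> a i z = (modDelta z ^ m * v z)%C) -> fg_step S (p + 6 * Z.of_nat m + o i) a (fun j => j = i)).
    { exists (Z.of_nat w0 + o i)%Z. intros w a Hw Ha.
      assert (W : (w - o i + 6 * Z.of_nat 0 + o i = w)%Z) by lia. rewrite <- W.
      apply (G (Datatypes.S (Z.to_nat (w - o i))) (w - o i)%Z O a (a i)); try lia.
      rewrite W; auto. apply (gs_MF l S HS); auto. intros; simpl; ring. }
    assert (ZS : forall p m a v, (forall z, in_H z -> a i z = (modDelta z ^ m * v z)%C) -> (forall z, in_H z -> v z = RtoC 0) -> fg_step S (p + 6 * Z.of_nat m + o i) a (fun j => j = i)).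
    { intros p m a v E V0. exists (fun _ _ => RtoC 0), (fun _ _ => RtoC 0). split; [|split]; try apply (gs_zero l S HS).
      intros j -> z Hz. rewrite E, V0 by auto. ring. }
    induction n; intros p m a v Hp Hw Ha Hv E.
    { apply (ZS p m a v E). intros; apply (MF_neg p); auto; lia. }
    destruct (Z.lt_ge_cases p 0) as [L|L]. { apply (ZS p m a v E). intros; apply (MF_neg p); auto; lia. }
    destruct (MF_HC p v Hv) as [c Hc].
    assert (NEXT : forall a' v', S (p + 6 * Z.of_nat m + o i)%Z a' -> MF p v' -> HC v' 0 -> (forall z, in_H z -> a' i z = (modDelta z ^ m * v' z)%C) ->
       fg_step S (p + 6 * Z.of_nat m + o i) a' (fun j => j = i)).
    { intros a' v' Sa' Mv' Hv' E'. destruct (divide_Delta p v' Mv' Hv') as [g [G1 G2]].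
      replace (p + 6 * Z.of_nat m + o i)%Z with ((p - 6) + 6 * Z.of_nat (Datatypes.S m) + o i)%Z in * by lia.
      apply (IHn _ (Datatypes.S m) a' g); auto; try lia. intros z Hz. rewrite E', G2 by auto. simpl. ring. }
    destruct (Ceq_dec c 0) as [->|NC]. apply (NEXT a v); auto.
    assert (Hup : U (Z.to_nat p) m).
    { exists (vmul (fun _ => / c)%C a), (fun z => / c * v z)%C. rewrite Z2Nat.id by lia. split; [|split; [|split]].
      - apply (gs_scal l); auto.
      - apply MF_scal; auto.
      - eapply HC_eq. apply HC_scal; exact Hc. field; auto.
      - intros z Hz. unfold vmul. rewrite E by auto. ring. }
    destruct (Hw0 _ m Hup ltac:(lia)) as [[Hp2 (u & u' & B1 & B2 & B3 & B4)]|[Hm1 (u & u' & B1 & B2 & B3 & B4)]].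
    + assert (B1' : S (p + 6 * Z.of_nat m + o i - 2)%Z u) by (eapply (gs_weight S); [|exact B1]; lia).
      destruct (NEXT (vadd a (vmul (fun _ => - c)%C (vmul E4 u))) (fun z => v z + (- c) * (E4 z * u' z))%C) as (b & d & D1 & D2 & D3).
      * apply (gs_add l S HS); auto. apply (gs_scal l); auto. eapply (gs_weight S); [|apply (gs_mul l S HS _ _ _ _ MF_E4 B1')]; lia.
      * apply MF_plus; auto. apply MF_scal. eapply MF_eq; [|apply (MF_mult _ _ _ _ MF_E4 B2)]. lia.
      * eapply HC_eq. apply HC_plus; [exact Hc|apply HC_scal, HC_mult; [exact HE4|exact B3]]. ring.
      * intros z Hz. unfold vadd, vmul. rewrite E, B4 by auto. ring.
      * exists (vadd b (vmul (fun _ => c) u)), d. split; [|split]; auto.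
        -- apply (gs_add l S HS); auto. apply (gs_scal l); auto. auto.
        -- intros j -> z Hz. specialize (D3 i eq_refl z Hz). unfold vadd, vmul in *.
           transitivity ((a i z + - c * (E4 z * u i z)) + c * (E4 z * u i z))%C. ring. rewrite D3. ring.
    + destruct (NEXT (vadd a (vmul (fun _ => - c)%C (vmul modDelta u))) (fun z => v z + (- c) * u' z)%C) as (b & d & D1 & D2 & D3).
      * apply (gs_add l S HS); auto. apply (gs_scal l); auto. eapply (gs_weight S); [|apply (gs_mul l S HS _ _ _ _ MF_Delta B1)]; lia.
      * apply MF_plus; auto. apply MF_scal. eapply MF_eq; [|exact B2]. lia.
      * eapply HC_eq. apply HC_plus; [exact Hc|apply HC_scal; exact B3]. ring.
      * intros z Hz. unfold vadd, vmul. rewrite E, B4 by auto. replace m with (Datatypes.S (m - 1)) by lia.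
        replace (Datatypes.S (m - 1) - 1)%nat with (m - 1)%nat by lia. simpl. ring.
      (* The multiple [c modDelta u] is redistributed as [E4 (c E4^2 u / 1728) - E6 (c E6 u /
         1728)]. *)
      * exists (vadd b (vmul (fun z => c * / 1728 * (E4 z * E4 z))%C u)), (vadd d (vmul (fun z => - c * / 1728 * E6 z)%C u)). split; [|split].
        -- apply (gs_add l S HS); auto. eapply (gs_weight S); [|apply (gs_mul l S HS 4 _ _ _ (MF_scal 4 (c * / 1728)%C _ (MF_mult 2 2 _ _ MF_E4 MF_E4)) B1)]; lia.
        -- apply (gs_add l S HS); auto. eapply (gs_weight S); [|apply (gs_mul l S HS 3 _ _ _ (MF_scal 3 (- c * / 1728)%C _ MF_E6) B1)]; lia.
        -- intros j -> z Hz. specialize (D3 i eq_refl z Hz). unfold vadd, vmul in *.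
           transitivity ((a i z + - c * (modDelta z * u i z)) + c * (modDelta z * u i z))%C. ring. rewrite D3. unfold modDelta. ring.
Qed.

(** Induction on the coordinates, as for finite sums of noetherian modules: once coordinate [i] is
    written as [E4 b + E6 c], the difference lies in the submodule [S'] of elements vanishing at
    [i]. *)
Theorem noether l : forall S, graded_submodule l S ->
  exists w0, forall w a, (w0 <= w)%Z -> S w a -> fg_step S w a (fun i => In i l).
Proof.
  induction l as [|i l IH]; intros S HS.
  - exists 0%Z. intros w a _ _. exists (fun _ _ => RtoC 0), (fun _ _ => RtoC 0). split; [|split]; try apply (gs_zero _ _ HS). intros j [].
  - destruct (ideal_step (i :: l) S i HS (or_introl eq_refl)) as [w1 H1].
    set (S' := fun w a => S w a /\ forall z, in_H z -> a i z = RtoC 0).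
    destruct (IH S') as [w2 H2].
    { split.
      - intros w. split; auto. apply (gs_zero _ _ HS).
      - intros w a b [A1 A2] [B1 B2]. split. apply (gs_add _ _ HS); auto. intros z Hz. unfold vadd. rewrite A2, B2 by auto. ring.
      - intros u w g a Hg [A1 A2]. split. apply (gs_mul _ _ HS); auto. intros z Hz. unfold vmul. rewrite A2 by auto. ring.
      - intros w a j [A1 A2] Hj. apply (gs_MF _ _ HS); auto. right; auto. }
    exists (Z.max w1 w2). intros w a Hw Ha.
    destruct (H1 w a ltac:(lia) Ha) as (b & c & B1 & B2 & B3).
    assert (E4b : S w (vmul E4 b)) by (eapply (gs_weight S); [|apply (gs_mul _ _ HS _ _ _ _ MF_E4 B1)]; lia).
    assert (E6c : S w (vmul E6 c)) by (eapply (gs_weight S); [|apply (gs_mul _ _ HS _ _ _ _ MF_E6 B2)]; lia).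
    destruct (H2 w (vadd a (vmul (fun _ => - (1))%C (vadd (vmul E4 b) (vmul E6 c)))) ltac:(lia)) as (b' & c' & [B1' Z1] & [B2' Z2] & B3').
    { split. apply (gs_add _ _ HS); auto. apply (gs_scal (i :: l)); auto. apply (gs_add _ _ HS); auto.
      intros z Hz. unfold vadd, vmul. rewrite (B3 i) by auto. ring. }
    exists (vadd b b'), (vadd c c'). split; [|split]; try (apply (gs_add _ _ HS); auto).
    intros j [<-|Hj] z Hz; unfold vadd in *.
    + rewrite Z1, Z2, (B3 i) by auto. ring.
    + specialize (B3' j Hj z Hz). unfold vmul in B3'.
      transitivity ((a j z + - (1) * (E4 z * b j z + E6 z * c j z)) + (E4 z * b j z + E6 z * c j z))%C. ring. rewrite B3'. ring.
Qed.
End Noether.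

(** * Derivation-stable modules and monic MLDEs *)

(** [Dk k f f'] states that [f' = D_k f]. *)
Definition Dk (k : Z) (f f' : C -> C) : Prop :=
  forall z, in_H z -> cderiv_at f z (I2pi * (f' z + RtoC (IZR k / 12) * (E2 z * f z)))%C.

Lemma RtoC_div12 u : RtoC (IZR u / 12) = (IZR u * / 12)%C.
Proof. rewrite RtoC_div by lra. reflexivity. Qed.

Lemma Dk_ext k f g f' g' : (forall z, in_H z -> f z = g z) -> (forall z, in_H z -> f' z = g' z) -> Dk k f f' -> Dk k g g'.
Proof. intros E E' H z Hz. rewrite <- E, <- E' by auto. apply (cderiv_ext_H f); auto. Qed.
Lemma Dk_eq k l f f' g' : k = l -> (forall z, in_H z -> f' z = g' z) -> Dk k f f' -> Dk l f g'.
Proof. intros -> E. apply Dk_ext; auto. Qed.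
Lemma serre_Dk v f f' : serre v f f' -> Dk (2 * v) f f'.
Proof. intros H z Hz. eapply cderiv_eq. apply H; auto. rewrite RtoC_div6, RtoC_div12, mult_IZR, RtoC_mult. field. Qed.
Lemma Dk_mult k l f g f' g' : Dk k f f' -> Dk l g g' ->
  Dk (k + l) (fun z => f z * g z)%C (fun z => f' z * g z + f z * g' z)%C.
Proof.
  intros H1 H2 z Hz. eapply cderiv_eq. apply cderiv_mult. apply H1; auto. apply H2; auto.
  cbv beta. rewrite !RtoC_div12, plus_IZR, RtoC_plus. ring.
Qed.
Lemma Dk_plus k f g f' g' : Dk k f f' -> Dk k g g' -> Dk k (fun z => f z + g z)%C (fun z => f' z + g' z)%C.
Proof. intros H1 H2 z Hz. eapply cderiv_eq. apply cderiv_plus. apply H1; auto. apply H2; auto. cbv beta. ring. Qed.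
Lemma Dk_zero k : Dk k (fun _ => RtoC 0) (fun _ => RtoC 0).
Proof. intros z Hz. eapply cderiv_eq. apply cderiv_const. ring. Qed.
Lemma Dk_psum n k (F F' : nat -> C -> C) : (forall i, (i < n)%nat -> Dk k (F i) (F' i)) ->
  Dk k (fun z => psum (fun i => F i z) n) (fun z => psum (fun i => F' i z) n).
Proof. induction n; simpl; intros H. apply Dk_zero. apply Dk_plus; auto. Qed.
Lemma MF_psum n v (F : nat -> C -> C) : (forall i, (i < n)%nat -> MF v (F i)) -> MF v (fun z => psum (fun i => F i z) n).
Proof. induction n; simpl; intros H. apply MF_zero. apply MF_plus; auto. Qed.

(** Pairs in [l] are (weight, generator); weights are halved, as in [MF]. *)
Inductive span (l : list (Z * (C -> C))) : Z -> (C -> C) -> Prop :=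
| span_gen o v : In (o, v) l -> span l o v
| span_zero w : span l w (fun _ => RtoC 0)
| span_add w f g : span l w f -> span l w g -> span l w (fun z => f z + g z)%C
| span_mul u w g f : MF u g -> span l w f -> span l (u + w) (fun z => g z * f z)%C
| span_ext w f g : (forall z, in_H z -> f z = g z) -> span l w f -> span l w g.

Lemma span_eq l u w f : u = w -> span l u f -> span l w f. Proof. intros ->; auto. Qed.
Lemma span_incl l m w f : incl l m -> span l w f -> span m w f.
Proof.
  intros HI H. induction H. apply span_gen; auto. apply span_zero. apply span_add; auto. apply span_mul; auto.
  eapply span_ext; eauto.
Qed.
Lemma span_psum l w n (F : nat -> C -> C) : (forall i, (i < n)%nat -> span l w (F i)) -> span l w (fun z => psum (fun i => F i z) n).
Proof. induction n; simpl; intros H. apply span_zero. apply span_add; auto. Qed.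

Definition Dstable (k : Z) (l : list (Z * (C -> C))) : Prop :=
  forall o v, In (o, v) l -> exists v', Dk (k + 2 * o) v v' /\ span l (o + 1) v'.

(** [system k f]: [f] lies in the degree-0 part of a finitely generated [D]-stable module whose weights are shifted by [k]. *)
Definition system (k : Z) (f : C -> C) : Prop := exists l, Dstable k l /\ span l 0 f.

Lemma system_ext k f g : (forall z, in_H z -> f z = g z) -> system k f -> system k g.
Proof. intros E (l & H1 & H2). exists l. split; auto. eapply span_ext; eauto. Qed.
Lemma system_eq k l f : k = l -> system k f -> system l f. Proof. intros ->; auto. Qed.

Lemma system_plus k f g : system k f -> system k g -> system k (fun z => f z + g z)%C.
Proof.
  intros (l & H1 & H2) (m & K1 & K2). exists (l ++ m). split.
  - intros o v Hv. apply in_app_iff in Hv. destruct Hv as [Hv|Hv].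
    + destruct (H1 o v Hv) as [v' [D1 D2]]. exists v'. split; auto. eapply span_incl; eauto. apply incl_appl, incl_refl.
    + destruct (K1 o v Hv) as [v' [D1 D2]]. exists v'. split; auto. eapply span_incl; eauto. apply incl_appr, incl_refl.
  - apply span_add; eapply span_incl; eauto. apply incl_appl, incl_refl. apply incl_appr, incl_refl.
Qed.

Definition pair_mul (p : (Z * (C -> C)) * (Z * (C -> C))) : Z * (C -> C) :=
  ((fst (fst p) + fst (snd p))%Z, (fun z => snd (fst p) z * snd (snd p) z)%C).

Lemma span_prod l m w w' f g : span l w f -> span m w' g ->
  span (map pair_mul (list_prod l m)) (w + w') (fun z => f z * g z)%C.
Proof.
  intros H K. induction H.
  - induction K.
    + apply (span_gen _ (o + o0) (fun z => v z * v0 z)%C). apply in_map_iff. exists ((o, v), (o0, v0)). split; auto. apply in_prod; auto.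
    + apply (span_ext _ _ (fun _ => RtoC 0)). intros; ring. apply span_zero.
    + eapply span_ext; [|apply span_add; [apply IHK1|apply IHK2]]. intros; cbv beta; ring.
    + eapply span_ext; [|eapply (span_eq _ (u + (o + w))); [lia|apply span_mul; [eassumption|apply IHK]]]. intros; cbv beta; ring.
    + eapply span_ext; [|apply IHK]. intros; cbv beta; rewrite H0 by auto; ring.
  - apply (span_ext _ _ (fun _ => RtoC 0)). intros; ring. apply span_zero.
  - eapply span_ext; [|apply span_add; [apply IHspan1|apply IHspan2]]. intros; cbv beta; ring.
  - eapply span_ext; [|eapply (span_eq _ (u + (w + w'))); [lia|apply span_mul; [eassumption|apply IHspan]]]. intros; cbv beta; ring.
  - eapply span_ext; [|apply IHspan]. intros; cbv beta; rewrite H by auto; ring.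
Qed.

Lemma system_mult k k' f g : system k f -> system k' g -> system (k + k') (fun z => f z * g z)%C.
Proof.
  intros (l & H1 & H2) (m & K1 & K2). exists (map pair_mul (list_prod l m)). split.
  - intros o v Hv. apply in_map_iff in Hv. destruct Hv as [[[p a] [q b]] [E Hp]].
    apply in_prod_iff in Hp. destruct Hp as [Ha Hb]. unfold pair_mul in E. simpl in E. injection E as <- <-.
    destruct (H1 p a Ha) as [a' [A1 A2]]. destruct (K1 q b Hb) as [b' [B1 B2]].
    exists (fun z => a' z * b z + a z * b' z)%C. split.
    + eapply Dk_eq; [| |apply (Dk_mult _ _ _ _ _ _ A1 B1)]. lia. auto.
    + apply span_add; [apply (span_eq _ (p + 1 + q))|apply (span_eq _ (p + (q + 1)))]; try lia; apply span_prod; auto using span_gen.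
  - apply (span_prod l m 0 0); auto.
Qed.

(** A generator 1 placed in degree [-v] sees the derivation [D_0], which kills it; [f] times this
    generator then lies in degree 0. *)
Lemma system_MF v f : MF v f -> system (2 * v) f.
Proof.
  intros H. exists [((- v)%Z, fun _ => RtoC 1)]. split.
  - intros o u [E|[]]. injection E as <- <-. exists (fun _ => RtoC 0). split; [|apply span_zero].
    intros z Hz. eapply cderiv_eq. apply cderiv_const. replace (2 * v + 2 * - v)%Z with 0%Z by lia.
    rewrite RtoC_div12. ring.
  - eapply span_ext; [|apply (span_eq _ (v + - v)); [lia|apply span_mul; [exact H|apply span_gen; left; reflexivity]]].
    intros; cbv beta; ring.
Qed.

(** [D_1 E2 = - E4 / 12] and [D_(-1) 1 = E2 / 12]. *)
Lemma Dstable_E2 o : Dstable (1 - 2 * o) [(o, E2); ((o - 1)%Z, fun _ => RtoC 1)].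
Proof.
  intros p u [E|[E|[]]]; injection E as <- <-.
  - exists (fun z => (- / 12 * E4 z) * 1)%C. split.
    + intros z Hz. eapply cderiv_eq. apply E2_deriv; auto.
      replace (1 - 2 * o + 2 * o)%Z with 1%Z by lia. rewrite RtoC_div12. field.
    + apply (span_eq _ (2 + (o - 1))); [lia|]. apply (span_mul _ 2 (o - 1) (fun z => - / 12 * E4 z)%C (fun _ => RtoC 1)).
      apply MF_scal, MF_E4. apply span_gen; right; left; reflexivity.
  - exists (fun z => / 12 * E2 z)%C. split.
    + intros z Hz. eapply cderiv_eq. apply cderiv_const.
      replace (1 - 2 * o + 2 * (o - 1))%Z with (-1)%Z by lia. rewrite RtoC_div12.
      replace (IZR (-1)) with (- (1))%R by lra. rewrite RtoC_opp. field.
    + apply (span_eq _ (0 + o)); [lia|]. apply (span_eq _ (0 + (o - 1 + 1))); [lia|].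
      apply (span_mul _ 0 (o - 1 + 1) (fun _ => / 12)%C E2). apply MF_const. apply (span_eq _ o); [lia|]. apply span_gen; left; reflexivity.
Qed.

(** One module serves both this lemma and the next: the shift [o = 0] puts [E2] into degree 0, the
    shift [o = 1] puts 1 there, and the weight changes from 1 to -1. *)
Lemma system_E2 : system 1 E2.
Proof. eexists. split. exact (Dstable_E2 0). apply span_gen; left; reflexivity. Qed.
Lemma system_one : system (-1) (fun _ => RtoC 1).
Proof. eexists. split. exact (Dstable_E2 1). apply span_gen; right; left; reflexivity. Qed.

Lemma system_pow k f n : system k f -> system (Z.of_nat n * k) (fun z => f z ^ n)%C.
Proof.
  intros H. induction n. apply (system_MF 0 (fun _ => RtoC 1)), MF_const.
  apply (system_eq (k + Z.of_nat n * k)); [lia|]. apply (system_mult _ _ _ _ H IHn).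
Qed.

Lemma system_down k l f : (l <= k)%Z -> system k f -> system l f.
Proof.
  intros H S. eapply system_ext; [|eapply (system_eq (Z.of_nat (Z.to_nat (k - l)) * -1 + k)); [lia|]].
  2: apply (system_mult _ _ _ _ (system_pow _ _ (Z.to_nat (k - l)) system_one) S).
  intros; cbv beta. rewrite Cpow_1_l. ring.
Qed.

(** * From the two generators to all of SL(2,Z), and the normal form of an equation *)

Lemma Cpow_double (x : C) n : (x ^ (2 * n))%C = ((x * x) ^ n)%C.
Proof. rewrite Cpow_mult_r. f_equal. simpl. ring. Qed.

Lemma linear_neq0 (c d : Z) z : in_H z -> (c <> 0 \/ d <> 0)%Z -> (IZR c * z + IZR d)%C <> RtoC 0.
Proof.
  intros Hz H E. assert (E1 := f_equal Im E). rewrite im_plus, im_scal_l, !im_RtoC in E1. unfold in_H in Hz.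
  assert (C0 : IZR c = 0) by nra. apply eq_IZR_R0 in C0. subst c.
  assert (E2 := f_equal Re E). rewrite re_plus, re_scal_l, !re_RtoC in E2. destruct H as [H|H]; [lia|].
  apply H, eq_IZR. lra.
Qed.

(** Euclid's algorithm on the first column: with [a = c q + r], the matrix is, up to sign, [T^q S]
    times one whose lower left entry is [r], and [|r| < |c|]. The bound [n] only measures the
    recursion. *)
Lemma modular_SL2 v f : MF v f -> forall n (a b c d : Z) z, (Z.abs_nat c < n)%nat -> (a * d - b * c)%Z = 1%Z -> in_H z ->
  in_H ((IZR a * z + IZR b) / (IZR c * z + IZR d))%C /\
  f ((IZR a * z + IZR b) / (IZR c * z + IZR d))%C = (zp (IZR c * z + IZR d) v * f z)%C.
Proof.
  intros (_ & HP & HS & _). assert (PZ := periodic_Z f HP).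
  assert (HT : forall (m : Z) z, in_H z -> in_H (z + IZR m)%C).
  { unfold in_H. intros m z Hz. rewrite im_plus, im_RtoC. lra. }
  induction n; intros a b c d z Hc Hd Hz; [lia|].
  destruct (Z.eq_dec c 0) as [->|NC].
  - assert (ad : (a * d = 1)%Z) by lia.
    assert (H1 : ((a = 1 /\ d = 1) \/ (a = -1 /\ d = -1))%Z).
    { destruct (Z.mul_eq_1 _ _ ad); subst; lia. }
    destruct H1 as [[-> ->]|[-> ->]].
    + assert (E : ((1 * z + IZR b) / (0 * z + 1))%C = (z + IZR b)%C) by field.
      rewrite E. split. apply HT; auto. rewrite PZ by auto. replace (0 * z + 1)%C with (RtoC 1) by ring.
      unfold zp. rewrite Cmult_1_r, !Cpow_1_l. field.
    + assert (N1 : RtoC (-1) = (- (1))%C) by (rewrite <- RtoC_opp; f_equal; lra).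
      assert (E : ((RtoC (-1) * z + IZR b) / (0 * z + RtoC (-1)))%C = (z + IZR (- b))%C).
      { rewrite N1, opp_IZR, RtoC_opp. field. }
      rewrite E. split. apply HT; auto. rewrite PZ by auto. replace (0 * z + RtoC (-1))%C with (RtoC (-1)) by ring.
      unfold zp. replace (RtoC (-1) * RtoC (-1))%C with (RtoC 1) by (rewrite N1; ring). rewrite !Cpow_1_l. field.
  - set (q := (a / c)%Z). set (r := (a mod c)%Z). assert (Ea : (a = c * q + r)%Z) by (apply Z.div_mod; auto).
    assert (Hr : (Z.abs_nat r < n)%nat) by (assert (T := Z.mod_bound_or c a); assert (T2 := Z.mod_pos_bound a c); assert (T3 := Z.mod_neg_bound a c); fold r in T2, T3; lia).
    clearbody q r. subst a.
    set (b' := (b - q * d)%Z).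
    assert (D' : (- c * b' - - d * r = 1)%Z) by (unfold b'; lia).
    destruct (IHn (- c)%Z (- d)%Z r b' z Hr D' Hz) as [U1 U2].
    assert (NR : (IZR r * z + IZR b')%C <> RtoC 0) by (apply linear_neq0; auto; lia).
    assert (NCD : (IZR c * z + IZR d)%C <> RtoC 0) by (apply linear_neq0; auto; lia).
    set (u := ((IZR (- c) * z + IZR (- d)) / (IZR r * z + IZR b'))%C) in *.
    assert (Eu : (u * (IZR r * z + IZR b'))%C = (- (IZR c * z + IZR d))%C).
    { unfold u. rewrite !opp_IZR, !RtoC_opp. field. auto. }
    assert (NU : u <> RtoC 0) by (apply in_H_neq0; auto).
    assert (E : ((IZR (c * q + r) * z + IZR b) / (IZR c * z + IZR d))%C = (- / u + IZR q)%C).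
    { unfold u. rewrite !opp_IZR, !RtoC_opp. unfold b'. rewrite plus_IZR, mult_IZR, minus_IZR, mult_IZR, RtoC_plus, RtoC_mult, RtoC_minus, RtoC_mult.
      unfold b' in NR. rewrite minus_IZR, mult_IZR, RtoC_minus, RtoC_mult in NR. field. repeat split; auto.
      match goal with |- ?x <> _ => replace x with (- (IZR c * z + IZR d))%C by ring end.
      intros X. apply NCD. transitivity (- - (IZR c * z + IZR d))%C; [ring|rewrite X; ring]. }
    rewrite E. assert (IS := in_H_S u U1). split. apply HT; auto.
    rewrite PZ, HS, U2 by auto. rewrite Cmult_assoc. f_equal.
    clearbody u b'. unfold zp. set (x := (IZR r * z + IZR b')%C) in *. set (y := (IZR c * z + IZR d)%C) in *. clearbody x y.
    assert (Y : (y * y)%C = ((u * u) * (x * x))%C) by (transitivity ((u * x) * (u * x))%C; [rewrite Eu; ring|ring]).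
    rewrite Y, !Cpow_mult_l. field. repeat split; auto using Cpow_nz, Cmult_neq_0.
Qed.

Lemma MF_modular (i : nat) f : MF (Z.of_nat i) f -> modular_form (2 * i) f.
Proof.
  intros H. split; [|split]; try apply H.
  intros a b c d z Hd Hz. destruct (modular_SL2 _ f H _ a b c d z (Nat.lt_succ_diag_r _) Hd Hz) as [_ E].
  rewrite E, zp_nat, <- Cpow_double. reflexivity.
Qed.

Lemma modular_MF (i : nat) f : modular_form (2 * i) f -> MF (Z.of_nat i) f.
Proof.
  intros (H1 & H2 & H3). split; [auto|split; [|split; auto]].
  - intros z Hz. assert (E := H2 1%Z 1%Z 0%Z 1%Z z eq_refl Hz). change (pow_n (K := C_Ring)) with Cpow in E.
    replace ((1 * z + 1) / (0 * z + 1))%C with (z + 1)%C in E by field.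
    replace (0 * z + 1)%C with (RtoC 1) in E by ring. rewrite Cpow_1_l in E. rewrite E. ring.
  - intros z Hz. assert (E := H2 0%Z (-1)%Z 1%Z 0%Z z eq_refl Hz). change (pow_n (K := C_Ring)) with Cpow in E. rewrite Cpow_double in E.
    replace (1 * z + 0)%C with z in E by ring. rewrite zp_nat, <- E. f_equal.
    replace (RtoC (-1)) with (- (1))%C by (rewrite <- RtoC_opp; f_equal; lra). field. apply in_H_neq0; auto.
Qed.

Lemma sum_n_psum (F : nat -> C) n : sum_n F n = psum F (S n).
Proof.
  induction n. rewrite sum_O. simpl. ring. rewrite sum_Sn, IHn. reflexivity.
Qed.

(** The equation solved for its top derivative and indexed by the order [j] of the derivative, so
    that [G j] is [- g_(n - j)]. *)
Definition mlde (k : Z) (f : C -> C) : Prop :=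
  exists (n : nat) (G h : nat -> C -> C),
    (forall j, (j < n)%nat -> MF (Z.of_nat n - Z.of_nat j) (G j)) /\
    (forall z, in_H z -> h O z = f z) /\
    (forall j, (j < n)%nat -> Dk (k + 2 * Z.of_nat j) (h j) (h (S j))) /\
    (forall z, in_H z -> h n z = psum (fun j => G j z * h j z)%C n).

Lemma mlde_iff k f : satisfies_MLDE k f <-> mlde k f.
Proof.
  assert (E : forall (h : nat -> C -> C) (g : nat -> C -> C) n z,
    sum_n (fun i => if (1 <=? i)%nat then Cmult (g i z) (h (n - i)%nat z) else RtoC 0) n = psum (fun j => g (n - j)%nat z * h j z)%C n).
  { intros h g n z. rewrite sum_n_psum, psum_shift, (psum_rev (fun j => g (n - j)%nat z * h j z)%C).
    simpl. rewrite Cplus_0_l. apply psum_ext. intros j Hj. f_equal; f_equal; lia. }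
  split.
  - intros (n & g & h & H1 & H2 & H3 & H4). exists n, (fun j z => - (1) * g (n - j)%nat z)%C, h. split; [|split; [exact H2|split; [exact H3|]]].
    + intros j Hj. apply MF_scal. apply (MF_eq (Z.of_nat (n - j))). lia. apply modular_MF, H1. lia.
    + intros z Hz. specialize (H4 z Hz). rewrite E in H4.
      transitivity ((h n z + psum (fun j => g (n - j)%nat z * h j z) n) + (- (1)) * psum (fun j => g (n - j)%nat z * h j z) n)%C. ring.
      rewrite H4, <- psum_scal, Cplus_0_l. apply psum_ext. intros; ring.
  - intros (n & G & h & H1 & H2 & H3 & H4). exists n, (fun i z => - (1) * G (n - i)%nat z)%C, h. split; [|split; [exact H2|split; [exact H3|]]].
    + intros i Hi. apply MF_modular, MF_scal. apply (MF_eq (Z.of_nat n - Z.of_nat (n - i))). lia. apply H1. lia.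
    + intros z Hz. rewrite (E h (fun i z => - (1) * G (n - i)%nat z)%C), H4, <- psum_plus by auto.
      transitivity (psum (fun _ => 0 * 0)%C n). apply psum_ext. intros j Hj. replace (n - (n - j))%nat with j by lia. ring.
      rewrite psum_scal. ring.
Qed.

Lemma mlde_system k f : mlde k f -> system k f.
Proof.
  intros (n & G & h & H1 & H2 & H3 & H4).
  set (l := map (fun j => (Z.of_nat j, h j)) (seq 0 n)).
  assert (GEN : forall j, (j < n)%nat -> span l (Z.of_nat j) (h j)).
  { intros j Hj. apply span_gen. apply in_map_iff. exists j. split; auto. apply in_seq. lia. }
  assert (LAST : span l (Z.of_nat n) (h n)).
  { apply (span_ext _ _ (fun z => psum (fun j => G j z * h j z)%C n)). intros; symmetry; auto.
    apply (span_psum _ _ _ (fun j z => G j z * h j z)%C). intros j Hj.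
    apply (span_eq _ (Z.of_nat n - Z.of_nat j + Z.of_nat j)); [lia|]. apply span_mul; auto. }
  exists l. split.
  - intros o v Hv. apply in_map_iff in Hv. destruct Hv as [j [E Hj]]. injection E as <- <-. apply in_seq in Hj.
    exists (h (S j)). split. apply H3; lia. apply (span_eq _ (Z.of_nat (S j))); [lia|].
    destruct (Nat.eq_dec (S j) n) as [->|]; auto. apply GEN; lia.
  - apply (span_ext _ _ (h O)); auto. destruct n; auto. apply (GEN O). lia.
Qed.

Lemma psum_comm (F : nat -> nat -> C) m n : psum (fun i => psum (F i) m) n = psum (fun j => psum (fun i => F i j) n) m.
Proof.
  induction n; simpl. transitivity (psum (fun _ => 0 * 0)%C m). rewrite psum_scal; ring. apply psum_ext; intros; ring.
  rewrite IHn, <- psum_plus. reflexivity.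
Qed.

Lemma psum_pick (F : nat -> C) i n : (i < n)%nat -> psum (fun j => (if (j =? i)%nat then RtoC 1 else RtoC 0) * F j)%C n = F i.
Proof.
  induction n; intros H; [lia|]. simpl. destruct (Nat.eqb_spec n i) as [->|N].
  - transitivity (psum (fun _ => 0 * 0)%C i + 1 * F i)%C. f_equal. apply psum_ext. intros k Hk.
    destruct (Nat.eqb_spec k i); [lia|ring]. rewrite psum_scal. ring.
  - rewrite IHn by lia. ring.
Qed.

Lemma span_coef l w f : span l w f -> exists a : nat -> C -> C,
  (forall i, (i < length l)%nat -> MF (w - fst (nth i l (0%Z, fun _ => RtoC 0))) (a i)) /\
  forall z, in_H z -> f z = psum (fun i => a i z * snd (nth i l (0%Z, fun _ => RtoC 0)) z)%C (length l).
Proof.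
  intros H. induction H.
  - apply (In_nth _ _ (0%Z, fun _ => RtoC 0)) in H. destruct H as [i [Hi E]].
    exists (fun j _ => if (j =? i)%nat then RtoC 1 else RtoC 0). split.
    + intros j Hj. destruct (Nat.eqb_spec j i) as [->|]. rewrite E. simpl. rewrite Z.sub_diag. apply MF_const. apply MF_zero.
    + intros z Hz. rewrite (psum_pick (fun j => snd (nth j l (0%Z, fun _ => RtoC 0)) z)) by auto. rewrite E. reflexivity.
  - exists (fun _ _ => RtoC 0). split. intros; apply MF_zero. intros. rewrite psum_scal. ring.
  - destruct IHspan1 as [a [A1 A2]], IHspan2 as [b [B1 B2]]. exists (fun i z => a i z + b i z)%C. split.
    + intros; apply MF_plus; auto.
    + intros z Hz. rewrite A2, B2, <- psum_plus by auto. apply psum_ext. intros; ring.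
  - destruct IHspan as [a [A1 A2]]. exists (fun i z => g z * a i z)%C. split.
    + intros i Hi. eapply MF_eq; [|apply MF_mult; eauto]. lia.
    + intros z Hz. rewrite A2, <- psum_scal by auto. apply psum_ext. intros; ring.
  - destruct IHspan as [a [A1 A2]]. exists a. split; auto. intros. rewrite <- H by auto. auto.
Qed.

(** Coordinates of a derivative are not unique, since the generators may satisfy relations; a
    coherent sequence of coordinate vectors has to be chosen step by step. *)
Lemma dependent_choice {X : Type} (P : nat -> X -> Prop) (R : nat -> X -> X -> Prop) x0 :
  P O x0 -> (forall n x, P n x -> exists y, P (S n) y /\ R n x y) ->
  exists E, E O = x0 /\ forall n, P n (E n) /\ R n (E n) (E (S n)).
Proof.
  intros H0 HS.
  set (E := fix E n := match n with O => x0 | S m => epsilon (inhabits x0) (fun y => P (S m) y /\ R m (E m) y) end).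
  assert (HP : forall n, P n (E n)).
  { induction n. exact H0. destruct (epsilon_spec (inhabits x0) _ (HS n (E n) IHn)). assumption. }
  exists E. split; auto. intros n. split; auto. apply (epsilon_spec (inhabits x0) _ (HS n (E n) (HP n))).
Qed.

Inductive generated (e : nat -> nat -> C -> C) : Z -> (nat -> C -> C) -> Prop :=
| gen_gen j : generated e (Z.of_nat j) (e j)
| gen_zero w : generated e w (fun _ _ => RtoC 0)
| gen_add w a b : generated e w a -> generated e w b -> generated e w (vadd nat a b)
| gen_mul u w g a : MF u g -> generated e w a -> generated e (u + w) (vmul nat g a).

(** Coefficients of [e j] with [j > w] have negative weight and vanish. This is what keeps elements
    of weight [m - 2] and [m - 3] among combinations of the predecessors of [e m]. *)
Lemma generated_coef e w a : generated e w a -> forall n, (w < Z.of_nat n)%Z -> exists g : nat -> C -> C,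
  (forall j, (j < n)%nat -> MF (w - Z.of_nat j) (g j)) /\
  forall i z, in_H z -> a i z = psum (fun j => g j z * e j i z)%C n.
Proof.
  intros H. induction H; intros n Hn.
  - exists (fun k _ => if (k =? j)%nat then RtoC 1 else RtoC 0). split.
    + intros k Hk. destruct (Nat.eqb_spec k j) as [->|]. rewrite Z.sub_diag. apply MF_const. apply MF_zero.
    + intros i z Hz. rewrite (psum_pick (fun j => e j i z)) by lia. reflexivity.
  - exists (fun _ _ => RtoC 0). split. intros; apply MF_zero. intros. rewrite psum_scal. ring.
  - destruct (IHgenerated1 n Hn) as [g [A1 A2]], (IHgenerated2 n Hn) as [g' [B1 B2]]. exists (fun i z => g i z + g' i z)%C. split.
    + intros; apply MF_plus; auto.
    + intros i z Hz. unfold vadd. rewrite A2, B2, <- psum_plus by auto. apply psum_ext. intros; ring.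
  - destruct (Z.lt_ge_cases u 0) as [L|L].
    + exists (fun _ _ => RtoC 0). split. intros; apply MF_zero. intros. unfold vmul. rewrite (MF_neg u g), psum_scal by auto. ring.
    + destruct (IHgenerated n ltac:(lia)) as [h [A1 A2]]. exists (fun i z => g z * h i z)%C. split.
      * intros i Hi. eapply MF_eq; [|apply MF_mult; eauto]. lia.
      * intros i z Hz. unfold vmul. rewrite A2, <- psum_scal by auto. apply psum_ext. intros; ring.
Qed.

(** The derivatives [e j] of the coordinate vector of [f] generate a submodule of a noetherian graded module,
    in which every element of large weight lies in [E4 S + E6 S]; hence some [e n] is a combination of its predecessors. *)
Theorem system_mlde k f : system k f -> mlde k f.
Proof.
  intros (l & HD & Hf).
  set (n := length l). set (o := fun i => fst (nth i l (0%Z, fun _ => RtoC 0))). set (v := fun i => snd (nth i l (0%Z, fun _ => RtoC 0))).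
  assert (HA : forall i, exists a, (i < n)%nat -> (forall j, (j < n)%nat -> MF (o i + 1 - o j) (a j)) /\
     Dk (k + 2 * o i) (v i) (fun z => psum (fun j => a j z * v j z)%C n)).
  { intros i. destruct (Nat.lt_ge_cases i n) as [L|L].
    - destruct (HD (o i) (v i)) as [v' [D1 D2]].
      { unfold o, v. rewrite <- surjective_pairing. apply nth_In; auto. }
      destruct (span_coef _ _ _ D2) as [a [A1 A2]]. exists a. intros _. split. auto.
      eapply Dk_eq; [reflexivity|exact A2|exact D1].
    - exists (fun _ _ => RtoC 0). lia. }
  apply choice in HA. destruct HA as [A HA].
  destruct (span_coef _ _ _ Hf) as [a0 [A1 A2]]. fold n in A1, A2.
  destruct (dependent_choice (fun w (e : nat -> C -> C) => forall i, (i < n)%nat -> MF (Z.of_nat w - o i) (e i))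
    (fun w e e' => Dk (k + 2 * Z.of_nat w) (fun z => psum (fun i => e i z * v i z)%C n) (fun z => psum (fun i => e' i z * v i z)%C n)) a0)
    as [E [E0 HE]].
  { exact A1. }
  { intros w e He.
    assert (HX : forall i, exists e', (i < n)%nat -> MF (Z.of_nat w - o i + 1) e' /\ serre (Z.of_nat w - o i) (e i) e').
    { intros i. destruct (Nat.lt_ge_cases i n) as [L|L]. destruct (MF_D _ _ (He i L)) as [e' X]. exists e'; auto. exists (fun _ => RtoC 0); lia. }
    apply choice in HX. destruct HX as [e' He'].
    (* The connection on coordinates: the Serre derivatives of the coefficients, plus the
       coefficients applied to the matrix [A] of [D] on the generators. *)
    exists (fun i z => e' i z + psum (fun j => e j z * A j i z) n)%C. split.
    - intros i Hi. apply MF_plus. eapply MF_eq; [|apply He'; auto]. lia.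
      apply (MF_psum n _ (fun j z => e j z * A j i z)%C). intros j Hj.
      eapply MF_eq; [|apply MF_mult; [apply He; auto|apply HA; auto]]. lia.
    - eapply Dk_eq; [reflexivity| |apply (Dk_psum n _ (fun i z => e i z * v i z)%C (fun i z => e' i z * v i z + e i z * psum (fun j => A i j z * v j z) n)%C)].
      + intros z Hz. cbv beta. rewrite psum_plus.
        transitivity (psum (fun i => e' i z * v i z) n + psum (fun i => psum (fun j => e j z * A j i z) n * v i z) n)%C.
        2: { rewrite <- psum_plus. apply psum_ext. intros; ring. }
        f_equal.
        transitivity (psum (fun i => psum (fun j => e i z * A i j z * v j z) n) n)%C.
        { apply psum_ext. intros. rewrite <- psum_scal. apply psum_ext. intros; ring. }
        rewrite psum_comm. apply psum_ext. intros i Hi. rewrite Cmult_comm, <- psum_scal. apply psum_ext. intros; ring.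
      + intros i Hi. eapply Dk_eq; [|intros; reflexivity|apply Dk_mult; [apply serre_Dk, He'; auto|apply HA; auto]]. lia. }
  assert (HG : graded_submodule nat o (seq 0 n) (generated E)).
  { split. apply gen_zero. apply gen_add. apply gen_mul.
    intros w a i H Hi. apply in_seq in Hi. induction H.
    - apply HE; lia.
    - apply MF_zero.
    - apply MF_plus; auto.
    - eapply MF_eq; [|apply MF_mult; eauto]. lia. }
  destruct (noether _ _ _ _ HG) as [w0 Hw0].
  set (m := Z.to_nat w0).
  destruct (Hw0 (Z.of_nat m) (E m) ltac:(lia) (gen_gen E m)) as (b & c & B1 & B2 & B3).
  destruct (generated_coef _ _ _ B1 m ltac:(lia)) as [p [P1 P2]].
  destruct (generated_coef _ _ _ B2 m ltac:(lia)) as [q [Q1 Q2]].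
  exists m, (fun j z => E4 z * p j z + E6 z * q j z)%C, (fun j z => psum (fun i => E j i z * v i z)%C n).
  split; [|split; [|split]].
  - intros j Hj. apply MF_plus. eapply MF_eq; [|apply MF_mult; [apply MF_E4|apply P1; auto]]. lia.
    eapply MF_eq; [|apply MF_mult; [apply MF_E6|apply Q1; auto]]. lia.
  - intros z Hz. rewrite E0. symmetry; apply A2; auto.
  - intros j Hj. apply HE.
  - intros z Hz.
    transitivity (psum (fun i => psum (fun j => (E4 z * p j z + E6 z * q j z) * (E j i z * v i z)) m)%C n).
    + apply psum_ext. intros i Hi. rewrite B3, P2, Q2 by (auto; apply in_seq; lia).
      rewrite <- !psum_scal, <- psum_plus, Cmult_comm, <- psum_scal. apply psum_ext. intros; ring.
    + rewrite psum_comm. apply psum_ext. intros. rewrite <- psum_scal. reflexivity.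
Qed.

(** * Algebraic independence of E2, E4, E6 *)

(** Synthetic division by [y - r]. Recording [b n = a (S n)] carries the top coefficient through the
    induction in [poly_zero]. *)
Lemma poly_factor n : forall (a : nat -> C) r, exists b : nat -> C, b n = a (S n) /\
  forall y, psum (fun i => a i * y ^ i)%C (S (S n)) = (psum (fun i => a i * r ^ i) (S (S n)) + (y - r) * psum (fun i => b i * y ^ i) (S n))%C.
Proof.
  induction n; intros a r.
  - exists (fun _ => a 1%nat). split; auto. intros y. simpl. ring.
  - destruct (IHn (fun i => a (S i)) r) as [b [B1 B2]].
    exists (fun i => match i with O => psum (fun i => a (S i) * r ^ i)%C (S (S n)) | S i => b i end). split; auto.
    assert (SH : forall (c : nat -> C) y m, psum (fun i => c i * y ^ i)%C (S m) = (c O + y * psum (fun i => c (S i) * y ^ i) m)%C).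
    { intros c y m. rewrite psum_shift, <- psum_scal. f_equal. simpl; ring. apply psum_ext. intros. rewrite Cpow_S. ring. }
    intros y. rewrite (SH a y), (SH a r), (B2 y).
    rewrite (SH (fun i => match i with O => _ | S i => b i end) y (S n)). ring.
Qed.

Lemma poly_zero n : forall (a : nat -> C) (y : nat -> C), (forall i j, y i = y j -> i = j) ->
  (forall k, psum (fun i => a i * y k ^ i)%C (S n) = RtoC 0) -> a n = RtoC 0.
Proof.
  induction n; intros a y HI H.
  - specialize (H O). simpl in H. rewrite <- H. ring.
  - destruct (poly_factor n a (y O)) as [b [B1 B2]]. rewrite <- B1. apply (IHn b (fun k => y (S k))).
    + intros i j E. apply HI in E. lia.
    + intros k. specialize (B2 (y (S k))). rewrite !H in B2.
      assert (NE : (y (S k) - y O)%C <> RtoC 0). { intros X. apply Ceq_minus, HI in X. lia. }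
      transitivity (/ (y (S k) - y O) * (0 + (y (S k) - y O) * psum (fun i => b i * y (S k) ^ i) (S n)))%C. field; auto.
      rewrite <- B2. ring.
Qed.

Lemma zp_split z (v : Z) (i : nat) : z <> RtoC 0 -> (zp z (v - Z.of_nat i) * (z ^ 2) ^ i)%C = zp z v.
Proof.
  intros H. replace v with ((v - Z.of_nat i) + Z.of_nat i)%Z at 2 by lia. rewrite zp_plus, zp_nat by auto.
  replace (z ^ 2)%C with (z * z)%C by (simpl; ring). reflexivity.
Qed.

(** Applying the weight-[2 v] slash action of [z |-> -1/(z + n)] turns the relation at [z] into a polynomial
    relation in [E2 z + 12 / (2 pi i (z + n))], for every [n]. *)
Theorem E2_transcendental n v (phi : nat -> C -> C) :
  (forall i, (i <= n)%nat -> MF (v - Z.of_nat i) (phi i)) ->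
  (forall z, in_H z -> psum (fun i => phi i z * E2 z ^ i)%C (S n) = RtoC 0) ->
  forall z, in_H z -> phi n z = RtoC 0.
Proof.
  intros HM H z Hz.
  assert (HT : forall k : nat, in_H (z + IZR (Z.of_nat k))%C) by (intros; unfold in_H; rewrite im_plus, im_RtoC; unfold in_H in Hz; lra).
  assert (NI := I2pi_neq0).
  apply (poly_zero n (fun i => phi i z) (fun k => E2 z + 12 / (I2pi * (z + IZR (Z.of_nat k))))%C).
  - intros i j E. assert (Ni := in_H_neq0 _ (HT i)). assert (Nj := in_H_neq0 _ (HT j)).
    set (a := (z + IZR (Z.of_nat i))%C) in *. set (b := (z + IZR (Z.of_nat j))%C) in *.
    assert (E1 : a = b).
    { assert (N12 : RtoC 12 <> RtoC 0) by (apply RtoC_neq; lra).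
      assert (E' : (12 / (I2pi * a))%C = (12 / (I2pi * b))%C).
      { transitivity (- E2 z + (E2 z + 12 / (I2pi * a)))%C. ring. rewrite E. ring. }
      transitivity (12 / (I2pi * (12 / (I2pi * a))))%C. field; auto. rewrite E'. field; auto. }
    unfold a, b in E1. assert (E2 : RtoC (IZR (Z.of_nat i)) = RtoC (IZR (Z.of_nat j))).
    { transitivity (- z + (z + IZR (Z.of_nat i)))%C. ring. rewrite E1. ring. }
    apply RtoC_inj, eq_IZR in E2. lia.
  - intros k. set (u := (z + IZR (Z.of_nat k))%C). assert (Hu : in_H u) by apply HT. assert (Nu := in_H_neq0 u Hu).
    assert (E := H (- / u)%C (in_H_S u Hu)).
    apply (f_equal (fun x => / zp u v * x)%C) in E. rewrite Cmult_0_r, <- psum_scal in E. rewrite <- E.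
    apply psum_ext. intros i Hi. destruct (HM i ltac:(lia)) as (_ & P1 & P2 & _).
    assert (EE : E2 u = E2 z) by (apply (periodic_Z E2); [apply Eis_T|auto]).
    assert (EP : phi i u = phi i z) by (apply (periodic_Z (phi i) P1); auto).
    rewrite P2, E2_S, EE, EP by auto.
    replace (u ^ 2 * E2 z + 12 * u / I2pi)%C with (u ^ 2 * (E2 z + 12 / (I2pi * u)))%C by (simpl; field; auto).
    rewrite Cpow_mult_l, <- (zp_split u v i) by auto.
    assert (N2 : (u ^ 2)%C <> RtoC 0) by (apply Cpow_nz; auto).
    assert (N3 := Cpow_nz _ i N2). assert (N4 := zp_neq0 u (v - Z.of_nat i) Nu).
    set (X := zp u (v - Z.of_nat i)) in *. set (Y := ((u ^ 2) ^ i)%C) in *. clearbody X Y. field. auto.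
Qed.

(** The constant term of [f] must vanish because that of [g] is 1; dividing by [modDelta] and
    repeating lowers the weight until it is negative. *)
Lemma MF_cancel g v f : HC g 1 -> MF v f -> (forall z, in_H z -> (g z * f z)%C = RtoC 0) -> forall z, in_H z -> f z = RtoC 0.
Proof.
  intros Hg. enough (G : forall n v f, (v < 6 * Z.of_nat n)%Z -> MF v f -> (forall z, in_H z -> (g z * f z)%C = RtoC 0) -> forall z, in_H z -> f z = RtoC 0)
    by (apply (G (S (Z.to_nat v)) v); lia).
  clear - Hg. induction n; intros v f Hv Hf H. apply (MF_neg v); auto; lia.
  destruct (MF_HC v f Hf) as [c Hc].
  assert (c = 0)%C as ->.
  { apply (HC_unique (fun z => g z * f z)%C). eapply HC_eq; [apply HC_mult; eauto|ring].
    apply (HC_ext (fun _ => RtoC 0)). intros; symmetry; auto. apply HC_const. }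
  destruct (divide_Delta v f Hf Hc) as [h [H1 H2]].
  assert (Z0 : forall z, in_H z -> h z = RtoC 0).
  { apply (IHn (v - 6)%Z); auto. lia. intros z Hz. transitivity (/ modDelta z * (g z * f z))%C.
    rewrite H2 by auto. field. apply Delta_neq0; auto. rewrite H by auto. ring. }
  intros z Hz. rewrite H2, Z0 by auto. ring.
Qed.

(** [Ci] is fixed by inversion and [Ci^6 = -1], so [E6] vanishes there; [E4] cannot vanish as well,
    since [modDelta] has no zeros. *)
Lemma E6_i : E6 Ci = RtoC 0 /\ E4 Ci <> RtoC 0.
Proof.
  assert (HI : in_H Ci) by (unfold in_H; simpl; lra).
  assert (Z6 : E6 Ci = RtoC 0).
  { destruct MF_E6 as (_ & _ & HS & _). specialize (HS Ci HI). replace (- / Ci)%C with Ci in HS by (apply C_eq; simpl; field).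
    change 3%Z with (Z.of_nat 3) in HS. rewrite zp_nat in HS.
    replace ((Ci * Ci) ^ 3)%C with (- (1))%C in HS by (apply C_eq; simpl; ring).
    transitivity (/ 2 * (E6 Ci + E6 Ci))%C. field. rewrite HS at 2. ring. }
  split; auto. intros Z4. apply (Delta_neq0 Ci HI). unfold modDelta. rewrite Z6, Z4. ring.
Qed.

Lemma psum_single (F : nat -> C) j n : (j < n)%nat -> (forall i, (i < n)%nat -> i <> j -> F i = RtoC 0) -> psum F n = F j.
Proof.
  intros Hj H. rewrite <- (psum_pick F j n Hj). apply psum_ext. intros i Hi.
  destruct (Nat.eqb_spec i j) as [->|]. ring. rewrite H by auto. ring.
Qed.

(** Evaluate at [i], where [E6] vanishes and [E4] does not, then divide by [E6]. *)
Theorem E4_E6_independent m n : forall v (a : nat -> nat -> C),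
  (forall c b, a c b <> RtoC 0 -> (2 * Z.of_nat b + 3 * Z.of_nat c = v)%Z) ->
  (forall z, in_H z -> psum (fun c => psum (fun b => a c b * E46 b c z) m)%C n = RtoC 0) ->
  forall c b, (c < n)%nat -> (b < m)%nat -> a c b = RtoC 0.
Proof.
  destruct E6_i as [Z6 N4]. assert (HI : in_H Ci) by (unfold in_H; simpl; lra).
  induction n; intros v a Hw H c b Hc Hb; [lia|].
  assert (SH : forall z, psum (fun c => psum (fun b => a c b * E46 b c z) m)%C (S n) =
     (psum (fun b => a O b * E46 b 0 z) m + E6 z * psum (fun c => psum (fun b => a (S c) b * E46 b c z) m) n)%C).
  { intros z. rewrite psum_shift, <- psum_scal. f_equal. apply psum_ext. intros. rewrite <- psum_scal. apply psum_ext. intros.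
    unfold E46. rewrite (Cpow_S (E6 z)). ring. }
  assert (A0 : forall b, (b < m)%nat -> a O b = RtoC 0).
  (* At fixed weight and [c = 0] at most one exponent [b] carries a nonzero coefficient, so the
     value at [Ci] is a single term. *)
  { clear b Hb. intros b Hb. apply NNPP. intros NZ. assert (E := H Ci HI). rewrite SH, Z6, (psum_single _ b) in E; auto.
    - assert (E0 : E46 b 0 Ci = (E4 Ci ^ b)%C) by (unfold E46; simpl; ring). rewrite E0, Cmult_0_l, Cplus_0_r in E.
      apply NZ. transitivity (/ (E4 Ci ^ b) * (a O b * E4 Ci ^ b))%C. field. apply Cpow_nz; auto. rewrite E. ring.
    - intros i Hi Hib. destruct (classic (a O i = RtoC 0)) as [->|Ni]. ring. apply Hw in Ni. apply Hw in NZ. lia. }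
  destruct c as [|c]; auto.
  apply (IHn (v - 3)%Z (fun c b => a (S c) b)); try lia.
  - intros c' b' N. apply Hw in N. lia.
  - apply (MF_cancel E6 (v - 3)%Z). apply HC_Eis.
    + apply (MF_psum n _ (fun c z => psum (fun b => a (S c) b * E46 b c z) m)%C). intros c' _.
      apply (MF_psum m _ (fun b z => a (S c') b * E46 b c' z)%C). intros b' _.
      destruct (classic (a (S c') b' = RtoC 0)) as [->|N].
      * apply (MF_ext _ (fun _ => RtoC 0)). intros; ring. apply MF_zero.
      * apply MF_scal. eapply MF_eq; [|apply MF_E46]. apply Hw in N. lia.
    + intros z Hz. assert (E := H z Hz). rewrite SH in E.
      replace (psum (fun b => a O b * E46 b 0 z)%C m) with (RtoC 0) in E. rewrite Cplus_0_l in E. exact E.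
      rewrite <- (psum_zero m). apply psum_ext. intros k Hk. rewrite A0 by auto. ring.
Qed.

(** * The upper bound on weights *)

(** Its span in degree [w] consists of the quasimodular forms of weight [2 w] and depth below
    [s]. *)
Definition E2pows (s : nat) : list (Z * (C -> C)) := map (fun i => (Z.of_nat i, fun z => (E2 z ^ i)%C)) (seq 0 s).

Lemma E2pows_gen i s : (i < s)%nat -> span (E2pows s) (Z.of_nat i) (fun z => E2 z ^ i)%C.
Proof. intros H. apply span_gen. apply in_map_iff. exists i. split; auto. apply in_seq. lia. Qed.

Lemma E2pows_ind s o v : In (o, v) (E2pows s) -> exists i, (i < s)%nat /\ o = Z.of_nat i /\ v = (fun z => E2 z ^ i)%C.
Proof.
  intros H. apply in_map_iff in H. destruct H as [i [E Hi]]. injection E as <- <-. exists i. apply in_seq in Hi. split; auto. lia.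
Qed.

Lemma E2pows_le s t w f : (s <= t)%nat -> span (E2pows s) w f -> span (E2pows t) w f.
Proof.
  intros H. apply span_incl. intros [o v] Hi. apply E2pows_ind in Hi. destruct Hi as (i & Hi & -> & ->).
  apply in_map_iff. exists i. split; auto. apply in_seq; lia.
Qed.

Lemma E2pows_mul s w f : span (E2pows s) w f -> span (E2pows (S s)) (w + 1) (fun z => E2 z * f z)%C.
Proof.
  intros H. induction H.
  - apply E2pows_ind in H. destruct H as (i & Hi & -> & ->). apply (span_eq _ (Z.of_nat (S i))). lia.
    apply (E2pows_gen (S i)). lia.
  - apply (span_ext _ _ (fun _ => RtoC 0)). intros; ring. apply span_zero.
  - eapply span_ext; [|apply span_add; [apply IHspan1|apply IHspan2]]. intros; cbv beta; ring.
  - eapply span_ext; [|apply (span_eq _ (u + (w + 1))); [lia|apply span_mul; eauto]]. intros; cbv beta; ring.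
  - eapply span_ext; [|apply IHspan]. intros; cbv beta; rewrite H by auto; ring.
Qed.

Lemma Dk_shift m m' f f' : Dk m f f' -> Dk m' f (fun z => f' z + (IZR m - IZR m') * / 12 * (E2 z * f z))%C.
Proof. intros H z Hz. eapply cderiv_eq. apply H; auto. rewrite !RtoC_div12. ring. Qed.

Lemma Dk_unique m f f' f'' : Dk m f f' -> Dk m f f'' -> forall z, in_H z -> f' z = f'' z.
Proof.
  intros H K z Hz. assert (E := cderiv_unique _ _ _ _ (H z Hz) (K z Hz)). assert (N := I2pi_neq0).
  set (t := (RtoC (IZR m / 12) * (E2 z * f z))%C) in *. clearbody t.
  transitivity (/ I2pi * (I2pi * (f' z + t)) - t)%C. field; auto. rewrite E. field; auto.
Qed.

Lemma Dk_scal m c f f' : Dk m f f' -> Dk m (fun z => c * f z)%C (fun z => c * f' z)%C.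
Proof. intros H z Hz. eapply cderiv_eq. apply cderiv_scal, H; auto. ring. Qed.

Definition dE2pow (i : nat) (z : C) : C :=
  match i with O => RtoC 0 | S j => (- / 12 * INR i * E4 z * E2 z ^ j)%C end.

(** In weight [i], rather than the modular weight [2 i], differentiating [E2^i] lowers the depth,
    because [D_1 E2 = - E4 / 12]. *)
Lemma Dk_E2pow i : Dk (Z.of_nat i) (fun z => E2 z ^ i)%C (dE2pow i).
Proof.
  intros z Hz. destruct i as [|j].
  - apply (cderiv_ext (fun _ => RtoC 1)). reflexivity. eapply cderiv_eq. apply cderiv_const. unfold dE2pow. simpl (IZR _). rewrite RtoC_div12. ring.
  - eapply cderiv_eq. apply cderiv_pow. apply E2_deriv; auto. unfold dE2pow. rewrite RtoC_div12, <- INR_IZR_INZ, (Cpow_S (E2 z) j). field.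
Qed.

Lemma dE2pow_span i s : (i <= s)%nat -> span (E2pows s) (Z.of_nat i + 1) (dE2pow i).
Proof.
  intros H. destruct i as [|j]. apply (span_ext _ _ (fun _ => RtoC 0)). reflexivity. apply span_zero.
  apply (span_eq _ (2 + Z.of_nat j)). lia.
  apply (span_mul _ 2 _ (fun z => - / 12 * INR (S j) * E4 z)%C (fun z => E2 z ^ j)%C). apply MF_scal, MF_E4. apply E2pows_gen. lia.
Qed.

(** Changing the index of the derivation only adds a multiple of [E2 f]. Each piece is therefore
    differentiated in its most convenient weight, at the price of one more power of [E2]. *)
Lemma E2pows_D s w f : span (E2pows s) w f -> forall m, exists f', Dk m f f' /\ span (E2pows (S s)) (w + 1) f'.
Proof.
  assert (SH : forall w f m m' f', span (E2pows s) w f -> Dk m f f' -> span (E2pows (S s)) (w + 1) f' ->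
     exists f', Dk m' f f' /\ span (E2pows (S s)) (w + 1) f').
  { clear. intros w f m m' f' H1 H2 H3. eexists. split. exact (Dk_shift m m' f f' H2). apply span_add; auto.
    apply (span_eq _ (0 + (w + 1))); [lia|]. apply (span_mul _ 0 _ (fun _ => (IZR m - IZR m') * / 12)%C (fun z => E2 z * f z)%C).
    apply MF_const. apply E2pows_mul; auto. }
  intros H. induction H; intros m.
  - assert (H' := span_gen _ _ _ H). apply E2pows_ind in H. destruct H as (i & Hi & -> & ->).
    apply (SH _ _ (Z.of_nat i) m (dE2pow i)); auto. apply Dk_E2pow. apply (E2pows_le s); [lia|]. apply dE2pow_span; lia.
  - exists (fun _ => RtoC 0). split. apply Dk_zero. apply span_zero.
  - destruct (IHspan1 m) as [f' [F1 F2]], (IHspan2 m) as [g' [G1 G2]]. exists (fun z => f' z + g' z)%C. split. apply Dk_plus; auto. apply span_add; auto.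
  - destruct (IHspan 0%Z) as [f' [F1 F2]]. destruct (MF_D u g H) as [g' [G1 G2]]. apply serre_Dk in G2.
    assert (D := Dk_mult _ _ _ _ _ _ G2 F1).
    apply (SH _ _ (2 * u + 0)%Z m _ (span_mul _ u w g f H H0) D). apply span_add.
    + apply (span_eq _ (u + 1 + w)); [lia|]. apply span_mul; auto. apply (E2pows_le s); auto.
    + apply (span_eq _ (u + (w + 1))); [lia|]. apply span_mul; auto.
  - destruct (IHspan m) as [f' [F1 F2]]. exists f'. split; auto. eapply Dk_ext; [exact H| |exact F1]. auto.
Qed.

(** [lead phi s w c f]: [f] has weight [2 w], and [c phi] is its coefficient of [E2 ^ s], of higher powers [0]. *)
Definition lead (phi : C -> C) (s : nat) (w : Z) (c : C) (f : C -> C) : Prop :=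
  exists r, span (E2pows s) w r /\ forall z, in_H z -> f z = (c * (phi z * E2 z ^ s) + r z)%C.

(** In weight [2 (w - s) + s = 2 w - s] the derivation does not raise the depth of [phi E2^s];
    passing to [D_m] adds [(2 w - s - m) / 12] times [phi E2^(s+1)], the new leading term. *)
Lemma lead_D phi s w c f f' m : MF (w - Z.of_nat s) phi -> lead phi s w c f -> Dk m f f' ->
  lead phi (S s) (w + 1) (c * RtoC (IZR (2 * w - Z.of_nat s - m) / 12)) f'.
Proof.
  intros HM [r [R1 R2]] HD. destruct (E2pows_D _ _ _ R1 m) as [r' [D1 D2]].
  destruct (MF_D _ _ HM) as [p' [P1 P2]]. apply serre_Dk in P2.
  assert (D3 := Dk_shift _ m _ _ (Dk_mult _ _ _ _ _ _ P2 (Dk_E2pow s))).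
  assert (D4 := Dk_plus _ _ _ _ _ (Dk_scal _ c _ _ D3) D1).
  apply (Dk_ext _ _ f _ _ (fun z Hz => eq_sym (R2 z Hz)) (fun z _ => eq_refl)) in D4.
  exists (fun z => c * (p' z * E2 z ^ s + phi z * dE2pow s z) + r' z)%C. split.
  - apply span_add; auto. apply (span_eq _ (0 + (w + 1))); [lia|].
    apply (span_mul _ 0 _ (fun _ => c) (fun z => p' z * E2 z ^ s + phi z * dE2pow s z)%C). apply MF_const. apply span_add.
    + apply (span_eq _ (w - Z.of_nat s + 1 + Z.of_nat s)); [lia|]. apply (span_mul _ _ _ p' (fun z => E2 z ^ s)%C); auto. apply E2pows_gen; lia.
    + apply (span_eq _ (w - Z.of_nat s + (Z.of_nat s + 1))); [lia|]. apply span_mul; auto. apply (E2pows_le s); [lia|]. apply dE2pow_span; lia.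
  - intros z Hz. rewrite (Dk_unique _ _ _ _ HD D4 z Hz).
    rewrite RtoC_div12, plus_IZR, !minus_IZR, !mult_IZR, !RtoC_plus, !RtoC_minus, !RtoC_mult, (Cpow_S (E2 z) s), minus_IZR, RtoC_minus.
    field.
Qed.

Lemma lead_span phi s w c f t : MF (w - Z.of_nat s) phi -> lead phi s w c f -> (s < t)%nat -> span (E2pows t) w f.
Proof.
  intros HM [r [R1 R2]] H. apply (span_ext _ _ (fun z => (c * phi z) * E2 z ^ s + r z)%C). intros z Hz. rewrite R2 by auto. ring.
  apply span_add. apply (span_eq _ (w - Z.of_nat s + Z.of_nat s)); [lia|]. apply (span_mul _ _ _ (fun z => c * phi z)%C (fun z => E2 z ^ s)%C).
  apply MF_scal; auto. apply E2pows_gen; auto. apply (E2pows_le s); auto. lia.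
Qed.

(** If [f] also has depth below [s], subtracting the two expressions gives a polynomial relation for
    [E2] with top coefficient [- c phi]. *)
Lemma lead_zero phi s w c f : MF (w - Z.of_nat s) phi -> lead phi s w c f -> span (E2pows s) w f -> c <> RtoC 0 ->
  forall z, in_H z -> phi z = RtoC 0.
Proof.
  intros HM [r [R1 R2]] HS Nc.
  assert (HR : span (E2pows s) w (fun z => f z + (- (1)) * r z)%C).
  { apply span_add; auto. apply (span_mul _ 0 w (fun _ => - (1))%C r); auto. apply MF_const. }
  apply span_coef in HR. destruct HR as [a [A1 A2]]. unfold E2pows in A1, A2. rewrite length_map, length_seq in A1, A2.
  assert (NT : forall i, (i < s)%nat -> nth i (E2pows s) (0%Z, fun _ => RtoC 0) = (Z.of_nat i, fun z => E2 z ^ i)%C).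
  { intros i Hi. unfold E2pows. rewrite (nth_indep _ _ (Z.of_nat O, fun z => (E2 z ^ O)%C)) by (rewrite length_map, length_seq; auto).
    rewrite (map_nth (fun i => (Z.of_nat i, fun z => (E2 z ^ i)%C))), seq_nth by auto. reflexivity. }
  fold (E2pows s) in A1, A2.
  assert (T := E2_transcendental s w (fun i => if (i =? s)%nat then fun z => - c * phi z else a i)%C).
  cbv beta in T. rewrite Nat.eqb_refl in T.
  assert (T' : forall z, in_H z -> (- c * phi z)%C = RtoC 0).
  { apply T.
    - intros i Hi. destruct (Nat.eqb_spec i s) as [->|N]. apply MF_scal; auto. specialize (A1 i ltac:(lia)). rewrite NT in A1 by lia. exact A1.
    - intros z Hz. change (psum ?F (S s)) with (psum F s + F s)%C. cbv beta. rewrite Nat.eqb_refl.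
      transitivity ((f z + - (1) * r z) + - c * phi z * E2 z ^ s)%C.
      + f_equal. rewrite A2 by auto. apply psum_ext. intros i Hi. rewrite NT by auto. destruct (Nat.eqb_spec i s); [lia|]. reflexivity.
      + rewrite R2 by auto. ring. }
  intros z Hz. transitivity (- / c * (- c * phi z))%C. field; auto. rewrite T' by auto. ring.
Qed.

Theorem mlde_upper phi s w f l : MF (w - Z.of_nat s) phi -> lead phi s w 1 f -> (2 * w - Z.of_nat s < l)%Z -> mlde l f ->
  forall z, in_H z -> phi z = RtoC 0.
Proof.
  intros HM HL Hl (n & G & h & H1 & H2 & H3 & H4).
  assert (LD : forall j, (j <= n)%nat -> exists c, c <> RtoC 0 /\ lead phi (s + j) (w + Z.of_nat j) c (h j)).
  { induction j; intros Hj.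
    - exists 1. split. apply C1_nz. rewrite Nat.add_0_r. replace (w + Z.of_nat 0)%Z with w by lia.
      destruct HL as [r [R1 R2]]. exists r. split; auto. intros; rewrite H2; auto.
    - destruct (IHj ltac:(lia)) as [c [Nc Hc]]. eexists. split.
      2: { rewrite Nat.add_succ_r. replace (w + Z.of_nat (S j))%Z with (w + Z.of_nat j + 1)%Z by lia.
        eapply lead_D; [|exact Hc|apply H3; lia]. eapply MF_eq; [|exact HM]. lia. }
      (* At order [j] the new factor is [(2 w - s - l - j) / 12], negative because [l > 2 w - s]. *)
      apply Cmult_neq_0; auto. apply RtoC_neq. apply Rmult_integral_contrapositive_currified; [|lra].
      apply not_0_IZR. lia. }
  (* The equation puts [h n] into depth below [s + n], although its coefficient of [E2^(s + n)] is
     [c phi] with [c] nonzero; hence [phi] vanishes. *)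
  destruct (LD n (Nat.le_refl n)) as [c [Nc Hc]].
  apply (lead_zero phi (s + n) (w + Z.of_nat n) c (h n)); auto. eapply MF_eq; [|exact HM]; lia.
  apply (span_ext _ _ (fun z => psum (fun j => G j z * h j z) n)%C). intros; symmetry; auto.
  apply (span_psum _ _ n (fun j z => G j z * h j z)%C). intros j Hj.
  apply (span_eq _ (Z.of_nat n - Z.of_nat j + (w + Z.of_nat j))); [lia|]. apply span_mul; auto.
  destruct (LD j ltac:(lia)) as [d [_ Hd]]. eapply lead_span; [|exact Hd|lia]. eapply MF_eq; [|exact HM]; lia.
Qed.

(** * The invariant [dwt] and the theorem *)

Lemma MLDE_system k f : satisfies_MLDE k f <-> system k f.
Proof. rewrite mlde_iff. split. apply mlde_system. apply system_mlde. Qed.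

(** An element of [zbar] is encoded by its down-set of integers, so that each claim on [dwt] becomes
    an inclusion between sets of weights. *)
Definition below (x : zbar) (j : Z) : Prop :=
  match x with Fin k => (j <= k)%Z | PInf => True | MInf => False end.

Lemma dwt_spec f j : system j f <-> below (dwt f) j.
Proof.
  unfold dwt. destruct (ClassicalDescription.excluded_middle_informative _) as [H|H].
  - destruct (constructive_indefinite_description _ H) as [k [K1 K2]]. simpl. split; intros Hj.
    + apply K2, MLDE_system; auto.
    + apply (system_down k); auto. apply MLDE_system; auto.
  - destruct (ClassicalDescription.excluded_middle_informative _) as [H'|H']; simpl.
    + split; auto. intros _. destruct H' as [k Hk].
      destruct (classic (exists i, satisfies_MLDE i f /\ (j < i)%Z)) as [[i [I1 I2]]|N].
      { apply (system_down i). lia. apply MLDE_system; auto. }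
      exfalso. apply H.
      (* In this branch there is no largest weight. Were all weights bounded by [j], climbing from
         [k] would stop after finitely many steps at a largest one. *)
      assert (B : forall i, satisfies_MLDE i f -> (i <= j)%Z) by (intros i Hi; apply Z.le_ngt; intros L; apply N; eauto).
      enough (G : forall n k, satisfies_MLDE k f -> (j - k < Z.of_nat n)%Z -> exists k, satisfies_MLDE k f /\ forall i, satisfies_MLDE i f -> (i <= k)%Z)
        by (apply (G (S (Z.to_nat (j - k))) k); auto; lia).
      clear k Hk. induction n; intros k Hk Hn. specialize (B k Hk). lia.
      destruct (classic (exists i, satisfies_MLDE i f /\ (k < i)%Z)) as [[i [I1 I2]]|M].
      apply (IHn i); auto; lia. exists k. split; auto. intros i Hi. apply Z.le_ngt. intros L. apply M; eauto.
    + split; [|contradiction]. intros Hj. apply H'. exists j. apply MLDE_system; auto.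
Qed.

Lemma below_le x y : (forall j, below x j -> below y j) -> zbar_le x y.
Proof.
  destruct x as [a| |], y as [b| |]; simpl; intros H; auto.
  - apply H. lia.
  - apply (H a). lia.
  - assert (T := H (b + 1)%Z I). lia.
  - exact (H 0%Z I).
Qed.

Lemma below_mono x y j : zbar_le x y -> below x j -> below y j.
Proof. destruct x, y; simpl; intros; auto; try lia; contradiction. Qed.

Lemma zbar_le_antisym x y : zbar_le x y -> zbar_le y x -> x = y.
Proof. destruct x, y; simpl; intros; auto; try contradiction. f_equal; lia. Qed.

Lemma zbar_lt_below x y : zbar_lt x y -> exists j, below y j /\ ~ below x j.
Proof.
  intros [H N]. apply NNPP. intros E. apply N, zbar_le_antisym; auto. apply below_le. intros j Hj.
  apply NNPP. intros F. eauto.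
Qed.

Lemma below_add x y j : below (zbar_add x y) j -> exists a b, below x a /\ below y b /\ (j <= a + b)%Z.
Proof.
  destruct x as [a| |], y as [b| |]; simpl; intros H; try contradiction.
  - exists a, b. repeat split; lia.
  - exists a, (j - a)%Z. repeat split; lia.
  - exists (j - b)%Z, b. repeat split; lia.
  - exists j, 0%Z. repeat split; lia.
Qed.

Lemma system_psum n k (F : nat -> C -> C) : (forall i, (i < n)%nat -> system k (F i)) -> system k (fun z => psum (fun i => F i z) n).
Proof.
  induction n; simpl; intros H.
  - exists nil. split. intros o v []. apply span_zero.
  - apply (system_plus k (fun z => psum (fun i => F i z) n)); auto.
Qed.

(** The sum over a box of exponents is regrouped by powers of [E2]. The nonzero coefficient at
    [(s, b0, c0)] supplies the half weight [w], and the independence of [E4] and [E6] makes [phi s]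
    a nonzero function. *)
Lemma quasimodular_coef k s f : quasimodular k s f -> exists (w : Z) (phi : nat -> C -> C),
  k = (2 * w)%Z /\ (forall i, MF (w - Z.of_nat i) (phi i)) /\
  (exists z, in_H z /\ phi s z <> RtoC 0) /\ forall z, in_H z -> f z = psum (fun i => phi i z * E2 z ^ i)%C (S s).
Proof.
  intros (coef & H1 & (b0 & c0 & H2 & H3) & H4).
  set (w := (Z.of_nat s + 2 * Z.of_nat b0 + 3 * Z.of_nat c0)%Z). assert (Hk : k = (2 * w)%Z) by (unfold w; lia).
  set (m := S (Z.to_nat k)).
  set (a := fun i c b => if Z.eqb (Z.of_nat (2 * i + 4 * b + 6 * c)) k then coef i b c else RtoC 0).
  exists w, (fun i z => psum (fun c => psum (fun b => a i c b * E46 b c z)%C m) m). split; [|split; [|split]]; auto.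
  - intros i. apply (MF_psum m _ (fun c z => psum (fun b => a i c b * E46 b c z)%C m)). intros c _.
    apply (MF_psum m _ (fun b z => a i c b * E46 b c z)%C). intros b _. unfold a.
    destruct (Z.eqb_spec (Z.of_nat (2 * i + 4 * b + 6 * c)) k) as [E|E].
    + apply MF_scal. eapply MF_eq; [|apply MF_E46]. lia.
    + apply (MF_ext _ (fun _ => RtoC 0)). intros; ring. apply MF_zero.
  - apply NNPP. intros N. apply H3.
    assert (E := E4_E6_independent m m (w - Z.of_nat s) (a s)).
    assert (A0 : a s c0 b0 = RtoC 0).
    { apply E; unfold m; try lia.
      - intros c b. unfold a. destruct (Z.eqb_spec (Z.of_nat (2 * s + 4 * b + 6 * c)) k); intros X; [lia|contradiction].
      - intros z Hz. apply NNPP. intros X. apply N. exists z. auto. }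
    unfold a in A0. rewrite H2, Z.eqb_refl in A0. exact A0.
  - intros z Hz. rewrite H1, sum_n_psum by auto. fold m.
    transitivity (psum (fun i => psum (fun c => psum (fun b => a i c b * E46 b c z) m) m * E2 z ^ i)%C m).
    + apply psum_ext. intros i _. rewrite sum_n_psum. fold m.
      transitivity (psum (fun b => psum (fun c => E2 z ^ i * (a i c b * E46 b c z))%C m) m).
      * apply psum_ext. intros b _. rewrite sum_n_psum. apply psum_ext. intros c _. unfold a.
        destruct (Z.eqb _ _); [|ring]. unfold Emon, E46. change (pow_n (K := C_Ring)) with Cpow. ring.
      * rewrite psum_comm, Cmult_comm, <- psum_scal. apply psum_ext. intros c _. rewrite <- psum_scal. reflexivity.
    (* The box runs up to [k], which is at least [s]; powers of [E2] above [s] have zero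
       coefficients by the depth condition. *)
    + replace m with (S s + (m - S s))%nat by (unfold m; lia). rewrite psum_add.
      rewrite (psum_ext (fun j => _) (fun _ => RtoC 0) (m - S s)), psum_zero. apply Cplus_0_r.
      intros j _. replace (S s + (m - S s))%nat with m by (unfold m; lia).
      transitivity (psum (fun _ => psum (fun _ => RtoC 0) m) m * E2 z ^ (S s + j))%C; [|rewrite !psum_zero; ring].
      f_equal. apply psum_ext. intros c _. apply psum_ext. intros b _. unfold a.
      destruct (Z.eqb_spec (Z.of_nat (2 * (S s + j) + 4 * b + 6 * c)) k) as [E|E]; [rewrite H4 by (auto; lia)|]; ring.
Qed.

Lemma quasimodular_dwt k s f : quasimodular k s f -> dwt f = Fin (k - Z.of_nat s).
Proof.
  intros H. destruct (quasimodular_coef k s f H) as (w & phi & -> & P1 & (z0 & Hz0 & N0) & P3).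
  apply zbar_le_antisym; apply below_le; intros j Hj.
  - apply dwt_spec, system_mlde in Hj. simpl. apply Z.le_ngt. intros L. apply N0.
    apply (mlde_upper (phi s) s w f j); auto.
    exists (fun z => psum (fun i => phi i z * E2 z ^ i)%C s). split.
    + apply (span_psum _ _ s (fun i z => phi i z * E2 z ^ i)%C). intros i Hi.
      apply (span_eq _ (w - Z.of_nat i + Z.of_nat i)); [lia|]. apply (span_mul _ _ _ (phi i) (fun z => E2 z ^ i)%C); auto. apply E2pows_gen; auto.
    + intros z Hz. rewrite P3 by auto. simpl. ring.
  - apply dwt_spec. simpl in Hj. apply (system_down (2 * w - Z.of_nat s)); auto.
    apply (system_ext _ _ _ (fun z Hz => eq_sym (P3 z Hz))).
    apply (system_psum (S s) _ (fun i z => phi i z * E2 z ^ i)%C). intros i Hi.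
    (* The [i]-th term has weight [2 (w - i) + i = 2 w - i], which is at least [2 w - s]; all terms
       are lowered to this common weight before adding. *)
    apply (system_down (2 * (w - Z.of_nat i) + Z.of_nat i * 1)). lia.
    apply (system_mult _ _ (phi i) (fun z => E2 z ^ i)%C). apply system_MF; auto. apply system_pow, system_E2.
Qed.

Theorem theorem4p5 :
  forall f g : C -> C, holo_H f -> holo_H g ->
    zbar_le (zbar_add (dwt f) (dwt g)) (dwt (fun z => Cmult (f z) (g z))) /\
    (dwt f = dwt g -> zbar_le (dwt g) (dwt (fun z => Cplus (f z) (g z)))) /\
    (zbar_lt (dwt g) (dwt f) -> dwt (fun z => Cplus (f z) (g z)) = dwt g) /\
    (forall (k : Z) (s : nat),
       quasimodular k s f -> (exists z, in_H z /\ f z <> RtoC 0) ->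
       dwt f = Fin (k - Z.of_nat s)%Z).
Proof.
  intros f g _ _. split; [|split; [|split]].
  - apply below_le. intros j Hj. destruct (below_add _ _ _ Hj) as (a & b & Ha & Hb & L).
    apply dwt_spec, (system_down (a + b)); auto. apply system_mult; apply dwt_spec; auto.
  - intros E. apply below_le. intros j Hj. apply dwt_spec, system_plus; apply dwt_spec; auto. rewrite E; auto.
  - intros HL. destruct (zbar_lt_below _ _ HL) as (i & I1 & I2). apply dwt_spec in I1. rewrite <- dwt_spec in I2.
    destruct HL as [HL _]. apply zbar_le_antisym; apply below_le; intros j Hj; apply dwt_spec.
    + apply dwt_spec in Hj.
      (* The weight [i] belongs to [f] but not to [g]. As [g = (f + g) - f] has weight [min i j],
         this minimum cannot be [i], so it is [j]. *)
      assert (G : system (Z.min i j) g).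
      { apply (system_ext _ (fun z => (f z + g z) + - (1) * f z)%C). intros; ring. apply system_plus.
        apply (system_down j); auto; lia.
        apply (system_mult 0 (Z.min i j) (fun _ => - (1))%C). apply (system_MF 0), MF_const. apply (system_down i); auto; lia. }
      destruct (Z.min_spec i j) as [[_ E]|[_ E]]; rewrite E in G; auto. contradiction.
    + apply system_plus; apply dwt_spec; auto. apply (below_mono (dwt g)); auto.
  - intros k s H _. apply quasimodular_dwt; auto.
Qed.
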